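(* Assume (A1), (A2) and (A4) (stated in the context). There are $\varepsilon_3>0$ and functions $\bar\beta_1(\varepsilon),\bar x_1(\varepsilon)$ of $\varepsilon\in[0,\varepsilon_3)$ as described in the context such that for any $\varepsilon\in(0,\varepsilon_3)$ there exists a family of single jump-up transition layer solutions $(u,v)(x;\varepsilon)$, with $u(\cdot;\varepsilon),v(\cdot;\varepsilon)\in C^2[0,1]$, of $$\varepsilon^2u_{xx}+f(u,v)=0,\quad Dv_{xx}-f(u,v)=0,\quad x\in(0,1),\qquad (u_x,v_x)(0)=(0,0)=(u_x,v_x)(1),$$ satisfying $\int_0^1\{u(x;\varepsilon)+v(x;\varepsilon)\}dx=\xi$. Furthermore, with $x^*(\varepsilon)=x_0+\varepsilon\bar x_1(\varepsilon)$, the following estimate holds: $$\Big\|u(x;\varepsilon)-U^-\big(\tfrac{x}{x^*(\varepsilon)};\varepsilon;\bar\beta_1(\varepsilon),\bar x_1(\varepsilon)\big)\Big\|_{C^2_{\varepsilon}[0,x^*(\varepsilon)]}+\Big\|v(x;\varepsilon)-V^-\big(\tfrac{x}{x^*(\varepsilon)};\varepsilon;\bar\beta_1(\varepsilon),\bar x_1(\varepsilon)\big)\Big\|_{C^2_{1}[0,x^*(\varepsilon)]}$$ $$+\Big\|u(x;\varepsilon)-U^+\big(\tfrac{x-x^*(\varepsilon)}{1-x^*(\varepsilon)};\varepsilon;\bar\beta_1(\varepsilon),\bar x_1(\varepsilon)\big)\Big\|_{C^2_{\varepsilon}[x^*(\varepsilon),1]}+\Big\|v(x;\varepsilon)-V^+\big(\tfrac{x-x^*(\varepsilon)}{1-x^*(\varepsilon)};\varepsilon;\bar\beta_1(\varepsilon),\bar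 x_1(\varepsilon)\big)\Big\|_{C^2_{1}[x^*(\varepsilon),1]}=o(\varepsilon)$$ as $\varepsilon\to0$, where moreover the differences on $[0,x^*(\varepsilon)]$ have zero derivative at $x=0$ and vanish at $x=x^*(\varepsilon)$, and the differences on $[x^*(\varepsilon),1]$ vanish at $x=x^*(\varepsilon)$ and have zero derivative at $x=1$.
   Context: $D>0$ is fixed, $\varepsilon>0$ small, $f=f(u,v)$ is a sufficiently smooth real function. Assumptions. (A1) For each $v$ in an open interval $I=(\underline v,\overline v)$, $f(u,v)=0$ has exactly three roots $h^-(v)<h^0(v)<h^+(v)$, and $f_u(h^\pm(v),v)<0$, $f_u(h^0(v),v)>0$. (A2) $J(v):=\int_{h^-(v)}^{h^+(v)}f(u,v)\,du$ ($v\in I$) has an isolated zero $v^*\in I$ with $J'(v^* )=\int_{h^-(v^* )}^{h^+(v^* )}f_v(u,v^* )\,du\ne0$. (A4) The constant $\xi$ satisfies $h^-(v^* )+v^*<\xi<h^+(v^* )+v^*$. Norms: for an interval $[c,d]$ and $\nu>0$, $\|w\|_{C^2_\nu[c,d]}=\sum_{j=0}^2\max_{[c,d]}|(\nu\frac{d}{dx})^jw|$. Jump-up transition layer solution: as $\varepsilon\to0$, $u(x;\varepsilon)\to h^-(v^* )$ on $[0,x_0)$ and $\to h^+(v^* )$ on $(x_0,1]$, uniformly on compact subsets of $[0,x_0)\cup(x_0,1]$, and $v(x;\varepsilon)\to v^*$ uniformly on $[0,1]$; the layer is located at $x=x^*(\varepsilon)$. Fix a constant $\alpha$ with $h^-(v^*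 )<\alpha<h^+(v^* )$. Put $x_0=\dfrac{v^*+h^+(v^* )-\xi}{h^+(v^* )-h^-(v^* )}\in(0,1)$. Write $\dot{}=d/dz$. Leading profiles: $\phi_0^-$ on $(-\infty,0]$ and $\phi_0^+$ on $[0,\infty)$ are the monotone increasing solutions of $\ddot\phi_0^-+x_0^2f(h^-(v^* )+\phi_0^-,v^* )=0$, $\phi_0^-(-\infty)=0$, $\phi_0^-(0)=\alpha-h^-(v^* )$; $\ddot\phi_0^++(1-x_0)^2f(h^+(v^* )+\phi_0^+,v^* )=0$, $\phi_0^+(0)=\alpha-h^+(v^* )$, $\phi_0^+(\infty)=0$. Let $\tilde f^\pm,\tilde f_u^\pm,\tilde f_v^\pm$ denote $f,f_u,f_v$ evaluated at $(h^\pm(v^* )+\phi_0^\pm(z),v^* )$. First-order profiles, for real parameters $\beta_1,x_1$: $\phi_1^\pm(z;\beta_1,x_1)$ solve $\ddot\phi_1^-+x_0^2\tilde f_u^-\phi_1^-=-2x_0x_1\tilde f^--x_0^2\tilde f_u^-h_v^-(v^* )\beta_1-x_0^2\tilde f_v^-\beta_1$ on $(-\infty,0)$, $\phi_1^-(-\infty)=0$, $\phi_1^-(0)=-h_v^-(v^* )\beta_1$; $\ddot\phi_1^++(1-x_0)^2\tilde f_u^+\phi_1^+=2(1-x_0)x_1\tilde f^+-(1-x_0)^2\tilde f_u^+h_v^+(v^* )\beta_1-(1-x_0)^2\tilde f_v^+\beta_1$ on $(0,\infty)$, $\phi_1^+(0)=-h_v^+(v^* )\beta_1$, $\phi_1^+(\infty)=0$.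 Here $h^\pm_v=dh^\pm/dv$. Put $\psi_j^\pm=-\phi_j^\pm/D$ ($j=0,1$). Let $\theta\in C^\infty[0,1]$ be a cut-off function with $\theta=0$ on $[0,1/2]$, $\theta=1$ on $[3/4,1]$, $0\le\theta\le1$. Define for $y\in[0,1]$ $U^-(y;\varepsilon;\beta_1,x_1)=h^-(v^* )+\varepsilon h_v^-(v^* )\beta_1+\theta(y)\{\phi_0^-(\frac{y-1}\varepsilon)+\varepsilon\phi_1^-(\frac{y-1}\varepsilon;\beta_1,x_1)\}$, $V^-(y;\varepsilon;\beta_1,x_1)=v^*+\varepsilon\beta_1+\theta(y)\{\varepsilon^2\psi_0^-(\frac{y-1}\varepsilon)+\varepsilon^3\psi_1^-(\frac{y-1}\varepsilon;\beta_1,x_1)-\varepsilon^2\psi_0^-(0)-\varepsilon^3\psi_1^-(0;\beta_1,x_1)\}$, $U^+(y;\varepsilon;\beta_1,x_1)=h^+(v^* )+\varepsilon h_v^+(v^* )\beta_1+\theta(1-y)\{\phi_0^+(\frac y\varepsilon)+\varepsilon\phi_1^+(\frac y\varepsilon;\beta_1,x_1)\}$, $V^+(y;\varepsilon;\beta_1,x_1)=v^*+\varepsilon\beta_1+\theta(1-y)\{\varepsilon^2\psi_0^+(\frac y\varepsilon)+\varepsilon^3\psi_1^+(\frac y\varepsilon;\beta_1,x_1)-\varepsilon^2\psi_0^+(0)-\varepsilon^3\psi_1^+(0;\beta_1,x_1)\}$. The functions $\bar\beta_1,\bar x_1:[0,\varepsilon_3)\to\mathbb R$ describe the layer: they satisfy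 $\bar\beta_1(\varepsilon)\to\bar\beta_1(0)=0$ and $\bar x_1(\varepsilon)\to\bar x_1(0)=\dfrac{x_0\int_{-\infty}^0\phi_0^-(z)dz+(1-x_0)\int_0^\infty\phi_0^+(z)dz}{h^+(v^* )-h^-(v^* )}$ as $\varepsilon\to0$, and $u(x^*(\varepsilon);\varepsilon)=\alpha$, $v(x^*(\varepsilon);\varepsilon)=v^*+\varepsilon\bar\beta_1(\varepsilon)$ with $x^*(\varepsilon)=x_0+\varepsilon\bar x_1(\varepsilon)$. *)

(* Defs.v *)
From Stdlib Require Import Reals Rtopology.
From Coquelicot Require Import Coquelicot.
Open Scope R_scope.

(** The derivative of [w], relative to [[c, d]], at the point [x]: one-sided at
    the end points, so that only the values of [w] on [[c, d]] matter. *)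
Definition is_derive_on (c d : R) (w : R -> R) (x l : R) : Prop :=
  filterlim (fun y => (w y - w x) / (y - x))
    (within (fun y => c <= y <= d) (locally' x)) (locally l).

(** [w] is in [C^2[c, d]], with first and second derivatives [w1], [w2]. *)
Definition C2_on (c d : R) (w w1 w2 : R -> R) : Prop :=
  forall x, c <= x <= d ->
    is_derive_on c d w x (w1 x) /\
    is_derive_on c d w1 x (w2 x) /\
    filterlim w2 (within (fun y => c <= y <= d) (locally x)) (locally (w2 x)).

Definition is_max_abs (c d : R) (g : R -> R) (m : R) : Prop :=
  (exists x, c <= x <= d /\ Rabs (g x) = m) /\
  (forall x, c <= x <= d -> Rabs (g x) <= m).

(** [w] is in [C^2[c, d]] and its weighted norm is [n]. *)
Definition is_C2_norm (nu c d : R) (w : R -> R) (n : R) : Prop :=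
  exists w1 w2 : R -> R, exists m0 m1 m2 : R,
    C2_on c d w w1 w2 /\
    is_max_abs c d w m0 /\
    is_max_abs c d (fun x => nu * w1 x) m1 /\
    is_max_abs c d (fun x => nu ^ 2 * w2 x) m2 /\
    n = m0 + m1 + m2.

Definition partial_u (f : R -> R -> R) (u v : R) : R := Derive (fun s => f s v) u.
Definition partial_v (f : R -> R -> R) (u v : R) : R := Derive (fun s => f u s) v.

Definition in_interval (vlo vhi : Rbar) (v : R) : Prop :=
  Rbar_lt vlo v /\ Rbar_lt v vhi.

Definition assumption_A1 (f : R -> R -> R) (vlo vhi : Rbar) (hm h0 hp : R -> R) : Prop :=
  forall v : R, in_interval vlo vhi v ->
    hm v < h0 v < hp v /\
    (forall u, f u v = 0 <-> u = hm v \/ u = h0 v \/ u = hp v) /\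
    partial_u f (hm v) v < 0 /\
    partial_u f (hp v) v < 0 /\
    0 < partial_u f (h0 v) v.

Definition J (f : R -> R -> R) (hm hp : R -> R) (v : R) : R :=
  RInt (fun u => f u v) (hm v) (hp v).

Definition assumption_A2 (f : R -> R -> R) (vlo vhi : Rbar) (hm hp : R -> R)
    (vs : R) : Prop :=
  in_interval vlo vhi vs /\
  J f hm hp vs = 0 /\
  locally' vs (fun v => in_interval vlo vhi v -> J f hm hp v <> 0) /\
  is_derive (J f hm hp) vs (RInt (fun u => partial_v f u vs) (hm vs) (hp vs)) /\
  RInt (fun u => partial_v f u vs) (hm vs) (hp vs) <> 0.

Definition assumption_A4 (hm hp : R -> R) (vs xi : R) : Prop :=
  hm vs + vs < xi < hp vs + vs.

Definition layer_x0 (hm hp : R -> R) (vs xi : R) : R :=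
  (vs + hp vs - xi) / (hp vs - hm vs).

(** Smoothness at the end points of [[0, 1]] is automatic, [theta] being
    constant near each of them. *)
Definition is_cutoff (theta : R -> R) : Prop :=
  (forall (n : nat) (y : R), 0 < y < 1 -> ex_derive_n theta n y) /\
  (forall y, 0 <= y <= 1 / 2 -> theta y = 0) /\
  (forall y, 3 / 4 <= y <= 1 -> theta y = 1) /\
  (forall y, 0 <= y <= 1 -> 0 <= theta y <= 1).

(** [phi'' = rhs] on a half-line, with [phi] continuous up to [0], [phi 0 = a]
    and limit [0] at infinity.  The conjunct [ex_derive] is not redundant:
    [is_derive_n phi 2] alone only speaks of the total function [Derive phi]. *)
Definition solves_left (rhs : R -> R) (a : R) (phi : R -> R) : Prop :=
  (forall z, z < 0 -> ex_derive phi z /\ is_derive_n phi 2 z (rhs z)) /\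
  filterlim phi (at_left 0) (locally (phi 0)) /\
  phi 0 = a /\
  is_lim phi m_infty 0.

Definition solves_right (rhs : R -> R) (a : R) (phi : R -> R) : Prop :=
  (forall z, 0 < z -> ex_derive phi z /\ is_derive_n phi 2 z (rhs z)) /\
  filterlim phi (at_right 0) (locally (phi 0)) /\
  phi 0 = a /\
  is_lim phi p_infty 0.

Definition profile0_minus (f : R -> R -> R) (hm : R -> R) (vs x0 alpha : R)
    (phi : R -> R) : Prop :=
  solves_left (fun z => - (x0 ^ 2 * f (hm vs + phi z) vs)) (alpha - hm vs) phi /\
  (forall z1 z2, z1 <= z2 <= 0 -> phi z1 <= phi z2).

Definition profile0_plus (f : R -> R -> R) (hp : R -> R) (vs x0 alpha : R)
    (phi : R -> R) : Prop :=
  solves_right (fun z => - ((1 - x0) ^ 2 * f (hp vs + phi z) vs)) (alpha - hp vs) phi /\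
  (forall z1 z2, 0 <= z1 <= z2 -> phi z1 <= phi z2).

Definition profile1_minus (f : R -> R -> R) (hm : R -> R) (vs x0 : R)
    (phi0 : R -> R) (b1 x1 : R) (phi1 : R -> R) : Prop :=
  let ft z := f (hm vs + phi0 z) vs in
  let fut z := partial_u f (hm vs + phi0 z) vs in
  let fvt z := partial_v f (hm vs + phi0 z) vs in
  solves_left
    (fun z => - (x0 ^ 2 * fut z * phi1 z)
              - 2 * x0 * x1 * ft z
              - x0 ^ 2 * fut z * Derive hm vs * b1
              - x0 ^ 2 * fvt z * b1)
    (- Derive hm vs * b1) phi1.

Definition profile1_plus (f : R -> R -> R) (hp : R -> R) (vs x0 : R)
    (phi0 : R -> R) (b1 x1 : R) (phi1 : R -> R) : Prop :=
  let ft z := f (hp vs + phi0 z) vs in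
  let fut z := partial_u f (hp vs + phi0 z) vs in
  let fvt z := partial_v f (hp vs + phi0 z) vs in
  solves_right
    (fun z => - ((1 - x0) ^ 2 * fut z * phi1 z)
              + 2 * (1 - x0) * x1 * ft z
              - (1 - x0) ^ 2 * fut z * Derive hp vs * b1
              - (1 - x0) ^ 2 * fvt z * b1)
    (- Derive hp vs * b1) phi1.

(** In the four approximations [phi1 b1 x1 z] stands for phi_1(z; b1, x1). *)
Definition U_minus (hm : R -> R) (vs : R) (theta phi0 : R -> R)
    (phi1 : R -> R -> R -> R) (eps b1 x1 y : R) : R :=
  hm vs + eps * Derive hm vs * b1
  + theta y * (phi0 ((y - 1) / eps) + eps * phi1 b1 x1 ((y - 1) / eps)).

Definition U_plus (hp : R -> R) (vs : R) (theta phi0 : R -> R)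
    (phi1 : R -> R -> R -> R) (eps b1 x1 y : R) : R :=
  hp vs + eps * Derive hp vs * b1
  + theta (1 - y) * (phi0 (y / eps) + eps * phi1 b1 x1 (y / eps)).

Definition V_minus (D vs : R) (theta phi0 : R -> R)
    (phi1 : R -> R -> R -> R) (eps b1 x1 y : R) : R :=
  let psi0 z := - phi0 z / D in
  let psi1 z := - phi1 b1 x1 z / D in
  vs + eps * b1
  + theta y * (eps ^ 2 * psi0 ((y - 1) / eps) + eps ^ 3 * psi1 ((y - 1) / eps)
               - eps ^ 2 * psi0 0 - eps ^ 3 * psi1 0).

Definition V_plus (D vs : R) (theta phi0 : R -> R)
    (phi1 : R -> R -> R -> R) (eps b1 x1 y : R) : R :=
  let psi0 z := - phi0 z / D in
  let psi1 z := - phi1 b1 x1 z / D in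
  vs + eps * b1
  + theta (1 - y) * (eps ^ 2 * psi0 (y / eps) + eps ^ 3 * psi1 (y / eps)
                     - eps ^ 2 * psi0 0 - eps ^ 3 * psi1 0).

(** A solution in [C^2[0, 1]] of the Neumann problem. *)
Definition is_neumann_solution (D : R) (f : R -> R -> R) (eps : R)
    (u v : R -> R) : Prop :=
  exists u1 u2 v1 v2 : R -> R,
    C2_on 0 1 u u1 u2 /\
    C2_on 0 1 v v1 v2 /\
    (forall x, 0 < x < 1 ->
       eps ^ 2 * u2 x + f (u x) (v x) = 0 /\ D * v2 x - f (u x) (v x) = 0) /\
    u1 0 = 0 /\ v1 0 = 0 /\ u1 1 = 0 /\ v1 1 = 0.

(** Single jump-up transition layer at [x0], for a family [u eps], [v eps]:
    [u] tends to [um] on [[0, x0)] and to [up] on [(x0, 1]], uniformly on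
    compact subsets of the union, and [v] tends to [vs] uniformly on [[0, 1]]. *)
Definition jump_up_layer (x0 um up vs : R) (u v : R -> R -> R) : Prop :=
  (forall K : R -> Prop, Rtopology.compact K ->
     (forall x, K x -> 0 <= x < x0 \/ x0 < x <= 1) ->
     forall eta, 0 < eta ->
       at_right 0 (fun eps => forall x, K x ->
         (x < x0 -> Rabs (u eps x - um) < eta) /\
         (x0 < x -> Rabs (u eps x - up) < eta))) /\
  (forall eta, 0 < eta ->
     at_right 0 (fun eps => forall x, 0 <= x <= 1 -> Rabs (v eps x - vs) < eta)).

(* Main.v *)
Require Import Defs.
From Stdlib Require Import Reals Ranalysis5 Lra Lia Psatz Classical ClassicalEpsilon.
From Coquelicot Require Import Coquelicot.
Open Scope R_scope.

(** Adding the two equations shows that [eps ^ 2 u + D v] is affine, hence constant by the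
    Neumann conditions.  So [v = vs + b + k (al - u)] with [k = eps ^ 2 / D], where [al] is the
    value of [u] at the layer position and [vs + b] that of [v], and in the stretched time
    around that position the system becomes one autonomous equation [U'' + g U = 0] with
    [g s = f s (vs + b + k (al - s))].  A jump-up layer is half a period of it: a monotone orbit
    between two rest points [a], near [hm vs], and [d], near [hp vs].  The unknowns [a], [d], [b]
    have to satisfy three conditions: the integral of [g] over [[a, d]] vanishes, the orbit takes
    the time [1 / eps], and the mass is [xi].

    Existence.  The slope condition [J' (vs) <> 0] lets the first condition determine [b] as a
    function of [a] and [d] ([equal_area_level]); moreover [b = O(eps ^ 2)], because the area is
    stationary in [a] and [d] at the saddles, so that the coefficient [b / eps] of the formal
    expansion tends to zero.  The other two conditions prescribe the two weighted times, the
    integrals of [d - U] and of [U - a] along the orbit.  The first is sensitive only to the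
    passage near [a], the second only to the passage near [d], and each ranges from values of
    order [eps ^ (-1/2)] to arbitrarily large ones as its rest point approaches the saddle: the
    two-dimensional intermediate value theorem [poincare_miranda] applies ([layer_exists]).
    Orbits are built in an angular variable in which the energy relation is regular at the rest
    points ([oscillator_solution]), and a cut-off gives a meaning to the times also where there
    is no orbit.

    Accuracy.  On each side of the layer the orbit is within [O(eps ^ 2)] of the heteroclinic
    profile of the limit equation, by a Gronwall estimate in the core and a maximum principle
    near the saddle ([half_orbit_close]).  If [xs = x0 + eps x1] is the layer position, the
    variable of the formal expansion differs from the stretched time by the factor [xs], which
    the zeroth-order profile replaces by [x0].  The term in [x1] of the first-order profile is
    exactly the generator of this dilation, and its term in [b / eps] is itself of order [eps]
    ([first_order_decomposition]).  So the formal approximation is accurate to order [eps ^ 2];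
    second derivatives are compared through the equations and first derivatives by interpolation
    ([approximation_error]), and the slow component through the conservation law ([half_layer]).
    The reflection [u -> - u], [x -> 1 - x] turns the right half of the layer into a left half.

    Position.  The mass condition expresses [x1] by the integrals of [U - hm vs] and [U - hp vs]
    over the two halves ([mass_identity]), which converge to the integrals of the zeroth-order
    profiles at the rate [eps] ([half_mass]).  Two derivatives of [f] suffice for all of this. *)

(** * Calculus on the line *)

Ltac nonneg :=
  repeat first [lra | apply pow2_ge_0 | apply Rle_0_sqr | apply Rabs_pos | apply Rdiv_le_0_compat
               | apply Rmult_le_pos | apply Rplus_le_le_0_compat].

Ltac positive :=
  repeat first [lra | apply pow_lt | apply Rdiv_lt_0_compat | apply Rmult_lt_0_compat
               | apply Rplus_lt_0_compat].

Ltac signs := first [solve [positive] | solve [nonneg]].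

Lemma sq_le_self (e : R) : 0 <= e <= 1 -> e ^ 2 <= e.
Proof. intros He. nra. Qed.

Lemma contract_le (s x y : R) : 0 <= s <= 1 -> 0 <= x -> x <= y -> s * x <= y.
Proof. intros Hs Hx Hy. nra. Qed.

Lemma exp_le (x y : R) : x <= y -> exp x <= exp y.
Proof. intros [H| ->]; [left; now apply exp_increasing|lra]. Qed.

Lemma is_derive_eq (f : R -> R) (x l l' : R) :
  is_derive f x l -> l = l' -> is_derive f x l'.
Proof. now intros H <-. Qed.

Lemma is_derive_R_plus (f g : R -> R) (x l m : R) :
  is_derive f x l -> is_derive g x m -> is_derive (fun y => f y + g y) x (l + m).
Proof. intros Hf Hg. exact (is_derive_plus f g x l m Hf Hg). Qed.

Lemma is_derive_R_minus (f g : R -> R) (x l m : R) :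
  is_derive f x l -> is_derive g x m -> is_derive (fun y => f y - g y) x (l - m).
Proof. intros Hf Hg. exact (is_derive_minus f g x l m Hf Hg). Qed.

Lemma is_derive_R_opp (f : R -> R) (x l : R) :
  is_derive f x l -> is_derive (fun y => - f y) x (- l).
Proof. intros Hf. exact (is_derive_opp f x l Hf). Qed.

Lemma is_derive_R_mult (f g : R -> R) (x l m : R) :
  is_derive f x l -> is_derive g x m ->
  is_derive (fun y => f y * g y) x (l * g x + f x * m).
Proof. intros Hf Hg. exact (is_derive_mult f g x l m Hf Hg Rmult_comm). Qed.

Lemma is_derive_R_scal (f : R -> R) (c x l : R) :
  is_derive f x l -> is_derive (fun y => c * f y) x (c * l).
Proof. intros Hf. exact (is_derive_scal f x c l Hf). Qed.

Lemma is_derive_R_comp (f g : R -> R) (x l m : R) :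
  is_derive f (g x) l -> is_derive g x m -> is_derive (fun y => f (g y)) x (l * m).
Proof.
  intros Hf Hg. apply (is_derive_eq _ _ (scal m l)); [|apply Rmult_comm].
  exact (is_derive_comp f g x l m Hf Hg).
Qed.

Lemma is_derive_R_const (c x : R) : is_derive (fun _ => c) x 0.
Proof. exact (is_derive_const c x). Qed.

Lemma is_derive_R_id (x : R) : is_derive (fun y => y) x 1.
Proof. exact (is_derive_id x). Qed.

Lemma le_div (x y c : R) : 0 < c -> x * c <= y -> x <= y / c.
Proof. intros Hc H. now apply (Rle_div_r x y c Hc). Qed.

Lemma div_le (x y c : R) : 0 < c -> x <= y * c -> x / c <= y.
Proof. intros Hc H. now apply (Rle_div_l x y c Hc). Qed.

Lemma lt_div (x y c : R) : 0 < c -> x * c < y -> x < y / c.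
Proof. intros Hc H. now apply (Rlt_div_r x y c Hc). Qed.

Lemma ex_RInt_cont (f : R -> R) (a b : R) : (forall x, continuous f x) -> ex_RInt f a b.
Proof.
  intros H. apply (ex_RInt_continuous (V := R_CompleteNormedModule)). intros; apply H.
Qed.

Lemma is_derive_primitive (f : R -> R) (a x : R) :
  (forall y, continuous f y) -> is_derive (fun y => RInt f a y) x (f x).
Proof.
  intros H. apply (is_derive_RInt f (fun y => RInt f a y) a x); [|apply H].
  apply filter_forall. intros y.
  apply (RInt_correct (V := R_CompleteNormedModule) f a y). now apply ex_RInt_cont.
Qed.

(* An equality of reals may be stated at the carrier of an algebraic structure, where [ring] does
   not recognise it. *)
Ltac ring_R := match goal with |- ?x = ?y => change (@eq R x y) end; ring.

Lemma is_derive_continuity_pt (f : R -> R) (x l : R) :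
  is_derive f x l -> continuity_pt f x.
Proof.
  intros H. apply continuity_pt_filterlim.
  apply (ex_derive_continuous f x). now exists l.
Qed.

Lemma mvt (f df : R -> R) (a b : R) :
  (forall x, Rmin a b <= x <= Rmax a b -> is_derive f x (df x)) ->
  exists c, Rmin a b <= c <= Rmax a b /\ f b - f a = df c * (b - a).
Proof.
  intros H. apply MVT_gen.
  - intros x Hx; apply H; lra.
  - intros x Hx. apply (is_derive_continuity_pt _ _ (df x)). now apply H.
Qed.

Lemma between_minmax (lo hi a b x : R) :
  lo <= a <= hi -> lo <= b <= hi -> Rmin a b <= x <= Rmax a b -> lo <= x <= hi.
Proof.
  intros Ha Hb. unfold Rmin, Rmax. destruct (Rle_dec a b); lra.
Qed.

Lemma lipschitz_of_derive (f df : R -> R) (lo hi M a b : R) :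
  (forall x, lo <= x <= hi -> is_derive f x (df x)) ->
  (forall x, lo <= x <= hi -> Rabs (df x) <= M) ->
  lo <= a <= hi -> lo <= b <= hi ->
  Rabs (f b - f a) <= M * Rabs (b - a).
Proof.
  intros Hd HM Ha Hb.
  destruct (mvt f df a b) as [c [Hc E]].
  - intros x Hx. apply Hd. now apply (between_minmax lo hi a b).
  - rewrite E, Rabs_mult. apply Rmult_le_compat_r; [apply Rabs_pos|].
    apply HM. now apply (between_minmax lo hi a b).
Qed.

Lemma nondecreasing_of_derive (f df : R -> R) (a b : R) :
  a <= b ->
  (forall x, a <= x <= b -> is_derive f x (df x)) ->
  (forall x, a <= x <= b -> 0 <= df x) ->
  f a <= f b.
Proof.
  intros Hab Hd Hp.
  destruct (mvt f df a b) as [c [Hc E]].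
  - intros x Hx. apply Hd. rewrite Rmin_left, Rmax_right in Hx; lra.
  - rewrite Rmin_left, Rmax_right in Hc by lra.
    specialize (Hp c Hc). nra.
Qed.

Lemma constant_of_derive_zero (f : R -> R) (a b : R) :
  (forall x, Rmin a b <= x <= Rmax a b -> is_derive f x 0) -> f a = f b.
Proof.
  intros H. destruct (mvt f (fun _ => 0) a b H) as [c [_ E]]. lra.
Qed.

(** * Zeros of planar maps *)

Section Discrete.
Variables (A B : nat -> nat -> bool).

Definition same_on_cell (C : nat -> nat -> bool) (i j : nat) : Prop :=
  C (S i) j = C i j /\ C i (S j) = C i j /\ C (S i) (S j) = C i j.

(* An edge is counted when it joins a vertex with [A] false to a vertex with [A] true and
   [B] false: it is crossed by the part of the boundary of [A] that lies outside [B]. *)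
Let edge (a b a' b' : bool) : bool :=
  (negb a && (a' && negb b')) || (negb a' && (a && negb b)).
Let hor i j := edge (A i j) (B i j) (A (S i) j) (B (S i) j).
Let ver i j := edge (A i j) (B i j) (A i (S j)) (B i (S j)).

Fixpoint row_parity (n j : nat) : bool :=
  match n with O => false | S i => xorb (row_parity i j) (hor i j) end.

Lemma cell_parity (i j : nat) :
  same_on_cell A i j \/ same_on_cell B i j ->
  xorb (xorb (hor i j) (hor i (S j))) (xorb (ver i j) (ver (S i) j)) = false.
Proof.
  unfold same_on_cell, hor, ver, edge.
  destruct (A i j), (A (S i) j), (A i (S j)), (A (S i) (S j)),
    (B i j), (B (S i) j), (B i (S j)), (B (S i) (S j)); simpl;
    intros [[H1 [H2 H3]]|[H1 [H2 H3]]]; try discriminate; reflexivity.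
Qed.

(** Adding the cells between two consecutive rows cancels the interior vertical edges. *)
Lemma row_parity_step (n j : nat) :
  (forall i, (i < n)%nat -> same_on_cell A i j \/ same_on_cell B i j) ->
  xorb (row_parity n j) (row_parity n (S j)) = xorb (ver 0 j) (ver n j).
Proof.
  induction n as [|n IH]; intros H; simpl.
  - now destruct (ver 0 j).
  - assert (E : xorb (row_parity n j) (row_parity n (S j)) = xorb (ver 0 j) (ver n j))
      by (apply IH; intros; apply H; lia).
    assert (C := cell_parity n j (H n (Nat.lt_succ_diag_r n))).
    destruct (row_parity n j), (row_parity n (S j)), (hor n j), (hor n (S j)),
      (ver 0 j), (ver n j), (ver (S n) j); simpl in *; congruence.
Qed.

(** The parity of the number of counted edges is the same on all rows of the grid, because
    each cell has an even number of them and the two vertical sides have none.  It is odd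
    on the bottom row, along which [A] changes and [B] is false, and even on the top row. *)
Lemma no_mixed_cell_absurd (n : nat) :
  (forall j, (j <= n)%nat -> A 0 j = false) ->
  (forall j, (j <= n)%nat -> A n j = true) ->
  (forall i, (i <= n)%nat -> B i 0 = false) ->
  (forall i, (i <= n)%nat -> B i n = true) ->
  (forall i j, (i < n)%nat -> (j < n)%nat -> same_on_cell A i j \/ same_on_cell B i j) ->
  False.
Proof.
  intros A0 An B0 Bn H.
  assert (Hrow : forall j, (j <= n)%nat -> row_parity n j = row_parity n 0).
  { induction j as [|j IH]; intros Hj; [reflexivity|].
    rewrite <- IH by lia.
    assert (E := row_parity_step n j (fun i Hi => H i j Hi Hj)).
    unfold ver, edge in E. rewrite !A0, !An in E by lia. simpl in E.
    destruct (row_parity n j), (row_parity n (S j)); simpl in E; congruence. }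
  assert (Hbot : forall i, (i <= n)%nat -> row_parity i 0 = A i 0%nat).
  { induction i as [|i IH]; intros Hi; simpl.
    - now rewrite A0 by lia.
    - rewrite IH by lia. unfold hor, edge. rewrite !B0 by lia.
      destruct (A i 0%nat), (A (S i) 0%nat); reflexivity. }
  assert (Htop : forall i, (i <= n)%nat -> row_parity i n = false).
  { induction i as [|i IH]; intros Hi; simpl; [reflexivity|].
    rewrite IH by lia. unfold hor, edge. rewrite !Bn by lia.
    destruct (A i n), (A (S i) n); reflexivity. }
  assert (E := Hrow n (le_n n)).
  rewrite (Hbot n), (Htop n), (An 0%nat) in E by lia. discriminate.
Qed.
End Discrete.

Definition lipschitz2 (a b c d : R) (F : R -> R -> R) (L : R) : Prop :=
  forall x y x' y', a <= x <= b -> c <= y <= d -> a <= x' <= b -> c <= y' <= d ->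
    Rabs (F x y - F x' y') <= L * (Rabs (x - x') + Rabs (y - y')).

(** Compactness of the rectangle turns the absence of common zeros into a positive gap, which
    is what a grid of finite mesh can resolve. *)
Lemma no_common_zero_gap (a b c d L : R) (F G : R -> R -> R) :
  0 < L -> lipschitz2 a b c d F L -> lipschitz2 a b c d G L ->
  (forall x y, a <= x <= b -> c <= y <= d -> ~ (F x y = 0 /\ G x y = 0)) ->
  exists m, 0 < m /\
    forall x y, a <= x <= b -> c <= y <= d -> m <= Rabs (F x y) + Rabs (G x y).
Proof.
  intros HL HF HG Hnz.
  set (r := fun x y => (Rabs (F x y) + Rabs (G x y)) / (8 * L)).
  assert (Hr : forall x y, 0 <= r x y).
  { intros x y. unfold r. apply Rdiv_le_0_compat; [|lra].
    generalize (Rabs_pos (F x y)) (Rabs_pos (G x y)); lra. }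
  set (delta := fun x y => match Rlt_dec 0 (r x y) with
                           | left H => mkposreal _ H | right _ => mkposreal 1 Rlt_0_1 end).
  destruct (compactness_value_2d a b c d delta) as [m Hm].
  exists (4 * L * m). split. { generalize (cond_pos m); nra. }
  intros x y Hx Hy. apply Rnot_lt_le. intros Hlt.
  apply (Hm x y Hx Hy). intros [u [v [Hu [Hv [Hxu [Hyv Hd]]]]]].
  assert (Huv : 0 < r u v).
  { destruct (Hr u v) as [|E]; [assumption|]. exfalso. apply (Hnz u v Hu Hv).
    unfold r, Rdiv in E. symmetry in E. apply Rmult_integral in E.
    destruct E as [E|E].
    - generalize (Rabs_pos (F u v)) (Rabs_pos (G u v)); intros.
      split; apply Rabs_eq_0; lra.
    - exfalso. apply (Rinv_neq_0_compat (8 * L)); lra. }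
  assert (Ed : pos (delta u v) = r u v).
  { unfold delta. destruct (Rlt_dec 0 (r u v)); [reflexivity|contradiction]. }
  rewrite Ed in *.
  assert (H1 := HF x y u v Hx Hy Hu Hv). assert (H2 := HG x y u v Hx Hy Hu Hv).
  assert (T1 : Rabs (F u v) <= Rabs (F x y) + Rabs (F x y - F u v)).
  { replace (F u v) with (F x y - (F x y - F u v)) at 1 by ring.
    eapply Rle_trans; [apply Rabs_triang|]. rewrite Rabs_Ropp. lra. }
  assert (T2 : Rabs (G u v) <= Rabs (G x y) + Rabs (G x y - G u v)).
  { replace (G u v) with (G x y - (G x y - G u v)) at 1 by ring.
    eapply Rle_trans; [apply Rabs_triang|]. rewrite Rabs_Ropp. lra. }
  assert (E : Rabs (F u v) + Rabs (G u v) = 8 * L * r u v).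
  { unfold r. field. lra. }
  nra.
Qed.

(** The two-dimensional intermediate value theorem.  Without a common zero the functions
    are never small together, so on a fine grid every cell has a constant sign of [F] or a
    constant sign of [G], which the parity argument excludes. *)
Lemma poincare_miranda (a b c d L : R) (F G : R -> R -> R) :
  a <= b -> c <= d -> 0 < L ->
  lipschitz2 a b c d F L -> lipschitz2 a b c d G L ->
  (forall y, c <= y <= d -> F a y < 0 < F b y) ->
  (forall x, a <= x <= b -> G x c < 0 < G x d) ->
  exists x y, a <= x <= b /\ c <= y <= d /\ F x y = 0 /\ G x y = 0.
Proof.
  intros Hab Hcd HL HF HG SF SG. apply NNPP. intros Hno.
  destruct (no_common_zero_gap a b c d L F G HL HF HG) as [m [Hm Hgap]].
  { intros x y Hx Hy [E1 E2]. apply Hno. now exists x, y. }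
  set (w := (b - a) + (d - c)).
  destruct (INR_archimed (m / 4) (L * w + 1)) as [n Hn]; [lra|].
  assert (HnR : 0 < INR n).
  { destruct (Rle_lt_dec (INR n) 0); [|assumption]. exfalso.
    unfold w in Hn. assert (0 <= L * (b - a + (d - c))) by (apply Rmult_le_pos; lra). nra. }
  set (X := fun i : nat => a + (b - a) * (INR i / INR n)).
  set (Y := fun j : nat => c + (d - c) * (INR j / INR n)).
  assert (Hfrac : forall i, (i <= n)%nat -> 0 <= INR i / INR n <= 1).
  { intros i Hi. apply le_INR in Hi. generalize (pos_INR i). intros. split.
    - apply Rdiv_le_0_compat; lra.
    - apply Rle_div_l; lra. }
  assert (HX : forall i, (i <= n)%nat -> a <= X i <= b).
  { intros i Hi. unfold X. specialize (Hfrac i Hi). split; nra. }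
  assert (HY : forall i, (i <= n)%nat -> c <= Y i <= d).
  { intros i Hi. unfold Y. specialize (Hfrac i Hi). split; nra. }
  set (sg := fun (H : R -> R -> R) i j => if Rle_dec 0 (H (X i) (Y j)) then true else false).
  assert (Hpos : forall H i j, 0 < H (X i) (Y j) -> sg H i j = true).
  { intros H i j HH. unfold sg. destruct (Rle_dec 0 (H (X i) (Y j))); [reflexivity|lra]. }
  assert (Hneg : forall H i j, H (X i) (Y j) < 0 -> sg H i j = false).
  { intros H i j HH. unfold sg. destruct (Rle_dec 0 (H (X i) (Y j))); [lra|reflexivity]. }
  assert (X0 : X 0%nat = a) by (unfold X; simpl; field; lra).
  assert (Xn : X n = b) by (unfold X; field; lra).
  assert (Y0 : Y 0%nat = c) by (unfold Y; simpl; field; lra).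
  assert (Yn : Y n = d) by (unfold Y; field; lra).
  assert (Hcell : forall H i j, lipschitz2 a b c d H L -> (i < n)%nat -> (j < n)%nat ->
            m / 2 <= Rabs (H (X i) (Y j)) -> same_on_cell (sg H) i j).
  { intros H i j HH Hi Hj Hbig.
    assert (Hstep : forall i' j', (i' = i \/ i' = S i) -> (j' = j \/ j' = S j) ->
              sg H i' j' = sg H i j).
    { intros i' j' Hi' Hj'.
      assert (Bi : (i' <= n)%nat) by (destruct Hi'; lia).
      assert (Bj : (j' <= n)%nat) by (destruct Hj'; lia).
      assert (D1 : Rabs (X i' - X i) <= (b - a) / INR n).
      { assert (0 <= (b - a) / INR n) by (apply Rdiv_le_0_compat; lra).
        destruct Hi'; subst i'; unfold X; rewrite ?S_INR.
        - replace (_ - _) with 0 by ring. now rewrite Rabs_R0.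
        - replace (_ - _) with ((b - a) / INR n) by (field; lra). rewrite Rabs_pos_eq; lra. }
      assert (D2 : Rabs (Y j' - Y j) <= (d - c) / INR n).
      { assert (0 <= (d - c) / INR n) by (apply Rdiv_le_0_compat; lra).
        destruct Hj'; subst j'; unfold Y; rewrite ?S_INR.
        - replace (_ - _) with 0 by ring. now rewrite Rabs_R0.
        - replace (_ - _) with ((d - c) / INR n) by (field; lra). rewrite Rabs_pos_eq; lra. }
      assert (D3 := HH (X i') (Y j') (X i) (Y j) (HX i' Bi) (HY j' Bj) (HX i ltac:(lia))
                       (HY j ltac:(lia))).
      assert (D4 : Rabs (H (X i') (Y j') - H (X i) (Y j)) < m / 4).
      { eapply Rle_lt_trans; [exact D3|].
        apply Rle_lt_trans with (L * (w / INR n)).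
        - apply Rmult_le_compat_l; [lra|]. unfold w.
          replace ((b - a + (d - c)) / INR n) with ((b - a) / INR n + (d - c) / INR n)
            by (field; lra). lra.
        - replace (L * (w / INR n)) with (L * w / INR n) by (field; lra).
          apply Rlt_div_l; [lra|]. nra. }
      apply Rabs_def2 in D4.
      destruct (Rle_lt_dec 0 (H (X i) (Y j))) as [S0|S0].
      - rewrite Rabs_pos_eq in Hbig by lra. rewrite !Hpos; [reflexivity|lra|lra].
      - rewrite Rabs_left in Hbig by lra. rewrite !Hneg; [reflexivity|lra|lra]. }
    repeat split; apply Hstep; auto. }
  apply (no_mixed_cell_absurd (sg F) (sg G) n).
  - intros j Hj. apply Hneg. rewrite X0. apply SF, HY, Hj.
  - intros j Hj. apply Hpos. rewrite Xn. apply SF, HY, Hj.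
  - intros i Hi. apply Hneg. rewrite Y0. apply SG, HX, Hi.
  - intros i Hi. apply Hpos. rewrite Yn. apply SG, HX, Hi.
  - intros i j Hi Hj.
    assert (Hg := Hgap (X i) (Y j) (HX i ltac:(lia)) (HY j ltac:(lia))).
    destruct (Rle_lt_dec (m / 2) (Rabs (F (X i) (Y j)))) as [h|h].
    + left. now apply Hcell.
    + right. apply Hcell; try assumption. lra.
Qed.

(** * The nonlinearity on a box *)

Lemma bounded_2d (f : R -> R -> R) (a b c d : R) :
  (forall x y, a <= x <= b -> c <= y <= d -> continuity_2d_pt f x y) ->
  exists M, forall x y, a <= x <= b -> c <= y <= d -> Rabs (f x y) <= M.
Proof.
  intros Hf.
  destruct (uniform_continuity_2d f a b c d Hf (mkposreal 1 Rlt_0_1)) as [r Hr]. simpl in Hr.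
  set (delta := fun u v : R =>
    mkposreal (Rmin r (/ (Rabs (f u v) + 1)))
      (Rmin_pos _ _ (cond_pos r)
         (Rinv_0_lt_compat _ (Rle_lt_0_plus_1 _ (Rabs_pos (f u v)))))).
  destruct (compactness_value_2d a b c d delta) as [m Hm].
  exists (/ m + 1). intros x y Hx Hy. apply Rnot_lt_le. intros Hlt.
  apply (Hm x y Hx Hy). intros [u [v [Hu [Hv [Hxu [Hyv Hd]]]]]].
  unfold delta in *. simpl in *.
  assert (Hmin1 := Rmin_l r (/ (Rabs (f u v) + 1))).
  assert (Hmin2 := Rmin_r r (/ (Rabs (f u v) + 1))).
  assert (E : Rabs (f x y - f u v) < 1) by (apply Hr; try assumption; lra).
  assert (Hp := Rabs_pos (f u v)). assert (Hm0 := cond_pos m).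
  assert (E2 : Rabs (f u v) + 1 <= / m).
  { rewrite <- (Rinv_inv (Rabs (f u v) + 1)). apply Rinv_le_contravar; lra. }
  assert (E3 : Rabs (f x y) <= Rabs (f u v) + Rabs (f x y - f u v)).
  { replace (f x y) with (f u v + (f x y - f u v)) at 1 by ring. apply Rabs_triang. }
  lra.
Qed.

Definition box (lo hi vs u v : R) : Prop := lo <= u <= hi /\ vs - 1 <= v <= vs + 1.

(** The smoothness of [f] on a rectangle that contains all values taken by the solutions and
    the profiles.  One constant serves for all bounds, and Lipschitz bounds on the partial
    derivatives stand for bounds on the second derivatives. *)
Record C2box (f fu fv : R -> R -> R) (lo hi vs M : R) : Prop := {
  box_M : 1 <= M;
  box_cont : forall u v, continuous (fun p : R * R => f (fst p) (snd p)) (u, v);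
  box_contu : forall u v, continuous (fun p : R * R => fu (fst p) (snd p)) (u, v);
  box_contv : forall u v, continuous (fun p : R * R => fv (fst p) (snd p)) (u, v);
  box_du : forall u v, is_derive (fun s => f s v) u (fu u v);
  box_dv : forall u v, is_derive (fun s => f u s) v (fv u v);
  box_f : forall u v, box lo hi vs u v -> Rabs (f u v) <= M;
  box_fu : forall u v, box lo hi vs u v -> Rabs (fu u v) <= M;
  box_fv : forall u v, box lo hi vs u v -> Rabs (fv u v) <= M;
  box_lipu : forall u v u' v', box lo hi vs u v -> box lo hi vs u' v' ->
    Rabs (fu u v - fu u' v') <= M * (Rabs (u - u') + Rabs (v - v'));
  box_lipv : forall u v u' v', box lo hi vs u v -> box lo hi vs u' v' ->
    Rabs (fv u v - fv u' v') <= M * (Rabs (u - u') + Rabs (v - v')) }.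
Arguments box_M {f fu fv lo hi vs M}.
Arguments box_cont {f fu fv lo hi vs M}.
Arguments box_contu {f fu fv lo hi vs M}.
Arguments box_contv {f fu fv lo hi vs M}.
Arguments box_du {f fu fv lo hi vs M}.
Arguments box_dv {f fu fv lo hi vs M}.
Arguments box_f {f fu fv lo hi vs M}.
Arguments box_fu {f fu fv lo hi vs M}.
Arguments box_fv {f fu fv lo hi vs M}.
Arguments box_lipu {f fu fv lo hi vs M}.
Arguments box_lipv {f fu fv lo hi vs M}.

Lemma lipschitz_box (g gu gv : R -> R -> R) (lo hi vs M : R) :
  (forall u v, is_derive (fun s => g s v) u (gu u v)) ->
  (forall u v, is_derive (fun s => g u s) v (gv u v)) ->
  (forall u v, box lo hi vs u v -> Rabs (gu u v) <= M) ->
  (forall u v, box lo hi vs u v -> Rabs (gv u v) <= M) ->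
  forall u v u' v', box lo hi vs u v -> box lo hi vs u' v' ->
    Rabs (g u v - g u' v') <= M * (Rabs (u - u') + Rabs (v - v')).
Proof.
  intros Hu Hv Bu Bv u v u' v' [H1 H2] [H3 H4].
  assert (E1 : Rabs (g u v - g u' v) <= M * Rabs (u - u')).
  { apply (lipschitz_of_derive (fun s => g s v) (fun s => gu s v) lo hi); try assumption.
    - intros x _. apply Hu.
    - intros x Hx. apply Bu. now split. }
  assert (E2 : Rabs (g u' v - g u' v') <= M * Rabs (v - v')).
  { apply (lipschitz_of_derive (fun s => g u' s) (fun s => gv u' s) (vs - 1) (vs + 1));
      try assumption.
    - intros x _. apply Hv.
    - intros x Hx. apply Bv. now split. }
  replace (g u v - g u' v') with ((g u v - g u' v) + (g u' v - g u' v')) by ring.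
  eapply Rle_trans; [apply Rabs_triang|]. lra.
Qed.

(** The second partial derivatives are continuous, hence bounded on the compact rectangle. *)
Lemma C2box_of_ex_diff (f : R -> R -> R) (lo hi vs : R) :
  (forall u v, ex_diff_n f 2 u v) ->
  exists M, C2box f (partial_u f) (partial_v f) lo hi vs M.
Proof.
  intros H.
  assert (B : forall g : R -> R -> R, (forall u v, continuity_2d_pt g u v) ->
     exists M, forall u v, box lo hi vs u v -> Rabs (g u v) <= M).
  { intros g Hg. destruct (bounded_2d g lo hi (vs - 1) (vs + 1)) as [M HM].
    - intros; apply Hg.
    - exists M. intros u v [H1 H2]. now apply HM. }
  simpl in H.
  destruct (B f) as [M0 B0]; [intros; apply H|].
  destruct (B (partial_u f)) as [M1 B1]; [intros; apply H|].
  destruct (B (partial_v f)) as [M2 B2]; [intros; apply H|].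
  destruct (B (partial_u (partial_u f))) as [M3 B3]; [intros; apply H|].
  destruct (B (partial_v (partial_u f))) as [M4 B4]; [intros; apply H|].
  destruct (B (partial_u (partial_v f))) as [M5 B5]; [intros; apply H|].
  destruct (B (partial_v (partial_v f))) as [M6 B6]; [intros; apply H|].
  set (M := 1 + Rabs M0 + Rabs M1 + Rabs M2 + Rabs M3 + Rabs M4 + Rabs M5 + Rabs M6).
  assert (P := fun x => Rabs_pos x).
  assert (P0 := P M0). assert (P1 := P M1). assert (P2 := P M2). assert (P3 := P M3).
  assert (P4 := P M4). assert (P5 := P M5). assert (P6 := P M6). clear P.
  assert (Q0 := Rle_abs M0). assert (Q1 := Rle_abs M1). assert (Q2 := Rle_abs M2).
  assert (Q3 := Rle_abs M3). assert (Q4 := Rle_abs M4). assert (Q5 := Rle_abs M5).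
  assert (Q6 := Rle_abs M6).
  exists M. split.
  - unfold M; lra.
  - intros u v. apply (continuity_2d_pt_filterlim f u v), H.
  - intros u v. apply (continuity_2d_pt_filterlim (partial_u f) u v), H.
  - intros u v. apply (continuity_2d_pt_filterlim (partial_v f) u v), H.
  - intros u v. apply Derive_correct. destruct (H u v) as [_ [E _]]. exact E.
  - intros u v. apply Derive_correct. destruct (H u v) as [_ [_ [E _]]]. exact E.
  - intros u v Huv. specialize (B0 u v Huv). unfold M; lra.
  - intros u v Huv. specialize (B1 u v Huv). unfold M; lra.
  - intros u v Huv. specialize (B2 u v Huv). unfold M; lra.
  - apply (lipschitz_box _ (partial_u (partial_u f)) (partial_v (partial_u f))).
    + intros u v. apply Derive_correct. apply (H u v).
    + intros u v. apply Derive_correct. apply (H u v).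
    + intros u v Huv. specialize (B3 u v Huv). unfold M; lra.
    + intros u v Huv. specialize (B4 u v Huv). unfold M; lra.
  - apply (lipschitz_box _ (partial_u (partial_v f)) (partial_v (partial_v f))).
    + intros u v. apply Derive_correct. apply (H u v).
    + intros u v. apply Derive_correct. apply (H u v).
    + intros u v Huv. specialize (B5 u v Huv). unfold M; lra.
    + intros u v Huv. specialize (B6 u v Huv). unfold M; lra.
Qed.

(** The reflection [u -> - u] exchanges the two wells and so reduces the right half of the
    layer to the left half. *)
Definition reflect (f : R -> R -> R) (u v : R) : R := - f (- u) v.

Lemma continuous_reflect_u (f : R -> R -> R) (u v : R) :
  continuous (fun p : R * R => f (fst p) (snd p)) (- u, v) ->
  continuous (fun p : R * R => f (- fst p) (snd p)) (u, v).
Proof.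
  intros H. apply (continuous_comp_2 (fun p : R * R => - fst p) (fun p : R * R => snd p) f).
  - apply (continuous_opp (V := R_NormedModule) (fun p : R * R => fst p)). apply continuous_fst.
  - apply continuous_snd.
  - exact H.
Qed.

Lemma is_derive_reflect (g : R -> R) (x l : R) :
  is_derive g (- x) l -> is_derive (fun s => g (- s)) x (- l).
Proof.
  intros H. apply (is_derive_eq _ _ (l * -1)); [|ring].
  apply (is_derive_R_comp g (fun s => - s)); [exact H|].
  apply (is_derive_R_opp (fun s => s)), is_derive_R_id.
Qed.

Lemma C2box_reflect (f fu fv : R -> R -> R) (lo hi vs M : R) :
  C2box f fu fv lo hi vs M ->
  C2box (reflect f) (fun u v => fu (- u) v) (reflect fv) (- hi) (- lo) vs M.
Proof.
  intros [HM Hc Hcu Hcv Hu Hv Bf Bu Bv Lu Lv]. unfold reflect.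
  assert (Hbox : forall u v, box (- hi) (- lo) vs u v -> box lo hi vs (- u) v).
  { intros u v [H1 H2]. split; [lra|assumption]. }
  split; try assumption.
  - intros u v. apply (continuous_opp (V := R_NormedModule) (fun p : R * R => f (- fst p) (snd p))).
    now apply continuous_reflect_u.
  - intros u v. now apply continuous_reflect_u.
  - intros u v. apply (continuous_opp (V := R_NormedModule) (fun p : R * R => fv (- fst p) (snd p))).
    now apply continuous_reflect_u.
  - intros u v. replace (fu (- u) v) with (- - fu (- u) v) by ring.
    apply (is_derive_opp (V := R_NormedModule) (fun s => f (- s) v)).
    apply (is_derive_reflect (fun s => f s v)). apply Hu.
  - intros u v. apply (is_derive_opp (V := R_NormedModule) (fun s => f (- u) s)). apply Hv.
  - intros u v H. rewrite Rabs_Ropp. now apply Bf, Hbox.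
  - intros u v H. now apply Bu, Hbox.
  - intros u v H. rewrite Rabs_Ropp. now apply Bv, Hbox.
  - intros u v u' v' H H'. eapply Rle_trans; [apply Lu; now apply Hbox|].
    replace (- u - - u') with (- (u - u')) by ring. rewrite Rabs_Ropp. lra.
  - intros u v u' v' H H'.
    replace (- fv (- u) v - - fv (- u') v') with (- (fv (- u) v - fv (- u') v')) by ring.
    rewrite Rabs_Ropp. eapply Rle_trans; [apply Lv; now apply Hbox|].
    replace (- u - - u') with (- (u - u')) by ring. rewrite Rabs_Ropp. lra.
Qed.

Section BoxFacts.
Variables (f fu fv : R -> R -> R) (lo hi vs M : R).
Hypothesis HB : C2box f fu fv lo hi vs M.

Lemma box_lip (u v u' v' : R) :
  box lo hi vs u v -> box lo hi vs u' v' ->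
  Rabs (f u v - f u' v') <= M * (Rabs (u - u') + Rabs (v - v')).
Proof.
  apply (lipschitz_box f fu fv).
  - apply (box_du HB).
  - apply (box_dv HB).
  - apply (box_fu HB).
  - apply (box_fv HB).
Qed.

Lemma box_taylor_u (u u' v : R) :
  box lo hi vs u v -> box lo hi vs u' v ->
  Rabs (f u' v - f u v - fu u v * (u' - u)) <= M * (u' - u) ^ 2.
Proof.
  intros H H'.
  destruct (mvt (fun s => f s v) (fun s => fu s v) u u') as [c [Hc E]].
  { intros x _. apply (box_du HB). }
  rewrite E.
  replace (fu c v * (u' - u) - fu u v * (u' - u)) with ((fu c v - fu u v) * (u' - u)) by ring.
  assert (Hcb : box lo hi vs c v).
  { split; [|apply H]. now apply (between_minmax lo hi u u'); [apply H|apply H'|]. }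
  assert (L := box_lipu HB c v u v Hcb H).
  rewrite Rminus_diag, Rabs_R0, Rplus_0_r in L.
  assert (Hcu : Rabs (c - u) <= Rabs (u' - u)).
  { revert Hc. unfold Rmin, Rmax, Rabs. destruct (Rle_dec u u'), (Rcase_abs (c - u)),
      (Rcase_abs (u' - u)); lra. }
  rewrite Rabs_mult.
  replace ((u' - u) ^ 2) with (Rabs (u' - u) * Rabs (u' - u))
    by (rewrite <- pow2_abs; ring).
  rewrite <- Rmult_assoc. apply Rmult_le_compat_r; [apply Rabs_pos|].
  eapply Rle_trans; [exact L|]. apply Rmult_le_compat_l; [|assumption].
  generalize (box_M HB); lra.
Qed.

Lemma continuous_along (p q : R -> R) (x : R) :
  continuous p x -> continuous q x -> continuous (fun s => f (p s) (q s)) x.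
Proof.
  intros Hp Hq. apply (continuous_comp_2 p q f); try assumption.
  apply (box_cont HB).
Qed.
End BoxFacts.

(** * Half-periods of a scalar oscillator *)

Lemma continuous_eps (f : R -> R) (x : R) :
  continuous f x -> forall e, 0 < e -> exists r, 0 < r /\
    forall y, Rabs (y - x) < r -> Rabs (f y - f x) < e.
Proof.
  intros H e He. apply continuity_pt_filterlim in H.
  destruct (H e He) as [r [Hr Hd]]. exists r. split; [exact Hr|].
  intros y Hy. destruct (Req_dec x y) as [->|N].
  - rewrite Rminus_diag, Rabs_R0. exact He.
  - apply (Hd y). split; [split; [exact I|exact N]|exact Hy].
Qed.

Lemma continuous_of_eps (f : R -> R) (x : R) :
  (forall e, 0 < e -> exists r, 0 < r /\
    forall y, Rabs (y - x) < r -> Rabs (f y - f x) < e) -> continuous f x.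
Proof.
  intros H. apply continuity_pt_filterlim. intros e He.
  destruct (H e He) as [r [Hr Hd]]. exists r. split; [exact Hr|].
  intros y [_ Hy]. apply Hd. exact Hy.
Qed.

Lemma is_derive_continuous (f : R -> R) (x l : R) : is_derive f x l -> continuous f x.
Proof. intros H. apply (ex_derive_continuous f x). now exists l. Qed.

(** Away from the zeros of [s] a smooth square is enough: this reads the acceleration off the
    energy relation. *)
Lemma is_derive_of_square (s : R -> R) (t y : R) :
  continuous s t -> s t <> 0 -> is_derive (fun x => s x * s x) t y ->
  is_derive s t (y / (2 * s t)).
Proof.
  intros Hc H0 Hd.
  assert (Hsq : 0 < s t * s t) by nra.
  assert (Hroot : is_derive (fun x => sqrt (s x * s x)) t (/ (2 * sqrt (s t * s t)) * y)).
  { apply (is_derive_R_comp sqrt (fun x => s x * s x)); [|exact Hd].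
    auto_derive; [exact Hsq|ring]. }
  destruct (continuous_eps s t Hc (Rabs (s t)) (Rabs_pos_lt _ H0)) as [r [Hr Hnear]].
  destruct (Rlt_le_dec 0 (s t)) as [P|P].
  - apply (is_derive_ext_loc (fun x => sqrt (s x * s x))).
    + exists (mkposreal r Hr). intros x Hx. specialize (Hnear x Hx).
      rewrite (Rabs_pos_eq (s t)) in Hnear by lra. apply Rabs_def2 in Hnear.
      apply sqrt_square. lra.
    + apply (is_derive_eq _ _ _ _ Hroot). rewrite sqrt_square by lra. field. lra.
  - apply (is_derive_ext_loc (fun x => - sqrt (s x * s x))).
    + exists (mkposreal r Hr). intros x Hx. specialize (Hnear x Hx).
      rewrite (Rabs_left1 (s t)) in Hnear by lra. apply Rabs_def2 in Hnear.
      change (- sqrt (s x * s x) = s x).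
      replace (s x * s x) with (- s x * - s x) by ring. rewrite sqrt_square; lra.
    + apply (is_derive_eq _ _ _ _ (is_derive_R_opp _ _ _ Hroot)).
      replace (s t * s t) with (- s t * - s t) by ring.
      rewrite sqrt_square by lra. field. lra.
Qed.

(** The second factor need only be continuous where the first one vanishes: at a rest point the
    speed is the product of a sine and of a factor that is not known to be differentiable. *)
Lemma is_derive_mult_at_zero (y q : R -> R) (t l : R) :
  is_derive y t l -> y t = 0 -> continuous q t ->
  is_derive (fun x => y x * q x) t (l * q t).
Proof.
  intros Hy H0 Hq. apply is_derive_Reals. apply is_derive_Reals in Hy.
  intros e He.
  assert (Hb := Rabs_pos (q t)). assert (Hl := Rabs_pos l).
  destruct (continuous_eps q t Hq 1 Rlt_0_1) as [r1 [Hr1 H1]].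
  destruct (continuous_eps q t Hq (e / (2 * (Rabs l + 1)))) as [r2 [Hr2 H2]].
  { apply Rdiv_lt_0_compat; lra. }
  destruct (Hy (e / (2 * (Rabs (q t) + 1)))) as [r3 H3].
  { apply Rdiv_lt_0_compat; lra. }
  assert (Hr : 0 < Rmin (Rmin r1 r2) r3).
  { repeat apply Rmin_pos; try assumption. apply cond_pos. }
  exists (mkposreal _ Hr). intros h Hh Hhr. simpl in Hhr.
  assert (M1 := Rmin_l (Rmin r1 r2) r3). assert (M2 := Rmin_r (Rmin r1 r2) r3).
  assert (M3 := Rmin_l r1 r2). assert (M4 := Rmin_r r1 r2).
  assert (Eh : t + h - t = h) by ring.
  assert (K1 := H1 (t + h)). assert (K2 := H2 (t + h)). rewrite Eh in K1, K2.
  specialize (K1 ltac:(lra)). specialize (K2 ltac:(lra)).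
  specialize (H3 h Hh ltac:(lra)). rewrite H0 in *.
  replace ((y (t + h) * q (t + h) - 0 * q t) / h - l * q t)
    with (((y (t + h) - 0) / h - l) * q (t + h) + l * (q (t + h) - q t)) by (field; exact Hh).
  assert (K3 : Rabs (q (t + h)) < Rabs (q t) + 1).
  { replace (q (t + h)) with (q t + (q (t + h) - q t)) by ring.
    eapply Rle_lt_trans; [apply Rabs_triang|]. lra. }
  eapply Rle_lt_trans; [apply Rabs_triang|]. rewrite !Rabs_mult.
  apply Rlt_le_trans with
    (e / (2 * (Rabs (q t) + 1)) * (Rabs (q t) + 1) + (Rabs l + 1) * (e / (2 * (Rabs l + 1)))).
  - apply Rplus_le_lt_compat.
    + apply Rmult_le_compat; try apply Rabs_pos; lra.
    + apply Rle_lt_trans with ((Rabs l) * (e / (2 * (Rabs l + 1)))).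
      * apply Rmult_le_compat_l; lra.
      * apply Rmult_lt_compat_r; [apply Rdiv_lt_0_compat; lra|lra].
  - right. field. lra.
Qed.

(** A clock that runs at the positive rate [/ k] can be read backwards for all times, since
    the rate is bounded below. *)
Lemma inverse_clock (T k : R -> R) (kmax : R) :
  0 < kmax -> (forall x, continuous k x) -> (forall x, 0 < k x <= kmax) ->
  (forall x, is_derive T x (/ k x)) ->
  exists Th : R -> R, (forall t, T (Th t) = t) /\ (forall x, Th (T x) = x) /\
    (forall t, is_derive Th t (k (Th t))).
Proof.
  intros Hm Hk Hkb HT.
  assert (Hgrow : forall x y, x <= y -> (y - x) / kmax <= T y - T x).
  { intros x y Hxy. destruct (mvt T (fun s => / k s) x y) as [c [Hc E]].
    - intros; apply HT.
    - rewrite E. unfold Rdiv. rewrite Rmult_comm. apply Rmult_le_compat_r; [lra|].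
      apply Rinv_le_contravar; apply Hkb. }
  assert (Hexp : forall x y, Rabs (y - x) <= kmax * Rabs (T y - T x)).
  { assert (W : forall x y, x <= y -> Rabs (y - x) <= kmax * Rabs (T y - T x)).
    { intros x y Hxy. specialize (Hgrow x y Hxy).
      assert (0 <= (y - x) / kmax) by (apply Rdiv_le_0_compat; lra).
      rewrite !Rabs_pos_eq by lra. apply Rle_div_l in Hgrow; [lra|lra]. }
    intros x y. destruct (Rle_dec x y); [now apply W|].
    rewrite (Rabs_minus_sym y x), (Rabs_minus_sym (T y)). apply W; lra. }
  assert (Hsurj : forall t, exists x, T x = t).
  { intros t. set (s := t - T 0).
    assert (H1 : s <= T (kmax * Rabs s) - T 0).
    { assert (G := Hgrow 0 (kmax * Rabs s)). generalize (Rabs_pos s) (Rle_abs s); intros.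
      specialize (G ltac:(nra)).
      replace ((kmax * Rabs s - 0) / kmax) with (Rabs s) in G by (field; lra). lra. }
    assert (H2 : T (- (kmax * Rabs s)) - T 0 <= s).
    { assert (G := Hgrow (- (kmax * Rabs s)) 0).
      generalize (Rabs_pos s) (Rle_abs (- s)); rewrite Rabs_Ropp; intros.
      specialize (G ltac:(nra)).
      replace ((0 - - (kmax * Rabs s)) / kmax) with (Rabs s) in G by (field; lra). lra. }
    destruct (IVT_gen T (- (kmax * Rabs s)) (kmax * Rabs s) t) as [x [_ Hx]].
    - intros x. apply (is_derive_continuity_pt _ _ _ (HT x)).
    - unfold s in *. rewrite Rmin_left, Rmax_right; lra.
    - now exists x. }
  set (Th := fun t => proj1_sig (constructive_indefinite_description _ (Hsurj t))).
  assert (E1 : forall t, T (Th t) = t).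
  { intros t. unfold Th. now destruct (constructive_indefinite_description _ (Hsurj t)). }
  assert (Hlip : forall s t, Rabs (Th t - Th s) <= kmax * Rabs (t - s)).
  { intros s t. assert (G := Hexp (Th s) (Th t)). rewrite !E1 in G. exact G. }
  exists Th. split; [exact E1|]. split.
  - intros x. assert (G := Hexp x (Th (T x))). rewrite E1, Rminus_diag, Rabs_R0, Rmult_0_r in G.
    assert (P := Rabs_pos (Th (T x) - x)).
    assert (E : Rabs (Th (T x) - x) = 0) by lra. apply Rabs_eq_0 in E. lra.
  - intros t. apply is_derive_Reals. intros e He.
    destruct (continuous_eps k (Th t) (Hk _) e He) as [r [Hr Hd]].
    assert (Hr' : 0 < r / kmax) by (apply Rdiv_lt_0_compat; lra).
    exists (mkposreal _ Hr'). intros h Hh Hhr. simpl in Hhr.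
    destruct (mvt T (fun s => / k s) (Th t) (Th (t + h))) as [c [Hc E]].
    { intros; apply HT. }
    rewrite !E1 in E. replace (t + h - t) with h in E by ring.
    assert (Kc : 0 < k c) by apply Hkb.
    replace (Th (t + h) - Th t) with (k c * h) by (rewrite E at 1; field; lra).
    replace (k c * h / h - k (Th t)) with (k c - k (Th t)) by (field; exact Hh).
    apply Hd. apply Rle_lt_trans with (Rabs (Th (t + h) - Th t)).
    + revert Hc. unfold Rmin, Rmax, Rabs. destruct (Rle_dec (Th t) (Th (t + h))),
        (Rcase_abs (c - Th t)), (Rcase_abs (Th (t + h) - Th t)); lra.
    + eapply Rle_lt_trans; [apply Hlip|]. replace (t + h - t) with h by ring.
      apply Rlt_div_r in Hhr; lra.
Qed.

(** An angular coordinate on [[a, d]]: its derivative vanishes at the ends like the square root of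
    the distance to them, as the speed of an orbit does. *)
Definition sweep (a d th : R) : R := (a + d) / 2 - (d - a) / 2 * cos th.

(** This is the second divided difference, at the points [a], [u] and [d], of a primitive
    of [g]: when the integral of [g] over [[a, d]] is zero, [(u - a) * (d - u) * stiffness]
    is the kinetic energy at [u] of the orbit of [x'' + g x = 0] that rests at [a] and [d].
    The two averages keep it regular at the rest points. *)
Definition stiffness (g : R -> R) (a d u : R) : R :=
  (RInt (fun s => g (d - s * (d - u))) 0 1 - RInt (fun s => g (a + s * (u - a))) 0 1)
  / (d - a).

Lemma sweep_range (a d th : R) : a <= d -> a <= sweep a d th <= d.
Proof. intros H. unfold sweep. generalize (COS_bound th). intros. nra. Qed.

Lemma sweep_left (a d th : R) : sweep a d th - a = (d - a) / 2 * (1 - cos th).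
Proof. unfold sweep. field. Qed.

Lemma sweep_right (a d th : R) : d - sweep a d th = (d - a) / 2 * (1 + cos th).
Proof. unfold sweep. field. Qed.

Lemma cos_lt_1 (th : R) : 0 < th < PI -> -1 < cos th < 1.
Proof.
  intros H. generalize (sin_gt_0 th (proj1 H) (proj2 H)) (sin2_cos2 th).
  unfold Rsqr. intros. split; nra.
Qed.

Lemma sweep_open (a d th : R) : a < d -> 0 < th < PI -> a < sweep a d th < d.
Proof. intros H Hth. unfold sweep. generalize (cos_lt_1 th Hth). intros. split; nra. Qed.

Section Oscillator.
Variables (g : R -> R) (a d G : R).
Hypothesis Hg : forall x, continuous g x.
Hypothesis Had : a < d.
Hypothesis Hlip : forall x y, a <= x <= d -> a <= y <= d -> Rabs (g x - g y) <= G * Rabs (x - y).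
Hypothesis Hzero : RInt g a d = 0.

Lemma ex_RInt_g (x y : R) : ex_RInt g x y.
Proof. now apply ex_RInt_cont. Qed.

Lemma continuous_affine (p q x : R) : continuous (fun s : R => g (p + s * q)) x.
Proof.
  apply (continuous_comp (fun s => p + s * q) g); [|apply Hg].
  apply (is_derive_continuous _ _ q). auto_derive; [exact I|ring].
Qed.

Lemma average_left (u : R) :
  (u - a) * RInt (fun s => g (a + s * (u - a))) 0 1 = RInt g a u.
Proof.
  assert (E := RInt_comp_lin g (u - a) a 0 1).
  rewrite !Rmult_0_r, Rmult_1_r, Rplus_0_l in E.
  replace (u - a + a) with u in E by ring. rewrite <- E by apply ex_RInt_g.
  rewrite (RInt_scal (V := R_CompleteNormedModule)).
  - unfold scal; simpl; unfold mult; simpl. f_equal. apply RInt_ext. intros x _. f_equal. ring.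
  - apply (ex_RInt_continuous (V := R_CompleteNormedModule)). intros x _.
    apply (continuous_ext (fun s => g (a + s * (u - a)))).
    + intros s. f_equal. ring.
    + apply continuous_affine.
Qed.

Lemma average_right (u : R) :
  (d - u) * RInt (fun s => g (d - s * (d - u))) 0 1 = RInt g u d.
Proof.
  assert (E := RInt_comp_lin g (- (d - u)) d 0 1).
  rewrite !Rmult_0_r, Rmult_1_r, Rplus_0_l in E.
  replace (- (d - u) + d) with u in E by ring.
  rewrite <- (opp_RInt_swap g) by apply ex_RInt_g.
  rewrite <- E by apply ex_RInt_g.
  rewrite (RInt_scal (V := R_CompleteNormedModule)).
  - unfold scal, opp; simpl; unfold mult; simpl.
    rewrite (RInt_ext (fun s => g (d - s * (d - u))) (fun s => g (- (d - u) * s + d))).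
    + ring.
    + intros x _. f_equal. ring.
  - apply (ex_RInt_continuous (V := R_CompleteNormedModule)). intros x _.
    apply (continuous_ext (fun s => g (d + s * - (d - u)))).
    + intros s. f_equal. ring.
    + apply continuous_affine.
Qed.

Lemma stiffness_energy (u : R) :
  (u - a) * (d - u) * stiffness g a d u = - RInt g a u.
Proof.
  unfold stiffness.
  assert (E1 := average_left u). assert (E2 := average_right u).
  assert (E3 : RInt g a u + RInt g u d = 0).
  { rewrite <- Hzero. apply (RInt_Chasles (V := R_CompleteNormedModule)); apply ex_RInt_g. }
  set (p := RInt (fun s => g (d - s * (d - u))) 0 1) in *.
  set (q := RInt (fun s => g (a + s * (u - a))) 0 1) in *.
  replace ((u - a) * (d - u) * ((p - q) / (d - a)))
    with (((u - a) * ((d - u) * p) - (d - u) * ((u - a) * q)) / (d - a)) by (field; lra).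
  rewrite E1, E2. replace (RInt g u d) with (- RInt g a u) by lra. field. lra.
Qed.

Lemma RInt_const_R (x y c : R) : RInt (fun _ => c) x y = (y - x) * c.
Proof. apply (RInt_const (V := R_CompleteNormedModule)). Qed.

Lemma stiffness_at_left : stiffness g a d a = - g a / (d - a).
Proof.
  unfold stiffness.
  assert (E2 := average_right a). rewrite Hzero in E2.
  assert (E : RInt (fun s => g (d - s * (d - a))) 0 1 = 0) by nra. rewrite E.
  rewrite (RInt_ext _ (fun _ => g a)), RInt_const_R.
  - field. lra.
  - intros x _. f_equal. ring.
Qed.

Lemma stiffness_at_right : stiffness g a d d = g d / (d - a).
Proof.
  unfold stiffness.
  assert (E1 := average_left d). rewrite Hzero in E1.
  assert (E : RInt (fun s => g (a + s * (d - a))) 0 1 = 0) by nra. rewrite E.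
  rewrite (RInt_ext _ (fun _ => g d)), RInt_const_R.
  - field. lra.
  - intros x _. f_equal. ring.
Qed.

Lemma RInt_abs_diff_le (p q : R -> R) (x y C : R) :
  x <= y -> (forall s, continuous p s) -> (forall s, continuous q s) ->
  (forall s, x <= s <= y -> Rabs (p s - q s) <= C) ->
  Rabs (RInt p x y - RInt q x y) <= (y - x) * C.
Proof.
  intros Hxy Hp Hq HC.
  assert (Ip : ex_RInt p x y)
    by (apply (ex_RInt_continuous (V := R_CompleteNormedModule)); intros; apply Hp).
  assert (Iq : ex_RInt q x y)
    by (apply (ex_RInt_continuous (V := R_CompleteNormedModule)); intros; apply Hq).
  assert (E : RInt p x y - RInt q x y = RInt (fun s => p s - q s) x y).
  { symmetry. apply (RInt_minus (V := R_CompleteNormedModule)); assumption. }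
  rewrite E. apply abs_RInt_le_const; [exact Hxy| |exact HC].
  apply (ex_RInt_minus (V := R_NormedModule)); assumption.
Qed.

(** The averages over [[0, 1]] vary with [u] at most as fast as [g] does, with no loss of
    regularity at the ends of the interval. *)
Lemma stiffness_lipschitz (u u' : R) :
  a <= u <= d -> a <= u' <= d ->
  Rabs (stiffness g a d u - stiffness g a d u') <= 2 * G / (d - a) * Rabs (u - u').
Proof.
  intros Hu Hu'.
  assert (HG : 0 <= G * Rabs (u - u')).
  { eapply Rle_trans; [apply Rabs_pos|apply Hlip; eassumption]. }
  assert (B1 : Rabs (RInt (fun s => g (d - s * (d - u))) 0 1
                     - RInt (fun s => g (d - s * (d - u'))) 0 1) <= (1 - 0) * (G * Rabs (u - u'))).
  { apply RInt_abs_diff_le; [lra| | |].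
    - intros s. apply (continuous_ext (fun s => g (d + s * - (d - u)))); [|apply continuous_affine].
      intros; f_equal; ring.
    - intros s. apply (continuous_ext (fun s => g (d + s * - (d - u')))); [|apply continuous_affine].
      intros; f_equal; ring.
    - intros s Hs. eapply Rle_trans; [apply Hlip; nra|].
      replace (d - s * (d - u) - (d - s * (d - u'))) with (s * (u - u')) by ring.
      rewrite Rabs_mult, (Rabs_pos_eq s) by lra. nra. }
  assert (B2 : Rabs (RInt (fun s => g (a + s * (u - a))) 0 1
                     - RInt (fun s => g (a + s * (u' - a))) 0 1) <= (1 - 0) * (G * Rabs (u - u'))).
  { apply RInt_abs_diff_le; [lra|intros; apply continuous_affine..|].
    intros s Hs. eapply Rle_trans; [apply Hlip; nra|].
    replace (a + s * (u - a) - (a + s * (u' - a))) with (s * (u - u')) by ring.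
    rewrite Rabs_mult, (Rabs_pos_eq s) by lra. nra. }
  unfold stiffness.
  replace (_ / (d - a) - _ / (d - a)) with
    (((RInt (fun s => g (d - s * (d - u))) 0 1 - RInt (fun s => g (d - s * (d - u'))) 0 1)
     - (RInt (fun s => g (a + s * (u - a))) 0 1 - RInt (fun s => g (a + s * (u' - a))) 0 1))
     / (d - a)) by (field; lra).
  unfold Rdiv. rewrite Rabs_mult, (Rabs_pos_eq (/ (d - a)))
    by (left; apply Rinv_0_lt_compat; lra).
  replace (2 * G * / (d - a) * Rabs (u - u')) with (2 * (G * Rabs (u - u')) * / (d - a)) by ring.
  apply Rmult_le_compat_r; [left; apply Rinv_0_lt_compat; lra|].
  unfold Rminus at 1. eapply Rle_trans; [apply Rabs_triang|]. rewrite Rabs_Ropp. lra.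
Qed.

Lemma is_derive_sweep (th : R) : is_derive (sweep a d) th ((d - a) / 2 * sin th).
Proof. unfold sweep. auto_derive; [exact I|field]. Qed.

Lemma continuous_stiffness_sweep (th : R) :
  continuous (fun x => stiffness g a d (sweep a d x)) th.
Proof.
  apply continuous_of_eps. intros e He.
  destruct (continuous_eps _ _ (is_derive_continuous _ _ _ (is_derive_sweep th))
    (e / (Rabs (2 * G / (d - a)) + 1))) as [r [Hr H]].
  { apply Rdiv_lt_0_compat; [exact He|]. generalize (Rabs_pos (2 * G / (d - a))); lra. }
  exists r. split; [exact Hr|]. intros y Hy. specialize (H y Hy).
  eapply Rle_lt_trans; [apply stiffness_lipschitz; apply sweep_range; lra|].
  assert (P := Rabs_pos (2 * G / (d - a))). assert (Q := Rle_abs (2 * G / (d - a))).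
  apply Rlt_div_r in H; [|lra]. assert (P2 := Rabs_pos (sweep a d y - sweep a d th)). nra.
Qed.

(** In the angle [th] with [u = sweep a d th] the energy relation reads
    [th' = sqrt (2 * stiffness)], a first-order equation without the singularities that the
    speed has at the two rest points. *)
Theorem oscillator_solution (al : R) :
  (forall u, a <= u <= d -> 0 < stiffness g a d u) -> a < al < d ->
  exists (L R1 : R) (U U1 : R -> R),
    0 < L /\ 0 < R1 /\
    L + R1 = RInt (fun th => / sqrt (2 * stiffness g a d (sweep a d th))) 0 PI /\
    (forall t, is_derive U t (U1 t)) /\
    (forall t, is_derive U1 t (- g (U t))) /\
    U (- L) = a /\ U1 (- L) = 0 /\ U 0 = al /\ U R1 = d /\ U1 R1 = 0 /\
    (forall t, a <= U t <= d) /\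
    (forall t, - L <= t <= R1 -> 0 <= U1 t) /\
    (forall t, (U1 t) ^ 2 = - 2 * RInt g a (U t)) /\
    (forall rho : R -> R, (forall x, continuous rho x) ->
       RInt (fun t => rho (U t)) (- L) R1 =
       RInt (fun th => rho (sweep a d th) / sqrt (2 * stiffness g a d (sweep a d th))) 0 PI).
Proof.
  intros HK Hal.
  set (K := fun th => stiffness g a d (sweep a d th)).
  set (k := fun th => sqrt (2 * K th)).
  assert (HKp : forall th, 0 < K th) by (intros th; apply HK, sweep_range; lra).
  assert (Hk0 : forall th, 0 < k th).
  { intros th. apply sqrt_lt_R0. specialize (HKp th). lra. }
  assert (Hk2 : forall th, k th * k th = 2 * K th).
  { intros th. apply sqrt_sqrt. specialize (HKp th). lra. }
  assert (Hkc : forall th, continuous k th).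
  { intros th. apply (continuous_comp (fun x => 2 * K x) sqrt).
    - apply (continuous_scal_r (V := R_NormedModule) 2 K). apply continuous_stiffness_sweep.
    - apply continuous_sqrt. }
  set (Kmax := stiffness g a d a + Rabs (2 * G / (d - a)) * (d - a)).
  assert (HKmax : forall th, K th <= Kmax).
  { intros th. unfold K, Kmax.
    assert (Hs := sweep_range a d th (Rlt_le _ _ Had)).
    assert (B := stiffness_lipschitz (sweep a d th) a Hs ltac:(lra)).
    assert (A := Rle_abs (stiffness g a d (sweep a d th) - stiffness g a d a)).
    assert (P := Rabs_pos (2 * G / (d - a))). assert (Q := Rle_abs (2 * G / (d - a))).
    rewrite (Rabs_pos_eq (sweep a d th - a)) in B by lra.
    assert (2 * G / (d - a) * (sweep a d th - a) <= Rabs (2 * G / (d - a)) * (d - a)).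
    { apply Rle_trans with (Rabs (2 * G / (d - a)) * (sweep a d th - a)); nra. }
    lra. }
  set (T := fun th => RInt (fun x => / k x) 0 th : R).
  assert (Hik : forall th, continuous (fun x => / k x) th).
  { intros th. apply (continuous_comp k Rinv); [apply Hkc|].
    apply continuity_pt_filterlim. apply continuity_pt_inv.
    - apply derivable_continuous_pt, derivable_pt_id.
    - unfold id. generalize (Hk0 th); lra. }
  assert (HTd : forall th, is_derive T th (/ k th)).
  { intros th. exact (is_derive_primitive (fun x => / k x) 0 th Hik). }
  destruct (inverse_clock T k (sqrt (2 * Kmax))) as [Th [HT1 [HT2 HTh]]]; try assumption.
  { apply sqrt_lt_R0. specialize (HKp 0). specialize (HKmax 0). lra. }
  { intros x. split; [apply Hk0|]. apply sqrt_le_1_alt. specialize (HKmax x). lra. }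
  assert (Hpi := PI_RGT_0).
  (* the angle at which the level [al] is crossed *)
  destruct (IVT_gen (sweep a d) 0 PI al) as [tha [Htha Etha]].
  { intros x. apply (is_derive_continuity_pt _ _ _ (is_derive_sweep x)). }
  { unfold sweep. rewrite cos_0, cos_PI, Rmin_left, Rmax_right; lra. }
  rewrite Rmin_left, Rmax_right in Htha by lra.
  assert (S0 : sweep a d 0 = a) by (unfold sweep; rewrite cos_0; field).
  assert (Spi : sweep a d PI = d) by (unfold sweep; rewrite cos_PI; field).
  assert (Htha' : 0 < tha < PI).
  { split; apply Rnot_le_lt; intros h.
    - replace tha with 0 in Etha by lra. lra.
    - replace tha with PI in Etha by lra. lra. }
  assert (HTmono : forall x y, x < y -> T x < T y).
  { intros x y Hxy. destruct (mvt T (fun s => / k s) x y) as [c [Hc E]].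
    - intros; apply HTd.
    - assert (0 < / k c) by (apply Rinv_0_lt_compat, Hk0). nra. }
  assert (HT0 : T 0 = 0) by (unfold T; apply (RInt_point (V := R_CompleteNormedModule))).
  set (L := T tha). set (R1 := T PI - T tha).
  set (U := fun t => sweep a d (Th (t + L))).
  set (U1 := fun t => (d - a) / 2 * sin (Th (t + L)) * k (Th (t + L))).
  assert (HThs : forall t, is_derive (fun s => Th (s + L)) t (k (Th (t + L)))).
  { intros t. apply (is_derive_eq _ _ (k (Th (t + L)) * 1)); [|ring].
    apply (is_derive_R_comp Th (fun s => s + L)); [apply HTh|].
    apply (is_derive_eq _ _ (1 + 0)); [|ring].
    apply is_derive_R_plus; [apply is_derive_R_id|apply is_derive_R_const]. }
  assert (HU : forall t, is_derive U t (U1 t)).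
  { intros t. apply (is_derive_R_comp (sweep a d) (fun s => Th (s + L))); [apply is_derive_sweep|].
    apply HThs. }
  assert (Hen : forall t, U1 t * U1 t = - 2 * RInt g a (U t)).
  { intros t. unfold U1, U. set (th := Th (t + L)).
    replace ((d - a) / 2 * sin th * k th * ((d - a) / 2 * sin th * k th))
      with (((d - a) / 2) ^ 2 * (sin th * sin th) * (k th * k th)) by ring.
    rewrite Hk2.
    assert (Es : sin th * sin th = (1 - cos th) * (1 + cos th)).
    { generalize (sin2_cos2 th). unfold Rsqr. lra. }
    assert (E := stiffness_energy (sweep a d th)). fold (K th) in E.
    rewrite sweep_left, sweep_right in E. rewrite Es. nra. }
  assert (HRd : forall x, is_derive (fun y => RInt g a y) x (g x)).
  { intros x. exact (is_derive_primitive g a x Hg). }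
  assert (HkTh : forall t, continuous (fun s => k (Th (s + L))) t).
  { intros t. apply (continuous_comp (fun s => Th (s + L)) k).
    - apply (is_derive_continuous _ _ _ (HThs t)).
    - apply Hkc. }
  assert (Hsin : forall t, is_derive (fun s => (d - a) / 2 * sin (Th (s + L))) t
                   ((d - a) / 2 * (cos (Th (t + L)) * k (Th (t + L))))).
  { intros t. apply is_derive_R_scal. apply (is_derive_R_comp sin (fun s => Th (s + L))).
    - apply is_derive_Reals. apply derivable_pt_lim_sin.
    - apply HThs. }
  assert (HU1 : forall t, is_derive U1 t (- g (U t))).
  { intros t. destruct (Req_dec (sin (Th (t + L))) 0) as [Z|Z].
    - (* a rest point: only the factor [sin] is differentiated *)
      apply (is_derive_eq _ _ ((d - a) / 2 * (cos (Th (t + L)) * k (Th (t + L)))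
                               * k (Th (t + L)))).
      + apply (is_derive_mult_at_zero (fun s => (d - a) / 2 * sin (Th (s + L)))
                 (fun s => k (Th (s + L)))); [apply Hsin|rewrite Z; ring|apply HkTh].
      + unfold U. set (th := Th (t + L)) in *.
        replace ((d - a) / 2 * (cos th * k th) * k th)
          with ((d - a) / 2 * cos th * (k th * k th)) by ring.
        rewrite Hk2. unfold K.
        assert (C2 : cos th = 1 \/ cos th = -1).
        { generalize (sin2_cos2 th). rewrite Z. unfold Rsqr. intros E.
          assert (F : (cos th - 1) * (cos th + 1) = 0) by lra.
          apply Rmult_integral in F. destruct F; [left|right]; lra. }
        destruct C2 as [C2|C2].
        * assert (Es : sweep a d th = a) by (unfold sweep; rewrite C2; field).
          rewrite Es, C2, stiffness_at_left. field. lra.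
        * assert (Es : sweep a d th = d) by (unfold sweep; rewrite C2; field).
          rewrite Es, C2, stiffness_at_right. field. lra.
    - assert (N : U1 t <> 0).
      { unfold U1. generalize (Hk0 (Th (t + L))). intros.
        repeat apply Rmult_integral_contrapositive_currified; try assumption; lra. }
      apply (is_derive_eq _ _ ((- 2 * (g (U t) * U1 t)) / (2 * U1 t))); [|field; exact N].
      apply is_derive_of_square.
      + apply (continuous_mult (fun s => (d - a) / 2 * sin (Th (s + L))) (fun s => k (Th (s + L)))).
        * apply (is_derive_continuous _ _ _ (Hsin t)).
        * apply HkTh.
      + exact N.
      + apply (is_derive_ext (fun x => - 2 * RInt g a (U x))).
        * intros x. symmetry. apply Hen.
        * apply is_derive_R_scal. apply (is_derive_R_comp (fun y => RInt g a y) U);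
            [apply HRd|apply HU]. }
  assert (EL : Th (- L + L) = 0) by (rewrite Rplus_opp_l; rewrite <- HT0 at 1; apply HT2).
  assert (ER : Th (R1 + L) = PI).
  { replace (R1 + L) with (T PI) by (unfold R1, L; ring). apply HT2. }
  assert (E0 : Th (0 + L) = tha) by (rewrite Rplus_0_l; apply HT2).
  exists L, R1, U, U1.
  split; [unfold L; rewrite <- HT0; apply HTmono; lra|].
  split; [unfold R1; assert (T tha < T PI) by (apply HTmono; lra); lra|].
  split; [transitivity (T PI); [unfold L, R1; ring|reflexivity]|].
  split; [exact HU|]. split; [exact HU1|].
  split; [unfold U; rewrite EL; exact S0|].
  split; [unfold U1; rewrite EL, sin_0; ring|].
  split; [unfold U; rewrite E0; exact Etha|].
  split; [unfold U; rewrite ER; exact Spi|].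
  split; [unfold U1; rewrite ER, sin_PI; ring|].
  split; [intros t; apply sweep_range; lra|].
  split.
  { intros t Ht. unfold U1.
    assert (Hth : 0 <= Th (t + L) <= PI).
    { split; apply Rnot_lt_le; intros h; apply HTmono in h; rewrite HT1 in h;
        unfold R1, L in *; rewrite ?HT0 in h; lra. }
    apply Rmult_le_pos; [|left; apply Hk0].
    apply Rmult_le_pos; [lra|]. apply sin_ge_0; lra. }
  split; [intros t; rewrite <- Hen; ring|].
  intros rho Hrho.
  assert (Hrc : forall x, continuous (fun th => rho (sweep a d th) / k th) x).
  { intros x. apply (continuous_mult (fun th => rho (sweep a d th)) (fun th => / k th)).
    - apply (continuous_comp (sweep a d) rho); [|apply Hrho].
      apply (is_derive_continuous _ _ _ (is_derive_sweep x)).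
    - apply Hik. }
  set (Y := fun th => RInt (fun x => rho (sweep a d x) / k x) 0 th : R).
  assert (HY : forall th, is_derive Y th (rho (sweep a d th) / k th)).
  { intros th. exact (is_derive_primitive (fun x => rho (sweep a d x) / k x) 0 th Hrc). }
  apply is_RInt_unique.
  replace (RInt (fun th => rho (sweep a d th) / sqrt (2 * stiffness g a d (sweep a d th))) 0 PI)
    with (Y (Th (R1 + L)) - Y (Th (- L + L))).
  - apply (is_RInt_derive (V := R_CompleteNormedModule) (fun t => Y (Th (t + L)))).
    + intros t _. apply (is_derive_eq _ _ (rho (sweep a d (Th (t + L))) / k (Th (t + L)) * k (Th (t + L)))).
      * apply (is_derive_R_comp Y (fun s => Th (s + L))); [apply HY|apply HThs].
      * unfold U. field. generalize (Hk0 (Th (t + L))); lra.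
    + intros t _. apply (continuous_comp U rho); [|apply Hrho].
      apply (is_derive_continuous _ _ _ (HU t)).
  - rewrite ER, EL. unfold Y at 2.
    rewrite (RInt_point (V := R_CompleteNormedModule)). unfold zero; simpl. unfold Y, k, K. ring.
Qed.
End Oscillator.

(** * Weighted time maps near the saddles *)

Lemma RInt_affine (x y p q : R) :
  RInt (fun s => p + q * (s - x)) x y = p * (y - x) + q / 2 * (y - x) ^ 2.
Proof.
  apply is_RInt_unique.
  replace (p * (y - x) + q / 2 * (y - x) ^ 2)
    with ((p * (y - x) + q / 2 * (y - x) ^ 2) - (p * (x - x) + q / 2 * (x - x) ^ 2)) by ring.
  apply (is_RInt_derive (V := R_CompleteNormedModule)
           (fun s => p * (s - x) + q / 2 * (s - x) ^ 2)).
  - intros s _. auto_derive; [exact I|field].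
  - intros s _. apply (is_derive_continuous _ _ q). auto_derive; [exact I|ring].
Qed.

Lemma RInt_le_affine (g : R -> R) (x y p q : R) :
  (forall s, continuous g s) -> x <= y ->
  (forall s, x <= s <= y -> g s <= p + q * (s - x)) ->
  RInt g x y <= p * (y - x) + q / 2 * (y - x) ^ 2.
Proof.
  intros Hg Hxy H. rewrite <- RInt_affine. apply RInt_le; [exact Hxy|now apply ex_RInt_cont| |].
  - apply ex_RInt_cont. intros s. apply (is_derive_continuous _ _ q). auto_derive; [exact I|ring].
  - intros s Hs. apply H. lra.
Qed.

Lemma RInt_ge_affine (g : R -> R) (x y p q : R) :
  (forall s, continuous g s) -> x <= y ->
  (forall s, x <= s <= y -> p + q * (s - x) <= g s) ->
  p * (y - x) + q / 2 * (y - x) ^ 2 <= RInt g x y.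
Proof.
  intros Hg Hxy H. rewrite <- RInt_affine. apply RInt_le; [exact Hxy| |now apply ex_RInt_cont|].
  - apply ex_RInt_cont. intros s. apply (is_derive_continuous _ _ q). auto_derive; [exact I|ring].
  - intros s Hs. apply H. lra.
Qed.

Lemma RInt_reflect (g : R -> R) (x y : R) :
  (forall s, continuous g s) -> RInt (fun s => - g (- s)) x y = - RInt g (- y) (- x).
Proof.
  intros Hg. assert (E := RInt_comp_lin g (-1) 0 x y).
  replace (-1 * x + 0) with (- x) in E by ring. replace (-1 * y + 0) with (- y) in E by ring.
  rewrite <- (opp_RInt_swap g) by now apply ex_RInt_cont.
  rewrite <- E by now apply ex_RInt_cont.
  unfold opp; simpl. rewrite Ropp_involutive. apply RInt_ext. intros s _.
  unfold scal; simpl; unfold mult; simpl.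
  replace (-1 * s + 0) with (- s) by ring. ring.
Qed.

Lemma continuous_neg_arg (g : R -> R) (x : R) :
  (forall s, continuous g s) -> continuous (fun s => - g (- s)) x.
Proof.
  intros Hg. apply (continuous_opp (V := R_NormedModule) (fun s : R => g (- s))).
  apply (continuous_comp Ropp g); [|apply Hg].
  apply (continuous_opp (V := R_NormedModule) (fun s : R => s)). apply continuous_id.
Qed.

(** A nonlinearity like [f] near the layer, with constants that do not depend on the two
    points: it decreases with slope at least [mu] near [a] and near [d], and the kinetic
    energy [- RInt g a u] is bounded below in between.  The ends [a] and [d] are the
    rest points of an orbit rather than zeros of [g]. *)
Record wells (g : R -> R) (a d del ell D mu m1 G : R) : Prop := {
  wells_cont : forall x, continuous g x;
  wells_const : 0 < del /\ 0 < mu /\ 0 < m1 /\ 0 < G /\ 0 < ell /\ 2 * del <= ell;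
  wells_len : ell <= d - a <= D;
  wells_lip : forall x y, a <= x <= d -> a <= y <= d -> Rabs (g x - g y) <= G * Rabs (x - y);
  wells_zero : RInt g a d = 0;
  wells_left : forall s, a <= s <= a + del -> g s <= g a - mu * (s - a);
  wells_right : forall s, d - del <= s <= d -> g d + mu * (d - s) <= g s;
  wells_mid : forall u, a + del <= u <= d - del -> m1 <= - RInt g a u }.
Arguments wells_cont {g a d del ell D mu m1 G}.
Arguments wells_const {g a d del ell D mu m1 G}.
Arguments wells_len {g a d del ell D mu m1 G}.
Arguments wells_lip {g a d del ell D mu m1 G}.
Arguments wells_zero {g a d del ell D mu m1 G}.
Arguments wells_left {g a d del ell D mu m1 G}.
Arguments wells_right {g a d del ell D mu m1 G}.
Arguments wells_mid {g a d del ell D mu m1 G}.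

Lemma wells_reflect (g : R -> R) (a d del ell D mu m1 G : R) :
  wells g a d del ell D mu m1 G ->
  wells (fun s => - g (- s)) (- d) (- a) del ell D mu m1 G.
Proof.
  intros [Hc Hk Hl HL Hz H1 H2 Hm]. split; try assumption.
  - intros x. now apply continuous_neg_arg.
  - lra.
  - intros x y Hx Hy. replace (- g (- x) - - g (- y)) with (- (g (- x) - g (- y))) by ring.
    rewrite Rabs_Ropp. eapply Rle_trans; [apply HL; lra|].
    replace (- x - - y) with (- (x - y)) by ring. rewrite Rabs_Ropp. lra.
  - rewrite RInt_reflect, !Ropp_involutive by assumption. rewrite Hz. apply Ropp_0.
  - intros s Hs. specialize (H2 (- s) ltac:(lra)). rewrite Ropp_involutive. lra.
  - intros s Hs. specialize (H1 (- s) ltac:(lra)). rewrite Ropp_involutive. lra.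
  - intros u Hu. specialize (Hm (- u) ltac:(lra)).
    rewrite RInt_reflect, !Ropp_involutive by assumption.
    assert (E : RInt g a (- u) + RInt g (- u) d = RInt g a d)
      by (apply (RInt_Chasles (V := R_CompleteNormedModule)); now apply ex_RInt_cont).
    lra.
Qed.

(** The lower cut-off keeps the time maps finite and Lipschitz also when [a] or [d] lies
    beyond its saddle, where no orbit starts; the quadratic part of the cut-off keeps the
    weighted time spent near one end bounded whatever happens there. *)
Definition cut_stiffness (g : R -> R) (a d c eta u : R) : R :=
  Rmax (stiffness g a d u) (eta + c * (u - a) * (d - u)).

Definition left_time (g : R -> R) (a d c eta : R) : R :=
  RInt (fun th => (d - sweep a d th) / sqrt (2 * cut_stiffness g a d c eta (sweep a d th))) 0 PI.

Definition right_time (g : R -> R) (a d c eta : R) : R :=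
  RInt (fun th => (sweep a d th - a) / sqrt (2 * cut_stiffness g a d c eta (sweep a d th))) 0 PI.

Lemma stiffness_reflect (g : R -> R) (a d u : R) :
  a < d -> (forall x, continuous g x) ->
  stiffness (fun s => - g (- s)) (- d) (- a) (- u) = stiffness g a d u.
Proof.
  intros Had Hg. unfold stiffness.
  assert (E : forall (p q : R), RInt (fun s => - g (p + s * q)) 0 1 = - RInt (fun s => g (p + s * q)) 0 1).
  { intros p q. apply (RInt_opp (V := R_CompleteNormedModule) (fun s => g (p + s * q))).
    apply ex_RInt_cont. intros x. now apply continuous_affine. }
  rewrite (RInt_ext (fun s => - g (- (- a - s * (- a - - u)))) (fun s => - g (a + s * (u - a))))
    by (intros; do 2 f_equal; ring).
  rewrite (RInt_ext (fun s => - g (- (- d + s * (- u - - d)))) (fun s => - g (d + s * - (d - u))))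
    by (intros; do 2 f_equal; ring).
  rewrite !E.
  rewrite (RInt_ext (fun s => g (d - s * (d - u))) (fun s => g (d + s * - (d - u))))
    by (intros; f_equal; ring).
  field. lra.
Qed.

Lemma sweep_reflect (a d th : R) : sweep (- d) (- a) (PI - th) = - sweep a d th.
Proof. unfold sweep. rewrite Rtrigo_facts.cos_pi_minus. field. Qed.

Lemma continuous_Rmax (p q : R -> R) (x : R) :
  continuous p x -> continuous q x -> continuous (fun s => Rmax (p s) (q s)) x.
Proof.
  intros Hp Hq. apply (continuous_ext (fun s => / 2 * (p s + q s + Rabs (p s - q s)))).
  - intros s. unfold Rmax, Rabs. destruct (Rle_dec (p s) (q s)), (Rcase_abs (p s - q s)); lra.
  - apply (continuous_scal_r (V := R_NormedModule) (/ 2)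
             (fun s => p s + q s + Rabs (p s - q s))).
    apply (continuous_plus (V := R_NormedModule) (fun s => p s + q s)).
    + now apply (continuous_plus (V := R_NormedModule) p q).
    + apply (continuous_comp (fun s => p s - q s) Rabs).
      * now apply (continuous_minus (V := R_NormedModule) p q).
      * apply continuous_Rabs.
Qed.

Lemma one_minus_cos_le (th : R) : 0 <= th -> 1 - cos th <= th ^ 2.
Proof.
  intros H. replace th with (2 * (th / 2)) at 1 by field.
  rewrite cos_2a_sin.
  assert (S : -(th / 2) <= sin (th / 2) <= th / 2).
  { destruct (Req_dec th 0) as [->|N].
    - replace (0 / 2) with 0 by field. rewrite sin_0. lra.
    - split.
      + destruct (Rle_lt_dec th PI).
        * apply Rle_trans with 0; [lra|]. apply sin_ge_0; lra.
        * generalize (SIN_bound (th / 2)) PI2_1. lra.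
      + left. apply sin_lt_x. lra. }
  nra.
Qed.

Section Sides.
Variables (g : R -> R) (a d del ell D mu m1 G c eta : R).
Hypothesis HW : wells g a d del ell D mu m1 G.
Hypothesis Hc : 0 < c.
Hypothesis Heta : 0 < eta.

Let Hg := wells_cont HW.
Let Had : a < d.
Proof. generalize (wells_const HW) (wells_len HW); lra. Qed.

Lemma cut_stiffness_pos (u : R) : a <= u <= d -> eta <= cut_stiffness g a d c eta u.
Proof.
  intros Hu. eapply Rle_trans; [|apply Rmax_r].
  assert (0 <= c * (u - a) * (d - u)).
  { apply Rmult_le_pos; [apply Rmult_le_pos|]; lra. }
  lra.
Qed.

Lemma continuous_cut_stiffness (th : R) :
  continuous (fun x => cut_stiffness g a d c eta (sweep a d x)) th.
Proof.
  apply continuous_Rmax.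
  - apply (continuous_stiffness_sweep g a d G Hg Had (wells_lip HW)).
  - apply (continuous_comp (sweep a d) (fun u => eta + c * (u - a) * (d - u))).
    + apply (is_derive_continuous _ _ _ (is_derive_sweep a d th)).
    + apply (is_derive_continuous _ _ (c * (d - sweep a d th) - c * (sweep a d th - a))).
      auto_derive; [exact I|ring].
Qed.

Lemma continuous_weighted (w : R -> R) (th : R) :
  (forall x, continuous w x) ->
  continuous (fun x => w (sweep a d x) / sqrt (2 * cut_stiffness g a d c eta (sweep a d x))) th.
Proof.
  intros Hw.
  apply (continuous_mult (fun x => w (sweep a d x))
    (fun x => / sqrt (2 * cut_stiffness g a d c eta (sweep a d x)))).
  - apply (continuous_comp (sweep a d) w); [|apply Hw].
    apply (is_derive_continuous _ _ _ (is_derive_sweep a d th)).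
  - apply (continuous_comp (fun x => sqrt (2 * cut_stiffness g a d c eta (sweep a d x))) Rinv).
    + apply (continuous_comp (fun x => 2 * cut_stiffness g a d c eta (sweep a d x)) sqrt).
      * apply (continuous_scal_r (V := R_NormedModule) 2
          (fun x => cut_stiffness g a d c eta (sweep a d x))).
        apply continuous_cut_stiffness.
      * apply continuous_sqrt.
    + apply continuity_pt_filterlim. apply continuity_pt_inv.
      * apply derivable_continuous_pt, derivable_pt_id.
      * unfold id. apply Rgt_not_eq. apply sqrt_lt_R0.
        generalize (cut_stiffness_pos (sweep a d th) (sweep_range a d th (Rlt_le _ _ Had))). lra.
Qed.

Lemma energy_near_left (u : R) :
  a <= u <= a + del -> - g a * (u - a) + mu / 2 * (u - a) ^ 2 <= - RInt g a u.
Proof.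
  intros Hu.
  assert (E := RInt_le_affine g a u (g a) (- mu) Hg ltac:(lra)).
  assert (RInt g a u <= g a * (u - a) + - mu / 2 * (u - a) ^ 2); [|lra].
  apply E. intros s Hs.
  generalize (wells_left HW s ltac:(lra)). lra.
Qed.

(** Near [a] the energy of the orbit is at least [ga * (u - a)], so that it leaves [a] in finite
    time; near [d] the weight [d - u] makes up for the slow motion. *)
Lemma left_time_upper (ga : R) :
  0 < ga -> ga <= - g a -> ga * D <= m1 ->
  left_time g a d c eta <= PI * sqrt (D ^ 3 / (2 * ga) + D / (c * ell)).
Proof.
  intros Hga Hga1 Hga2.
  destruct (wells_const HW) as [H1 [H2 [H3 [H4 [H5 H6]]]]].
  assert (H7 := wells_len HW). assert (HD : 0 < D) by lra.
  set (X := D ^ 3 / (2 * ga) + D / (c * ell)).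
  assert (P1 : 0 < D ^ 3 / (2 * ga)).
  { apply Rdiv_lt_0_compat; [apply pow_lt; lra|lra]. }
  assert (Hcl : 0 < c * ell) by nra.
  assert (P2 : 0 < D / (c * ell)) by (apply Rdiv_lt_0_compat; lra).
  unfold left_time. rewrite <- (Rminus_0_r PI) at 2.
  rewrite <- RInt_const_R.
  apply RInt_le; [generalize PI_RGT_0; lra| | |].
  - apply ex_RInt_cont. intros th. apply (continuous_weighted (fun u => d - u)).
    intros x. apply (is_derive_continuous _ _ (-1)). auto_derive; [exact I|ring].
  - apply ex_RInt_cont. intros th. apply continuous_const.
  - intros th Hth. assert (Hu := sweep_open a d th Had Hth). set (u := sweep a d th) in *.
    assert (Hpos := cut_stiffness_pos u ltac:(lra)).
    set (K := cut_stiffness g a d c eta u) in *.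
    assert (Key : (d - u) ^ 2 <= X * (2 * K)).
    { destruct (Rle_lt_dec u (d - del)) as [h|h].
      - assert (N : ga * (u - a) <= - RInt g a u).
        { destruct (Rle_lt_dec u (a + del)).
          - generalize (energy_near_left u ltac:(lra)). intros. 
            assert (0 <= mu / 2 * (u - a) ^ 2) by (apply Rmult_le_pos; [lra|apply pow2_ge_0]).
            nra.
          - generalize (wells_mid HW u ltac:(lra)). nra. }
        rewrite <- (stiffness_energy g a d Hg Had (wells_zero HW)) in N.
        assert (N2 : ga <= (d - u) * stiffness g a d u).
        { apply (Rmult_le_reg_l (u - a)); [lra|]. lra. }
        assert (N3 : stiffness g a d u <= K) by apply Rmax_l.
        assert (N4 : ga <= D * K).
        { apply Rle_trans with ((d - u) * K); [nra|]. apply Rmult_le_compat_r; lra. }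
        apply Rle_trans with (D ^ 2).
        { apply pow_incr. lra. }
        apply Rle_trans with (D ^ 3 / (2 * ga) * (2 * K)).
        + replace (D ^ 3 / (2 * ga) * (2 * K)) with (D ^ 2 * (D * K) / ga) by (field; lra).
          apply le_div; [lra|].
          apply Rmult_le_compat_l; [apply pow2_ge_0|lra].
        + apply Rmult_le_compat_r; unfold X; lra.
      - assert (N3 : eta + c * (u - a) * (d - u) <= K) by apply Rmax_r.
        assert (N4 : c * ell * (d - u) <= 2 * K).
        { assert (c * (ell / 2) <= c * (u - a)) by (apply Rmult_le_compat_l; lra).
          assert (c * (ell / 2) * (d - u) <= c * (u - a) * (d - u))
            by (apply Rmult_le_compat_r; lra).
          lra. }
        apply Rle_trans with (D * (d - u)); [nra|].
        apply Rle_trans with (D / (c * ell) * (2 * K)).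
        + replace (D * (d - u)) with (D / (c * ell) * (c * ell * (d - u))) by (field; split; lra).
          apply Rmult_le_compat_l; lra.
        + apply Rmult_le_compat_r; unfold X; lra. }
    assert (HsK : 0 < sqrt (2 * K)) by (apply sqrt_lt_R0; lra).
    apply div_le; [exact HsK|].
    rewrite <- sqrt_mult by (unfold X; lra).
    rewrite <- (sqrt_pow2 (d - u)) by lra. now apply sqrt_le_1_alt.
Qed.

(** When [g a] is almost nonnegative there, the stiffness at the angle [th] is at most of the
    order of [s ^ 2 + th ^ 2], and the integral of [1 / (s + th)] diverges logarithmically as
    [s] tends to zero. *)
Lemma left_time_lower (s : R) :
  0 < s -> s ^ 2 = eta -> - g a <= D * eta ->
  ell / (2 * sqrt (2 * (2 * D * (1 + G) / ell + 1 + c * D ^ 2))) * ln (/ s)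
  <= left_time g a d c eta.
Proof.
  intros Hs Hse Hga.
  destruct (wells_const HW) as [H1 [H2 [H3 [H4 [H5 H6]]]]].
  assert (H7 := wells_len HW). assert (HD : 0 < D) by lra.
  set (Q := 2 * D * (1 + G) / ell + 1 + c * D ^ 2).
  assert (HQ1 : 0 < 2 * D * (1 + G) / ell) by (apply Rdiv_lt_0_compat; [nra|lra]).
  assert (HQ2 : 0 < c * D ^ 2) by (apply Rmult_lt_0_compat; [lra|apply pow_lt; lra]).
  assert (HQ : 0 < Q) by (unfold Q; lra).
  set (q := ell / (2 * sqrt (2 * Q))).
  assert (HsQ : 0 < sqrt (2 * Q)) by (apply sqrt_lt_R0; lra).
  assert (Hq : 0 < q) by (apply Rdiv_lt_0_compat; lra).
  set (w := fun th => (d - sweep a d th) / sqrt (2 * cut_stiffness g a d c eta (sweep a d th))).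
  assert (Hwc : forall th, continuous w th).
  { intros th. apply (continuous_weighted (fun u => d - u)).
    intros x. apply (is_derive_continuous _ _ (-1)). auto_derive; [exact I|ring]. }
  assert (Hw0 : forall th, 0 <= w th).
  { intros th. unfold w. assert (Hr := sweep_range a d th (Rlt_le _ _ Had)).
    apply Rdiv_le_0_compat; [lra|]. apply sqrt_lt_R0.
    generalize (cut_stiffness_pos _ Hr). lra. }
  assert (Hpi := PI2_1).
  assert (Hw1 : forall th, 0 < th < 1 -> q / (s + th) <= w th).
  { intros th Hth. unfold w.
    assert (Hu := sweep_open a d th Had ltac:(lra)).
    assert (Hcos : 0 <= cos th) by (apply cos_ge_0; lra).
    assert (Hr : ell / 2 <= d - sweep a d th) by (rewrite sweep_right; nra).
    assert (Hl : sweep a d th - a <= D * th ^ 2).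
    { rewrite sweep_left. generalize (one_minus_cos_le th ltac:(lra)) (COS_bound th). intros.
      assert (0 <= th ^ 2) by apply pow2_ge_0. nra. }
    set (u := sweep a d th) in *.
    assert (N : - RInt g a u <= D * eta * (u - a) + G * (u - a) ^ 2).
    { assert (E := RInt_ge_affine g a u (g a) (- G) Hg ltac:(lra)).
      assert (g a * (u - a) + - G / 2 * (u - a) ^ 2 <= RInt g a u).
      { apply E. intros x Hx.
        assert (L := wells_lip HW x a ltac:(lra) ltac:(lra)).
        rewrite (Rabs_pos_eq (x - a)) in L by lra.
        generalize (Rabs_maj2 (g x - g a)). lra. }
      assert (0 <= G * (u - a) ^ 2) by (apply Rmult_le_pos; [lra|apply pow2_ge_0]).
      nra. }
    rewrite <- (stiffness_energy g a d Hg Had (wells_zero HW)) in N.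
    assert (N2 : (d - u) * stiffness g a d u <= D * eta + G * (u - a)).
    { apply (Rmult_le_reg_l (u - a)); [lra|]. lra. }
    assert (Hth2 : 0 <= th ^ 2) by apply pow2_ge_0.
    assert (NK : stiffness g a d u <= 2 * D * (1 + G) / ell * (eta + th ^ 2)).
    { replace (2 * D * (1 + G) / ell * (eta + th ^ 2))
        with (D * (1 + G) * (eta + th ^ 2) / (ell / 2)) by (field; lra).
      apply le_div; [lra|].
      assert (B : D * eta + G * (u - a) <= D * (1 + G) * (eta + th ^ 2)).
      { assert (G * (u - a) <= G * (D * th ^ 2)) by (apply Rmult_le_compat_l; lra).
        assert (0 <= D * th ^ 2) by signs. assert (0 <= D * G * eta) by (apply Rmult_le_pos; signs).
        lra. }
      destruct (Rle_lt_dec (stiffness g a d u) 0).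
      - apply Rle_trans with 0; [nra|]. apply Rmult_le_pos; [signs|lra].
      - eapply Rle_trans; [|exact B]. eapply Rle_trans; [|exact N2]. nra. }
    assert (NC : cut_stiffness g a d c eta u <= Q * (eta + th ^ 2)).
    { assert (0 < eta + th ^ 2) by lra.
      apply Rmax_lub.
      - eapply Rle_trans; [exact NK|]. apply Rmult_le_compat_r; [lra|]. unfold Q. lra.
      - apply Rle_trans with ((1 + c * D ^ 2) * (eta + th ^ 2)).
        + assert (c * (u - a) * (d - u) <= c * (D * th ^ 2) * D).
          { replace (c * (u - a) * (d - u)) with (c * ((u - a) * (d - u))) by ring.
            replace (c * (D * th ^ 2) * D) with (c * ((D * th ^ 2) * D)) by ring.
            apply Rmult_le_compat_l; [lra|]. apply Rmult_le_compat; lra. }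
          assert (0 <= c * D ^ 2 * eta) by (apply Rmult_le_pos; lra). nra.
        + apply Rmult_le_compat_r; [lra|]. unfold Q. lra. }
    assert (Hpos := cut_stiffness_pos u ltac:(lra)).
    set (K := cut_stiffness g a d c eta u) in *.
    assert (HsK : sqrt (2 * K) <= sqrt (2 * Q) * (s + th)).
    { rewrite <- (sqrt_pow2 (s + th)) by lra. rewrite <- sqrt_mult by (try apply pow2_ge_0; lra).
      apply sqrt_le_1_alt. rewrite <- Hse in NC. 
      apply Rle_trans with (2 * (Q * (s ^ 2 + th ^ 2))); [lra|].
      assert (0 <= 2 * Q * (2 * s * th)) by (apply Rmult_le_pos; signs). nra. }
    assert (HK0 : 0 < sqrt (2 * K)) by (apply sqrt_lt_R0; lra).
    apply le_div; [exact HK0|].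
    apply Rle_trans with (q / (s + th) * (sqrt (2 * Q) * (s + th))).
    - apply Rmult_le_compat_l; [apply Rdiv_le_0_compat; lra|exact HsK].
    - unfold q.
      replace (ell / (2 * sqrt (2 * Q)) / (s + th) * (sqrt (2 * Q) * (s + th))) with (ell / 2)
        by (field; split; lra).
      exact Hr. }
  assert (HI : RInt (fun th => q / (s + th)) 0 1 = q * (ln (s + 1) - ln s)).
  { apply is_RInt_unique.
    replace (q * (ln (s + 1) - ln s)) with (q * ln (s + 1) - q * ln (s + 0))
      by (rewrite Rplus_0_r; ring).
    apply (is_RInt_derive (V := R_CompleteNormedModule) (fun th => q * ln (s + th))).
    - intros x Hx. rewrite Rmin_left, Rmax_right in Hx by lra. auto_derive; [lra|field; lra].
    - intros x Hx. rewrite Rmin_left, Rmax_right in Hx by lra.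
      apply (is_derive_continuous _ _ (- q / (s + x) ^ 2)). auto_derive; [lra|field; lra]. }
  assert (HI2 : RInt (fun th => q / (s + th)) 0 1 <= RInt w 0 1).
  { apply RInt_le; [lra| |now apply ex_RInt_cont|exact Hw1].
    apply (ex_RInt_continuous (V := R_CompleteNormedModule)). intros x Hx.
    rewrite Rmin_left, Rmax_right in Hx by lra.
    apply (is_derive_continuous _ _ (- q / (s + x) ^ 2)). auto_derive; [lra|field; lra]. }
  assert (HI3 : 0 <= RInt w 1 PI).
  { apply RInt_ge_0; [lra|now apply ex_RInt_cont|]. intros; apply Hw0. }
  assert (HI4 : RInt w 0 1 + RInt w 1 PI = RInt w 0 PI)
    by (apply (RInt_Chasles (V := R_CompleteNormedModule)); now apply ex_RInt_cont).
  change (q * ln (/ s) <= RInt w 0 PI).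
  apply Rle_trans with (q * (ln (s + 1) - ln s)); [|lra].
  apply Rmult_le_compat_l; [lra|].
  rewrite ln_Rinv by exact Hs.
  assert (0 < ln (s + 1)) by (rewrite <- ln_1; apply ln_increasing; lra). lra.
Qed.

(** The cut-off is inactive as soon as both rest points lie slightly inside their saddles. *)
Lemma stiffness_lower :
  D * eta <= - g a -> D * eta <= g d -> D ^ 2 * eta + c * D ^ 4 <= m1 -> 2 * c * D ^ 2 <= mu ->
  forall u, a <= u <= d -> eta + c * (u - a) * (d - u) <= stiffness g a d u.
Proof.
  intros Ha Hd Hm Hmu u Hu.
  destruct (wells_const HW) as [H1 [H2 [H3 [H4 [H5 H6]]]]].
  assert (H7 := wells_len HW). assert (HD : 0 < D) by lra.
  assert (Hz := wells_zero HW).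
  destruct (Req_dec u a) as [->|Na].
  { rewrite (stiffness_at_left g a d Hg Had Hz). apply le_div; nra. }
  destruct (Req_dec u d) as [->|Nd].
  { rewrite (stiffness_at_right g a d Hg Had Hz). apply le_div; nra. }
  assert (Hu' : a < u < d) by lra. clear Hu Na Nd.
  assert (Hp : 0 < (u - a) * (d - u)) by nra.
  apply (Rmult_le_reg_l ((u - a) * (d - u))); [exact Hp|].
  rewrite (stiffness_energy g a d Hg Had Hz).
  (* At the distance [x] from a saddle the energy is at least [D * eta * x + mu / 2 * x ^ 2]. *)
  assert (Near : forall x y, 0 < x -> 0 < y -> x + y = d - a ->
            x * y * (eta + c * (x * y)) <= D * eta * x + mu / 2 * x ^ 2).
  { intros x y Hx Hy Hxy.
    assert (B1 : x * y * eta <= D * eta * x).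
    { replace (x * y * eta) with (y * (eta * x)) by ring.
      replace (D * eta * x) with (D * (eta * x)) by ring. apply Rmult_le_compat_r; signs. }
    assert (B2 : c * (x * y) * (x * y) <= c * D ^ 2 * x ^ 2).
    { replace (c * (x * y) * (x * y)) with (c * x ^ 2 * y ^ 2) by ring.
      replace (c * D ^ 2 * x ^ 2) with (c * x ^ 2 * D ^ 2) by ring.
      apply Rmult_le_compat_l; [apply Rmult_le_pos; [lra|apply pow2_ge_0]|].
      apply pow_incr; lra. }
    assert (B3 : c * D ^ 2 * x ^ 2 <= mu / 2 * x ^ 2)
      by (apply Rmult_le_compat_r; [apply pow2_ge_0|lra]).
    lra. }
  replace (eta + c * (u - a) * (d - u)) with (eta + c * ((u - a) * (d - u))) by ring.
  destruct (Rle_lt_dec u (a + del)) as [h|h].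
  - eapply Rle_trans; [apply Near; lra|].
    eapply Rle_trans; [|apply energy_near_left; lra]. nra.
  - destruct (Rle_lt_dec u (d - del)) as [h'|h'].
    + eapply Rle_trans; [|apply (wells_mid HW); lra].
      eapply Rle_trans; [|exact Hm].
      assert (B : (u - a) * (d - u) <= D ^ 2).
      { replace (D ^ 2) with (D * D) by ring. apply Rmult_le_compat; lra. }
      replace (D ^ 2 * eta + c * D ^ 4) with (D ^ 2 * (eta + c * D ^ 2)) by ring.
      apply Rmult_le_compat; nra.
    + replace ((u - a) * (d - u)) with ((d - u) * (u - a)) by ring.
      eapply Rle_trans; [apply Near; lra|].
      assert (E : RInt g a u + RInt g u d = 0).
      { rewrite <- Hz. apply (RInt_Chasles (V := R_CompleteNormedModule)); now apply ex_RInt_cont. }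
      assert (E2 := RInt_ge_affine g u d (g d + mu * (d - u)) (- mu) Hg ltac:(lra)).
      assert ((g d + mu * (d - u)) * (d - u) + - mu / 2 * (d - u) ^ 2 <= RInt g u d).
      { apply E2. intros x Hx.
        generalize (wells_right HW x ltac:(lra)). lra. }
      nra.
Qed.

Lemma right_time_reflect :
  right_time g a d c eta = left_time (fun s => - g (- s)) (- d) (- a) c eta.
Proof.
  unfold right_time, left_time.
  set (w := fun th => (- a - sweep (- d) (- a) th) / sqrt (2 * cut_stiffness (fun s => - g (- s)) (- d) (- a) c eta (sweep (- d) (- a) th))).
  assert (Ew : forall th, w (PI - th) =
     (sweep a d th - a) / sqrt (2 * cut_stiffness g a d c eta (sweep a d th))).
  { intros th. unfold w. rewrite sweep_reflect. unfold cut_stiffness.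
    rewrite stiffness_reflect by assumption.
    replace (eta + c * (- sweep a d th - - d) * (- a - - sweep a d th))
      with (eta + c * (sweep a d th - a) * (d - sweep a d th)) by ring.
    replace (- a - - sweep a d th) with (sweep a d th - a) by ring. reflexivity. }
  rewrite <- (RInt_ext (fun th => w (PI - th))) by (intros; apply Ew).
  assert (Hwc : forall x, continuous w x).
  { intros x. apply (continuous_ext (fun y => w (PI - (PI - y)))).
    - intros y. f_equal. ring.
    - apply (continuous_comp (fun y => PI - y) (fun th => w (PI - th))).
      + apply (is_derive_continuous _ _ (-1)). auto_derive; [exact I|ring].
      + apply (continuous_ext (fun th => (sweep a d th - a) / sqrt (2 * cut_stiffness g a d c eta (sweep a d th)))).
        * intros y. symmetry. apply Ew.
        * apply (continuous_weighted (fun u => u - a)).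
          intros y. apply (is_derive_continuous _ _ 1). auto_derive; [exact I|ring]. }
  assert (E := RInt_comp_lin w (-1) PI 0 PI).
  replace (-1 * 0 + PI) with PI in E by ring. replace (-1 * PI + PI) with 0 in E by ring.
  rewrite <- (opp_RInt_swap w) by now apply ex_RInt_cont.
  rewrite <- E by now apply ex_RInt_cont.
  rewrite (RInt_scal (V := R_CompleteNormedModule)).
  - unfold opp, scal; simpl; unfold mult; simpl.
    rewrite (RInt_ext (fun th => w (PI - th)) (fun th => w (-1 * th + PI))).
    + match goal with |- ?x = _ => generalize (x : R) end. intros x. lra.
    + intros; f_equal; ring.
  - apply ex_RInt_cont. intros x. apply (continuous_comp (fun th => -1 * th + PI) w); [|apply Hwc].
    apply (is_derive_continuous _ _ (-1)). auto_derive; [exact I|ring].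
Qed.
End Sides.

(** * Equal areas and uniform wells *)

(** For all sufficiently small positive values; a conjunction of such statements is again one,
    and this collects the smallness conditions of a proof. *)
Definition small (P : R -> Prop) : Prop :=
  exists e0, 0 < e0 /\ forall e, 0 < e < e0 -> P e.

Lemma small_and (P Q : R -> Prop) : small P -> small Q -> small (fun e => P e /\ Q e).
Proof.
  intros [p [Hp HP]] [q [Hq HQ]]. exists (Rmin p q). split; [now apply Rmin_pos|].
  intros e He. generalize (Rmin_l p q) (Rmin_r p q). intros.
  split; [apply HP|apply HQ]; lra.
Qed.

Lemma small_imp (P Q : R -> Prop) : (forall e, 0 < e -> P e -> Q e) -> small P -> small Q.
Proof.
  intros H [p [Hp HP]]. exists p. split; [exact Hp|]. intros e He. apply H; [lra|now apply HP].
Qed.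

Lemma small_linear (C k : R) : 0 < k -> small (fun e => C * e < k).
Proof.
  intros Hk. exists (k / (Rabs C + 1)). assert (P := Rabs_pos C). split.
  - apply Rdiv_lt_0_compat; lra.
  - intros e [He1 He2]. apply Rlt_div_r in He2; [|lra].
    generalize (Rle_abs C). intros. nra.
Qed.

Lemma RInt_abs_le (p : R -> R) (x y C : R) :
  (forall s, continuous p s) -> (forall s, Rmin x y <= s <= Rmax x y -> Rabs (p s) <= C) ->
  Rabs (RInt p x y) <= C * Rabs (y - x).
Proof.
  intros Hp HC. destruct (Rle_dec x y) as [h|h].
  - rewrite (Rabs_pos_eq (y - x)), (Rmult_comm C) by lra.
    apply abs_RInt_le_const; [exact h|now apply ex_RInt_cont|].
    intros t Ht. apply HC. rewrite Rmin_left, Rmax_right; lra.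
  - rewrite <- (opp_RInt_swap p) by now apply ex_RInt_cont.
    unfold opp; simpl. rewrite Rabs_Ropp, (Rabs_left (y - x)) by lra.
    replace (C * - (y - x)) with ((x - y) * C) by ring.
    apply abs_RInt_le_const; [lra|now apply ex_RInt_cont|].
    intros t Ht. apply HC. rewrite Rmin_right, Rmax_left; lra.
Qed.

Lemma RInt_Chasles_R (p : R -> R) (x y z : R) :
  (forall s, continuous p s) -> RInt p x y + RInt p y z = RInt p x z.
Proof.
  intros H. apply (RInt_Chasles (V := R_CompleteNormedModule)); now apply ex_RInt_cont.
Qed.

(** The Neumann problem conserves [eps ^ 2 u + D v], so that [v] is an affine function of [u];
    this is the resulting scalar nonlinearity, with [k = eps ^ 2 / D] and [v = vs + b] where
    [u = al]. *)
Definition reduced (f : R -> R -> R) (vs al k b s : R) : R := f s (vs + b + k * (al - s)).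

Section Wells.
Variables (f fu fv : R -> R -> R) (hm hp vs al M : R).
Hypothesis HB : C2box f fu fv (hm - 1) (hp + 1) vs M.
Hypothesis Hal : hm < al < hp.
Hypothesis Hfm : f hm vs = 0.
Hypothesis Hfp : f hp vs = 0.
Hypothesis Hum : fu hm vs < 0.
Hypothesis Hup : fu hp vs < 0.
Hypothesis Harea : RInt (fun s => f s vs) hm hp = 0.
Hypothesis Hpot : forall u, hm < u < hp -> RInt (fun s => f s vs) hm u < 0.
Hypothesis Hslope : RInt (fun s => fv s vs) hm hp <> 0.

Let D := hp - hm + 2.
Let M1 : 1 <= M := box_M HB.
Let D2 : 2 <= D.
Proof. unfold D; lra. Qed.

Lemma continuous_reduced (k b x : R) : continuous (reduced f vs al k b) x.
Proof.
  apply (continuous_along f fu fv _ _ _ _ HB (fun s => s) (fun s => vs + b + k * (al - s))).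
  - apply continuous_id.
  - apply (is_derive_continuous _ _ (- k)). auto_derive; [exact I|ring].
Qed.

Lemma continuous_slice (x : R) : continuous (fun s => f s vs) x.
Proof.
  apply (continuous_along f fu fv _ _ _ _ HB (fun s => s) (fun _ => vs));
    [apply continuous_id|apply continuous_const].
Qed.

Lemma continuous_slice_v (x : R) : continuous (fun s => fv s vs) x.
Proof.
  apply (continuous_comp_2 (fun s => s) (fun _ => vs) fv);
    [apply continuous_id|apply continuous_const|apply (box_contv HB)].
Qed.

Lemma arg_bound (be k b s : R) :
  Rabs k <= be -> Rabs b <= be -> hm - 1 <= s <= hp + 1 ->
  Rabs (b + k * (al - s)) <= (1 + D) * be.
Proof.
  intros Hk Hb Hs. eapply Rle_trans; [apply Rabs_triang|]. rewrite Rabs_mult.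
  assert (Rabs (al - s) <= D) by (apply Rabs_le; unfold D; lra).
  assert (Rabs k * Rabs (al - s) <= be * D)
    by (apply Rmult_le_compat; try apply Rabs_pos; assumption).
  lra.
Qed.

Lemma arg_box (be k b s : R) :
  (1 + D) * be <= 1 -> Rabs k <= be -> Rabs b <= be -> hm - 1 <= s <= hp + 1 ->
  box (hm - 1) (hp + 1) vs s (vs + b + k * (al - s)).
Proof.
  intros Hbe Hk Hb Hs. split; [exact Hs|].
  assert (A := arg_bound be k b s Hk Hb Hs).
  assert (Rabs (b + k * (al - s)) <= 1) as A' by lra. apply Rabs_le_between in A'. lra.
Qed.

Lemma reduced_lipschitz (be k b x y : R) :
  (1 + D) * be <= 1 -> Rabs k <= be -> Rabs b <= be ->
  hm - 1 <= x <= hp + 1 -> hm - 1 <= y <= hp + 1 ->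
  Rabs (reduced f vs al k b x - reduced f vs al k b y) <= 2 * M * Rabs (x - y).
Proof.
  intros Hbe Hk Hb Hx Hy. unfold reduced.
  eapply Rle_trans.
  - apply (box_lip f fu fv _ _ _ _ HB); now apply (arg_box be).
  - replace (vs + b + k * (al - x) - (vs + b + k * (al - y))) with (- k * (x - y)) by ring.
    rewrite Rabs_mult, Rabs_Ropp.
    assert (P := Rabs_pos (x - y)). assert (Pk := Rabs_pos k).
    assert (Rabs k <= 1) by nra. assert (Rabs k * Rabs (x - y) <= 1 * Rabs (x - y))
      by (apply Rmult_le_compat_r; lra).
    replace (2 * M * Rabs (x - y)) with (M * (Rabs (x - y) + 1 * Rabs (x - y))) by ring.
    apply Rmult_le_compat_l; lra.
Qed.

Lemma reduced_slice (be k b x : R) :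
  (1 + D) * be <= 1 -> Rabs k <= be -> Rabs b <= be -> hm - 1 <= x <= hp + 1 ->
  Rabs (reduced f vs al k b x - f x vs) <= M * (Rabs b + D * Rabs k).
Proof.
  intros Hbe Hk Hb Hx. unfold reduced.
  eapply Rle_trans.
  - apply (box_lip f fu fv _ _ _ _ HB); [now apply (arg_box be)|]. split; [exact Hx|lra].
  - rewrite Rminus_diag, Rabs_R0, Rplus_0_l. apply Rmult_le_compat_l; [lra|].
    replace (vs + b + k * (al - x) - vs) with (b + k * (al - x)) by ring.
    eapply Rle_trans; [apply Rabs_triang|]. rewrite Rabs_mult.
    assert (Rabs (al - x) <= D) by (apply Rabs_le; unfold D; lra).
    assert (Rabs k * Rabs (al - x) <= Rabs k * D)
      by (apply Rmult_le_compat_l; [apply Rabs_pos|assumption]).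
    lra.
Qed.

Lemma slope_near (h m u v : R) :
  hm <= h <= hp -> fu h vs <= - 2 * m -> 0 < m -> M * (Rabs (u - h) + Rabs (v - vs)) <= m ->
  fu u v <= - m.
Proof.
  intros Hh Hf Hm H.
  assert (P1 := Rabs_pos (u - h)). assert (P2 := Rabs_pos (v - vs)).
  destruct (Rle_lt_dec (Rabs (u - h) + Rabs (v - vs)) 1) as [h1|h1].
  - assert (B : box (hm - 1) (hp + 1) vs u v).
    { assert (A1 : Rabs (u - h) <= 1) by lra. assert (A2 : Rabs (v - vs) <= 1) by lra.
      apply Rabs_le_between in A1, A2. split; lra. }
    assert (B' : box (hm - 1) (hp + 1) vs h vs) by (split; lra).
    assert (L := box_lipu HB u v h vs B B').
    generalize (Rle_abs (fu u v - fu h vs)). lra.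
  - exfalso.
    assert (Hb : box (hm - 1) (hp + 1) vs h vs) by (split; lra).
    assert (L := box_fu HB h vs Hb).
    generalize (Rabs_maj2 (fu h vs)). nra.
Qed.

(** Near a saddle the reduced nonlinearity inherits half of the slope of [f], because its
    second argument moves only slowly with the first. *)
Lemma reduced_slope (h m be k b x y : R) :
  hm <= h <= hp -> fu h vs <= - 2 * m -> 0 < m ->
  (1 + D) * be <= 1 -> Rabs k <= be -> Rabs b <= be -> M * be <= m / 2 ->
  x <= y -> hm - 1 <= x -> y <= hp + 1 ->
  M * (Rabs (x - h) + (1 + D) * be) <= m -> M * (Rabs (y - h) + (1 + D) * be) <= m ->
  reduced f vs al k b y <= reduced f vs al k b x - m / 2 * (y - x).
Proof.
  intros Hh Hf Hm Hbe Hk Hb Hmb Hxy Hx Hy Hxh Hyh. unfold reduced.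
  set (w := vs + b + k * (al - y)).
  destruct (mvt (fun s => f s w) (fun s => fu s w) x y) as [c [Hc E]].
  { intros; apply (box_du HB). }
  rewrite Rmin_left, Rmax_right in Hc by lra.
  assert (Fc : fu c w <= - m).
  { apply (slope_near h); try assumption. unfold w.
    replace (vs + b + k * (al - y) - vs) with (b + k * (al - y)) by ring.
    assert (A := arg_bound be k b y Hk Hb ltac:(lra)).
    assert (Hch : Rabs (c - h) <= Rmax (Rabs (x - h)) (Rabs (y - h))).
    { unfold Rmax, Rabs. destruct (Rcase_abs (c - h)), (Rcase_abs (x - h)), (Rcase_abs (y - h));
        match goal with |- context [Rle_dec ?p ?q] => destruct (Rle_dec p q) end; lra. }
    unfold Rmax in Hch. destruct (Rle_dec (Rabs (x - h)) (Rabs (y - h))).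
    - eapply Rle_trans; [|exact Hyh]. apply Rmult_le_compat_l; lra.
    - eapply Rle_trans; [|exact Hxh]. apply Rmult_le_compat_l; lra. }
  assert (Bw : box (hm - 1) (hp + 1) vs x w).
  { destruct (arg_box be k b y Hbe Hk Hb ltac:(lra)) as [_ B]. split; [lra|exact B]. }
  assert (L := box_lip f fu fv _ _ _ _ HB x w x (vs + b + k * (al - x)) Bw
                 (arg_box be k b x Hbe Hk Hb ltac:(lra))).
  rewrite Rminus_diag, Rabs_R0, Rplus_0_l in L.
  assert (L2 : M * Rabs (w - (vs + b + k * (al - x))) <= m / 2 * (y - x)).
  { replace (w - (vs + b + k * (al - x))) with (- k * (y - x)) by (unfold w; ring).
    rewrite Rabs_mult, Rabs_Ropp, (Rabs_pos_eq (y - x)) by lra.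
    rewrite <- Rmult_assoc. apply Rmult_le_compat_r; [lra|].
    eapply Rle_trans; [|exact Hmb]. apply Rmult_le_compat_l; lra. }
  assert (L3 := Rle_abs (f x w - f x (vs + b + k * (al - x)))).
  nra.
Qed.

(** The slopes at the two saddles and the depth of the potential survive small perturbations
    of all parameters; the second part says how the sign of the reduced nonlinearity near a
    saddle depends on the side. *)
Lemma wells_uniform :
  exists del mu m1 be0, 0 < mu /\ 0 < m1 /\ 0 < be0 /\ (1 + D) * be0 <= 1 /\
    (forall k b a d, Rabs k <= be0 -> Rabs b <= be0 ->
       Rabs (a - hm) <= be0 -> Rabs (d - hp) <= be0 ->
       RInt (reduced f vs al k b) a d = 0 ->
       wells (reduced f vs al k b) a d del ((hp - hm) / 2) D mu m1 (2 * M)) /\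
    (forall k b h e, Rabs k <= be0 -> Rabs b <= be0 -> h = hm \/ h = hp -> 0 <= e <= be0 ->
       reduced f vs al k b (h + e) <= M * (Rabs b + D * Rabs k) - mu * e /\
       mu * e - M * (Rabs b + D * Rabs k) <= reduced f vs al k b (h - e)).
Proof.
  set (m := Rmin (- fu hm vs) (- fu hp vs) / 2).
  assert (Hm : 0 < m) by (unfold m; assert (0 < Rmin (- fu hm vs) (- fu hp vs))
                            by (apply Rmin_pos; lra); lra).
  assert (Hm1 : fu hm vs <= - 2 * m)
    by (unfold m; generalize (Rmin_l (- fu hm vs) (- fu hp vs)); lra).
  assert (Hm2 : fu hp vs <= - 2 * m)
    by (unfold m; generalize (Rmin_r (- fu hm vs) (- fu hp vs)); lra).
  set (del := Rmin (m / (4 * M)) ((hp - hm) / 4)).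
  assert (Hdel : 0 < del).
  { apply Rmin_pos; [apply Rdiv_lt_0_compat|]; lra. }
  assert (Hdel1 : M * del <= m / 4).
  { apply Rle_trans with (M * (m / (4 * M))); [apply Rmult_le_compat_l; [lra|apply Rmin_l]|].
    right. field. lra. }
  assert (Hdel2 : del <= (hp - hm) / 4) by apply Rmin_r.
  set (F := fun u => - RInt (fun s => f s vs) hm u).
  assert (HF : forall u, is_derive F u (- f u vs)).
  { intros u. apply is_derive_R_opp.
    exact (is_derive_primitive (fun s => f s vs) hm u continuous_slice). }
  destruct (continuity_ab_min F (hm + del / 2) (hp - del / 2)) as [um [Hum1 Hum2]].
  { lra. }
  { intros u _. apply (is_derive_continuity_pt _ _ _ (HF u)). }
  set (m2 := F um) in Hum1.
  assert (Hm3 : 0 < m2) by (unfold m2, F; generalize (Hpot um ltac:(lra)); lra).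
  set (E := M * (D * (1 + D) + 1)).
  assert (HE : 0 < E) by (unfold E; clear - M1 D2; nra).
  set (be0 := Rmin (Rmin (m / (4 * M * (2 + D))) (m2 / (2 * E)))
                   (Rmin (Rmin (del / 2) ((hp - hm) / 4)) (/ (1 + D)))).
  assert (Hbe0 : 0 < be0).
  { repeat apply Rmin_pos; try lra; try (apply Rdiv_lt_0_compat; nra).
    apply Rinv_0_lt_compat. lra. }
  assert (Hb1 : M * ((2 + D) * be0) <= m / 4).
  { apply Rle_trans with (M * ((2 + D) * (m / (4 * M * (2 + D))))).
    - apply Rmult_le_compat_l; [lra|]. apply Rmult_le_compat_l; [lra|].
      eapply Rle_trans; [apply Rmin_l|apply Rmin_l].
    - right. field. lra. }
  assert (Hb2 : E * be0 <= m2 / 2).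
  { apply Rle_trans with (E * (m2 / (2 * E))).
    - apply Rmult_le_compat_l; [lra|]. eapply Rle_trans; [apply Rmin_l|apply Rmin_r].
    - right. field. lra. }
  assert (Hb3 : be0 <= del / 2).
  { eapply Rle_trans; [apply Rmin_r|]. eapply Rle_trans; [apply Rmin_l|apply Rmin_l]. }
  assert (Hb4 : be0 <= (hp - hm) / 4).
  { eapply Rle_trans; [apply Rmin_r|]. eapply Rle_trans; [apply Rmin_l|apply Rmin_r]. }
  assert (Hb5 : (1 + D) * be0 <= 1).
  { apply Rle_trans with ((1 + D) * (/ (1 + D))).
    - apply Rmult_le_compat_l; [lra|]. eapply Rle_trans; [apply Rmin_r|apply Rmin_r].
    - right. field. lra. }
  assert (Hb6 : be0 <= 1 / 3).
  { assert (0 <= (hp - hm) * be0) by (apply Rmult_le_pos; lra). unfold D in Hb5. lra. }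
  clearbody be0 del m2.
  assert (Hb7 : M * be0 <= m / 2).
  { assert (M * be0 <= M * (del / 2)) by (apply Rmult_le_compat_l; lra). lra. }
  assert (Near : forall h x, Rabs (x - h) <= be0 + del -> M * (Rabs (x - h) + (1 + D) * be0) <= m).
  { intros h x Hx. apply Rle_trans with (M * ((be0 + del) + (1 + D) * be0)).
    - apply Rmult_le_compat_l; lra.
    - clear - Hb1 Hdel1 Hm. lra. }
  exists del, (m / 2), (m2 / 2), be0.
  split; [lra|]. split; [lra|]. split; [exact Hbe0|]. split; [exact Hb5|]. split.
  - intros k b a d Hk Hb Ha Hd Hz.
    assert (Ha' := proj1 (Rabs_le_between _ _) Ha). assert (Hd' := proj1 (Rabs_le_between _ _) Hd).
    split; try assumption.
    + intros x. apply continuous_reduced.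
    + repeat split; lra.
    + unfold D. lra.
    + intros x y Hx Hy. apply (reduced_lipschitz be0); try assumption; lra.
    + intros s Hs. apply (reduced_slope hm m be0); try assumption; try lra.
      * apply Near. lra.
      * apply Near. apply Rabs_le. lra.
    + intros s Hs.
      assert (R := reduced_slope hp m be0 k b s d ltac:(lra) Hm2 Hm Hb5 Hk Hb Hb7 ltac:(lra)
                     ltac:(lra) ltac:(lra) ltac:(apply Near; apply Rabs_le; lra)
                     ltac:(apply Near; lra)).
      lra.
    + intros u Hu.
      assert (Fu : m2 <= F u) by (apply Hum1; lra). unfold F in Fu.
      assert (Dec : RInt (reduced f vs al k b) a u - RInt (fun s => f s vs) hm u
        = (RInt (reduced f vs al k b) a u - RInt (fun s => f s vs) a u)
          + RInt (fun s => f s vs) a hm).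
      { assert (C := RInt_Chasles_R (fun s => f s vs) a hm u continuous_slice). lra. }
      assert (B1 : Rabs (RInt (reduced f vs al k b) a u - RInt (fun s => f s vs) a u)
                   <= (u - a) * (M * ((1 + D) * be0))).
      { apply RInt_abs_diff_le; [lra|apply continuous_reduced|apply continuous_slice|].
        intros s Hs. eapply Rle_trans; [apply (reduced_slice be0); try assumption; lra|].
        apply Rmult_le_compat_l; [lra|]. assert (D * Rabs k <= D * be0)
          by (apply Rmult_le_compat_l; lra). lra. }
      assert (B2 : Rabs (RInt (fun s => f s vs) a hm) <= M * Rabs (hm - a)).
      { apply RInt_abs_le; [apply continuous_slice|]. intros s Hs.
        apply (box_f HB). split; [|lra].
        apply (between_minmax _ _ a hm); lra. }
      rewrite Rabs_minus_sym in B2.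
      assert (B3 : (u - a) * (M * ((1 + D) * be0)) <= D * (M * ((1 + D) * be0))).
      { apply Rmult_le_compat_r; [|unfold D; lra].
        apply Rmult_le_pos; [lra|]. apply Rmult_le_pos; lra. }
      assert (B4 : M * Rabs (a - hm) <= M * be0) by (apply Rmult_le_compat_l; lra).
      assert (B5 := Rle_abs (RInt (reduced f vs al k b) a u - RInt (fun s => f s vs) a u)).
      assert (B6 := Rle_abs (RInt (fun s => f s vs) a hm)).
      unfold E in Hb2. lra.
  - intros k b h e Hk Hb Hh He.
    assert (Hh' : hm <= h <= hp) by (destruct Hh; subst; lra).
    assert (Hfh : f h vs = 0) by (destruct Hh; subst; assumption).
    assert (Huh : fu h vs <= - 2 * m) by (destruct Hh; subst; assumption).
    assert (S := reduced_slice be0 k b h Hb5 Hk Hb ltac:(lra)). rewrite Hfh, Rminus_0_r in S.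
    apply Rabs_le_between in S.
    assert (Hself : M * (Rabs (h - h) + (1 + D) * be0) <= m).
    { apply Near. rewrite Rminus_diag, Rabs_R0. lra. }
    split.
    + assert (R := reduced_slope h m be0 k b h (h + e) Hh' Huh Hm Hb5 Hk Hb Hb7 ltac:(lra)
                     ltac:(lra) ltac:(lra) Hself ltac:(apply Near; apply Rabs_le; lra)).
      lra.
    + assert (R := reduced_slope h m be0 k b (h - e) h Hh' Huh Hm Hb5 Hk Hb Hb7 ltac:(lra)
                     ltac:(lra) ltac:(lra) ltac:(apply Near; apply Rabs_le; lra) Hself).
      lra.
Qed.

(** The derivative of the area with respect to [b] is close to the integral of [fv] at the
    limit, which is not zero; the sign [sg] is that of this integral. *)
Lemma area_slope :
  exists J1 be1 sg, 0 < J1 /\ 0 < be1 /\ (1 + D) * be1 <= 1 /\ (sg = 1 \/ sg = -1) /\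
    forall k a d b b', Rabs k <= be1 -> Rabs b <= be1 -> Rabs b' <= be1 ->
      Rabs (a - hm) <= be1 -> Rabs (d - hp) <= be1 -> b <= b' ->
      J1 * (b' - b)
      <= sg * (RInt (reduced f vs al k b') a d - RInt (reduced f vs al k b) a d).
Proof.
  set (Jp := RInt (fun s => fv s vs) hm hp) in *.
  set (E := D * M * (1 + D) + 2 * M).
  assert (HE : 0 < E) by (unfold E; clear - M1 D2; nra).
  assert (HJ : 0 < Rabs Jp) by now apply Rabs_pos_lt.
  set (be1 := Rmin (Rabs Jp / (2 * E)) (Rmin (/ (1 + D)) ((hp - hm) / 4))).
  assert (Hbe : 0 < be1).
  { repeat apply Rmin_pos; [apply Rdiv_lt_0_compat; lra|apply Rinv_0_lt_compat; lra|lra]. }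
  assert (Hb1 : E * be1 <= Rabs Jp / 2).
  { apply Rle_trans with (E * (Rabs Jp / (2 * E))).
    - apply Rmult_le_compat_l; [lra|apply Rmin_l].
    - right. field. lra. }
  assert (Hb2 : (1 + D) * be1 <= 1).
  { apply Rle_trans with ((1 + D) * (/ (1 + D))).
    - apply Rmult_le_compat_l; [lra|]. eapply Rle_trans; [apply Rmin_r|apply Rmin_l].
    - right. field. lra. }
  assert (Hb3 : be1 <= (hp - hm) / 4) by (eapply Rle_trans; [apply Rmin_r|apply Rmin_r]).
  clearbody be1.
  set (sg := if Rlt_dec 0 Jp then 1 else -1).
  assert (Hsg : sg * Jp = Rabs Jp).
  { unfold sg. destruct (Rlt_dec 0 Jp); [rewrite Rabs_pos_eq|rewrite Rabs_left1]; lra. }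
  assert (Hsg1 : sg = 1 \/ sg = -1) by (unfold sg; destruct (Rlt_dec 0 Jp); auto).
  assert (Hsg2 : Rabs sg = 1).
  { destruct Hsg1 as [-> | ->]; [apply Rabs_R1|rewrite Rabs_left; lra]. }
  exists (Rabs Jp / 2), be1, sg. split; [lra|]. split; [exact Hbe|]. split; [exact Hb2|].
  split; [exact Hsg1|]. intros k a d b b' Hk Hb Hb' Ha Hd Hbb.
  assert (Ha' := proj1 (Rabs_le_between _ _) Ha). assert (Hd' := proj1 (Rabs_le_between _ _) Hd).
  assert (Hb4 : be1 <= 1 / 3).
  { assert (0 <= (hp - hm) * be1) by (apply Rmult_le_pos; lra). unfold D in Hb2. lra. }
  set (q := fun s => (b' - b) * fv s vs).
  assert (Hq : forall s, continuous q s).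
  { intros s. apply (continuous_scal_r (V := R_NormedModule) (b' - b) (fun s => fv s vs)).
    apply continuous_slice_v. }
  assert (B1 : Rabs (RInt (fun s => reduced f vs al k b' s - reduced f vs al k b s) a d
                     - RInt q a d) <= (d - a) * ((b' - b) * (M * ((1 + D) * be1)))).
  { apply RInt_abs_diff_le; [lra| |exact Hq|].
    - intros s. apply (continuous_minus (V := R_NormedModule) (reduced f vs al k b'));
        apply continuous_reduced.
    - intros s Hs. unfold reduced, q.
      destruct (mvt (fun v => f s v) (fun v => fv s v) (vs + b + k * (al - s))
                  (vs + b' + k * (al - s))) as [c [Hc Ec]].
      { intros; apply (box_dv HB). }
      rewrite Ec.
      replace (fv s c * (vs + b' + k * (al - s) - (vs + b + k * (al - s))) - (b' - b) * fv s vs)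
        with ((b' - b) * (fv s c - fv s vs)) by ring.
      rewrite Rabs_mult, (Rabs_pos_eq (b' - b)) by lra.
      apply Rmult_le_compat_l; [lra|].
      assert (A1 := arg_bound be1 k b s Hk Hb ltac:(lra)).
      assert (A2 := arg_bound be1 k b' s Hk Hb' ltac:(lra)).
      apply Rabs_le_between in A1, A2.
      assert (A3 : Rabs (c - vs) <= (1 + D) * be1).
      { apply Rabs_le. rewrite Rmin_left, Rmax_right in Hc by lra. lra. }
      eapply Rle_trans.
      + apply (box_lipv HB).
        * split; [lra|]. apply Rabs_le_between in A3. lra.
        * split; lra.
      + rewrite Rminus_diag, Rabs_R0, Rplus_0_l. apply Rmult_le_compat_l; lra. }
  assert (E1 : RInt (fun s => reduced f vs al k b' s - reduced f vs al k b s) a d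
    = RInt (reduced f vs al k b') a d - RInt (reduced f vs al k b) a d).
  { apply (RInt_minus (V := R_CompleteNormedModule)); apply ex_RInt_cont; apply continuous_reduced. }
  assert (E2 : RInt q a d = (b' - b) * RInt (fun s => fv s vs) a d).
  { apply (RInt_scal (V := R_CompleteNormedModule)).
    apply ex_RInt_cont, continuous_slice_v. }
  rewrite E1, E2 in B1.
  assert (Bv : forall x y, hm - 1 <= x <= hp + 1 -> hm - 1 <= y <= hp + 1 ->
            Rabs (RInt (fun s => fv s vs) x y) <= M * Rabs (y - x)).
  { intros x y Hx Hy. apply RInt_abs_le; [apply continuous_slice_v|]. intros s Hs.
    apply (box_fv HB). split; [|lra]. now apply (between_minmax _ _ x y). }
  assert (B2 : Rabs (RInt (fun s => fv s vs) a d - Jp) <= 2 * M * be1).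
  { assert (C1 := RInt_Chasles_R (fun s => fv s vs) a hm d continuous_slice_v).
    assert (C2 := RInt_Chasles_R (fun s => fv s vs) hm hp d continuous_slice_v).
    replace (RInt (fun s => fv s vs) a d - Jp)
      with (RInt (fun s => fv s vs) a hm + RInt (fun s => fv s vs) hp d) by (unfold Jp; lra).
    eapply Rle_trans; [apply Rabs_triang|].
    assert (B3 := Bv a hm ltac:(lra) ltac:(lra)). assert (B4 := Bv hp d ltac:(lra) ltac:(lra)).
    rewrite Rabs_minus_sym in B3.
    assert (M * Rabs (a - hm) <= M * be1) by (apply Rmult_le_compat_l; lra).
    assert (M * Rabs (d - hp) <= M * be1) by (apply Rmult_le_compat_l; lra). lra. }
  set (Q := RInt (fun s => fv s vs) a d) in *.
  set (P := RInt (reduced f vs al k b') a d - RInt (reduced f vs al k b) a d) in *.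
  assert (B3 : Rabs (P - (b' - b) * Jp) <= E * be1 * (b' - b)).
  { replace (P - (b' - b) * Jp) with ((P - (b' - b) * Q) + (b' - b) * (Q - Jp)) by ring.
    eapply Rle_trans; [apply Rabs_triang|]. rewrite (Rabs_mult (b' - b)), (Rabs_pos_eq (b' - b)) by lra.
    assert (T1 : (d - a) * ((b' - b) * (M * ((1 + D) * be1)))
             <= D * ((b' - b) * (M * ((1 + D) * be1)))).
    { apply Rmult_le_compat_r; [|unfold D; lra].
      apply Rmult_le_pos; [lra|]. apply Rmult_le_pos; [lra|]. apply Rmult_le_pos; lra. }
    assert (T2 : (b' - b) * Rabs (Q - Jp) <= (b' - b) * (2 * M * be1))
      by (apply Rmult_le_compat_l; lra).
    unfold E. lra. }
  assert (B4 : Rabs (sg * P - (b' - b) * Rabs Jp) <= E * be1 * (b' - b)).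
  { rewrite <- Hsg. replace (sg * P - (b' - b) * (sg * Jp)) with (sg * (P - (b' - b) * Jp)) by ring.
    rewrite Rabs_mult, Hsg2, Rmult_1_l. exact B3. }
  apply Rabs_le_between in B4.
  assert (E * be1 * (b' - b) <= Rabs Jp / 2 * (b' - b)) by (apply Rmult_le_compat_r; lra).
  lra.
Qed.

Lemma area_endpoints (be k b a d a' d' : R) :
  (1 + D) * be <= 1 -> Rabs k <= be -> Rabs b <= be ->
  hm - 1 <= a <= hp + 1 -> hm - 1 <= d <= hp + 1 ->
  hm - 1 <= a' <= hp + 1 -> hm - 1 <= d' <= hp + 1 ->
  Rabs (RInt (reduced f vs al k b) a d - RInt (reduced f vs al k b) a' d')
  <= M * (Rabs (a - a') + Rabs (d - d')).
Proof.
  intros Hbe Hk Hb Ha Hd Ha' Hd'.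
  assert (Bv : forall x y, hm - 1 <= x <= hp + 1 -> hm - 1 <= y <= hp + 1 ->
            Rabs (RInt (reduced f vs al k b) x y) <= M * Rabs (y - x)).
  { intros x y Hx Hy. apply RInt_abs_le; [apply continuous_reduced|]. intros s Hs.
    apply (box_f HB). apply (arg_box be); try assumption.
    now apply (between_minmax _ _ x y). }
  assert (C1 := RInt_Chasles_R _ a a' d (continuous_reduced k b)).
  assert (C2 := RInt_Chasles_R _ a' d' d (continuous_reduced k b)).
  replace (RInt (reduced f vs al k b) a d - RInt (reduced f vs al k b) a' d')
    with (RInt (reduced f vs al k b) a a' + RInt (reduced f vs al k b) d' d) by lra.
  eapply Rle_trans; [apply Rabs_triang|].
  assert (B3 := Bv a a' Ha Ha'). assert (B4 := Bv d' d Hd' Hd).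
  rewrite (Rabs_minus_sym a' a) in B3. lra.
Qed.

(** The area is of second order in the displacement of [a] and [d], since [f] vanishes at the
    saddles. *)
Lemma area_at_zero (e k a d : R) :
  e <= 1 -> (1 + D) * Rabs k <= 1 -> Rabs (a - hm) <= e -> Rabs (d - hp) <= e -> a <= d ->
  Rabs (RInt (reduced f vs al k 0) a d) <= M * (2 * e ^ 2 + D ^ 2 * Rabs k).
Proof.
  intros He Hk Ha Hd Had.
  assert (Ha' := proj1 (Rabs_le_between _ _) Ha). assert (Hd' := proj1 (Rabs_le_between _ _) Hd).
  assert (Z0 : Rabs 0 <= Rabs k) by (rewrite Rabs_R0; apply Rabs_pos).
  assert (B1 : Rabs (RInt (reduced f vs al k 0) a d - RInt (fun s => f s vs) a d)
               <= (d - a) * (M * (D * Rabs k))).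
  { apply RInt_abs_diff_le; [lra|apply continuous_reduced|apply continuous_slice|].
    intros s Hs. eapply Rle_trans.
    - apply (reduced_slice (Rabs k)); try assumption; lra.
    - rewrite Rabs_R0, Rplus_0_l. lra. }
  assert (Bw : forall h x, hm <= h <= hp -> f h vs = 0 -> Rabs (x - h) <= e ->
            Rabs (RInt (fun s => f s vs) h x) <= M * e ^ 2).
  { intros h x Hh Hf Hx. assert (Hx' := proj1 (Rabs_le_between _ _) Hx).
    apply Rle_trans with (M * e * Rabs (x - h)).
    - apply RInt_abs_le; [apply continuous_slice|]. intros s Hs.
      assert (Hs' : h - e <= s <= h + e) by (apply (between_minmax _ _ h x); lra).
      assert (L := box_lip f fu fv _ _ _ _ HB s vs h vs ltac:(split; lra) ltac:(split; lra)).
      rewrite Rminus_diag, Rabs_R0, Rplus_0_r, Hf, Rminus_0_r in L.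
      eapply Rle_trans; [exact L|]. apply Rmult_le_compat_l; [lra|]. apply Rabs_le. lra.
    - replace (M * e ^ 2) with (M * e * e) by ring.
      assert (0 <= e) by (eapply Rle_trans; [apply Rabs_pos|exact Hx]).
      apply Rmult_le_compat_l; [apply Rmult_le_pos; lra|exact Hx]. }
  assert (Bm := Bw hm a ltac:(lra) Hfm Ha). assert (Bp := Bw hp d ltac:(lra) Hfp Hd).
  assert (C1 := RInt_Chasles_R (fun s => f s vs) hm a d continuous_slice).
  assert (C2 := RInt_Chasles_R (fun s => f s vs) hm hp d continuous_slice).
  assert (B2 : (d - a) * (M * (D * Rabs k)) <= D * (M * (D * Rabs k))).
  { apply Rmult_le_compat_r; [|unfold D; lra].
    apply Rmult_le_pos; [lra|]. apply Rmult_le_pos; [lra|apply Rabs_pos]. }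
  apply Rabs_le_between in B1, Bm, Bp. apply Rabs_le. lra.
Qed.

(** Equal areas fix the level [b] of the slow variable to second order in the size of the
    perturbation, because the area varies with [b] at a nonzero rate while it is
    stationary with respect to [a] and [d] at the saddles. *)
Lemma equal_area_level (K : R) :
  exists B J1, 0 < B /\ 0 < J1 /\
    small (fun e => forall k, Rabs k <= K * e ^ 2 ->
      (forall a d, Rabs (a - hm) <= e -> Rabs (d - hp) <= e ->
         exists b, Rabs b <= B * e ^ 2 /\ RInt (reduced f vs al k b) a d = 0) /\
      (forall a d a' d' b b',
         Rabs (a - hm) <= e -> Rabs (d - hp) <= e -> Rabs (a' - hm) <= e -> Rabs (d' - hp) <= e ->
         Rabs b <= B * e ^ 2 -> Rabs b' <= B * e ^ 2 ->
         RInt (reduced f vs al k b) a d = 0 -> RInt (reduced f vs al k b') a' d' = 0 ->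
         J1 * Rabs (b - b') <= M * (Rabs (a - a') + Rabs (d - d')))).
Proof.
  destruct area_slope as [J1 [be1 [sg [HJ1 [Hbe1 [Hb1 [Hsg Hslp]]]]]]].
  set (C0 := M * (2 + D ^ 2 * Rabs K)).
  assert (HC0 : 0 < C0).
  { unfold C0. assert (0 <= D ^ 2 * Rabs K) by (apply Rmult_le_pos; [apply pow2_ge_0|apply Rabs_pos]).
    apply Rmult_lt_0_compat; lra. }
  set (B := (C0 + 1) / J1). assert (HB0 : 0 < B) by (apply Rdiv_lt_0_compat; lra).
  exists B, J1. split; [exact HB0|]. split; [exact HJ1|].
  assert (Hsq : Rabs sg = 1).
  { destruct Hsg as [-> | ->]; [apply Rabs_R1|rewrite Rabs_left; lra]. }
  apply (small_imp (fun e => (1 * e < be1 /\ 1 * e < 1) /\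
    (Rabs K * e < be1 /\ 2 * B * e < be1) /\ 2 * e < hp - hm)).
  2:{ repeat apply small_and; apply small_linear; lra. }
  intros e He [[E1 E2] [[E3 E4] E5]] k Hk.
  assert (Hke : Rabs k <= be1).
  { assert (K * e ^ 2 <= Rabs K * e * 1).
    { assert (K * e ^ 2 <= Rabs K * e ^ 2)
        by (apply Rmult_le_compat_r; [apply pow2_ge_0|apply Rle_abs]).
      assert (0 <= Rabs K * e) by (apply Rmult_le_pos; [apply Rabs_pos|lra]).
      assert (Rabs K * e * e <= Rabs K * e * 1) by (apply Rmult_le_compat_l; lra). lra. }
    lra. }
  assert (HBe : 2 * B * e ^ 2 <= be1).
  { assert (2 * B * e * e <= 2 * B * e * 1) by (apply Rmult_le_compat_l; nra). lra. }
  assert (He2 : 0 < e ^ 2) by (apply pow_lt; lra).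
  split.
  - intros a d Ha Hd.
    assert (Ha' := proj1 (Rabs_le_between _ _) Ha). assert (Hd' := proj1 (Rabs_le_between _ _) Hd).
    set (Ph := fun b => sg * RInt (reduced f vs al k b) a d).
    assert (Hinc : forall b b', Rabs b <= be1 -> Rabs b' <= be1 -> b <= b' ->
              J1 * (b' - b) <= Ph b' - Ph b).
    { intros b b' Hb Hb' Hbb. unfold Ph.
      assert (H := Hslp k a d b b' Hke Hb Hb' ltac:(lra) ltac:(lra) Hbb). lra. }
    assert (HPh0 : Rabs (Ph 0) <= C0 * e ^ 2).
    { unfold Ph. rewrite Rabs_mult, Hsq, Rmult_1_l.
      eapply Rle_trans; [apply (area_at_zero e); try assumption; try lra|].
      - apply Rle_trans with ((1 + D) * be1); [apply Rmult_le_compat_l; lra|exact Hb1].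
      - unfold C0. assert (D ^ 2 * Rabs k <= D ^ 2 * (Rabs K * e ^ 2)).
        { apply Rmult_le_compat_l; [apply pow2_ge_0|]. eapply Rle_trans; [exact Hk|].
          apply Rmult_le_compat_r; [lra|apply Rle_abs]. }
        apply Rle_trans with (M * (2 * e ^ 2 + D ^ 2 * (Rabs K * e ^ 2))).
        + apply Rmult_le_compat_l; lra.
        + right. ring. }
    apply Rabs_le_between in HPh0.
    assert (BJ : J1 * (B * e ^ 2) = C0 * e ^ 2 + e ^ 2) by (unfold B; field; lra).
    assert (BP : 0 <= B * e ^ 2) by (apply Rmult_le_pos; lra).
    assert (R1 : Rabs (B * e ^ 2) <= be1) by (rewrite Rabs_pos_eq; lra).
    assert (R2 : Rabs (- (B * e ^ 2)) <= be1) by (rewrite Rabs_Ropp; exact R1).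
    assert (R0 : Rabs 0 <= be1) by (rewrite Rabs_R0; lra).
    assert (S1 := Hinc 0 (B * e ^ 2) R0 R1 BP).
    assert (S2 := Hinc (- (B * e ^ 2)) 0 R2 R0 ltac:(lra)).
    destruct (IVT_interv Ph (- (B * e ^ 2)) (B * e ^ 2)) as [b [Hb Eb]].
    + intros b Hb. apply continuity_pt_filterlim. apply continuous_of_eps. intros eta Heta.
      exists (Rmin (B * e ^ 2) (eta / (D * M + 1))).
      assert (HDM0 : 0 <= D * M) by (unfold D; apply Rmult_le_pos; lra).
      assert (HDM : 0 < D * M + 1) by lra. split.
      { apply Rmin_pos; [apply Rmult_lt_0_compat; lra|]. apply Rdiv_lt_0_compat; lra. }
      intros y Hy. assert (Y1 := Rlt_le_trans _ _ _ Hy (Rmin_l _ _)).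
      assert (Y2 := Rlt_le_trans _ _ _ Hy (Rmin_r _ _)).
      unfold Ph. replace (sg * RInt (reduced f vs al k y) a d - sg * RInt (reduced f vs al k b) a d)
        with (sg * (RInt (reduced f vs al k y) a d - RInt (reduced f vs al k b) a d)) by ring.
      rewrite Rabs_mult, Hsq, Rmult_1_l.
      assert (Y3 := proj1 (Rabs_lt_between _ _) Y1).
      assert (Hb' : Rabs b <= be1) by (apply Rabs_le; lra).
      assert (Hy' : Rabs y <= be1) by (apply Rabs_le; lra).
      eapply Rle_lt_trans.
      * apply (RInt_abs_diff_le _ _ a d (M * Rabs (y - b)));
          [lra|apply continuous_reduced|apply continuous_reduced|].
        intros s Hs. unfold reduced.
        eapply Rle_trans; [apply (box_lip f fu fv _ _ _ _ HB); apply (arg_box be1);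
                           try assumption; lra|].
        rewrite Rminus_diag, Rabs_R0, Rplus_0_l. apply Rmult_le_compat_l; [lra|].
        right. f_equal. ring.
      * apply Rlt_div_r in Y2; [|lra]. assert (Yp := Rabs_pos (y - b)).
        apply Rle_lt_trans with (D * (M * Rabs (y - b))); [|lra].
        apply Rmult_le_compat_r; [apply Rmult_le_pos; lra|unfold D; lra].
    + clear - S1 S2 HPh0 BJ He2 HB0. nra.
    + clear - S1 S2 HPh0 BJ He2 HB0. nra.
    + clear - S1 S2 HPh0 BJ He2 HB0. nra.
    + exists b. split; [apply Rabs_le; lra|]. unfold Ph in Eb.
      apply Rmult_integral in Eb. destruct Eb as [Eb|Eb]; [|exact Eb].
      exfalso. destruct Hsg; lra.
  - assert (W : forall a d a' d' b b',
         Rabs (a - hm) <= e -> Rabs (d - hp) <= e -> Rabs (a' - hm) <= e -> Rabs (d' - hp) <= e ->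
         Rabs b <= B * e ^ 2 -> Rabs b' <= B * e ^ 2 -> b <= b' ->
         RInt (reduced f vs al k b) a d = 0 -> RInt (reduced f vs al k b') a' d' = 0 ->
         J1 * (b' - b) <= M * (Rabs (a - a') + Rabs (d - d'))).
    { intros a d a' d' b b' Ha Hd Ha' Hd' Hb Hb' Hbb Z Z'.
      assert (A1 := proj1 (Rabs_le_between _ _) Ha). assert (A2 := proj1 (Rabs_le_between _ _) Hd).
      assert (A3 := proj1 (Rabs_le_between _ _) Ha'). assert (A4 := proj1 (Rabs_le_between _ _) Hd').
      assert (H := Hslp k a d b b' Hke ltac:(lra) ltac:(lra) ltac:(lra) ltac:(lra) Hbb).
      eapply Rle_trans; [exact H|]. rewrite Z, Rminus_0_r.
      eapply Rle_trans; [apply Rle_abs|]. rewrite Rabs_mult, Hsq, Rmult_1_l.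
      rewrite <- (Rminus_0_r (RInt _ a d)), <- Z'.
      apply (area_endpoints be1); try assumption; lra. }
    intros a d a' d' b b' Ha Hd Ha' Hd' Hb Hb' Z Z'.
    destruct (Rle_dec b b') as [h|h].
    + rewrite Rabs_minus_sym, Rabs_pos_eq by lra. now apply W.
    + rewrite Rabs_pos_eq by lra. rewrite (Rabs_minus_sym a), (Rabs_minus_sym d).
      apply W; try assumption. lra.
Qed.
End Wells.

(** * Lipschitz dependence of the time maps on the rest points *)

Definition dist2 (p q : R * R) : R := Rabs (fst p - fst q) + Rabs (snd p - snd q).

Lemma dist2_pos (p q : R * R) : 0 <= dist2 p q.
Proof.
  unfold dist2. generalize (Rabs_pos (fst p - fst q)) (Rabs_pos (snd p - snd q)). lra.
Qed.

Section BoundedLipschitz.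
Variable (S : R * R -> Prop).

(** Bounded functions of a parameter in [S] that are Lipschitz in it, uniformly in a further
    variable in [T]; unlike joint continuity, this passes through integrals at once. *)
Definition BL {X : Type} (T : X -> Prop) (F : R * R -> X -> R) : Prop :=
  exists C, 0 <= C /\ forall p q x, S p -> S q -> T x ->
    Rabs (F p x) <= C /\ Rabs (F p x - F q x) <= C * dist2 p q.

Section Algebra.
Context {X : Type} (T : X -> Prop).

Lemma BL_ext (F H : R * R -> X -> R) :
  (forall p x, S p -> T x -> F p x = H p x) -> BL T F -> BL T H.
Proof.
  intros E [C [HC B]]. exists C. split; [exact HC|]. intros p q x Hp Hq Hx.
  rewrite <- !E by assumption. now apply B.
Qed.

Lemma BL_fun (h : X -> R) (C : R) : (forall x, T x -> Rabs (h x) <= C) -> BL T (fun _ x => h x).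
Proof.
  intros H. exists (Rabs C). split; [apply Rabs_pos|]. intros p q x _ _ Hx. split.
  - eapply Rle_trans; [now apply H|apply Rle_abs].
  - rewrite Rminus_diag, Rabs_R0. apply Rmult_le_pos; [apply Rabs_pos|apply dist2_pos].
Qed.

Lemma BL_const (c : R) : BL T (fun _ _ => c).
Proof. apply (BL_fun (fun _ => c) (Rabs c)). intros; lra. Qed.

Lemma BL_plus (F H : R * R -> X -> R) : BL T F -> BL T H -> BL T (fun p x => F p x + H p x).
Proof.
  intros [C [HC B]] [C' [HC' B']]. exists (C + C'). split; [lra|].
  intros p q x Hp Hq Hx. destruct (B p q x Hp Hq Hx) as [B1 B2].
  destruct (B' p q x Hp Hq Hx) as [B3 B4]. split.
  - eapply Rle_trans; [apply Rabs_triang|]. lra.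
  - replace (F p x + H p x - (F q x + H q x)) with ((F p x - F q x) + (H p x - H q x)) by ring.
    eapply Rle_trans; [apply Rabs_triang|]. lra.
Qed.

Lemma BL_mult (F H : R * R -> X -> R) : BL T F -> BL T H -> BL T (fun p x => F p x * H p x).
Proof.
  intros [C [HC B]] [C' [HC' B']]. exists (2 * C * C'). split; [nra|].
  intros p q x Hp Hq Hx. destruct (B p q x Hp Hq Hx) as [B1 B2].
  destruct (B' p q x Hp Hq Hx) as [B3 B4]. destruct (B' q p x Hq Hp Hx) as [B5 _].
  destruct (B q p x Hq Hp Hx) as [B6 _]. assert (Dp := dist2_pos p q). split.
  - rewrite Rabs_mult. apply Rle_trans with (C * C'); [|nra].
    apply Rmult_le_compat; try apply Rabs_pos; assumption.
  - replace (F p x * H p x - F q x * H q x)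
      with ((F p x - F q x) * H p x + F q x * (H p x - H q x)) by ring.
    eapply Rle_trans; [apply Rabs_triang|]. rewrite !Rabs_mult.
    apply Rle_trans with (C * dist2 p q * C' + C * (C' * dist2 p q)).
    + apply Rplus_le_compat; apply Rmult_le_compat; try apply Rabs_pos; assumption.
    + right. ring.
Qed.

Lemma BL_scal (c : R) (F : R * R -> X -> R) : BL T F -> BL T (fun p x => c * F p x).
Proof. intros H. apply (BL_mult (fun _ _ => c)); [apply BL_const|exact H]. Qed.

Lemma BL_minus (F H : R * R -> X -> R) : BL T F -> BL T H -> BL T (fun p x => F p x - H p x).
Proof.
  intros HF HH. apply (BL_ext (fun p x => F p x + -1 * H p x)).
  - intros; ring.
  - apply BL_plus; [exact HF|now apply BL_scal].
Qed.

Lemma BL_comp (h : R -> R) (Y : R -> Prop) (C : R) (F : R * R -> X -> R) :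
  (forall y y', Y y -> Y y' -> Rabs (h y) <= C /\ Rabs (h y - h y') <= C * Rabs (y - y')) ->
  (forall p x, S p -> T x -> Y (F p x)) -> BL T F -> BL T (fun p x => h (F p x)).
Proof.
  intros Hh HY [C' [HC' B]]. exists (Rabs C * (1 + C')). assert (PC := Rabs_pos C). split; [nra|].
  intros p q x Hp Hq Hx. destruct (B p q x Hp Hq Hx) as [_ B2].
  destruct (Hh _ _ (HY p x Hp Hx) (HY q x Hq Hx)) as [H1 H2].
  assert (QC := Rle_abs C). assert (Dp := dist2_pos p q).
  assert (P := Rabs_pos (F p x - F q x)). split; [nra|].
  eapply Rle_trans; [exact H2|]. apply Rle_trans with (Rabs C * (C' * dist2 p q)); nra.
Qed.

Lemma BL_comp2 (h : R -> R -> R) (Y : R -> R -> Prop) (C : R) (F H : R * R -> X -> R) :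
  (forall u v u' v', Y u v -> Y u' v' ->
     Rabs (h u v) <= C /\ Rabs (h u v - h u' v') <= C * (Rabs (u - u') + Rabs (v - v'))) ->
  (forall p x, S p -> T x -> Y (F p x) (H p x)) -> BL T F -> BL T H ->
  BL T (fun p x => h (F p x) (H p x)).
Proof.
  intros Hh HY [C1 [HC1 B]] [C2 [HC2 B']]. exists (Rabs C * (1 + C1 + C2)).
  assert (PC := Rabs_pos C). split; [nra|].
  intros p q x Hp Hq Hx. destruct (B p q x Hp Hq Hx) as [_ B2].
  destruct (B' p q x Hp Hq Hx) as [_ B3].
  destruct (Hh _ _ _ _ (HY p x Hp Hx) (HY q x Hq Hx)) as [H1 H2].
  assert (QC := Rle_abs C). assert (Dp := dist2_pos p q).
  assert (P := Rabs_pos (F p x - F q x)). assert (P' := Rabs_pos (H p x - H q x)).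
  split; [nra|].
  eapply Rle_trans; [exact H2|]. apply Rle_trans with (Rabs C * ((C1 + C2) * dist2 p q)); nra.
Qed.

Lemma BL_max (F H : R * R -> X -> R) :
  BL T F -> BL T H -> BL T (fun p x => Rmax (F p x) (H p x)).
Proof.
  intros [C [HC B]] [C' [HC' B']]. exists (C + C'). split; [lra|].
  intros p q x Hp Hq Hx. destruct (B p q x Hp Hq Hx) as [B1 B2].
  destruct (B' p q x Hp Hq Hx) as [B3 B4]. apply Rabs_le_between in B1, B2, B3, B4.
  unfold Rmax. destruct (Rle_dec (F p x) (H p x)), (Rle_dec (F q x) (H q x)); split;
    apply Rabs_le; lra.
Qed.

Lemma BL_inv_sqrt (F : R * R -> X -> R) (e : R) :
  0 < e -> (forall p x, S p -> T x -> e <= F p x) -> BL T F -> BL T (fun p x => / sqrt (F p x)).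
Proof.
  intros He HF HB.
  assert (Hr : 0 < sqrt e) by now apply sqrt_lt_R0.
  assert (Hi : 0 < / sqrt e) by now apply Rinv_0_lt_compat.
  apply (BL_comp (fun y => / sqrt y) (fun y => e <= y) (/ sqrt e + / sqrt e * / sqrt e * / sqrt e));
    [|exact HF|exact HB].
  assert (Hlow : forall y, e <= y -> 0 < / sqrt y <= / sqrt e).
  { intros y Hy. split; [apply Rinv_0_lt_compat, sqrt_lt_R0; lra|].
    apply Rinv_le_contravar; [exact Hr|]. now apply sqrt_le_1_alt. }
  assert (Hi3 : 0 < / sqrt e * / sqrt e * / sqrt e) by (repeat apply Rmult_lt_0_compat; exact Hi).
  intros y y' Hy Hy'. destruct (Hlow y Hy) as [L1 L2]. destruct (Hlow y' Hy') as [L3 L4]. split.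
  - rewrite Rabs_pos_eq; lra.
  - assert (Sy : sqrt e <= sqrt y) by now apply sqrt_le_1_alt.
    assert (Sy' : sqrt e <= sqrt y') by now apply sqrt_le_1_alt.
    replace (/ sqrt y - / sqrt y') with
      ((/ sqrt y * / sqrt y' * / (sqrt y + sqrt y')) * (y' - y)).
    2:{ assert (E : y' - y = (sqrt y' - sqrt y) * (sqrt y + sqrt y')).
        { replace ((sqrt y' - sqrt y) * (sqrt y + sqrt y'))
            with (sqrt y' * sqrt y' - sqrt y * sqrt y) by ring.
          rewrite !sqrt_sqrt; lra. }
        rewrite E. field. repeat split; lra. }
    assert (L5 : 0 < / (sqrt y + sqrt y') <= / sqrt e).
    { split; [apply Rinv_0_lt_compat; lra|]. apply Rinv_le_contravar; lra. }
    rewrite Rabs_mult, (Rabs_minus_sym y' y).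
    apply Rmult_le_compat_r; [apply Rabs_pos|].
    rewrite Rabs_pos_eq by (repeat apply Rmult_le_pos; lra).
    apply Rle_trans with (/ sqrt e * / sqrt e * / sqrt e); [|lra].
    repeat (apply Rmult_le_compat; try lra); try (apply Rmult_le_pos; lra).
Qed.

Lemma BL_inv (F : R * R -> X -> R) (e : R) :
  0 < e -> (forall p x, S p -> T x -> e <= F p x) -> BL T F -> BL T (fun p x => / F p x).
Proof.
  intros He HF HB. assert (Hi : 0 < / e) by now apply Rinv_0_lt_compat.
  apply (BL_comp Rinv (fun y => e <= y) (/ e + / e * / e)); [|exact HF|exact HB].
  assert (Hlow : forall y, e <= y -> 0 < / y <= / e).
  { intros y Hy. split; [apply Rinv_0_lt_compat; lra|]. apply Rinv_le_contravar; lra. }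
  assert (Hi2 : 0 < / e * / e) by (apply Rmult_lt_0_compat; exact Hi).
  intros y y' Hy Hy'. destruct (Hlow y Hy) as [L1 L2]. destruct (Hlow y' Hy') as [L3 L4]. split.
  - rewrite Rabs_pos_eq; lra.
  - replace (/ y - / y') with (/ y * / y' * (y' - y)) by (field; lra).
    rewrite Rabs_mult, (Rabs_minus_sym y' y).
    apply Rmult_le_compat_r; [apply Rabs_pos|].
    rewrite Rabs_pos_eq by (apply Rmult_le_pos; lra).
    apply Rle_trans with (/ e * / e); [|lra]. apply Rmult_le_compat; lra.
Qed.

(** The bounds are uniform in the integration variable, which joins the passive variable. *)
Lemma BL_RInt (lo hi : R) (F : R * R -> X * R -> R) :
  lo <= hi -> (forall p x s, S p -> T x -> continuous (fun s => F p (x, s)) s) ->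
  BL (fun y : X * R => T (fst y) /\ lo <= snd y <= hi) F ->
  BL T (fun p x => RInt (fun s => F p (x, s)) lo hi).
Proof.
  intros Hlh Hc [C [HC B]]. exists (C * (hi - lo)). split; [nra|].
  intros p q x Hp Hq Hx. split.
  - replace (hi - lo) with (Rabs (hi - lo)) by (rewrite Rabs_pos_eq; lra).
    apply RInt_abs_le; [now intros; apply Hc|]. intros s Hs.
    rewrite Rmin_left, Rmax_right in Hs by lra. apply (B p p (x, s)); simpl; auto.
  - replace (C * (hi - lo) * dist2 p q) with ((hi - lo) * (C * dist2 p q)) by ring.
    apply RInt_abs_diff_le; [lra|now intros; apply Hc|now intros; apply Hc|].
    intros s Hs. apply (B p q (x, s)); simpl; auto.
Qed.
End Algebra.

Lemma BL_fst {X : Type} (T : X -> Prop) (C : R) :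
  (forall p, S p -> Rabs (fst p) <= C) -> BL T (fun p _ => fst p).
Proof.
  intros H. exists (Rabs C + 1). assert (PC := Rabs_pos C). split; [lra|].
  intros p q _ Hp Hq _. assert (QC := Rle_abs C). specialize (H p Hp). split; [lra|].
  unfold dist2. generalize (Rabs_pos (snd p - snd q)) (Rabs_pos (fst p - fst q)). intros. nra.
Qed.

Lemma BL_snd {X : Type} (T : X -> Prop) (C : R) :
  (forall p, S p -> Rabs (snd p) <= C) -> BL T (fun p _ => snd p).
Proof.
  intros H. exists (Rabs C + 1). assert (PC := Rabs_pos C). split; [lra|].
  intros p q _ Hp Hq _. assert (QC := Rle_abs C). specialize (H p Hp). split; [lra|].
  unfold dist2. generalize (Rabs_pos (snd p - snd q)) (Rabs_pos (fst p - fst q)). intros. nra.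
Qed.

Lemma BL_reindex {X Y : Type} (T : X -> Prop) (T' : Y -> Prop) (r : Y -> X)
    (F : R * R -> X -> R) :
  (forall y, T' y -> T (r y)) -> BL T F -> BL T' (fun p y => F p (r y)).
Proof.
  intros H [C [HC B]]. exists C. split; [exact HC|]. intros p q y Hp Hq Hy.
  apply B; auto.
Qed.
End BoundedLipschitz.

Section TimeMaps.
Variables (f fu fv : R -> R -> R) (lo hi vs al k M D del ell mu m1 G c eta : R).
Hypothesis HB : C2box f fu fv lo hi vs M.
Variables (S : R * R -> Prop) (b : R * R -> R).
Hypothesis Hw : forall p, S p ->
  wells (reduced f vs al k (b p)) (fst p) (snd p) del ell D mu m1 G.
Hypothesis HS : forall p, S p -> lo <= fst p /\ snd p <= hi.
Hypothesis Harg : forall p s, S p -> lo <= s <= hi -> box lo hi vs s (vs + b p + k * (al - s)).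
Hypothesis HbL : BL S (fun _ : unit => True) (fun p _ => b p).
Hypothesis Hlen : 0 < ell.
Hypothesis Hc : 0 < c.
Hypothesis Heta : 0 < eta.

Let lt_of (p : R * R) : S p -> fst p < snd p.
Proof. intros Hp. generalize (wells_len (Hw p Hp)). lra. Qed.

Let Tall (X : Type) (_ : X) : Prop := True.

Let BLfst (X : Type) (T : X -> Prop) : BL S T (fun p _ => fst p).
Proof.
  apply (BL_fst S T (Rabs lo + Rabs hi)). intros p Hp.
  assert (L := lt_of p Hp). destruct (HS p Hp). apply Rabs_le.
  generalize (Rle_abs lo) (Rle_abs hi) (Rabs_maj2 lo) (Rabs_pos lo) (Rabs_pos hi). lra.
Qed.

Let BLsnd (X : Type) (T : X -> Prop) : BL S T (fun p _ => snd p).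
Proof.
  apply (BL_snd S T (Rabs lo + Rabs hi)). intros p Hp.
  assert (L := lt_of p Hp). destruct (HS p Hp). apply Rabs_le.
  generalize (Rle_abs lo) (Rle_abs hi) (Rabs_maj2 lo) (Rabs_pos lo) (Rabs_pos hi). lra.
Qed.

Lemma BL_sweep {X : Type} (T : X -> Prop) (r : X -> R) :
  BL S T (fun p x => sweep (fst p) (snd p) (r x)).
Proof.
  apply (BL_ext S T (fun p x => / 2 * (fst p + snd p) - / 2 * (snd p - fst p) * cos (r x))).
  - intros p x _ _. unfold sweep. field.
  - apply BL_minus.
    + apply BL_scal. apply BL_plus; [apply BLfst|apply BLsnd].
    + apply BL_mult.
      * apply BL_scal. apply BL_minus; [apply BLsnd|apply BLfst].
      * apply (BL_fun S T (fun x => cos (r x)) 1). intros x _. apply Rabs_le, COS_bound.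
Qed.

Lemma BL_reduced {X : Type} (T : X -> Prop) (A : R * R -> X -> R) :
  (forall p x, S p -> T x -> lo <= A p x <= hi) -> BL S T A ->
  BL S T (fun p x => reduced f vs al k (b p) (A p x)).
Proof.
  intros Hr HA. unfold reduced.
  apply (BL_comp2 S T f (box lo hi vs) M A (fun p x => vs + b p + k * (al - A p x))).
  - intros u v u' v' H H'. split; [now apply (box_f HB)|].
    now apply (box_lip f fu fv _ _ _ _ HB).
  - intros p x Hp Hx. apply Harg; auto.
  - exact HA.
  - apply BL_plus.
    + apply BL_plus; [apply BL_const|].
      apply (BL_reindex S (fun _ : unit => True) T (fun _ => tt) (fun p _ => b p)); auto.
    + apply BL_scal. apply BL_minus; [apply BL_const|exact HA].
Qed.

Lemma BL_stiffness :
  BL S (Tall R) (fun p th => stiffness (reduced f vs al k (b p)) (fst p) (snd p)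
                                (sweep (fst p) (snd p) th)).
Proof.
  set (U := fun (p : R * R) th => sweep (fst p) (snd p) th).
  assert (Hgc : forall p x, continuous (reduced f vs al k (b p)) x).
  { intros p x.
    apply (continuous_along f fu fv _ _ _ _ HB (fun s => s) (fun s => vs + b p + k * (al - s))).
    - apply continuous_id.
    - apply (is_derive_continuous _ _ (- k)). auto_derive; [exact I|ring]. }
  assert (HU : forall p th, S p -> fst p <= U p th <= snd p).
  { intros p th Hp. apply sweep_range. generalize (lt_of p Hp). lra. }
  apply (BL_ext S (Tall R) (fun p th =>
    (RInt (fun s => reduced f vs al k (b p) (snd p - s * (snd p - U p th))) 0 1
     - RInt (fun s => reduced f vs al k (b p) (fst p + s * (U p th - fst p))) 0 1)
    * (/ (snd p - fst p)))); [intros; reflexivity|].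
  apply BL_mult; [apply BL_minus|].
  - apply (BL_RInt S (Tall R) 0 1
      (fun p y => reduced f vs al k (b p) (snd p - snd y * (snd p - U p (fst y))))).
    + lra.
    + intros p th s Hp _. simpl.
      apply (continuous_comp (fun s => snd p - s * (snd p - U p th)) (reduced f vs al k (b p)));
        [|apply Hgc].
      apply (is_derive_continuous _ _ (- (snd p - U p th))). auto_derive; [exact I|ring].
    + apply BL_reduced.
      * intros p [th s] Hp [_ Hs]; simpl in *. destruct (HS p Hp). specialize (HU p th Hp).
        split; nra.
      * apply BL_minus; [apply BLsnd|]. apply BL_mult.
        -- apply (BL_fun S _ (fun y : R * R => snd y) 1). intros [th s] [_ Hs]; simpl in *.
           apply Rabs_le. lra.
        -- apply BL_minus; [apply BLsnd|]. apply (BL_sweep _ (fun y : R * R => fst y)).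
  - apply (BL_RInt S (Tall R) 0 1
      (fun p y => reduced f vs al k (b p) (fst p + snd y * (U p (fst y) - fst p)))).
    + lra.
    + intros p th s Hp _. simpl.
      apply (continuous_comp (fun s => fst p + s * (U p th - fst p)) (reduced f vs al k (b p)));
        [|apply Hgc].
      apply (is_derive_continuous _ _ (U p th - fst p)). auto_derive; [exact I|ring].
    + apply BL_reduced.
      * intros p [th s] Hp [_ Hs]; simpl in *. destruct (HS p Hp). specialize (HU p th Hp).
        split; nra.
      * apply BL_plus; [apply BLfst|]. apply BL_mult.
        -- apply (BL_fun S _ (fun y : R * R => snd y) 1). intros [th s] [_ Hs]; simpl in *.
           apply Rabs_le. lra.
        -- apply BL_minus; [|apply BLfst]. apply (BL_sweep _ (fun y : R * R => fst y)).
  - apply (BL_inv S (Tall R) _ ell); [exact Hlen| |].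
    + intros p x Hp _. generalize (wells_len (Hw p Hp)). lra.
    + apply BL_minus; [apply BLsnd|apply BLfst].
Qed.

(** The cut-off bounds the radicand away from zero, where the inverse square root is
    Lipschitz. *)
Lemma BL_weighted_time (w : R * R -> R -> R) :
  (forall p u, S p -> continuous (w p) u) ->
  BL S (Tall R) (fun p th => w p (sweep (fst p) (snd p) th)) ->
  BL S (Tall unit) (fun p _ =>
    RInt (fun th => w p (sweep (fst p) (snd p) th)
      / sqrt (2 * cut_stiffness (reduced f vs al k (b p)) (fst p) (snd p) c eta
                   (sweep (fst p) (snd p) th))) 0 PI).
Proof.
  intros Hwc HwL.
  apply (BL_RInt S (Tall unit) 0 PI (fun p y => w p (sweep (fst p) (snd p) (snd y))
      / sqrt (2 * cut_stiffness (reduced f vs al k (b p)) (fst p) (snd p) c eta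
                   (sweep (fst p) (snd p) (snd y))))).
  - generalize PI_RGT_0; lra.
  - intros p x th Hp _. simpl.
    apply (continuous_weighted _ _ _ _ _ _ _ _ _ c eta (Hw p Hp) Hc Heta (w p)).
    intros u. now apply Hwc.
  - apply BL_mult.
    + now apply (BL_reindex S (Tall R) _ (fun y : unit * R => snd y)
               (fun p th => w p (sweep (fst p) (snd p) th))).
    + apply (BL_inv_sqrt S _ _ (2 * eta)); [lra| |].
      * intros p [x th] Hp _. simpl.
        assert (C := cut_stiffness_pos (reduced f vs al k (b p)) (fst p) (snd p) c eta Hc
                  (sweep (fst p) (snd p) th)
                  (sweep_range _ _ th (Rlt_le _ _ (lt_of p Hp)))). lra.
      * apply BL_scal. unfold cut_stiffness. apply BL_max.
        -- apply (BL_reindex S (Tall R) _ (fun y : unit * R => snd y) (fun p th =>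
             stiffness (reduced f vs al k (b p)) (fst p) (snd p) (sweep (fst p) (snd p) th))).
           ++ exact (fun _ _ => I).
           ++ apply BL_stiffness.
        -- apply BL_plus; [apply BL_const|]. apply BL_mult.
           ++ apply BL_scal. apply BL_minus; [|apply BLfst].
              apply (BL_sweep _ (fun y : unit * R => snd y)).
           ++ apply BL_minus; [apply BLsnd|]. apply (BL_sweep _ (fun y : unit * R => snd y)).
Qed.

Lemma BL_left_time :
  BL S (Tall unit) (fun p _ => left_time (reduced f vs al k (b p)) (fst p) (snd p) c eta).
Proof.
  apply (BL_weighted_time (fun p u => snd p - u)).
  - intros p u _. apply (is_derive_continuous _ _ (-1)). auto_derive; [exact I|ring].
  - apply BL_minus; [apply BLsnd|]. apply (BL_sweep _ (fun y => y)).
Qed.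

Lemma BL_right_time :
  BL S (Tall unit) (fun p _ => right_time (reduced f vs al k (b p)) (fst p) (snd p) c eta).
Proof.
  apply (BL_weighted_time (fun p u => u - fst p)).
  - intros p u _. apply (is_derive_continuous _ _ 1). auto_derive; [exact I|ring].
  - apply BL_minus; [|apply BLfst]. apply (BL_sweep _ (fun y => y)).
Qed.
End TimeMaps.

(** * Existence of the layer solutions *)

(** The layer in the stretched time [t = (x - xs) / e], where [xs] is its position: the interval
    becomes [[- L, R1]] and the Neumann conditions make the two ends rest points.  The lower
    bound on the speed, with [c] independent of [e], gives the exponential approach to the
    outer states; [orbit_mass] is the mass condition after the slow variable is eliminated. *)
Record layer_orbit (f : R -> R -> R) (hm hp vs al xi k c e : R)
    (a d b L R1 : R) (U U1 : R -> R) : Prop := {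
  orbit_a : Rabs (a - hm) <= e;
  orbit_d : Rabs (d - hp) <= e;
  orbit_L : 0 < L;
  orbit_R : 0 < R1;
  orbit_length : L + R1 = 1 / e;
  orbit_U : forall t, is_derive U t (U1 t);
  orbit_U1 : forall t, is_derive U1 t (- reduced f vs al k b (U t));
  orbit_left : U (- L) = a /\ U1 (- L) = 0;
  orbit_0 : U 0 = al;
  orbit_right : U R1 = d /\ U1 R1 = 0;
  orbit_range : forall t, a <= U t <= d;
  orbit_speed : forall t, - L <= t <= R1 -> c * ((U t - a) * (d - U t)) <= U1 t;
  orbit_energy : forall t, U1 t ^ 2 = - 2 * RInt (reduced f vs al k b) a (U t);
  orbit_area : RInt (reduced f vs al k b) a d = 0;
  orbit_mass : RInt (fun t => (1 - k) * U t + (vs + b + k * al - xi)) (- L) R1 = 0 }.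
Arguments orbit_a {f hm hp vs al xi k c e a d b L R1 U U1}.
Arguments orbit_d {f hm hp vs al xi k c e a d b L R1 U U1}.
Arguments orbit_L {f hm hp vs al xi k c e a d b L R1 U U1}.
Arguments orbit_R {f hm hp vs al xi k c e a d b L R1 U U1}.
Arguments orbit_length {f hm hp vs al xi k c e a d b L R1 U U1}.
Arguments orbit_U {f hm hp vs al xi k c e a d b L R1 U U1}.
Arguments orbit_U1 {f hm hp vs al xi k c e a d b L R1 U U1}.
Arguments orbit_left {f hm hp vs al xi k c e a d b L R1 U U1}.
Arguments orbit_0 {f hm hp vs al xi k c e a d b L R1 U U1}.
Arguments orbit_right {f hm hp vs al xi k c e a d b L R1 U U1}.
Arguments orbit_range {f hm hp vs al xi k c e a d b L R1 U U1}.
Arguments orbit_speed {f hm hp vs al xi k c e a d b L R1 U U1}.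
Arguments orbit_energy {f hm hp vs al xi k c e a d b L R1 U U1}.
Arguments orbit_area {f hm hp vs al xi k c e a d b L R1 U U1}.
Arguments orbit_mass {f hm hp vs al xi k c e a d b L R1 U U1}.

Lemma exp_large_small (q T eta0 : R) :
  0 < q -> 0 < eta0 -> exists s, 0 < s /\ s ^ 2 <= eta0 /\ T < q * ln (/ s).
Proof.
  intros Hq He.
  set (Y := (Rabs T + 1) / q + Rabs (ln eta0)).
  assert (Y1 : (Rabs T + 1) / q <= Y) by (unfold Y; generalize (Rabs_pos (ln eta0)); lra).
  assert (Y0 : 0 < (Rabs T + 1) / q)
    by (apply Rdiv_lt_0_compat; [generalize (Rabs_pos T); lra|lra]).
  assert (Y2 : Rabs (ln eta0) <= Y) by (unfold Y; lra).
  exists (exp (- Y)). split; [apply exp_pos|]. split.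
  - replace (exp (- Y) ^ 2) with (exp (- Y + - Y)) by (rewrite exp_plus; ring).
    rewrite <- (exp_ln eta0) at 1 by exact He.
    assert (A := Rabs_maj2 (ln eta0)).
    apply exp_le. lra.
  - rewrite <- exp_Ropp, Ropp_involutive, ln_exp.
    apply Rlt_le_trans with (q * ((Rabs T + 1) / q)).
    + replace (q * ((Rabs T + 1) / q)) with (Rabs T + 1) by (field; lra).
      generalize (Rle_abs T). lra.
    + apply Rmult_le_compat_l; lra.
Qed.

Section Existence.
Variables (f fu fv : R -> R -> R) (hm hp vs al M Dif xi : R).
Hypothesis HB : C2box f fu fv (hm - 1) (hp + 1) vs M.
Hypothesis Hal : hm < al < hp.
Hypothesis Hfm : f hm vs = 0.
Hypothesis Hfp : f hp vs = 0.
Hypothesis Hum : fu hm vs < 0.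
Hypothesis Hup : fu hp vs < 0.
Hypothesis Harea : RInt (fun s => f s vs) hm hp = 0.
Hypothesis Hpot : forall u, hm < u < hp -> RInt (fun s => f s vs) hm u < 0.
Hypothesis Hslope : RInt (fun s => fv s vs) hm hp <> 0.
Hypothesis HDif : 0 < Dif.
Hypothesis Hxi : hm + vs < xi < hp + vs.

(** The two conditions, total time [1 / e] and mass [xi], are equivalent to prescribing the
    two weighted times, of which the first is governed by [a] alone and the second by [d]
    alone: it is short, of order [e ^ (-1/2)], when the rest point is at distance [e] inside
    its saddle, and arbitrarily long when the rest point is at or beyond the saddle. *)
Theorem layer_exists :
  exists B c, 0 < B /\ 0 < c /\
    small (fun e => exists a d b L R1 U U1,
      Rabs b <= B * e ^ 2 /\
      layer_orbit f hm hp vs al xi (e ^ 2 / Dif) c e a d b L R1 U U1).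
Proof.
  assert (M1 : 1 <= M) by apply (box_M HB).
  destruct (wells_uniform f fu fv hm hp vs al M HB Hal Hfm Hfp Hum Hup Hpot)
    as [del [mu [m1 [be0 [Hmu [Hm1 [Hbe0 [Hbe1 [HW Hoff]]]]]]]]].
  destruct (equal_area_level f fu fv hm hp vs al M HB Hal Hfm Hfp Harea Hslope (/ Dif))
    as [B [J1 [HB0 [HJ1 Hlev]]]].
  set (D := hp - hm + 2) in *. assert (HD : 2 <= D) by (unfold D; lra).
  set (ell := (hp - hm) / 2) in *. assert (Hell : 0 < ell) by (unfold ell; lra).
  assert (HiD : 0 < / Dif) by now apply Rinv_0_lt_compat.
  set (c := Rmin (m1 / (2 * D ^ 4)) (mu / (2 * D ^ 2))).
  assert (HD2 : 0 < D ^ 2) by (apply pow_lt; lra).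
  assert (HD3 : 0 < D ^ 3) by (apply pow_lt; lra).
  assert (HD4 : 0 < D ^ 4) by (apply pow_lt; lra).
  assert (Hc : 0 < c) by (apply Rmin_pos; apply Rdiv_lt_0_compat; lra).
  assert (Hc1 : c * D ^ 4 <= m1 / 2).
  { apply Rle_trans with (m1 / (2 * D ^ 4) * D ^ 4).
    - apply Rmult_le_compat_r; [lra|apply Rmin_l].
    - right. field. lra. }
  assert (Hc2 : 2 * c * D ^ 2 <= mu).
  { apply Rle_trans with (2 * (mu / (2 * D ^ 2)) * D ^ 2).
    - apply Rmult_le_compat_r; [lra|]. apply Rmult_le_compat_l; [lra|apply Rmin_r].
    - right. field. lra. }
  clearbody c.
  set (r1 := hp + vs - xi). set (r2 := xi - hm - vs).
  set (r0 := Rmin r1 r2 / 2).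
  assert (Hr0 : 0 < r0) by (unfold r0; assert (0 < Rmin r1 r2)
    by (apply Rmin_pos; unfold r1, r2; lra); lra).
  assert (Hr1 : 2 * r0 <= r1) by (unfold r0; generalize (Rmin_l r1 r2); lra).
  assert (Hr2 : 2 * r0 <= r2) by (unfold r0; generalize (Rmin_r r1 r2); lra).
  clearbody r0.
  set (P := r1 + r2).
  set (q := ell / (2 * sqrt (2 * (2 * D * (1 + 2 * M) / ell + 1 + c * D ^ 2)))).
  assert (Hq : 0 < q).
  { apply Rdiv_lt_0_compat; [lra|]. apply Rmult_lt_0_compat; [lra|]. apply sqrt_lt_R0.
    assert (0 < 2 * D * (1 + 2 * M) / ell) by (apply Rdiv_lt_0_compat; [repeat apply Rmult_lt_0_compat; lra|lra]).
    assert (0 < c * D ^ 2) by (apply Rmult_lt_0_compat; lra). lra. }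
  assert (Hpi := PI_RGT_0).
  set (Z := PI ^ 2 * (D ^ 3 / mu + D / (c * ell))).
  exists B, (sqrt (2 * c)). split; [exact HB0|]. split; [apply sqrt_lt_R0; lra|].
  apply (small_imp (fun e => (forall k, Rabs k <= / Dif * e ^ 2 ->
      (forall a d, Rabs (a - hm) <= e -> Rabs (d - hp) <= e ->
         exists b, Rabs b <= B * e ^ 2 /\ RInt (reduced f vs al k b) a d = 0) /\
      (forall a d a' d' b b',
         Rabs (a - hm) <= e -> Rabs (d - hp) <= e -> Rabs (a' - hm) <= e -> Rabs (d' - hp) <= e ->
         Rabs b <= B * e ^ 2 -> Rabs b' <= B * e ^ 2 ->
         RInt (reduced f vs al k b) a d = 0 -> RInt (reduced f vs al k b') a' d' = 0 ->
         J1 * Rabs (b - b') <= M * (Rabs (a - a') + Rabs (d - d')))) /\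
    (((1 * e < be0 /\ 1 * e < 1) /\ (1 * e < Rmin (al - hm) (hp - al) /\ / Dif * e < 1 / 2)) /\
     ((/ Dif * e < be0 /\ B * e < be0) /\ (M * (B + D * / Dif) * e < mu / 2 /\
      (1 + B + D * / Dif) * e < r0))) /\
    (mu * D * e < 2 * m1 /\ Z * e < r0 ^ 2))).
  2:{ apply small_and; [exact Hlev|].
      assert (0 < r0 ^ 2) by (apply pow_lt; lra).
      assert (0 < Rmin (al - hm) (hp - al)) by (apply Rmin_pos; lra).
      repeat apply small_and; apply small_linear; lra. }
  intros e He [Hlev_e [[[[E1 E2] [E3 E4]] [[E5 E6] [E7 E8]]] [E9 E10]]].
  assert (Rl := Rmin_l (al - hm) (hp - al)). assert (Rr := Rmin_r (al - hm) (hp - al)).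
  clear Hlev. set (k := e ^ 2 / Dif).
  assert (He2 : 0 < e ^ 2) by (apply pow_lt; lra).
  assert (He21 : e ^ 2 <= e) by (clear - He E2; nra).
  assert (Hk0 : 0 < k) by (apply Rdiv_lt_0_compat; lra).
  assert (Ek : k = / Dif * e ^ 2) by (unfold k; field; lra).
  assert (Hke : k <= / Dif * e) by (rewrite Ek; apply Rmult_le_compat_l; lra).
  destruct (Hlev_e k) as [Hex Hbl]; [rewrite Rabs_pos_eq; lra|]. clear Hlev_e.
  assert (HBe : B * e ^ 2 <= B * e) by (apply Rmult_le_compat_l; lra).
  set (S := fun p : R * R => Rabs (fst p - hm) <= e /\ Rabs (snd p - hp) <= e).
  assert (Hb : exists b : R * R -> R, forall p, S p ->
            Rabs (b p) <= B * e ^ 2 /\ RInt (reduced f vs al k (b p)) (fst p) (snd p) = 0).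
  { assert (Hb : forall p, exists b, S p ->
            Rabs b <= B * e ^ 2 /\ RInt (reduced f vs al k b) (fst p) (snd p) = 0).
    { intros p. destruct (classic (S p)) as [Hp|Hp].
      - destruct (Hex (fst p) (snd p) (proj1 Hp) (proj2 Hp)) as [b Hb]. now exists b.
      - exists 0. intros; contradiction. }
    exists (fun p => proj1_sig (constructive_indefinite_description _ (Hb p))).
    intros p. now destruct (constructive_indefinite_description _ (Hb p)). }
  destruct Hb as [b Hb]. clear Hex.
  assert (Hkb : Rabs k <= be0) by (rewrite Rabs_pos_eq; lra).
  assert (Hw : forall p, S p ->
     wells (reduced f vs al k (b p)) (fst p) (snd p) del ell D mu m1 (2 * M)).
  { intros p Hp. destruct (Hb p Hp) as [Hb1 Hb2]. destruct Hp as [Hp1 Hp2].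
    apply HW; try assumption; lra. }
  assert (Hrho : forall p s, S p -> hm - 1 <= s <= hp + 1 ->
            Rabs (b p + k * (al - s)) <= (B + D * / Dif) * e).
  { intros p s Hp Hs. destruct (Hb p Hp) as [Hb1 _].
    eapply Rle_trans; [apply Rabs_triang|]. rewrite Rabs_mult, (Rabs_pos_eq k) by lra.
    assert (Rabs (al - s) <= D) by (apply Rabs_le; unfold D; lra).
    assert (k * Rabs (al - s) <= / Dif * e * D) by (apply Rmult_le_compat; try apply Rabs_pos; lra).
    lra. }
  set (rho := fun p u => (1 - k) * u + (vs + b p + k * al - xi)).
  assert (HSp : forall p, S p -> hm - e <= fst p <= hm + e /\ hp - e <= snd p <= hp + e).
  { intros p [H1 H2]. apply Rabs_le_between in H1, H2. lra. }
  assert (Hrd : forall p, S p -> r0 <= rho p (snd p) <= P).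
  { intros p Hp. destruct (HSp p Hp) as [H1 H2].
    assert (A := Hrho p (snd p) Hp ltac:(lra)). apply Rabs_le_between in A.
    unfold rho, P, r2, r1 in *. lra. }
  assert (Hra : forall p, S p -> r0 <= - rho p (fst p) <= P).
  { intros p Hp. destruct (HSp p Hp) as [H1 H2].
    assert (A := Hrho p (fst p) Hp ltac:(lra)). apply Rabs_le_between in A.
    unfold rho, P, r2, r1 in *. lra. }
  assert (HMd : forall p, S p -> M * (Rabs (b p) + D * Rabs k) <= mu / 2 * e).
  { intros p Hp. destruct (Hb p Hp) as [Hb1 _]. rewrite (Rabs_pos_eq k) by lra.
    apply Rle_trans with (M * (B + D * / Dif) * e * e).
    - replace (M * (B + D * / Dif) * e * e) with (M * (B * e ^ 2 + D * k)) by (rewrite Ek; ring).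
      apply Rmult_le_compat_l; lra.
    - apply Rmult_le_compat_r; lra. }
  destruct (exp_large_small q (2 * P / e) (m1 / (2 * D ^ 2))) as [s [Hs [Hs2 HsP]]];
    [exact Hq|apply Rdiv_lt_0_compat; lra|].
  (* [s] is so small that a truncated time exceeds [2 * P / e], a common bound of the two
     prescribed times, once its rest point is within [D * eta] of the saddle or beyond it. *)
  set (eta := s ^ 2) in *. assert (Heta : 0 < eta) by (apply pow_lt; exact Hs).
  assert (HDeta : 0 < D * eta) by (apply Rmult_lt_0_compat; lra).
  assert (Hmue : 0 < mu * e) by (apply Rmult_lt_0_compat; lra).
  assert (Hetam : D ^ 2 * eta <= m1 / 2).
  { apply Rle_trans with (D ^ 2 * (m1 / (2 * D ^ 2))).
    - apply Rmult_le_compat_l; lra.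
    - right. field. lra. }
  assert (Long : forall g a d, wells g a d del ell D mu m1 (2 * M) -> - g a <= D * eta ->
            2 * P / e < left_time g a d c eta).
  { intros g a d Hgw Hga. eapply Rlt_le_trans; [exact HsP|].
    exact (left_time_lower g a d del ell D mu m1 (2 * M) c eta Hgw Hc Heta s Hs eq_refl Hga). }
  assert (Short : forall g a d, wells g a d del ell D mu m1 (2 * M) -> mu / 2 * e <= - g a ->
            left_time g a d c eta < r0 / e).
  { intros g a d Hgw Hga.
    eapply Rle_lt_trans;
      [apply (left_time_upper g a d del ell D mu m1 (2 * M) c eta Hgw Hc Heta (mu / 2 * e));
       [lra|exact Hga|lra]|].
    set (X := D ^ 3 / (2 * (mu / 2 * e)) + D / (c * ell)).
    assert (Hce : 0 < c * ell) by (apply Rmult_lt_0_compat; lra).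
    assert (HX1 : 0 < D ^ 3 / mu) by (apply Rdiv_lt_0_compat; lra).
    assert (HX2 : 0 < D / (c * ell)) by (apply Rdiv_lt_0_compat; lra).
    assert (HXe : X * e <= D ^ 3 / mu + D / (c * ell)).
    { unfold X. replace ((D ^ 3 / (2 * (mu / 2 * e)) + D / (c * ell)) * e)
        with (D ^ 3 / mu + D / (c * ell) * e) by (field; repeat split; lra).
      assert (D / (c * ell) * e <= D / (c * ell) * 1) by (apply Rmult_le_compat_l; lra). lra. }
    assert (HX : 0 <= X).
    { unfold X. assert (0 < D ^ 3 / (2 * (mu / 2 * e))) by (apply Rdiv_lt_0_compat; lra). lra. }
    rewrite <- (sqrt_pow2 PI) by lra. rewrite <- sqrt_mult; [|apply pow2_ge_0|exact HX].
    rewrite <- (sqrt_pow2 (r0 / e)) by (apply Rdiv_le_0_compat; lra).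
    apply sqrt_lt_1_alt. split; [apply Rmult_le_pos; [apply pow2_ge_0|exact HX]|].
    replace ((r0 / e) ^ 2) with (r0 ^ 2 / e ^ 2) by (field; lra).
    apply lt_div; [exact He2|].
    apply Rle_lt_trans with (Z * e); [|exact E10]. unfold Z.
    replace (PI ^ 2 * X * e ^ 2) with (PI ^ 2 * (X * e) * e) by ring.
    apply Rmult_le_compat_r; [lra|]. apply Rmult_le_compat_l; [apply pow2_ge_0|exact HXe]. }
  set (inv := / ((1 - k) * e)).
  assert (Hk12 : 1 / 2 < 1 - k < 1) by lra.
  assert (Hinv : / e <= inv <= 2 / e).
  { unfold inv. split.
    - apply Rinv_le_contravar; clear - He Hk12; nra.
    - replace (2 / e) with (/ (1 / 2 * e)) by (field; lra).
      apply Rinv_le_contravar; clear - He Hk12; nra. }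
  assert (Hie : 0 < / e) by now apply Rinv_0_lt_compat.
  assert (Htarget : forall r, r0 <= r <= P -> r0 / e <= r * inv <= 2 * P / e).
  { intros r Hr. unfold Rdiv. split.
    - apply Rmult_le_compat; lra.
    - replace (2 * P * / e) with (P * (2 / e)) by (field; lra). apply Rmult_le_compat; lra. }
  (* [rho p u] is the integrand of the mass condition at the height [u].  As it is affine in [u]
     with slope [1 - k], an orbit that takes the time [1 / e] and has mass [xi] has the weighted
     times [rho p d * inv] and [- rho p a * inv]. *)
  set (F := fun x y => let p := (x, y) in
    rho p (snd p) * inv - left_time (reduced f vs al k (b p)) (fst p) (snd p) c eta).
  set (H := fun x y => let p := (x, y) in
    - rho p (fst p) * inv - right_time (reduced f vs al k (b p)) (fst p) (snd p) c eta).
  assert (Hbdist : BL S (fun _ : unit => True) (fun p _ => b p)).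
  { exists (B * e ^ 2 + M / J1). assert (HMJ : 0 < M / J1) by (apply Rdiv_lt_0_compat; lra).
    assert (0 < B * e ^ 2) by (apply Rmult_lt_0_compat; lra). split; [lra|]. intros p p' _ Hp Hp' _.
    destruct (Hb p Hp) as [Hb1 Hb2]. destruct (Hb p' Hp') as [Hb3 Hb4]. split; [lra|].
    assert (L := Hbl _ _ _ _ _ _ (proj1 Hp) (proj2 Hp) (proj1 Hp') (proj2 Hp') Hb1 Hb3 Hb2 Hb4).
    fold (dist2 p p') in L. assert (Dp := dist2_pos p p').
    assert (0 <= B * e ^ 2 * dist2 p p') by (apply Rmult_le_pos; lra).
    apply Rle_trans with (M / J1 * dist2 p p'); [|lra].
    replace (M / J1 * dist2 p p') with (M * dist2 p p' / J1) by (field; lra).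
    apply le_div; lra. }
  assert (HSb : forall p, S p -> hm - 1 <= fst p /\ snd p <= hp + 1).
  { intros p Hp. destruct (HSp p Hp). lra. }
  assert (Harg : forall p x, S p -> hm - 1 <= x <= hp + 1 ->
            box (hm - 1) (hp + 1) vs x (vs + b p + k * (al - x))).
  { intros p x Hp Hx. apply (arg_box hm hp vs al Hal be0); try assumption.
    destruct (Hb p Hp). lra. }
  assert (HLt := BL_left_time f fu fv (hm - 1) (hp + 1) vs al k M D del ell mu m1 (2 * M) c eta
                   HB S b Hw HSb Harg Hbdist Hell Hc Heta).
  assert (HRt := BL_right_time f fu fv (hm - 1) (hp + 1) vs al k M D del ell mu m1 (2 * M) c eta
                   HB S b Hw HSb Harg Hbdist Hell Hc Heta).
  assert (BLf : BL S (fun _ : unit => True) (fun p _ => fst p)).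
  { apply (BL_fst S _ (Rabs hm + 1)). intros p Hp. destruct (HSp p Hp) as [H1 _].
    apply Rabs_le. generalize (Rle_abs hm) (Rabs_maj2 hm). lra. }
  assert (BLs : BL S (fun _ : unit => True) (fun p _ => snd p)).
  { apply (BL_snd S _ (Rabs hp + 1)). intros p Hp. destruct (HSp p Hp) as [_ H1].
    apply Rabs_le. generalize (Rle_abs hp) (Rabs_maj2 hp). lra. }
  assert (BLrho : forall w : R * R -> R, BL S (fun _ : unit => True) (fun p _ => w p) ->
            BL S (fun _ : unit => True) (fun p _ => rho p (w p))).
  { intros w Hw'. apply BL_plus; [now apply BL_scal|].
    apply BL_minus; [|apply BL_const]. apply BL_plus; [|apply BL_const].
    apply BL_plus; [apply BL_const|exact Hbdist]. }
  assert (Hlip : forall W : R * R -> R, BL S (fun _ : unit => True) (fun p _ => W p) ->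
            exists C, 0 <= C /\
            lipschitz2 (hm - e) (hm + e) (hp - e) (hp + e) (fun x y => W (x, y)) C).
  { intros W [C [HC BW]]. exists C. split; [exact HC|]. intros x y x' y' Hx Hy Hx' Hy'.
    apply (BW (x, y) (x', y') tt); try exact I; split; simpl; apply Rabs_le; lra. }
  destruct (Hlip (fun p => F (fst p) (snd p))) as [C1 [HC1 LF]].
  { apply (BL_ext S _ (fun p _ => rho p (snd p) * inv
            - left_time (reduced f vs al k (b p)) (fst p) (snd p) c eta)).
    - intros [x y] _ _ _. reflexivity.
    - apply BL_minus; [|exact HLt]. apply BL_mult; [now apply BLrho|apply BL_const]. }
  destruct (Hlip (fun p => H (fst p) (snd p))) as [C2 [HC2 LH]].
  { apply (BL_ext S _ (fun p _ => (-1 * rho p (fst p)) * inv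
            - right_time (reduced f vs al k (b p)) (fst p) (snd p) c eta)).
    - intros [x y] _ _ _. unfold H. simpl. ring.
    - apply BL_minus; [|exact HRt]. apply BL_mult; [|apply BL_const].
      apply BL_scal. now apply BLrho. }
  simpl in LF, LH.
  assert (HSxy : forall x y, hm - e <= x <= hm + e -> hp - e <= y <= hp + e -> S (x, y)).
  { intros x y Hx Hy. split; simpl; apply Rabs_le; lra. }
  assert (Lmono : forall W C, lipschitz2 (hm - e) (hm + e) (hp - e) (hp + e) W C ->
            C <= C1 + C2 + 1 -> lipschitz2 (hm - e) (hm + e) (hp - e) (hp + e) W (C1 + C2 + 1)).
  { intros W C L HC x y x' y' Hx Hy Hx' Hy'. eapply Rle_trans; [now apply L|].
    apply Rmult_le_compat_r; [|exact HC].
    generalize (Rabs_pos (x - x')) (Rabs_pos (y - y')); lra. }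
  destruct (poincare_miranda (hm - e) (hm + e) (hp - e) (hp + e) (C1 + C2 + 1) F
              (fun x y => - H x y)) as [a [d [Ha [Hd [ZF ZH]]]]].
  { lra. } { lra. } { lra. }
  { apply (Lmono F C1); [exact LF|lra]. }
  { apply (Lmono _ C2); [|lra]. intros x y x' y' Hx Hy Hx' Hy'.
    replace (- H x y - - H x' y') with (- (H x y - H x' y')) by ring.
    rewrite Rabs_Ropp. now apply LH. }
  { intros y Hy. split.
    - assert (Hp := HSxy (hm - e) y ltac:(lra) Hy).
      assert (T := Htarget _ (Hrd _ Hp)).
      assert (L := Long _ _ _ (Hw _ Hp)). simpl in L.
      destruct (Hb _ Hp) as [Hb1 _].
      destruct (Hoff k (b (hm - e, y)) hm e Hkb ltac:(lra) (or_introl eq_refl) ltac:(lra)) as [_ O].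
      assert (Q := HMd _ Hp). specialize (L ltac:(lra)). unfold F. simpl in *. lra.
    - assert (Hp := HSxy (hm + e) y ltac:(lra) Hy).
      assert (T := Htarget _ (Hrd _ Hp)).
      assert (L := Short _ _ _ (Hw _ Hp)). simpl in L.
      destruct (Hb _ Hp) as [Hb1 _].
      destruct (Hoff k (b (hm + e, y)) hm e Hkb ltac:(lra) (or_introl eq_refl) ltac:(lra)) as [O _].
      assert (Q := HMd _ Hp). specialize (L ltac:(lra)). unfold F. simpl in *. lra. }
  { intros x Hx. split.
    - assert (Hp := HSxy x (hp - e) Hx ltac:(lra)).
      assert (T := Htarget _ (Hra _ Hp)).
      assert (L := Short _ _ _ (wells_reflect _ _ _ _ _ _ _ _ _ (Hw _ Hp))).
      rewrite <- (right_time_reflect _ _ _ _ _ _ _ _ _ c eta (Hw _ Hp) Hc Heta) in L.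
      simpl in L. rewrite !Ropp_involutive in L.
      destruct (Hb _ Hp) as [Hb1 _].
      destruct (Hoff k (b (x, hp - e)) hp e Hkb ltac:(lra) (or_intror eq_refl) ltac:(lra)) as [_ O].
      assert (Q := HMd _ Hp). specialize (L ltac:(lra)). unfold H. simpl in *. lra.
    - assert (Hp := HSxy x (hp + e) Hx ltac:(lra)).
      assert (T := Htarget _ (Hra _ Hp)).
      assert (L := Long _ _ _ (wells_reflect _ _ _ _ _ _ _ _ _ (Hw _ Hp))).
      rewrite <- (right_time_reflect _ _ _ _ _ _ _ _ _ c eta (Hw _ Hp) Hc Heta) in L.
      simpl in L. rewrite !Ropp_involutive in L.
      destruct (Hb _ Hp) as [Hb1 _].
      destruct (Hoff k (b (x, hp + e)) hp e Hkb ltac:(lra) (or_intror eq_refl) ltac:(lra)) as [O _].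
      assert (Q := HMd _ Hp). specialize (L ltac:(lra)). unfold H. simpl in *. lra. }
  (* At the common zero both times stay below [2 * P / e], so that neither rest point is within
     [D * eta] of its saddle: the cut-off is inactive and the times are those of an orbit. *)
  assert (Hp := HSxy a d Ha Hd). set (p := (a, d)) in *.
  assert (Hwp := Hw p Hp). destruct (Hb p Hp) as [Hb1 Hb2].
  assert (EF : left_time (reduced f vs al k (b p)) a d c eta = rho p d * inv)
    by (unfold F in ZF; simpl in ZF; fold p in ZF; lra).
  assert (EH : right_time (reduced f vs al k (b p)) a d c eta = - rho p a * inv)
    by (unfold H in ZH; simpl in ZH; fold p in ZH; lra).
  assert (Trd := Htarget _ (Hrd p Hp)). assert (Tra := Htarget _ (Hra p Hp)). simpl in Trd, Tra.
  set (g := reduced f vs al k (b p)) in *. simpl in Hwp, Hb2.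
  assert (Had : a < d) by (generalize (wells_len Hwp); lra).
  assert (Hga : D * eta <= - g a).
  { apply Rnot_lt_le. intros h. generalize (Long _ _ _ Hwp ltac:(lra)). lra. }
  assert (Hgd : D * eta <= g d).
  { apply Rnot_lt_le. intros h.
    assert (L := Long _ _ _ (wells_reflect _ _ _ _ _ _ _ _ _ Hwp)).
    rewrite <- (right_time_reflect _ _ _ _ _ _ _ _ _ c eta Hwp Hc Heta) in L.
    simpl in L. rewrite !Ropp_involutive in L. specialize (L ltac:(lra)). lra. }
  assert (HK := stiffness_lower g a d del ell D mu m1 (2 * M) c eta Hwp Hc Heta Hga Hgd
                  ltac:(lra) Hc2).
  assert (Hcut : forall u, a <= u <= d -> cut_stiffness g a d c eta u = stiffness g a d u).
  { intros u Hu. apply Rmax_left. now apply HK. }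
  assert (Hgc := wells_cont Hwp).
  assert (HKpos : forall u, a <= u <= d -> 0 < stiffness g a d u).
  { intros u Hu. specialize (HK u Hu). assert (0 <= c * (u - a) * (d - u))
      by (apply Rmult_le_pos; [apply Rmult_le_pos|]; lra). lra. }
  destruct (oscillator_solution g a d (2 * M) Hgc Had (wells_lip Hwp) Hb2 al HKpos)
    as [L [R1 [U [U1 [HL [HR1 [Hlen [HU [HU1 [Ua [U1a [U0 [Ud [U1d [Ur [Upos [Uen Uint]]]]]]]]]]]]]]]]].
  { lra. }
  set (wt := fun th => / sqrt (2 * stiffness g a d (sweep a d th))) in *.
  assert (Hwtc : forall w : R -> R, (forall x, continuous w x) ->
     ex_RInt (fun th => w (sweep a d th) * wt th) 0 PI).
  { intros w Hwc. apply ex_RInt_cont. intros th.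
    apply (continuous_ext (fun x => w (sweep a d x) / sqrt (2 * cut_stiffness g a d c eta (sweep a d x)))).
    - intros x. unfold wt. rewrite Hcut by (apply sweep_range; lra). reflexivity.
    - apply (continuous_weighted _ _ _ _ _ _ _ _ _ c eta Hwp Hc Heta w _ Hwc). }
  assert (EL : RInt (fun th => (d - sweep a d th) * wt th) 0 PI = rho p d * inv).
  { rewrite <- EF. apply RInt_ext. intros th _. rewrite Hcut by (apply sweep_range; lra).
    reflexivity. }
  assert (ER : RInt (fun th => (sweep a d th - a) * wt th) 0 PI = - rho p a * inv).
  { rewrite <- EH. apply RInt_ext. intros th _. rewrite Hcut by (apply sweep_range; lra).
    reflexivity. }
  assert (Caff : forall m n x : R, continuous (fun u : R => m + n * u) x).
  { intros m n x. apply (is_derive_continuous _ _ n). auto_derive; [exact I|ring]. }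
  assert (Elin : forall m n, RInt (fun th => (m + n * sweep a d th) * wt th) 0 PI
            = m * RInt wt 0 PI + n * RInt (fun th => sweep a d th * wt th) 0 PI).
  { intros m n.
    assert (I1 : ex_RInt (fun th => wt th) 0 PI).
    { apply (ex_RInt_ext (fun th => 1 * wt th)); [intros; apply Rmult_1_l|].
      apply (Hwtc (fun _ => 1)). intros x. apply continuous_const. }
    assert (I2 : ex_RInt (fun th => sweep a d th * wt th) 0 PI).
    { apply (Hwtc (fun u => u)). intros x. apply continuous_id. }
    rewrite (RInt_ext _ (fun th => plus (scal m (wt th)) (scal n (sweep a d th * wt th)))).
    - rewrite (RInt_plus (V := R_CompleteNormedModule)).
      + rewrite (RInt_scal (V := R_CompleteNormedModule)) by exact I1.
        rewrite (RInt_scal (V := R_CompleteNormedModule)) by exact I2. reflexivity.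
      + now apply (ex_RInt_scal (V := R_NormedModule)).
      + now apply (ex_RInt_scal (V := R_NormedModule)).
    - intros th _. unfold plus, scal; simpl; unfold mult; simpl. ring_R. }
  assert (EL' := Elin d (-1)). assert (ER' := Elin (- a) 1).
  rewrite (RInt_ext _ (fun th => (d - sweep a d th) * wt th)) in EL' by (intros; ring_R).
  rewrite (RInt_ext _ (fun th => (sweep a d th - a) * wt th)) in ER' by (intros; ring_R).
  rewrite EL in EL'. rewrite ER in ER'.
  set (T0 := RInt wt 0 PI) in *. set (T1 := RInt (fun th => sweep a d th * wt th) 0 PI) in *.
  assert (Einv : (1 - k) * inv = / e) by (unfold inv; field; lra).
  (* The sum of the two weighted times is [(d - a) * T0], that of the targets is
     [(d - a) / e]. *)
  assert (HT0 : T0 = 1 / e).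
  { assert (Eq1 : (d - a) * T0 = (d - a) * ((1 - k) * inv)).
    { unfold rho in EL', ER'. lra. }
    apply Rmult_eq_reg_l in Eq1; [|lra]. rewrite Eq1, Einv. change (@eq R (/ e) (1 / e)). field. lra. }
  exists a, d, (b p), L, R1, U, U1. split; [exact Hb1|].
  split; try assumption; try (split; assumption).
  - apply (proj1 Hp).
  - apply (proj2 Hp).
  - rewrite Hlen. exact HT0.
  - intros t Ht. specialize (Ur t). specialize (Upos t Ht). specialize (Uen t).
    assert (En := stiffness_energy g a d Hgc Had Hb2 (U t)).
    assert (HKt := HK (U t) Ur).
    assert (Hsq : 0 <= (U t - a) * (d - U t)) by (apply Rmult_le_pos; lra).
    set (X := (U t - a) * (d - U t)) in *.
    assert (Hmul : X * (c * X) <= X * stiffness g a d (U t)).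
    { apply Rmult_le_compat_l; [exact Hsq|]. unfold X at 1. lra. }
    rewrite <- (sqrt_pow2 (U1 t)) by exact Upos. rewrite <- (sqrt_pow2 X) by exact Hsq.
    rewrite <- sqrt_mult; [|lra|apply pow2_ge_0]. apply sqrt_le_1_alt. rewrite Uen. clear - Hmul En. nra.
  - assert (Em := Uint (fun u => (1 - k) * u + (vs + b p + k * al - xi))). cbv beta in Em.
    rewrite Em.
    + rewrite (RInt_ext _ (fun th => ((vs + b p + k * al - xi) + (1 - k) * sweep a d th) * wt th)).
      * rewrite Elin. fold T0 T1.
        assert (Eq2 : (1 - k) * (T1 - a * T0) = - rho p a * ((1 - k) * inv)) by (rewrite <- Rmult_assoc, (Rmult_comm _ (1 - k)), Rmult_assoc; f_equal; lra).
        rewrite Einv in Eq2. unfold rho in Eq2. rewrite HT0 in *. 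
        replace (1 / e) with (/ e) in * by (field; lra). lra.
      * intros th _. unfold wt, Rdiv. ring_R.
    + intros x. apply (continuous_ext (fun u => (vs + b p + k * al - xi) + (1 - k) * u)); [intros; ring_R|apply Caff].
Qed.
End Existence.

(** * The layer profiles *)

Definition C2_line (w w1 w2 : R -> R) : Prop :=
  (forall z, is_derive w z (w1 z)) /\ (forall z, is_derive w1 z (w2 z)) /\
  (forall z, continuous w2 z).

Lemma at_left_eps (phi : R -> R) (l : R) :
  filterlim phi (at_left 0) (locally l) ->
  forall e, 0 < e -> exists r, 0 < r /\ forall y, - r < y < 0 -> Rabs (phi y - l) < e.
Proof.
  intros H e He.
  assert (Hl : locally l (fun y => Rabs (y - l) < e)).
  { exists (mkposreal e He). intros y Hy. exact Hy. }
  destruct (H _ Hl) as [r Hr]. exists r. split; [apply cond_pos|].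
  intros y Hy. apply Hr; [|lra]. change (Rabs (y - 0) < r). apply Rabs_lt_between. lra.
Qed.

Lemma continuous_stopped (phi : R -> R) :
  (forall z, z < 0 -> continuous phi z) -> filterlim phi (at_left 0) (locally (phi 0)) ->
  forall z, continuous (fun s => phi (Rmin s 0)) z.
Proof.
  intros Hc H0 z. apply continuous_of_eps. intros e He.
  destruct (total_order_T z 0) as [[h|h]|h].
  - destruct (continuous_eps phi z (Hc z h) e He) as [r [Hr Hd]].
    exists (Rmin r (- z)). split; [apply Rmin_pos; lra|]. intros y Hy.
    assert (Y1 := Rlt_le_trans _ _ _ Hy (Rmin_l _ _)).
    assert (Y2 := Rlt_le_trans _ _ _ Hy (Rmin_r _ _)). apply Rabs_lt_between in Y2.
    rewrite !Rmin_left by lra. now apply Hd.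
  - subst z. destruct (at_left_eps phi (phi 0) H0 e He) as [r [Hr Hd]].
    exists r. split; [exact Hr|]. intros y Hy. apply Rabs_lt_between in Hy.
    rewrite (Rmin_right 0 0) by lra. destruct (Rlt_le_dec y 0).
    + rewrite Rmin_left by lra. apply Hd. lra.
    + rewrite Rmin_right by lra. rewrite Rminus_diag, Rabs_R0. exact He.
  - exists z. split; [exact h|]. intros y Hy. apply Rabs_lt_between in Hy.
    rewrite !Rmin_right by lra. rewrite Rminus_diag, Rabs_R0. exact He.
Qed.

Lemma solves_left_continuous (r phi : R -> R) (a : R) :
  solves_left r a phi -> forall z, continuous (fun s => phi (Rmin s 0)) z.
Proof.
  intros [H1 [H2 [H3 H4]]]. apply continuous_stopped; [|exact H2].
  intros z Hz. apply (ex_derive_continuous phi z). now apply H1.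
Qed.

(** A profile on the half-line is the restriction of a function that is twice continuously
    differentiable on the whole line: integrate the right-hand side, frozen at its value in
    the end point. *)
Lemma extend_left (r phi : R -> R) (a : R) :
  solves_left r a phi -> (forall z, continuous (fun s => r (Rmin s 0)) z) ->
  exists psi psi1 psi2, C2_line psi psi1 psi2 /\
    forall z, z <= 0 -> psi z = phi z /\ psi2 z = r z.
Proof.
  intros Hs Hr. assert (Hphi := solves_left_continuous _ _ _ Hs).
  destruct Hs as [H1 [H2 [H3 H4]]].
  set (psi2 := fun s => r (Rmin s 0)).
  set (psi1 := fun z => Derive phi (-1) + RInt psi2 (-1) z).
  assert (D1 : forall z, is_derive psi1 z (psi2 z)).
  { intros z. apply (is_derive_eq _ _ (0 + psi2 z)); [|ring].
    apply is_derive_R_plus; [apply is_derive_R_const|]. exact (is_derive_primitive psi2 (-1) z Hr). }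
  assert (C1 : forall z, continuous psi1 z).
  { intros z. apply (is_derive_continuous _ _ _ (D1 z)). }
  set (psi := fun z => phi (-1) + RInt psi1 (-1) z).
  assert (D0 : forall z, is_derive psi z (psi1 z)).
  { intros z. apply (is_derive_eq _ _ (0 + psi1 z)); [|ring].
    apply is_derive_R_plus; [apply is_derive_R_const|]. exact (is_derive_primitive psi1 (-1) z C1). }
  assert (Hneg : forall z x, z < 0 -> Rmin (-1) z <= x <= Rmax (-1) z -> x < 0).
  { intros z x Hz [_ Hx]. eapply Rle_lt_trans; [exact Hx|]. apply Rmax_lub_lt; lra. }
  assert (E1 : forall z, z < 0 -> Derive phi z = psi1 z).
  { intros z Hz.
    assert (E : Derive phi (-1) - psi1 (-1) = Derive phi z - psi1 z).
    { apply (constant_of_derive_zero (fun x => Derive phi x - psi1 x)).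
      intros x Hx. apply Hneg in Hx; [|exact Hz].
      apply (is_derive_eq _ _ (r x - psi2 x)).
      - apply is_derive_R_minus; [|apply D1]. exact (proj2 (H1 x Hx)).
      - unfold psi2. rewrite Rmin_left by lra. ring. }
    unfold psi1 at 1 in E. rewrite (RInt_point (V := R_CompleteNormedModule)) in E.
    unfold zero in E; simpl in E. lra. }
  assert (E0 : forall z, z < 0 -> phi z = psi z).
  { intros z Hz.
    assert (E : phi (-1) - psi (-1) = phi z - psi z).
    { apply (constant_of_derive_zero (fun x => phi x - psi x)).
      intros x Hx. apply Hneg in Hx; [|exact Hz].
      apply (is_derive_eq _ _ (Derive phi x - psi1 x)).
      - apply is_derive_R_minus; [|apply D0]. apply Derive_correct. now apply H1.
      - rewrite E1 by exact Hx. ring. }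
    unfold psi at 1 in E. rewrite (RInt_point (V := R_CompleteNormedModule)) in E.
    unfold zero in E; simpl in E. lra. }
  exists psi, psi1, psi2. split; [split; [exact D0|split; [exact D1|exact Hr]]|].
  intros z Hz. split.
  - destruct (Rlt_le_dec z 0) as [h|h]; [symmetry; now apply E0|].
    replace z with 0 by lra. apply cond_eq. intros e He.
    destruct (at_left_eps phi (phi 0) H2 (e / 2)) as [r1 [Hr1 B1]]; [lra|].
    destruct (continuous_eps psi 0 (is_derive_continuous _ _ _ (D0 0)) (e / 2)) as [r2 [Hr2 B2]];
      [lra|].
    set (y := - (Rmin r1 r2 / 2)).
    assert (Hy : 0 < Rmin r1 r2) by now apply Rmin_pos.
    assert (M1 := Rmin_l r1 r2). assert (M2 := Rmin_r r1 r2).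
    assert (A1 := B1 y ltac:(unfold y; lra)).
    assert (A2 := B2 y ltac:(apply Rabs_lt_between; unfold y; lra)).
    rewrite (E0 y) in A1 by (unfold y; lra).
    replace (psi 0 - phi 0) with (- (psi y - psi 0) + (psi y - phi 0)) by ring.
    eapply Rle_lt_trans; [apply Rabs_triang|]. rewrite Rabs_Ropp. lra.
  - unfold psi2. now rewrite Rmin_left.
Qed.

Lemma lim_m_infty_eps (phi : R -> R) :
  is_lim phi m_infty 0 -> forall e, 0 < e -> exists Z, forall z, z < Z -> Rabs (phi z) < e.
Proof.
  intros H e He. apply is_lim_spec in H. destruct (H (mkposreal e He)) as [Z HZ].
  exists Z. intros z Hz. specialize (HZ z Hz). simpl in HZ. now rewrite Rminus_0_r in HZ.
Qed.

(** Going backwards in time, a function that grows at least at the rate [k] decays at least like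
    the exponential. *)
Lemma exp_comparison (w w1 : R -> R) (k z : R) :
  z <= 0 -> (forall x, is_derive w x (w1 x)) ->
  (forall x, z <= x <= 0 -> k * w x <= w1 x) -> w z <= w 0 * exp (k * z).
Proof.
  intros Hz Hd H.
  assert (E : w z * exp (- k * z) <= w 0 * exp (- k * 0)).
  { apply (nondecreasing_of_derive (fun x => w x * exp (- k * x))
            (fun x => (w1 x - k * w x) * exp (- k * x)) z 0 Hz).
    - intros x _. apply (is_derive_eq _ _ (w1 x * exp (- k * x) + w x * (- k * exp (- k * x)))); [|ring].
      apply (is_derive_R_mult w (fun y => exp (- k * y))); [apply Hd|].
      auto_derive; [exact I|ring].
    - intros x Hx. apply Rmult_le_pos; [generalize (H x Hx); lra|left; apply exp_pos]. }
  rewrite Rmult_0_r, exp_0, Rmult_1_r in E.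
  apply (Rmult_le_reg_r (exp (- k * z))); [apply exp_pos|].
  rewrite Rmult_assoc, <- exp_plus. replace (k * z + - k * z) with 0 by ring.
  rewrite exp_0, Rmult_1_r. exact E.
Qed.

Section Potential.
Variables (f fu fv : R -> R -> R) (lo hi vs M h al : R).
Hypothesis HB : C2box f fu fv lo hi vs M.
Hypothesis Hlo : lo + 1 <= h.
Hypothesis Hal : h < al.
Hypothesis Hhi : al + 1 <= hi.
Hypothesis Hf : f h vs = 0.
Hypothesis Hu : fu h vs < 0.
Hypothesis Hpot : forall u, h < u <= al -> RInt (fun s => f s vs) h u < 0.

Let Hsl (x : R) : continuous (fun s => f s vs) x.
Proof.
  apply (continuous_along f fu fv _ _ _ _ HB (fun s => s) (fun _ => vs));
    [apply continuous_id|apply continuous_const].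
Qed.

Lemma slice_upper (s : R) : h <= s <= al -> Rabs (f s vs) <= M * (s - h).
Proof.
  intros Hs. assert (L := box_lip f fu fv _ _ _ _ HB s vs h vs ltac:(split; lra) ltac:(split; lra)).
  rewrite Hf, Rminus_0_r, Rminus_diag, Rabs_R0, Rplus_0_r, (Rabs_pos_eq (s - h)) in L by lra.
  exact L.
Qed.

Lemma potential_upper (u : R) :
  h <= u <= al -> - 2 * RInt (fun s => f s vs) h u <= M * (u - h) ^ 2.
Proof.
  intros Hu'.
  assert (E := RInt_ge_affine (fun s => f s vs) h u 0 (- M) Hsl (proj1 Hu')).
  assert (0 * (u - h) + - M / 2 * (u - h) ^ 2 <= RInt (fun s => f s vs) h u); [|lra].
  apply E. intros s Hs. assert (A := slice_upper s ltac:(lra)).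
  generalize (Rabs_maj2 (f s vs)). lra.
Qed.

Lemma slope_well :
  exists m del, 0 < m /\ 0 < del /\ del <= al - h /\ del <= 1 /\
    forall u v, Rabs (u - h) <= del -> Rabs (v - vs) <= del -> fu u v <= - m.
Proof.
  assert (M1 : 1 <= M) by apply (box_M HB).
  set (m := - fu h vs / 2). set (del := Rmin (m / (2 * M)) (Rmin (al - h) 1)).
  assert (Hm : 0 < m) by (unfold m; lra).
  exists m, del. split; [exact Hm|].
  split; [repeat apply Rmin_pos; try lra; apply Rdiv_lt_0_compat; lra|].
  assert (D1 : del <= al - h) by (eapply Rle_trans; [apply Rmin_r|apply Rmin_l]).
  assert (D2 : del <= 1) by (eapply Rle_trans; [apply Rmin_r|apply Rmin_r]).
  split; [exact D1|]. split; [exact D2|].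
  intros u v Hu1 Hv1.
  assert (A1 := proj1 (Rabs_le_between _ _) Hu1). assert (A2 := proj1 (Rabs_le_between _ _) Hv1).
  assert (L := box_lipu HB u v h vs ltac:(split; lra) ltac:(split; lra)).
  assert (D3 : M * (2 * del) <= m).
  { apply Rle_trans with (M * (2 * (m / (2 * M)))).
    - apply Rmult_le_compat_l; [lra|]. apply Rmult_le_compat_l; [lra|apply Rmin_l].
    - right. field. lra. }
  assert (M * (Rabs (u - h) + Rabs (v - vs)) <= M * (2 * del)) by (apply Rmult_le_compat_l; lra).
  generalize (Rle_abs (fu u v - fu h vs)). unfold m in *. lra.
Qed.

(** Quadratic near the saddle because of the negative slope there, and elsewhere by
    compactness. *)
Lemma potential_lower :
  exists k, 0 < k /\ forall u, h <= u <= al ->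
    k ^ 2 * (u - h) ^ 2 <= - 2 * RInt (fun s => f s vs) h u.
Proof.
  destruct slope_well as [m [del [Hm [Hdel [Hdel1 [Hdel2 Hsw]]]]]].
  set (F := fun u => - 2 * RInt (fun s => f s vs) h u).
  assert (HF : forall u, is_derive F u (-2 * f u vs)).
  { intros u. apply is_derive_R_scal. exact (is_derive_primitive (fun s => f s vs) h u Hsl). }
  destruct (continuity_ab_min F (h + del) al) as [um [Hum1 Hum2]].
  { lra. }
  { intros u _. apply (is_derive_continuity_pt _ _ _ (HF u)). }
  assert (Hm2 : 0 < F um) by (unfold F; generalize (Hpot um ltac:(lra)); lra).
  set (q := Rmin m (F um / (al - h) ^ 2)).
  assert (Hah : 0 < (al - h) ^ 2) by (apply pow_lt; lra).
  assert (Hq : 0 < q) by (apply Rmin_pos; [lra|apply Rdiv_lt_0_compat; lra]).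
  exists (sqrt q). split; [now apply sqrt_lt_R0|]. intros u Hu'.
  rewrite pow2_sqrt by lra.
  destruct (Rle_lt_dec u (h + del)) as [c|c].
  - apply Rle_trans with (m * (u - h) ^ 2).
    { apply Rmult_le_compat_r; [apply pow2_ge_0|apply Rmin_l]. }
    assert (E := RInt_le_affine (fun s => f s vs) h u 0 (- m) Hsl (proj1 Hu')).
    assert (RInt (fun s => f s vs) h u <= 0 * (u - h) + - m / 2 * (u - h) ^ 2); [|lra].
    apply E. intros s Hs.
    destruct (mvt (fun x => f x vs) (fun x => fu x vs) h s) as [y [Hy Ey]].
    { intros; apply (box_du HB). }
    rewrite Rmin_left, Rmax_right in Hy by lra.
    assert (B := Hsw y vs ltac:(apply Rabs_le; lra) ltac:(rewrite Rminus_diag, Rabs_R0; lra)).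
    rewrite Hf in Ey. nra.
  - change (q * (u - h) ^ 2 <= F u). eapply Rle_trans; [|apply Hum1; lra].
    apply Rle_trans with (F um / (al - h) ^ 2 * (al - h) ^ 2).
    + apply Rmult_le_compat; [lra|apply pow2_ge_0|apply Rmin_r|apply pow_incr; lra].
    + right. field. lra.
Qed.

(** What the zeroth-order profile looks like in its stretched variable; the first integral
    fixes its speed as a function of its height. *)
Record profile_facts (s0 : R) (psi psi1 psi2 : R -> R) (k : R) : Prop := {
  prof_k : 0 < k;
  prof_C2 : C2_line psi psi1 psi2;
  prof_ode : forall z, z <= 0 -> psi2 z = - (s0 ^ 2 * f (h + psi z) vs);
  prof_0 : psi 0 = al - h;
  prof_range : forall z, z <= 0 -> 0 < psi z <= al - h;
  prof_energy : forall z, z <= 0 -> psi1 z ^ 2 = s0 ^ 2 * (- 2 * RInt (fun s => f s vs) h (h + psi z));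
  prof_pos : forall z, z <= 0 -> 0 < psi1 z;
  prof_speed : forall z, z <= 0 -> k * psi z <= psi1 z <= s0 * M * psi z;
  prof_force : forall z, z <= 0 -> Rabs (psi2 z) <= s0 ^ 2 * M * psi z;
  prof_decay : forall z, z <= 0 -> psi z <= (al - h) * exp (k * z) }.
Arguments prof_k {s0 psi psi1 psi2 k}.
Arguments prof_C2 {s0 psi psi1 psi2 k}.
Arguments prof_ode {s0 psi psi1 psi2 k}.
Arguments prof_0 {s0 psi psi1 psi2 k}.
Arguments prof_range {s0 psi psi1 psi2 k}.
Arguments prof_energy {s0 psi psi1 psi2 k}.
Arguments prof_pos {s0 psi psi1 psi2 k}.
Arguments prof_speed {s0 psi psi1 psi2 k}.
Arguments prof_force {s0 psi psi1 psi2 k}.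
Arguments prof_decay {s0 psi psi1 psi2 k}.

(** Monotonicity and the limit at infinity force the energy of the profile to be that of the
    saddle; the profile then solves a first-order equation, and the quadratic bounds of the
    potential give exponential decay. *)
Lemma profile_analysis (s0 : R) (phi : R -> R) :
  0 < s0 -> profile0_minus f (fun _ => h) vs s0 al phi ->
  exists psi psi1 psi2 k, profile_facts s0 psi psi1 psi2 k /\
    forall z, z <= 0 -> psi z = phi z.
Proof.
  intros Hs0 [Hsol Hmon]. assert (M1 : 1 <= M) by apply (box_M HB).
  assert (Hs2 : 0 < s0 ^ 2) by (apply pow_lt; lra).
  destruct (extend_left _ _ _ Hsol) as [psi [psi1 [psi2 [HC2 Hext]]]].
  { intros z. assert (Hc := solves_left_continuous _ _ _ Hsol z).
    apply (continuous_opp (V := R_NormedModule) (fun s => s0 ^ 2 * f (h + phi (Rmin s 0)) vs)).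
    apply (continuous_scal_r (V := R_NormedModule) (s0 ^ 2) (fun s => f (h + phi (Rmin s 0)) vs)).
    apply (continuous_along f fu fv _ _ _ _ HB (fun s => h + phi (Rmin s 0)) (fun _ => vs));
      [|apply continuous_const].
    apply (continuous_plus (V := R_NormedModule) (fun _ => h)); [apply continuous_const|exact Hc]. }
  destruct Hsol as [_ [_ [Hphi0 Hlim]]].
  destruct HC2 as [D0 [D1 C2]].
  assert (Hmon' : forall x y, x <= y <= 0 -> psi x <= psi y).
  { intros x y Hxy. rewrite (proj1 (Hext x ltac:(lra))), (proj1 (Hext y ltac:(lra))).
    now apply Hmon. }
  assert (Hode : forall z, z <= 0 -> psi2 z = - (s0 ^ 2 * f (h + psi z) vs)).
  { intros z Hz. destruct (Hext z Hz) as [E1 E2]. now rewrite E2, E1. }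
  assert (H0 : psi 0 = al - h) by (rewrite (proj1 (Hext 0 (Rle_refl 0))); exact Hphi0).
  assert (Hlim' : forall e, 0 < e -> exists Z, Z <= 0 /\ forall z, z < Z -> Rabs (psi z) < e).
  { intros e He. destruct (lim_m_infty_eps phi Hlim e He) as [Z HZ].
    exists (Rmin Z 0). split; [apply Rmin_r|]. intros z Hz.
    assert (z < Z) by (eapply Rlt_le_trans; [exact Hz|apply Rmin_l]).
    assert (z < 0) by (eapply Rlt_le_trans; [exact Hz|apply Rmin_r]).
    rewrite (proj1 (Hext z ltac:(lra))). now apply HZ. }
  assert (Hpos : forall z, z <= 0 -> 0 <= psi z).
  { intros z Hz. apply Rnot_lt_le. intros hn.
    destruct (Hlim' (- psi z) ltac:(lra)) as [Z [HZ0 HZ]].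
    assert (A := HZ (Rmin z Z - 1) ltac:(generalize (Rmin_r z Z); lra)).
    apply Rabs_lt_between in A.
    assert (B := Hmon' (Rmin z Z - 1) z ltac:(generalize (Rmin_l z Z); lra)). lra. }
  assert (Hup : forall z, z <= 0 -> psi z <= al - h).
  { intros z Hz. rewrite <- H0. apply Hmon'. lra. }
  assert (Hp1 : forall z, z <= 0 -> 0 <= psi1 z).
  { intros z Hz. apply Rnot_lt_le. intros hn.
    destruct (continuous_eps psi1 z (is_derive_continuous _ _ _ (D1 z)) (- psi1 z) ltac:(lra))
      as [r [Hr B]].
    destruct (mvt psi psi1 (z - r / 2) z) as [c [Hc E]]; [intros; apply D0|].
    rewrite Rmin_left, Rmax_right in Hc by lra.
    assert (A := B c ltac:(apply Rabs_lt_between; lra)). apply Rabs_lt_between in A.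
    assert (Q := Hmon' (z - r / 2) z ltac:(lra)). nra. }
  set (F := fun u => - 2 * RInt (fun s => f s vs) h u).
  assert (HF : forall u, is_derive F u (-2 * f u vs)).
  { intros u. apply is_derive_R_scal. exact (is_derive_primitive (fun s => f s vs) h u Hsl). }
  assert (Hen0 : forall z, z <= 0 -> psi1 z ^ 2 - s0 ^ 2 * F (h + psi z)
                                   = psi1 0 ^ 2 - s0 ^ 2 * F (h + psi 0)).
  { intros z Hz. apply (constant_of_derive_zero (fun x => psi1 x ^ 2 - s0 ^ 2 * F (h + psi x))).
    intros x Hx. rewrite Rmin_left, Rmax_right in Hx by lra.
    apply (is_derive_eq _ _ ((psi2 x * psi1 x + psi1 x * psi2 x) - s0 ^ 2 * (-2 * f (h + psi x) vs * (0 + psi1 x)))).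
    - apply is_derive_R_minus.
      + apply (is_derive_ext (fun y => psi1 y * psi1 y)); [intros; ring_R|].
        apply is_derive_R_mult; apply D1.
      + apply is_derive_R_scal. apply (is_derive_R_comp F (fun y => h + psi y)); [apply HF|].
        apply is_derive_R_plus; [apply is_derive_R_const|apply D0].
    - rewrite (Hode x) by lra. ring. }
  set (E := psi1 0 ^ 2 - s0 ^ 2 * F (h + psi 0)) in *.
  assert (HFb : forall z, z <= 0 -> 0 <= F (h + psi z) <= M * psi z ^ 2).
  { intros z Hz. specialize (Hpos z Hz). specialize (Hup z Hz). split.
    - destruct (Req_dec (psi z) 0) as [->|N].
      + unfold F. rewrite Rplus_0_r, (RInt_point (V := R_CompleteNormedModule)).
        unfold zero; simpl. lra.
      + unfold F. generalize (Hpot (h + psi z) ltac:(lra)). lra.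
    - assert (P := potential_upper (h + psi z) ltac:(lra)). fold F in P.
      replace (h + psi z - h) with (psi z) in P by ring. exact P. }
  (* the conserved energy vanishes because the profile comes to rest at infinity *)
  assert (HE : E = 0).
  { destruct (total_order_T E 0) as [[hE|hE]|hE]; [|exact hE|].
    - exfalso. set (e := Rmin 1 (- E / (2 * (s0 ^ 2 * M)))).
      assert (Hsm : 0 < s0 ^ 2 * M) by nra.
      assert (He : 0 < e) by (apply Rmin_pos; [lra|apply Rdiv_lt_0_compat; lra]).
      destruct (Hlim' e He) as [Z [HZ0 HZ]]. specialize (HZ (Z - 1) ltac:(lra)).
      assert (P := Hpos (Z - 1) ltac:(lra)). rewrite Rabs_pos_eq in HZ by exact P.
      destruct (HFb (Z - 1) ltac:(lra)) as [_ B]. assert (Q := Hen0 (Z - 1) ltac:(lra)).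
      assert (e1 := Rmin_l 1 (- E / (2 * (s0 ^ 2 * M)))). fold e in e1.
      assert (e2 := Rmin_r 1 (- E / (2 * (s0 ^ 2 * M)))). fold e in e2.
      assert (B2 : psi (Z - 1) ^ 2 <= e) by nra.
      assert (B3 : s0 ^ 2 * F (h + psi (Z - 1)) <= s0 ^ 2 * M * e).
      { rewrite Rmult_assoc. apply Rmult_le_compat_l; [lra|]. nra. }
      assert (B4 : s0 ^ 2 * M * e <= - E / 2).
      { apply Rle_trans with (s0 ^ 2 * M * (- E / (2 * (s0 ^ 2 * M)))).
        - apply Rmult_le_compat_l; lra.
        - right. field. repeat split; lra. }
      generalize (pow2_ge_0 (psi1 (Z - 1))). lra.
    - exfalso. set (w := sqrt E). assert (Hw : 0 < w) by now apply sqrt_lt_R0.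
      assert (Hw1 : forall z, z <= 0 -> w <= psi1 z).
      { intros z Hz. rewrite <- (sqrt_pow2 (psi1 z)) by now apply Hp1.
        apply sqrt_le_1_alt. assert (Q := Hen0 z Hz). destruct (HFb z Hz) as [B _]. nra. }
      set (z := - ((al - h + 1) / w)).
      assert (Hz : z < 0) by (unfold z; assert (0 < (al - h + 1) / w) by
        (apply Rdiv_lt_0_compat; lra); lra).
      destruct (mvt psi psi1 z 0) as [c [Hc Ec]]; [intros; apply D0|].
      rewrite Rmin_left, Rmax_right in Hc by lra.
      assert (A := Hw1 c ltac:(lra)). assert (P := Hpos z ltac:(lra)).
      assert (Q : w * (0 - z) = al - h + 1) by (unfold z; field; lra).
      rewrite H0 in Ec. nra. }
  assert (Hen : forall z, z <= 0 -> psi1 z ^ 2 = s0 ^ 2 * F (h + psi z)).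
  { intros z Hz. specialize (Hen0 z Hz). lra. }
  destruct potential_lower as [k [Hk HkF]].
  assert (HspU : forall z, z <= 0 -> psi1 z <= s0 * M * psi z).
  { intros z Hz. specialize (Hpos z Hz).
    assert (0 <= s0 * M * psi z) by (repeat apply Rmult_le_pos; lra).
    rewrite <- (sqrt_pow2 (psi1 z)) by now apply Hp1.
    rewrite <- (sqrt_pow2 (s0 * M * psi z)) by assumption. apply sqrt_le_1_alt.
    rewrite Hen by exact Hz. replace ((s0 * M * psi z) ^ 2) with (s0 ^ 2 * (M * M * psi z ^ 2)) by ring.
    apply Rmult_le_compat_l; [lra|]. destruct (HFb z Hz) as [_ B].
    eapply Rle_trans; [exact B|]. apply Rmult_le_compat_r; [apply pow2_ge_0|nra]. }
  assert (HspL : forall z, z <= 0 -> s0 * k * psi z <= psi1 z).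
  { intros z Hz. assert (P := Hpos z Hz). assert (P' := Hup z Hz).
    assert (0 <= s0 * k * psi z) by (repeat apply Rmult_le_pos; lra).
    rewrite <- (sqrt_pow2 (psi1 z)) by now apply Hp1.
    rewrite <- (sqrt_pow2 (s0 * k * psi z)) by assumption. apply sqrt_le_1_alt.
    rewrite Hen by exact Hz. replace ((s0 * k * psi z) ^ 2) with (s0 ^ 2 * (k ^ 2 * psi z ^ 2)) by ring.
    apply Rmult_le_compat_l; [lra|]. assert (B := HkF (h + psi z) ltac:(lra)).
    replace (h + psi z - h) with (psi z) in B by ring. exact B. }
  assert (Hsp : forall z, z <= 0 -> 0 < psi z).
  { intros z Hz.
    assert (A := exp_comparison (fun x => - psi x) (fun x => - psi1 x) (s0 * M) z Hz
       (fun x => is_derive_R_opp _ _ _ (D0 x))). cbv beta in A.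
    assert (- psi z <= - psi 0 * exp (s0 * M * z)).
    { apply A. intros x Hx. generalize (HspU x ltac:(lra)). lra. }
    assert (0 < psi 0 * exp (s0 * M * z)) by (apply Rmult_lt_0_compat; [lra|apply exp_pos]).
    lra. }
  exists psi, psi1, psi2, (s0 * k). split; [|intros z Hz; apply (Hext z Hz)].
  split.
  - nra.
  - split; [exact D0|split; [exact D1|exact C2]].
  - exact Hode.
  - exact H0.
  - intros z Hz. split; [now apply Hsp|now apply Hup].
  - exact Hen.
  - intros z Hz. eapply Rlt_le_trans; [|apply HspL; exact Hz].
    specialize (Hsp z Hz). repeat apply Rmult_lt_0_compat; lra.
  - intros z Hz. split; [now apply HspL|now apply HspU].
  - intros z Hz. rewrite Hode by exact Hz. rewrite Rabs_Ropp, Rabs_mult, (Rabs_pos_eq (s0 ^ 2)) by lra.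
    rewrite Rmult_assoc. apply Rmult_le_compat_l; [lra|].
    assert (P := Hpos z Hz). assert (P' := Hup z Hz).
    assert (A := slice_upper (h + psi z) ltac:(lra)).
    replace (h + psi z - h) with (psi z) in A by ring. exact A.
  - intros z Hz. rewrite <- H0. apply (exp_comparison psi psi1 (s0 * k) z Hz D0).
    intros x Hx. apply HspL. lra.
Qed.
End Potential.

Arguments prof_k {f vs M h al s0 psi psi1 psi2 k}.
Arguments prof_C2 {f vs M h al s0 psi psi1 psi2 k}.
Arguments prof_ode {f vs M h al s0 psi psi1 psi2 k}.
Arguments prof_0 {f vs M h al s0 psi psi1 psi2 k}.
Arguments prof_range {f vs M h al s0 psi psi1 psi2 k}.
Arguments prof_energy {f vs M h al s0 psi psi1 psi2 k}.
Arguments prof_pos {f vs M h al s0 psi psi1 psi2 k}.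
Arguments prof_speed {f vs M h al s0 psi psi1 psi2 k}.
Arguments prof_force {f vs M h al s0 psi psi1 psi2 k}.
Arguments prof_decay {f vs M h al s0 psi psi1 psi2 k}.

(** * Distance between the orbit and the heteroclinic profile *)

(** The part of a layer orbit on the left of the level [al], detached from the other half so that
    it applies to the right part as well, after reflection. *)
Record half_orbit (f : R -> R -> R) (vs al k b c a L : R) (U U1 : R -> R) : Prop := {
  half_U : forall t, is_derive U t (U1 t);
  half_U1 : forall t, is_derive U1 t (- reduced f vs al k b (U t));
  half_L : 0 < L;
  half_left : U (- L) = a /\ U1 (- L) = 0;
  half_0 : U 0 = al;
  half_range : forall t, - L <= t <= 0 -> a <= U t <= al;
  half_speed : forall t, - L <= t <= 0 -> c * (U t - a) <= U1 t;
  half_energy : U1 0 ^ 2 = - 2 * RInt (reduced f vs al k b) a al }.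
Arguments half_U {f vs al k b c a L U U1}.
Arguments half_U1 {f vs al k b c a L U U1}.
Arguments half_L {f vs al k b c a L U U1}.
Arguments half_left {f vs al k b c a L U U1}.
Arguments half_0 {f vs al k b c a L U U1}.
Arguments half_range {f vs al k b c a L U U1}.
Arguments half_speed {f vs al k b c a L U U1}.
Arguments half_energy {f vs al k b c a L U U1}.

Lemma exp_neg_le (y : R) : 0 < y -> exp (- y) <= 4 / y ^ 2.
Proof.
  intros Hy. assert (Hy2 : 0 < y ^ 2) by (apply pow_lt; lra).
  apply le_div; [exact Hy2|].
  assert (E : exp y = exp (y / 2) * exp (y / 2)) by (rewrite <- exp_plus; f_equal; field).
  assert (A : 1 + y / 2 <= exp (y / 2)) by (left; apply exp_ineq1; lra).
  assert (B : y ^ 2 <= 4 * exp y) by (rewrite E; nra).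
  apply (Rmult_le_reg_l (exp y)); [apply exp_pos|].
  replace (exp y * (exp (- y) * y ^ 2)) with (y ^ 2).
  - lra.
  - rewrite <- Rmult_assoc, <- exp_plus, Rplus_opp_r, exp_0. ring.
Qed.

(** A function that is convex wherever it is positive, does not decrease at the left end
    and is not positive at the right end cannot be positive: after a positive maximum it
    would have to increase further. *)
Lemma neumann_dirichlet_max (y y1 y2 : R -> R) (p q : R) :
  p <= q -> (forall x, is_derive y x (y1 x)) -> (forall x, is_derive y1 x (y2 x)) ->
  (forall x, p <= x <= q -> 0 < y x -> 0 < y2 x) -> 0 <= y1 p -> y q <= 0 ->
  forall x, p <= x <= q -> y x <= 0.
Proof.
  intros Hpq D0 D1 Hconv Hl Hr.
  destruct (continuity_ab_maj y p q Hpq) as [xm [Hmax Hxm]].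
  { intros x _. apply (is_derive_continuity_pt _ _ _ (D0 x)). }
  destruct (Rle_lt_dec (y xm) 0) as [h|h].
  { intros x Hx. eapply Rle_trans; [now apply Hmax|exact h]. }
  exfalso.
  assert (Hxq : xm < q).
  { apply Rnot_le_lt. intros hq. replace xm with q in h by lra. lra. }
  assert (H1 : 0 <= y1 xm).
  { apply Rnot_lt_le. intros hn.
    assert (Hpx : p < xm).
    { apply Rnot_le_lt. intros hp. replace xm with p in hn by lra. lra. }
    assert (Dm := D0 xm). apply is_derive_Reals in Dm.
    destruct (Dm (- y1 xm) ltac:(lra)) as [r Hr']. assert (r0 := cond_pos r).
    set (s := - (Rmin r (xm - p) / 2)).
    assert (Hs : 0 < Rmin r (xm - p)) by (apply Rmin_pos; lra).
    assert (m1 := Rmin_l r (xm - p)). assert (m2 := Rmin_r r (xm - p)).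
    specialize (Hr' s ltac:(unfold s; lra) ltac:(apply Rabs_lt_between; unfold s; lra)).
    apply Rabs_lt_between in Hr'.
    assert (Q : (y (xm + s) - y xm) / s < 0) by lra.
    assert (B := Hmax (xm + s) ltac:(unfold s; lra)).
    assert (P : 0 <= (y (xm + s) - y xm) / s).
    { replace ((y (xm + s) - y xm) / s) with ((y xm - y (xm + s)) / (- s))
        by (field; unfold s; lra).
      apply Rdiv_le_0_compat; [lra|unfold s; lra]. }
    lra. }
  assert (H2 : 0 < y2 xm) by (apply Hconv; assumption).
  assert (Dm := D1 xm). apply is_derive_Reals in Dm.
  destruct (Dm (y2 xm) H2) as [r Hr']. assert (r0 := cond_pos r).
  set (s := Rmin r (q - xm) / 2).
  assert (Hs : 0 < Rmin r (q - xm)) by (apply Rmin_pos; lra).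
  assert (m1 := Rmin_l r (q - xm)). assert (m2 := Rmin_r r (q - xm)).
  destruct (MVT_cor2 y y1 xm (xm + s)) as [x [E Hx]].
  { unfold s; lra. }
  { intros x _. apply is_derive_Reals, D0. }
  specialize (Hr' (x - xm) ltac:(lra) ltac:(apply Rabs_lt_between; unfold s in *; lra)).
  replace (xm + (x - xm)) with x in Hr' by ring. apply Rabs_lt_between in Hr'.
  assert (Q : 0 < (y1 x - y1 xm) / (x - xm)) by lra.
  assert (Q2 : 0 < y1 x - y1 xm).
  { replace (y1 x - y1 xm) with ((y1 x - y1 xm) / (x - xm) * (x - xm)) by (field; lra). nra. }
  assert (B := Hmax (xm + s) ltac:(unfold s; lra)).
  assert (0 < y1 x * (xm + s - xm)) by (apply Rmult_lt_0_compat; [lra|unfold s; lra]).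
  lra.
Qed.

Section Closeness.
Variables (f fu fv : R -> R -> R) (lo hi vs M h al : R).
Hypothesis HB : C2box f fu fv lo hi vs M.
Hypothesis Hlo : lo + 1 <= h.
Hypothesis Hal : h < al.
Hypothesis Hhi : al + 1 <= hi.
Hypothesis Hf : f h vs = 0.
Hypothesis Hu : fu h vs < 0.
Variables (q q1 q2 : R -> R) (kq : R).
Hypothesis HQ : profile_facts f vs M h al 1 q q1 q2 kq.

Let M1 : 1 <= M := box_M HB.
Let D := al - h + 1.

Let Hsl (x : R) : continuous (fun s => f s vs) x.
Proof.
  apply (continuous_along f fu fv _ _ _ _ HB (fun s => s) (fun _ => vs));
    [apply continuous_id|apply continuous_const].
Qed.

Let Hred (k b x : R) : continuous (reduced f vs al k b) x.
Proof.
  apply (continuous_along f fu fv _ _ _ _ HB (fun s => s) (fun s => vs + b + k * (al - s))).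
  - apply continuous_id.
  - apply (is_derive_continuous _ _ (- k)). auto_derive; [exact I|ring].
Qed.

Lemma slow_bound (K e k b u : R) :
  0 <= K -> e <= 1 -> Rabs k <= K * e ^ 2 -> Rabs b <= K * e ^ 2 -> h - e <= u <= al ->
  Rabs (b + k * (al - u)) <= K * (1 + D) * e ^ 2.
Proof.
  intros HK He Hk Hb Hu'. eapply Rle_trans; [apply Rabs_triang|]. rewrite Rabs_mult.
  assert (A : Rabs (al - u) <= D) by (apply Rabs_le; unfold D; lra).
  assert (Rabs k * Rabs (al - u) <= K * e ^ 2 * D)
    by (apply Rmult_le_compat; try apply Rabs_pos; assumption).
  lra.
Qed.

(** The two speeds at the level [al] are compared through the energies: these differ by
    [O(e ^ 2)], and the speed of the profile is bounded away from zero. *)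
Lemma initial_slope (K c e k b a L : R) (U U1 : R -> R) :
  0 <= K -> 0 < c -> 0 < e <= 1 -> K * (1 + D) * e ^ 2 <= 1 ->
  Rabs k <= K * e ^ 2 -> Rabs b <= K * e ^ 2 -> Rabs (a - h) <= e ->
  half_orbit f vs al k b c a L U U1 ->
  Rabs (U1 0 - q1 0) <= 2 * M * (D * (K * (1 + D)) + 1) / q1 0 * e ^ 2.
Proof.
  intros HK Hc He Hsm Hk Hb Ha HO.
  assert (Ha' := proj1 (Rabs_le_between _ _) Ha).
  assert (HL := half_L HO).
  assert (Haal : a <= al).
  { assert (A := half_range HO 0 ltac:(lra)).
    rewrite (half_0 HO) in A. lra. }
  assert (Hp : 0 <= U1 0).
  { assert (A := half_speed HO 0 ltac:(lra)).
    rewrite (half_0 HO) in A. assert (0 <= c * (al - a)) by nra. lra. }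
  assert (Hp0 := prof_pos HQ 0 (Rle_refl 0)).
  assert (E0 := prof_energy HQ 0 (Rle_refl 0)).
  rewrite (prof_0 HQ) in E0.
  replace (h + (al - h)) with al in E0 by ring.
  assert (E1 := half_energy HO).
  assert (B1 : Rabs (RInt (reduced f vs al k b) a al - RInt (fun s => f s vs) a al)
               <= (al - a) * (M * (K * (1 + D) * e ^ 2))).
  { apply RInt_abs_diff_le; [exact Haal|apply Hred|apply Hsl|]. intros s Hs. unfold reduced.
    assert (A := slow_bound K e k b s HK ltac:(lra) Hk Hb ltac:(lra)).
    assert (A' := proj1 (Rabs_le_between _ _) A).
    eapply Rle_trans; [apply (box_lip f fu fv _ _ _ _ HB); split; lra|].
    rewrite Rminus_diag, Rabs_R0, Rplus_0_l. apply Rmult_le_compat_l; [lra|].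
    replace (vs + b + k * (al - s) - vs) with (b + k * (al - s)) by ring. exact A. }
  assert (B2 : Rabs (RInt (fun s => f s vs) a h) <= M * e * Rabs (h - a)).
  { apply RInt_abs_le; [exact Hsl|]. intros s Hs.
    assert (Hs' : h - e <= s <= h + e) by (apply (between_minmax _ _ a h); lra).
    assert (A := box_lip f fu fv _ _ _ _ HB s vs h vs ltac:(split; lra) ltac:(split; lra)).
    rewrite Hf, Rminus_0_r, Rminus_diag, Rabs_R0, Rplus_0_r in A.
    eapply Rle_trans; [exact A|]. apply Rmult_le_compat_l; [lra|]. apply Rabs_le. lra. }
  rewrite Rabs_minus_sym in B2.
  assert (B3 : M * e * Rabs (a - h) <= M * e * e) by (apply Rmult_le_compat_l; signs).
  assert (C := RInt_Chasles_R (fun s => f s vs) a h al Hsl).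
  assert (B4 : (al - a) * (M * (K * (1 + D) * e ^ 2)) <= D * (M * (K * (1 + D) * e ^ 2))).
  { apply Rmult_le_compat_r; [|unfold D; lra].
    apply Rmult_le_pos; [lra|]. apply Rmult_le_pos; [|apply pow2_ge_0].
    apply Rmult_le_pos; [lra|unfold D; lra]. }
  assert (B5 : Rabs (U1 0 ^ 2 - q1 0 ^ 2) <= 2 * M * (D * (K * (1 + D)) + 1) * e ^ 2).
  { rewrite E0, E1. apply Rabs_le_between in B1, B2. apply Rabs_le. lra. }
  replace (2 * M * (D * (K * (1 + D)) + 1) / q1 0 * e ^ 2)
    with (2 * M * (D * (K * (1 + D)) + 1) * e ^ 2 / q1 0) by (field; lra).
  apply le_div; [exact Hp0|].
  eapply Rle_trans; [|exact B5].
  replace (U1 0 ^ 2 - q1 0 ^ 2) with ((U1 0 - q1 0) * (U1 0 + q1 0)) by ring.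
  rewrite Rabs_mult. apply Rmult_le_compat_l; [apply Rabs_pos|].
  rewrite Rabs_pos_eq; lra.
Qed.

(** Near the centre of the layer the two solutions are compared by Gronwall, and in the
    saddle region by a maximum principle: there the linearisation has a negative coefficient,
    so the exponentially growing modes are controlled by the boundary values at both ends. *)
Theorem half_orbit_close (K c cL : R) :
  0 <= K -> 0 < c -> 0 < cL ->
  exists C, 0 <= C /\ small (fun e => forall k b a L U U1,
    Rabs k <= K * e ^ 2 -> Rabs b <= K * e ^ 2 -> Rabs (a - h) <= e -> cL / e <= L ->
    half_orbit f vs al k b c a L U U1 ->
    forall t, - L <= t <= 0 -> Rabs (U t - h - q t) <= C * e ^ 2).
Proof.
  intros HK Hc HcL.
  destruct (slope_well f fu fv lo hi vs M h al HB Hlo Hal Hhi Hu)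
    as [m [del [Hm [Hdel [Hdel1 [Hdel2 Hsw]]]]]].
  assert (Hkq := prof_k HQ).
  assert (Hp0 := prof_pos HQ 0 (Rle_refl 0)).
  assert (HD : 1 <= D) by (unfold D; lra).
  set (W := K * (1 + D)). assert (HW : 0 <= W) by (unfold W; nra).
  set (C1 := 2 * M * (D * W + 1) / q1 0).
  (* Before the time [- T0] the profile is within [del / 2] of the saddle. *)
  set (T0 := ln (2 * (al - h) / del) / kq).
  assert (HT0 : 0 < T0).
  { apply Rdiv_lt_0_compat; [|exact Hkq]. rewrite <- ln_1. apply ln_increasing; [lra|].
    apply lt_div; lra. }
  assert (Hqdel : forall t, t <= - T0 -> q t <= del / 2).
  { intros t Ht. eapply Rle_trans; [apply (prof_decay HQ); lra|].
    apply Rle_trans with ((al - h) * exp (kq * - T0)).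
    - apply Rmult_le_compat_l; [lra|].
      apply exp_le.
      assert (kq * t <= kq * - T0) by (apply Rmult_le_compat_l; lra). lra.
    - replace (kq * - T0) with (- ln (2 * (al - h) / del)) by (unfold T0; field; lra).
      rewrite exp_Ropp, exp_ln by (apply Rdiv_lt_0_compat; lra). right. field. lra. }
  set (Lam := 1 + M + M * W).
  assert (HLam : 0 <= Lam) by (unfold Lam; nra).
  set (C2 := sqrt ((C1 ^ 2 + 1) * exp (Lam * T0))).
  assert (HC2 : 0 <= C2) by apply sqrt_pos.
  assert (Hrm : 0 < sqrt m) by now apply sqrt_lt_R0.
  set (C3 := M * (al - h) * (4 / (kq * cL) ^ 2)).
  assert (HkcL : 0 < kq * cL) by nra.
  assert (HkcL2 : 0 < (kq * cL) ^ 2) by (apply pow_lt; lra).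
  assert (HC3 : 0 <= C3).
  { unfold C3. repeat apply Rmult_le_pos; try lra. left. apply Rinv_0_lt_compat. exact HkcL2. }
  assert (HMW : 0 <= M * W / m) by (apply Rdiv_le_0_compat; signs).
  assert (HC3m : 0 <= C3 / sqrt m) by (apply Rdiv_le_0_compat; lra).
  exists (C2 + (M * W / m + 1) + C3 / sqrt m).
  split; [lra|].
  apply (small_imp (fun e => (1 * e < 1 /\ W * e < 1) /\ (W * e < del /\ (1 * e < del /\ C2 * e < del / 2)))).
  2:{ repeat apply small_and; apply small_linear; lra. }
  intros e He [[E1 E2] [E3 [E4 E5]]] k b a L U U1 Hk Hb Ha HLe HO.
  assert (He2 : 0 < e ^ 2) by (apply pow_lt; lra).
  assert (He21 : e ^ 2 <= e) by (apply sq_le_self; lra).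
  assert (HWe : W * e ^ 2 <= W * e) by (apply Rmult_le_compat_l; lra).
  assert (HCe : C2 * e ^ 2 <= C2 * e) by (apply Rmult_le_compat_l; lra).
  assert (Ha' := proj1 (Rabs_le_between _ _) Ha).
  assert (HL := half_L HO).
  destruct (prof_C2 HQ) as [Dq [Dq1 _]].
  assert (Hini := initial_slope K c e k b a L U U1 HK Hc ltac:(lra) ltac:(fold W; lra) Hk Hb Ha HO).
  fold W in Hini. fold C1 in Hini.
  set (w := fun t => U t - h - q t). set (w1 := fun t => U1 t - q1 t).
  set (w2 := fun t => - reduced f vs al k b (U t) - q2 t).
  assert (Dw : forall t, is_derive w t (w1 t)).
  { intros t. apply (is_derive_eq _ _ ((U1 t - 0) - q1 t)); [|unfold w1; ring].
    apply is_derive_R_minus; [|apply Dq]. apply is_derive_R_minus; [|apply is_derive_R_const].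
    apply (half_U HO). }
  assert (Dw1 : forall t, is_derive w1 t (w2 t)).
  { intros t. apply is_derive_R_minus; [|apply Dq1]. apply (half_U1 HO). }
  assert (Hq2 : forall t, t <= 0 -> q2 t = - f (h + q t) vs).
  { intros t Ht. rewrite (prof_ode HQ t Ht). ring. }
  assert (Hqr : forall t, t <= 0 -> 0 < q t <= al - h)
    by apply (prof_range HQ).
  assert (HUr := half_range HO).
  assert (Hv : forall t, - L <= t <= 0 -> Rabs (b + k * (al - U t)) <= W * e ^ 2).
  { intros t Ht. apply (slow_bound K e); try assumption; [lra|].
    specialize (HUr t Ht). lra. }
  assert (Hslow : forall t, - L <= t <= 0 ->
            Rabs (reduced f vs al k b (U t) - f (U t) vs) <= M * (W * e ^ 2)).
  { intros t Ht. unfold reduced. assert (A := Hv t Ht).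
    assert (A' := proj1 (Rabs_le_between _ _) A). specialize (HUr t Ht).
    eapply Rle_trans; [apply (box_lip f fu fv _ _ _ _ HB); split; lra|].
    rewrite Rminus_diag, Rabs_R0, Rplus_0_l. apply Rmult_le_compat_l; [lra|].
    replace (vs + b + k * (al - U t) - vs) with (b + k * (al - U t)) by ring. exact A. }
  assert (Hw2 : forall t, - L <= t <= 0 -> Rabs (w2 t) <= M * (Rabs (w t) + W * e ^ 2)).
  { intros t Ht. unfold w2. rewrite Hq2 by lra. assert (A := Hslow t Ht).
    specialize (HUr t Ht). specialize (Hqr t ltac:(lra)).
    assert (B := box_lip f fu fv _ _ _ _ HB (U t) vs (h + q t) vs
                   ltac:(split; lra) ltac:(split; lra)).
    rewrite Rminus_diag, Rabs_R0, Rplus_0_r in B.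
    replace (U t - (h + q t)) with (w t) in B by (unfold w; ring).
    replace (- reduced f vs al k b (U t) - - f (h + q t) vs)
      with (- ((reduced f vs al k b (U t) - f (U t) vs) + (f (U t) vs - f (h + q t) vs))) by ring.
    rewrite Rabs_Ropp. eapply Rle_trans; [apply Rabs_triang|]. lra. }
  assert (Hw0 : w 0 = 0).
  { unfold w. rewrite (half_0 HO), (prof_0 HQ). ring. }
  (* On the core [[- T0, 0]], of length independent of [e], Gronwall's inequality loses only a
     constant factor.  The term [e ^ 4] in the energy absorbs the inhomogeneity. *)
  assert (Core : forall t, - L <= t <= 0 -> - T0 <= t -> Rabs (w t) <= C2 * e ^ 2).
  { intros t Ht HtT.
    set (En := fun x => (w x * w x + w1 x * w1 x) + e ^ 4).
    set (En1 := fun x => ((w1 x * w x + w x * w1 x) + (w2 x * w1 x + w1 x * w2 x)) + 0).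
    assert (A : En t <= En 0 * exp (- Lam * t)).
    { apply (exp_comparison En En1); [lra| |].
      - intros x. unfold En. apply (is_derive_R_plus (fun x => w x * w x + w1 x * w1 x) (fun _ => e ^ 4)); [|apply is_derive_R_const].
        apply (is_derive_R_plus (fun x => w x * w x) (fun x => w1 x * w1 x));
          [apply (is_derive_R_mult w w); apply Dw|apply (is_derive_R_mult w1 w1); apply Dw1].
      - intros x Hx. assert (B := Hw2 x ltac:(lra)). unfold En1, En.
        assert (B1 : Rabs (w1 x * w2 x) <= Rabs (w1 x) * (M * (Rabs (w x) + W * e ^ 2))).
        { rewrite Rabs_mult. apply Rmult_le_compat_l; [apply Rabs_pos|exact B]. }
        assert (Q1 : Rabs (w x) ^ 2 = w x * w x) by (rewrite pow2_abs; ring).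
        assert (Q2 : Rabs (w1 x) ^ 2 = w1 x * w1 x) by (rewrite pow2_abs; ring).
        assert (Q3 : 2 * (Rabs (w1 x) * Rabs (w x)) <= w x * w x + w1 x * w1 x).
        { rewrite <- Q1, <- Q2. generalize (pow2_ge_0 (Rabs (w1 x) - Rabs (w x))). nra. }
        assert (Q4 : 2 * (Rabs (w1 x) * e ^ 2) <= w1 x * w1 x + e ^ 4).
        { rewrite <- Q2. generalize (pow2_ge_0 (Rabs (w1 x) - e ^ 2)). nra. }
        assert (Q5 := Rabs_maj2 (w1 x * w2 x)). assert (Q6 := Rabs_maj2 (w1 x * w x)).
        rewrite Rabs_mult in Q6.
        assert (S1 : 0 <= w x * w x) by signs. assert (S2 : 0 <= w1 x * w1 x) by signs.
        assert (S3 : 0 < e ^ 4) by (apply pow_lt; lra).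
        assert (B2 : 2 * (Rabs (w1 x) * (M * (Rabs (w x) + W * e ^ 2)))
                 <= M * (w x * w x + w1 x * w1 x) + M * W * (w1 x * w1 x + e ^ 4)).
        { assert (M * (2 * (Rabs (w1 x) * Rabs (w x))) <= M * (w x * w x + w1 x * w1 x))
            by (apply Rmult_le_compat_l; lra).
          assert (M * W * (2 * (Rabs (w1 x) * e ^ 2)) <= M * W * (w1 x * w1 x + e ^ 4))
            by (apply Rmult_le_compat_l; signs). lra. }
        assert (B3 : 0 <= M * W * (w x * w x)) by (apply Rmult_le_pos; signs).
        assert (B4 : 0 <= M * e ^ 4) by signs.
        unfold Lam. lra. }
    assert (HC1 : Rabs (w1 0) <= C1 * e ^ 2) by exact Hini.
    assert (B1 : En 0 <= (C1 ^ 2 + 1) * e ^ 4).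
    { unfold En. rewrite Hw0.
      assert (Rabs (w1 0) ^ 2 <= (C1 * e ^ 2) ^ 2)
        by (apply pow_incr; split; [apply Rabs_pos|exact HC1]).
      rewrite pow2_abs in H.
      replace ((C1 ^ 2 + 1) * e ^ 4) with ((C1 * e ^ 2) ^ 2 + e ^ 4) by ring. lra. }
    assert (B2 : exp (- Lam * t) <= exp (Lam * T0)).
    { apply exp_le. assert (Lam * - t <= Lam * T0) by (apply Rmult_le_compat_l; lra). lra. }
    assert (B3 : w t ^ 2 <= (C1 ^ 2 + 1) * exp (Lam * T0) * e ^ 4).
    { apply Rle_trans with (En t).
      - unfold En. assert (0 < e ^ 4) by (apply pow_lt; lra).
        assert (0 <= w1 t * w1 t) by signs. lra.
      - eapply Rle_trans; [exact A|].
        assert (0 < exp (- Lam * t)) by apply exp_pos.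
        assert (0 <= C1 ^ 2) by apply pow2_ge_0. assert (0 < e ^ 4) by (apply pow_lt; lra).
        apply Rle_trans with ((C1 ^ 2 + 1) * e ^ 4 * exp (Lam * T0)); [|right; ring].
        apply Rmult_le_compat; try lra.
        unfold En. assert (0 <= w1 0 * w1 0) by signs. assert (0 <= w 0 * w 0) by signs. lra. }
    assert (B5 : 0 <= (C1 ^ 2 + 1) * exp (Lam * T0)).
    { apply Rmult_le_pos; [generalize (pow2_ge_0 C1); lra|left; apply exp_pos]. }
    rewrite <- (sqrt_pow2 (Rabs (w t))) by apply Rabs_pos. rewrite pow2_abs.
    unfold C2. rewrite <- (sqrt_pow2 (e ^ 2)) by lra. rewrite <- sqrt_mult by (try apply pow2_ge_0; lra).
    apply sqrt_le_1_alt. replace ((e ^ 2) ^ 2) with (e ^ 4) by ring. exact B3. }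
  intros t Ht. change (Rabs (w t) <= (C2 + (M * W / m + 1) + C3 / sqrt m) * e ^ 2).
  destruct (Rle_lt_dec (- T0) t) as [Hcore|Htail].
  { eapply Rle_trans; [apply Core; assumption|]. apply Rmult_le_compat_r; lra. }
  assert (HLT : T0 < L) by lra.
  (* Before [- T0] the difference satisfies an equation with a coefficient of at least [m] up to
     [O(e ^ 2)], and a multiple of [e ^ 2] plus a decaying exponential is a barrier: the
     exponential makes up for the slope [dl] at the left end, where the orbit rests and the
     profile does not. *)
  assert (HUT : U (- T0) <= h + del).
  { assert (A := Core (- T0) ltac:(lra) (Rle_refl _)). apply Rabs_le_between in A. unfold w in A.
    assert (B := Hqdel (- T0) (Rle_refl _)). lra. }
  assert (HUtail : forall x, - L <= x <= - T0 -> h - del <= U x <= h + del).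
  { intros x Hx. split; [specialize (HUr x ltac:(lra)); lra|].
    eapply Rle_trans; [|exact HUT]. apply (nondecreasing_of_derive U U1); [lra| |].
    - intros; apply (half_U HO).
    - intros y Hy. eapply Rle_trans; [|apply (half_speed HO); lra].
      specialize (HUr y ltac:(lra)). signs. }
  assert (Hforce : forall x, - L <= x <= - T0 -> exists z, 0 <= z /\
            Rabs (w2 x - (m + z) * w x) <= M * (W * e ^ 2)).
  { intros x Hx. destruct (mvt (fun s => f s vs) (fun s => fu s vs) (h + q x) (U x)) as [y [Hy Ey]].
    { intros; apply (box_du HB). }
    assert (Hyb : h - del <= y <= h + del).
    { apply (between_minmax _ _ (h + q x) (U x)); [|now apply HUtail|exact Hy].
      assert (B := Hqdel x ltac:(lra)). specialize (Hqr x ltac:(lra)). lra. }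
    assert (B := Hsw y vs ltac:(apply Rabs_le; lra) ltac:(rewrite Rminus_diag, Rabs_R0; lra)).
    exists (- fu y vs - m). split; [lra|].
    replace (m + (- fu y vs - m)) with (- fu y vs) by ring.
    replace (U x - (h + q x)) with (w x) in Ey by (unfold w; ring).
    unfold w2. rewrite Hq2 by lra.
    replace (- reduced f vs al k b (U x) - - f (h + q x) vs - - fu y vs * w x)
      with (- (reduced f vs al k b (U x) - f (U x) vs)) by lra.
    rewrite Rabs_Ropp. apply Hslow. lra. }
  set (dl := q1 (- L)).
  assert (Hdl : 0 < dl) by (apply (prof_pos HQ); lra).
  assert (HdlC : dl <= C3 * e ^ 2).
  { destruct (prof_speed HQ (- L) ltac:(lra)) as [_ S1].
    assert (S2 := prof_decay HQ (- L) ltac:(lra)).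
    assert (S3 : exp (kq * - L) <= 4 / (kq * cL) ^ 2 * e ^ 2).
    { assert (S4 : kq * cL / e <= kq * L).
      { replace (kq * cL / e) with (kq * (cL / e)) by (field; lra).
        apply Rmult_le_compat_l; lra. }
      assert (S5 : 0 < kq * cL / e) by (apply Rdiv_lt_0_compat; lra).
      apply Rle_trans with (exp (- (kq * cL / e))).
      - apply exp_le. lra.
      - eapply Rle_trans; [apply exp_neg_le; exact S5|]. right. field. repeat split; lra. }
    unfold dl. eapply Rle_trans; [exact S1|]. unfold C3. rewrite Rmult_1_l.
    replace (M * (al - h) * (4 / (kq * cL) ^ 2) * e ^ 2)
      with (M * ((al - h) * (4 / (kq * cL) ^ 2 * e ^ 2))) by ring.
    apply Rmult_le_compat_l; [lra|]. eapply Rle_trans; [exact S2|].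
    apply Rmult_le_compat_l; lra. }
  set (S0 := (C2 + (M * W / m + 1)) * e ^ 2).
  assert (Barrier : forall sg, sg = 1 \/ sg = -1 -> forall x, - L <= x <= - T0 ->
            sg * w x <= S0 + dl / sqrt m).
  { intros sg Hsg x Hx.
    assert (Hmm : sqrt m * sqrt m = m) by (apply sqrt_sqrt; lra).
    set (ex := fun x => exp (- sqrt m * (x + L))).
    assert (Hex : forall x, 0 < ex x) by (intros; apply exp_pos).
    assert (Dex : forall c x, is_derive (fun x => c * ex x) x (c * (- sqrt m * ex x))).
    { intros c0 y. apply is_derive_R_scal. unfold ex. auto_derive; [exact I|ring]. }
    set (y := fun x => sg * w x - (S0 + dl / sqrt m * ex x)).
    assert (Y : y x <= 0).
    { apply (neumann_dirichlet_max y (fun x => sg * w1 x - (0 + dl / sqrt m * (- sqrt m * ex x)))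
               (fun x => sg * w2 x - (0 + dl / sqrt m * - sqrt m * (- sqrt m * ex x))) (- L) (- T0));
        [lra| | | | | |exact Hx].
      - intros z. unfold y. apply is_derive_R_minus; [apply is_derive_R_scal, Dw|].
        apply is_derive_R_plus; [apply is_derive_R_const|apply Dex].
      - intros z. apply is_derive_R_minus; [apply is_derive_R_scal, Dw1|].
        apply is_derive_R_plus; [apply is_derive_R_const|].
        apply (is_derive_ext (fun z => dl / sqrt m * - sqrt m * ex z)); [intros; ring_R|]. apply Dex.
      - intros z Hz Hyz. unfold y in Hyz.
        destruct (Hforce z Hz) as [r [Hr HF]].
        assert (HF' : m * (sg * w z) + r * (sg * w z) - M * (W * e ^ 2) <= sg * w2 z).
        { apply Rabs_le_between in HF. destruct Hsg as [-> | ->]; lra. }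
        assert (Hpos : 0 <= dl / sqrt m * ex z).
        { apply Rmult_le_pos; [apply Rdiv_le_0_compat; lra|left; apply Hex]. }
        assert (HS0 : 0 <= S0) by (unfold S0; apply Rmult_le_pos; lra).
        assert (Hrw : 0 <= r * (sg * w z)) by (apply Rmult_le_pos; lra).
        assert (HmS : M * (W * e ^ 2) <= m * S0).
        { unfold S0. replace (m * ((C2 + (M * W / m + 1)) * e ^ 2))
            with (M * (W * e ^ 2) + m * (C2 + 1) * e ^ 2) by (field; lra).
          assert (0 <= m * (C2 + 1) * e ^ 2) by (apply Rmult_le_pos; signs). lra. }
        replace (dl / sqrt m * - sqrt m * (- sqrt m * ex z))
          with (sqrt m * sqrt m * (dl / sqrt m * ex z)) by (field; lra).
        rewrite Hmm.
        assert (m * (S0 + dl / sqrt m * ex z) < m * (sg * w z)) by (apply Rmult_lt_compat_l; lra).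
        lra.
      - unfold ex. replace (- sqrt m * (- L + L)) with 0 by ring. rewrite exp_0.
        unfold w1. rewrite (proj2 (half_left HO)). fold dl.
        replace (dl / sqrt m * (- sqrt m * 1)) with (- dl) by (field; lra).
        destruct Hsg as [-> | ->]; lra.
      - unfold y. assert (A := Core (- T0) ltac:(lra) (Rle_refl _)).
        apply Rabs_le_between in A.
        assert (Hpos : 0 <= dl / sqrt m * ex (- T0)).
        { apply Rmult_le_pos; [apply Rdiv_le_0_compat; lra|left; apply Hex]. }
        assert (C2 * e ^ 2 <= S0).
        { unfold S0. apply Rmult_le_compat_r; lra. }
        destruct Hsg as [-> | ->]; lra. }
    unfold y in Y.
    assert (Hex1 : ex x <= 1).
    { unfold ex. rewrite <- exp_0.
      assert (Hneg : - sqrt m * (x + L) <= 0) by (assert (0 <= sqrt m * (x + L)) by signs; lra).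
      apply exp_le. lra. }
    assert (Hd0 : 0 <= dl / sqrt m) by (apply Rdiv_le_0_compat; lra).
    assert (dl / sqrt m * ex x <= dl / sqrt m * 1) by (apply Rmult_le_compat_l; lra).
    lra. }
  assert (B1 := Barrier 1 (or_introl eq_refl) t ltac:(lra)).
  assert (B2 := Barrier (-1) (or_intror eq_refl) t ltac:(lra)).
  assert (B3 : dl / sqrt m <= C3 / sqrt m * e ^ 2).
  { replace (C3 / sqrt m * e ^ 2) with (C3 * e ^ 2 / sqrt m) by (field; lra).
    unfold Rdiv. apply Rmult_le_compat_r; [left; now apply Rinv_0_lt_compat|exact HdlC]. }
  apply Rabs_le. unfold S0 in *. lra.
Qed.
End Closeness.

(** * The first-order profile *)

Definition vanishes_left (w : R -> R) : Prop :=
  forall e, 0 < e -> exists Z, Z < 0 /\ forall z, z < Z -> Rabs (w z) < e.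

(** On an interval of length one the derivative is somewhere at most twice the bound of the
    function, and it varies by at most the bound of the second derivative. *)
Lemma interpolation (w w1 w2 : R -> R) (x y A B : R) :
  Rabs (y - x) = 1 ->
  (forall s, Rmin x y <= s <= Rmax x y -> is_derive w s (w1 s)) ->
  (forall s, Rmin x y <= s <= Rmax x y -> is_derive w1 s (w2 s)) ->
  (forall s, Rmin x y <= s <= Rmax x y -> Rabs (w s) <= A) ->
  (forall s, Rmin x y <= s <= Rmax x y -> Rabs (w2 s) <= B) ->
  Rabs (w1 x) <= 2 * A + B.
Proof.
  intros Hxy D0 D1 HA HB.
  assert (Hx : Rmin x y <= x <= Rmax x y) by (split; [apply Rmin_l|apply Rmax_l]).
  assert (Hy : Rmin x y <= y <= Rmax x y) by (split; [apply Rmin_r|apply Rmax_r]).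
  destruct (mvt w w1 x y D0) as [c [Hc E]].
  assert (A1 : Rabs (w1 c) <= 2 * A).
  { assert (E2 : Rabs (w1 c) * Rabs (y - x) = Rabs (w y - w x)) by (rewrite E, Rabs_mult; ring).
    rewrite Hxy, Rmult_1_r in E2. rewrite E2. unfold Rminus.
    eapply Rle_trans; [apply Rabs_triang|]. rewrite Rabs_Ropp.
    generalize (HA x Hx) (HA y Hy). lra. }
  assert (A2 : Rabs (w1 x - w1 c) <= B).
  { assert (L := lipschitz_of_derive w1 w2 (Rmin x y) (Rmax x y) B c x D1 HB Hc Hx).
    assert (Q : Rabs (x - c) <= 1).
    { rewrite <- Hxy. revert Hc. unfold Rmin, Rmax, Rabs.
      destruct (Rle_dec x y), (Rcase_abs (x - c)), (Rcase_abs (y - x)); lra. }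
    assert (PB : 0 <= B) by (eapply Rle_trans; [apply Rabs_pos|apply (HB x Hx)]).
    eapply Rle_trans; [exact L|]. generalize (Rabs_pos (x - c)). nra. }
  replace (w1 x) with (w1 c + (w1 x - w1 c)) by ring.
  eapply Rle_trans; [apply Rabs_triang|]. lra.
Qed.

(** The Wronskian with the positive decaying solution is constant and vanishes at infinity,
    so every decaying solution is a multiple of that one. *)
Lemma decaying_solution_zero (p p1 y y1 coef : R -> R) (C : R) :
  (forall z, z < 0 -> is_derive p z (p1 z)) ->
  (forall z, z < 0 -> is_derive p1 z (coef z * p z)) ->
  (forall z, z < 0 -> is_derive y z (y1 z)) ->
  (forall z, z < 0 -> is_derive y1 z (coef z * y z)) ->
  (forall z, z <= 0 -> Rabs (coef z) <= C) -> (forall z, z <= 0 -> 0 < p z) ->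
  vanishes_left p -> vanishes_left p1 -> vanishes_left y ->
  continuous p 0 -> continuous y 0 -> y 0 = 0 ->
  forall z, z <= 0 -> y z = 0.
Proof.
  intros Dp Dp1 Dy Dy1 HC Hpos Vp Vp1 Vy Cp Cy H0.
  assert (PC : 0 <= C) by (eapply Rle_trans; [apply Rabs_pos|apply (HC 0 (Rle_refl 0))]).
  assert (Hneg : forall x z s, x < 0 -> z < 0 -> Rmin x z <= s <= Rmax x z -> s < 0).
  { intros x z s Hx Hz [_ Hs]. eapply Rle_lt_trans; [exact Hs|]. now apply Rmax_lub_lt. }
  set (W := fun z => y z * p1 z - y1 z * p z).
  assert (HW : forall x z, x < 0 -> z < 0 -> W x = W z).
  { intros x z Hx Hz. apply constant_of_derive_zero. intros s Hs. apply (Hneg x z) in Hs; try assumption.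
    apply (is_derive_eq _ _ ((y1 s * p1 s + y s * (coef s * p s)) - ((coef s * y s) * p s + y1 s * p1 s))); [|ring].
    apply is_derive_R_minus; [apply (is_derive_R_mult y p1)|apply (is_derive_R_mult y1 p)]; auto. }
  assert (HW0 : forall z, z < 0 -> W z = 0).
  { intros z0 Hz0. apply cond_eq. intros e He. rewrite Rminus_0_r.
    destruct (Vy 1 Rlt_0_1) as [Z1 [HZ1 B1]].
    destruct (Vp (e / (2 * (2 + C)))) as [Z2 [HZ2 B2]]; [apply Rdiv_lt_0_compat; lra|].
    destruct (Vp1 (e / 2)) as [Z3 [HZ3 B3]]; [lra|].
    set (z := Rmin Z1 (Rmin Z2 Z3) - 1).
    assert (m1 := Rmin_l Z1 (Rmin Z2 Z3)). assert (m2 := Rmin_r Z1 (Rmin Z2 Z3)).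
    assert (m3 := Rmin_l Z2 Z3). assert (m4 := Rmin_r Z2 Z3).
    assert (Hz : z < 0 /\ z < Z1 /\ z < Z2 /\ z < Z3) by (unfold z; lra).
    rewrite (HW z0 z) by lra.
    assert (By1 : Rabs (y1 z) <= 2 * 1 + C * 1).
    { apply (interpolation y y1 (fun s => coef s * y s) z (z - 1)).
      - replace (z - 1 - z) with (-1) by ring. rewrite Rabs_left; lra.
      - intros s Hs. rewrite Rmin_right, Rmax_left in Hs by lra. apply Dy; lra.
      - intros s Hs. rewrite Rmin_right, Rmax_left in Hs by lra. apply Dy1; lra.
      - intros s Hs. rewrite Rmin_right, Rmax_left in Hs by lra. left. apply B1; lra.
      - intros s Hs. rewrite Rmin_right, Rmax_left in Hs by lra. rewrite Rabs_mult.
        apply Rmult_le_compat; try apply Rabs_pos; [apply HC; lra|left; apply B1; lra]. }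
    unfold W, Rminus. eapply Rle_lt_trans; [apply Rabs_triang|].
    rewrite Rabs_Ropp, !Rabs_mult.
    assert (Q1 := B1 z ltac:(lra)). assert (Q2 := B2 z ltac:(lra)). assert (Q3 := B3 z ltac:(lra)).
    assert (Q4 : Rabs (y z) * Rabs (p1 z) <= 1 * Rabs (p1 z))
      by (apply Rmult_le_compat_r; [apply Rabs_pos|lra]).
    assert (Q5 : Rabs (y1 z) * Rabs (p z) <= (2 + C) * (e / (2 * (2 + C)))).
    { apply Rmult_le_compat; try apply Rabs_pos; lra. }
    replace ((2 + C) * (e / (2 * (2 + C)))) with (e / 2) in Q5 by (field; lra). lra. }
  set (c := y (-1) / p (-1)).
  assert (Hc : forall z, z < 0 -> y z - c * p z = 0).
  { intros z Hz.
    assert (E : y (-1) / p (-1) = y z / p z).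
    { apply (constant_of_derive_zero (fun s => y s / p s)). intros s Hs.
      apply (Hneg (-1) z) in Hs; [|lra|exact Hz]. assert (P := Hpos s (Rlt_le _ _ Hs)).
      apply (is_derive_eq _ _ ((y1 s * p s - y s * p1 s) / (p s) ^ 2)).
      - apply (is_derive_div y p); [now apply Dy|now apply Dp|lra].
      - replace (y1 s * p s - y s * p1 s) with (- W s) by (unfold W; ring).
        rewrite (HW0 s Hs). field. lra. }
    unfold c. rewrite E. field. generalize (Hpos z (Rlt_le _ _ Hz)). lra. }
  assert (Hc0 : y 0 - c * p 0 = 0).
  { apply cond_eq. intros e He. rewrite Rminus_0_r.
    assert (Cw : continuous (fun s => y s - c * p s) 0).
    { apply (continuous_minus (V := R_NormedModule) y); [exact Cy|].
      now apply (continuous_scal_r (V := R_NormedModule) c p). }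
    destruct (continuous_eps _ _ Cw e He) as [r [Hr B]].
    specialize (B (- (r / 2)) ltac:(apply Rabs_lt_between; lra)).
    rewrite (Hc (- (r / 2))) in B by lra.
    rewrite Rminus_0_l, Rabs_Ropp in B. exact B. }
  assert (Ec : c = 0).
  { rewrite H0 in Hc0. assert (P := Hpos 0 (Rle_refl 0)).
    assert (F : c * p 0 = 0) by lra. apply Rmult_integral in F. destruct F; lra. }
  intros z Hz. destruct (Req_dec z 0) as [->|N]; [exact H0|].
  assert (E := Hc z ltac:(lra)). rewrite Ec in E. lra.
Qed.

Lemma exp_pow2_le (k z : R) : 0 < k -> z <= 0 -> z ^ 2 * exp (k * z) <= 4 / k ^ 2.
Proof.
  intros Hk Hz. assert (Hk2 : 0 < k ^ 2) by (apply pow_lt; lra).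
  destruct (Req_dec z 0) as [->|N].
  - replace (0 ^ 2 * exp (k * 0)) with 0 by ring. apply Rdiv_le_0_compat; lra.
  - assert (A := exp_neg_le (- (k * z)) ltac:(nra)). rewrite Ropp_involutive in A.
    replace (4 / k ^ 2) with (z ^ 2 * (4 / (- (k * z)) ^ 2)) by (field; split; lra).
    apply Rmult_le_compat_l; [apply pow2_ge_0|exact A].
Qed.

Lemma exp_pow4_le (k z : R) : 0 < k -> z <= 0 -> z ^ 4 * exp (k * z) <= 256 / k ^ 4.
Proof.
  intros Hk Hz. assert (A := exp_pow2_le (k / 2) z ltac:(lra) Hz).
  assert (E : exp (k * z) = exp (k / 2 * z) * exp (k / 2 * z)).
  { rewrite <- exp_plus. f_equal. field. }
  rewrite E. replace (z ^ 4 * (exp (k / 2 * z) * exp (k / 2 * z)))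
    with ((z ^ 2 * exp (k / 2 * z)) ^ 2) by ring.
  replace (256 / k ^ 4) with ((4 / (k / 2) ^ 2) ^ 2) by (field; lra).
  apply pow_incr. split; [|exact A].
  apply Rmult_le_pos; [apply pow2_ge_0|left; apply exp_pos].
Qed.

Section FirstOrder.
Variables (f fu fv : R -> R -> R) (lo hi vs M h al hv s0 : R).
Hypothesis HB : C2box f fu fv lo hi vs M.
Hypothesis Hlo : lo + 1 <= h.
Hypothesis Hal : h < al.
Hypothesis Hhi : al + 1 <= hi.
Hypothesis Hs0 : 0 < s0.
Variables (psi psi1 psi2 : R -> R) (k : R).
Hypothesis HP : profile_facts f vs M h al s0 psi psi1 psi2 k.

Let M1 : 1 <= M := box_M HB.

(** The right-hand side of the equation of the first-order profile, as a function of the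
    position and of the value of that profile. *)
Definition first_order_rhs (b1 x1 z y : R) : R :=
  - (s0 ^ 2 * fu (h + psi z) vs * y) - 2 * s0 * x1 * f (h + psi z) vs
  - s0 ^ 2 * fu (h + psi z) vs * hv * b1 - s0 ^ 2 * fv (h + psi z) vs * b1.

Record first_order (b1 x1 : R) (chi chi1 chi2 : R -> R) : Prop := {
  first_C2 : C2_line chi chi1 chi2;
  first_ode : forall z, z <= 0 -> chi2 z = first_order_rhs b1 x1 z (chi z);
  first_0 : chi 0 = - hv * b1;
  first_lim : vanishes_left chi }.
Arguments first_C2 {b1 x1 chi chi1 chi2}.
Arguments first_ode {b1 x1 chi chi1 chi2}.
Arguments first_0 {b1 x1 chi chi1 chi2}.
Arguments first_lim {b1 x1 chi chi1 chi2}.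

Lemma psi_power (z : R) : z <= 0 ->
  z ^ 2 * psi z <= (al - h) * (4 / k ^ 2) /\ z ^ 4 * psi z <= (al - h) * (256 / k ^ 4).
Proof.
  intros Hz. assert (Hk := prof_k HP).
  assert (D := prof_decay HP z Hz). split.
  - apply Rle_trans with ((al - h) * (z ^ 2 * exp (k * z))).
    + replace ((al - h) * (z ^ 2 * exp (k * z))) with (z ^ 2 * ((al - h) * exp (k * z))) by ring.
      apply Rmult_le_compat_l; [apply pow2_ge_0|exact D].
    + apply Rmult_le_compat_l; [lra|now apply exp_pow2_le].
  - apply Rle_trans with ((al - h) * (z ^ 4 * exp (k * z))).
    + replace ((al - h) * (z ^ 4 * exp (k * z))) with (z ^ 4 * ((al - h) * exp (k * z))) by ring.
      apply Rmult_le_compat_l; [|exact D]. replace (z ^ 4) with ((z ^ 2) ^ 2) by ring. apply pow2_ge_0.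
    + apply Rmult_le_compat_l; [lra|now apply exp_pow4_le].
Qed.

Lemma vanishes_of_bound (w : R -> R) (C : R) :
  (forall z, z < 0 -> Rabs (w z) * z ^ 2 <= C) -> vanishes_left w.
Proof.
  intros H e He. exists (- (Rabs C / e + 1)).
  assert (P : 0 <= Rabs C / e) by (apply Rdiv_le_0_compat; [apply Rabs_pos|lra]).
  split; [lra|]. intros z Hz. specialize (H z ltac:(lra)).
  assert (Q := Rle_abs C). assert (Pw := Rabs_pos (w z)).
  apply Rnot_le_lt. intros hge.
  assert (e * (Rabs C / e) = Rabs C) by (field; lra).
  assert (e * z ^ 2 <= Rabs (w z) * z ^ 2) by (apply Rmult_le_compat_r; [apply pow2_ge_0|lra]).
  assert (Rabs C / e + 1 < z ^ 2) by nra. nra.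
Qed.

Lemma slice_u_bound (z : R) : z <= 0 -> Rabs (fu (h + psi z) vs) <= M /\
  Rabs (fv (h + psi z) vs) <= M /\ Rabs (f (h + psi z) vs) <= M * psi z.
Proof.
  intros Hz. assert (R := prof_range HP z Hz).
  assert (Hbx : box lo hi vs (h + psi z) vs) by (split; lra).
  split; [now apply (box_fu HB)|]. split; [now apply (box_fv HB)|].
  assert (F := prof_force HP z Hz).
  rewrite (prof_ode HP z Hz), Rabs_Ropp, Rabs_mult in F.
  assert (S2 : 0 < s0 ^ 2) by (apply pow_lt; lra). rewrite (Rabs_pos_eq (s0 ^ 2)) in F by lra.
  apply (Rmult_le_reg_l (s0 ^ 2)); [exact S2|]. lra.
Qed.

(** The dependence on the two parameters is explicit up to one fixed function: a change of
    [x1] only stretches the zeroth-order profile, so that its effect is the multiple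
    [x1 / s0] of the generator [z psi1 z] of the dilations. *)
Lemma first_order_decomposition (b1 x1 : R) (chi chi1 chi2 A A1 A2 : R -> R) :
  first_order b1 x1 chi chi1 chi2 -> first_order 1 0 A A1 A2 ->
  forall z, z <= 0 -> chi z = b1 * A z + x1 / s0 * (z * psi1 z).
Proof.
  intros HX HA.
  destruct (first_C2 HX) as [X0 [X1 _]]. destruct (first_C2 HA) as [B0 [B1 _]].
  destruct (prof_C2 HP) as [P0 [P1 _]].
  assert (Hk := prof_k HP).
  set (coef := fun z => - (s0 ^ 2 * fu (h + psi z) vs)).
  assert (P2 : forall z, z < 0 -> is_derive psi2 z (coef z * psi1 z)).
  { intros z Hz. apply (is_derive_ext_loc (fun x => - (s0 ^ 2 * f (h + psi x) vs))).
    - assert (Hr : 0 < - z) by lra. exists (mkposreal _ Hr). intros x Hx.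
      change (Rabs (x - z) < - z) in Hx. apply Rabs_lt_between in Hx.
      symmetry. apply (prof_ode HP). lra.
    - apply (is_derive_eq _ _ (- (s0 ^ 2 * (fu (h + psi z) vs * (0 + psi1 z))))); [|unfold coef; ring].
      apply is_derive_R_opp. apply is_derive_R_scal.
      apply (is_derive_R_comp (fun s => f s vs) (fun x => h + psi x)).
      + apply (box_du HB).
      + apply is_derive_R_plus; [apply is_derive_R_const|apply P0]. }
  set (y := fun z => chi z - (b1 * A z + x1 / s0 * (z * psi1 z))).
  set (y1 := fun z => chi1 z - (b1 * A1 z + x1 / s0 * (1 * psi1 z + z * psi2 z))).
  assert (Dzp : forall z, is_derive (fun z => z * psi1 z) z (1 * psi1 z + z * psi2 z)).
  { intros z. apply (is_derive_R_mult (fun z => z) psi1); [apply is_derive_R_id|apply P1]. }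
  assert (Dy : forall z, is_derive y z (y1 z)).
  { intros z. apply is_derive_R_minus; [apply X0|]. apply is_derive_R_plus.
    - apply is_derive_R_scal, B0.
    - apply is_derive_R_scal, Dzp. }
  assert (Hpsi0 : forall z, z <= 0 -> 0 < psi z) by apply (prof_range HP).
  assert (Hsp : forall z, z <= 0 -> 0 < psi1 z <= s0 * M * psi z).
  { intros z Hz. split; [now apply (prof_pos HP)|].
    apply (prof_speed HP z Hz). }
  assert (Vz : vanishes_left (fun z => z * psi1 z)).
  { apply (vanishes_of_bound _ (s0 * M * ((al - h) * (4 / k ^ 2) + (al - h) * (256 / k ^ 4)))).
    intros z Hz. destruct (psi_power z ltac:(lra)) as [Q1 Q2].
    assert (S := Hsp z ltac:(lra)). assert (R := Hpsi0 z ltac:(lra)).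
    rewrite Rabs_mult, (Rabs_left z), (Rabs_pos_eq (psi1 z)) by lra.
    apply Rle_trans with (s0 * M * (z ^ 2 * psi z + z ^ 4 * psi z)).
    - assert (T : - z * z ^ 2 <= z ^ 2 + z ^ 4) by nra.
      assert (T0 : 0 <= - z * z ^ 2) by (apply Rmult_le_pos; [lra|apply pow2_ge_0]).
      apply Rle_trans with ((- z * z ^ 2) * (s0 * M * psi z)).
      + replace (- z * psi1 z * z ^ 2) with ((- z * z ^ 2) * psi1 z) by ring.
        apply Rmult_le_compat_l; lra.
      + replace (s0 * M * (z ^ 2 * psi z + z ^ 4 * psi z))
          with ((z ^ 2 + z ^ 4) * (s0 * M * psi z)) by ring.
        apply Rmult_le_compat_r; [lra|exact T].
    - apply Rmult_le_compat_l; [nra|lra]. }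
  assert (Z : forall z, z <= 0 -> y z = 0).
  { apply (decaying_solution_zero psi1 psi2 y y1 coef (s0 ^ 2 * M)).
    - intros z _. apply P1.
    - exact P2.
    - intros z _. apply Dy.
    - intros z Hz.
      apply (is_derive_eq _ _ (chi2 z - (b1 * A2 z + x1 / s0 * ((0 * psi1 z + 1 * psi2 z) + (1 * psi2 z + z * (coef z * psi1 z)))))).
      + apply is_derive_R_minus; [apply X1|]. apply is_derive_R_plus.
        * apply is_derive_R_scal, B1.
        * apply is_derive_R_scal. apply is_derive_R_plus.
          -- apply (is_derive_R_mult (fun _ => 1) psi1); [apply is_derive_R_const|apply P1].
          -- apply (is_derive_R_mult (fun z => z) psi2); [apply is_derive_R_id|now apply P2].
      + rewrite (first_ode HX z), (first_ode HA z) by lra.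
        rewrite (prof_ode HP z) by lra.
        unfold first_order_rhs, y, coef. field. lra.
    - intros z Hz. unfold coef. rewrite Rabs_Ropp, Rabs_mult, (Rabs_pos_eq (s0 ^ 2)) by apply pow2_ge_0.
      apply Rmult_le_compat_l; [apply pow2_ge_0|]. now apply slice_u_bound.
    - intros z Hz. now apply Hsp.
    - apply (vanishes_of_bound _ (s0 * M * ((al - h) * (4 / k ^ 2)))). intros z Hz.
      destruct (psi_power z ltac:(lra)) as [Q1 _]. assert (S := Hsp z ltac:(lra)).
      rewrite Rabs_pos_eq by lra.
      apply Rle_trans with (s0 * M * (z ^ 2 * psi z)).
      + replace (s0 * M * (z ^ 2 * psi z)) with (s0 * M * psi z * z ^ 2) by ring.
        apply Rmult_le_compat_r; [apply pow2_ge_0|lra].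
      + apply Rmult_le_compat_l; [nra|exact Q1].
    - apply (vanishes_of_bound _ (s0 ^ 2 * M * ((al - h) * (4 / k ^ 2)))). intros z Hz.
      destruct (psi_power z ltac:(lra)) as [Q1 _].
      assert (F := prof_force HP z ltac:(lra)).
      apply Rle_trans with (s0 ^ 2 * M * (z ^ 2 * psi z)).
      + replace (s0 ^ 2 * M * (z ^ 2 * psi z)) with (s0 ^ 2 * M * psi z * z ^ 2) by ring.
        apply Rmult_le_compat_r; [apply pow2_ge_0|exact F].
      + apply Rmult_le_compat_l; [|exact Q1]. apply Rmult_le_pos; [apply pow2_ge_0|lra].
    - (* [y] vanishes at infinity because its three terms do *)
      intros e He.
      destruct (first_lim HX (e / 3) ltac:(lra)) as [Z1 [HZ1 Q1]].
      destruct (first_lim HA (e / (3 * (Rabs b1 + 1)))) as [Z2 [HZ2 Q2]].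
      { apply Rdiv_lt_0_compat; [lra|]. generalize (Rabs_pos b1). lra. }
      destruct (Vz (e / (3 * (Rabs (x1 / s0) + 1)))) as [Z3 [HZ3 Q3]].
      { apply Rdiv_lt_0_compat; [lra|]. generalize (Rabs_pos (x1 / s0)). lra. }
      exists (Rmin Z1 (Rmin Z2 Z3)).
      assert (m1 := Rmin_l Z1 (Rmin Z2 Z3)). assert (m2 := Rmin_r Z1 (Rmin Z2 Z3)).
      assert (m3 := Rmin_l Z2 Z3). assert (m4 := Rmin_r Z2 Z3).
      split; [lra|]. intros z Hz. specialize (Q1 z ltac:(lra)). specialize (Q2 z ltac:(lra)).
      specialize (Q3 z ltac:(lra)). unfold y, Rminus.
      assert (Small : forall c X, Rabs X < e / (3 * (Rabs c + 1)) -> Rabs (c * X) <= e / 3).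
      { intros c X HX'. rewrite Rabs_mult. assert (Pc := Rabs_pos c). assert (PX := Rabs_pos X).
        apply Rlt_div_r in HX'; [|lra]. nra. }
      assert (T1 := Small _ _ Q2). assert (T2 := Small _ _ Q3).
      eapply Rle_lt_trans; [apply Rabs_triang|]. rewrite Rabs_Ropp.
      assert (T3 := Rabs_triang (b1 * A z) (x1 / s0 * (z * psi1 z))). lra.
    - apply (is_derive_continuous _ _ _ (P1 0)).
    - apply (is_derive_continuous _ _ _ (Dy 0)).
    - unfold y. rewrite (first_0 HX), (first_0 HA). ring. }
  intros z Hz. specialize (Z z Hz). unfold y in Z. lra.
Qed.

Lemma bounded_left (w : R -> R) :
  (forall z, continuous w z) -> vanishes_left w -> exists C, 0 <= C /\ forall z, z <= 0 -> Rabs (w z) <= C.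
Proof.
  intros Hc Hv. destruct (Hv 1 Rlt_0_1) as [Z [HZ B]].
  destruct (continuity_ab_maj (fun z => Rabs (w z)) Z 0 ltac:(lra)) as [zm [Hm _]].
  { intros z _. apply continuity_pt_filterlim. apply (continuous_comp w Rabs); [apply Hc|apply continuous_Rabs]. }
  exists (Rabs (w zm) + 1). split; [generalize (Rabs_pos (w zm)); lra|].
  intros z Hz. destruct (Rlt_le_dec z Z) as [h0|h0].
  - specialize (B z h0). generalize (Rabs_pos (w zm)). lra.
  - specialize (Hm z ltac:(lra)). cbv beta in Hm. lra.
Qed.
End FirstOrder.

Arguments first_C2 {f fu fv vs h hv s0 psi b1 x1 chi chi1 chi2}.
Arguments first_ode {f fu fv vs h hv s0 psi b1 x1 chi chi1 chi2}.
Arguments first_0 {f fu fv vs h hv s0 psi b1 x1 chi chi1 chi2}.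
Arguments first_lim {f fu fv vs h hv s0 psi b1 x1 chi chi1 chi2}.

(** * Accuracy of the formal approximation *)

(** Rescaling by [s0] gives the profile in the time variable of the orbit. *)
Lemma profile_normalize (f : R -> R -> R) (vs M h al s0 k : R) (psi psi1 psi2 : R -> R) :
  0 < s0 -> profile_facts f vs M h al s0 psi psi1 psi2 k ->
  profile_facts f vs M h al 1 (fun t => psi (t / s0)) (fun t => psi1 (t / s0) / s0)
    (fun t => psi2 (t / s0) / s0 ^ 2) (k / s0).
Proof.
  intros Hs HP. assert (Hi : 0 < / s0) by now apply Rinv_0_lt_compat.
  assert (Hs2 : 0 < s0 ^ 2) by (apply pow_lt; lra).
  assert (Hz : forall t, t <= 0 -> t / s0 <= 0).
  { intros t Ht. unfold Rdiv. nra. }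
  destruct (prof_C2 HP) as [P0 [P1 P2]].
  assert (Dt : forall t, is_derive (fun t => t / s0) t (/ s0)).
  { intros t. auto_derive; [exact I|ring]. }
  split.
  - apply Rdiv_lt_0_compat; [apply (prof_k HP)|exact Hs].
  - split; [|split].
    + intros t. apply (is_derive_eq _ _ (psi1 (t / s0) * / s0)); [|reflexivity].
      apply (is_derive_R_comp psi (fun t => t / s0)); [apply P0|apply Dt].
    + intros t. apply (is_derive_ext (fun t => / s0 * psi1 (t / s0))); [intros; unfold Rdiv; ring_R|].
      apply (is_derive_eq _ _ (/ s0 * (psi2 (t / s0) * / s0))); [|field; lra].
      apply is_derive_R_scal. apply (is_derive_R_comp psi1 (fun t => t / s0)); [apply P1|apply Dt].
    + intros t. apply (continuous_ext (fun t => / s0 ^ 2 * psi2 (t / s0))); [intros; unfold Rdiv; ring_R|].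
      apply (continuous_scal_r (V := R_NormedModule) (/ s0 ^ 2) (fun t => psi2 (t / s0))).
      apply (continuous_comp (fun t => t / s0) psi2); [apply (is_derive_continuous _ _ _ (Dt t))|apply P2].
  - intros z Hz'. rewrite (prof_ode HP) by now apply Hz. field. lra.
  - unfold Rdiv. rewrite Rmult_0_l. apply (prof_0 HP).
  - intros z Hz'. apply (prof_range HP). now apply Hz.
  - intros z Hz'. replace ((psi1 (z / s0) / s0) ^ 2) with (psi1 (z / s0) ^ 2 / s0 ^ 2) by (field; lra).
    rewrite (prof_energy HP) by now apply Hz. field. lra.
  - intros z Hz'. apply Rdiv_lt_0_compat; [|exact Hs].
    apply (prof_pos HP). now apply Hz.
  - intros z Hz'. destruct (prof_speed HP (z / s0) (Hz z Hz')) as [S1 S2].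
    split.
    + apply le_div; [exact Hs|]. replace (k / s0 * psi (z / s0) * s0) with (k * psi (z / s0)) by (field; lra).
      exact S1.
    + apply div_le; [exact Hs|]. lra.
  - intros z Hz'. assert (F := prof_force HP (z / s0) (Hz z Hz')).
    unfold Rdiv at 1. rewrite Rabs_mult, (Rabs_pos_eq (/ s0 ^ 2)) by (left; now apply Rinv_0_lt_compat).
    apply div_le; [exact Hs2|]. lra.
  - intros z Hz'. assert (F := prof_decay HP (z / s0) (Hz z Hz')).
    replace (k / s0 * z) with (k * (z / s0)) by (field; lra). exact F.
Qed.

Section Approximation.
Variables (f fu fv : R -> R -> R) (lo hi vs M h al hv s0 : R).
Hypothesis HB : C2box f fu fv lo hi vs M.
Hypothesis Hlo : lo + 1 <= h.
Hypothesis Hal : h < al.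
Hypothesis Hhi : al + 1 <= hi.
Hypothesis Hf : f h vs = 0.
Hypothesis Hu : fu h vs < 0.
Hypothesis Hs0 : 0 < s0.
Variables (psi psi1 psi2 : R -> R) (kp : R).
Hypothesis HP : profile_facts f vs M h al s0 psi psi1 psi2 kp.
Variables (A A1 A2 : R -> R).
Hypothesis HA : first_order f fu fv vs h hv s0 psi 1 0 A A1 A2.

Let M1 : 1 <= M := box_M HB.
Let kp_pos : 0 < kp := prof_k HP.

(** The exponential decay beats every power: at distance [1 / (4 * e)], where the cut-off function
    acts, the profile is of second order in [e], with room for a factor [z]. *)
Lemma psi_bounds :
  exists Q, 0 <= Q /\
    (forall z, z <= 0 -> 0 < psi z <= Q /\ - z * psi z <= Q) /\
    (forall e z, 0 < e <= 1 / 8 -> z <= - (1 / (4 * e)) ->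
       psi z <= Q * e ^ 2 /\ - z * psi z <= Q * e ^ 2).
Proof.
  set (Q2 := (al - h) * (4 / kp ^ 2)). set (Q4 := (al - h) * (256 / kp ^ 4)).
  assert (K2 : 0 < kp ^ 2) by (apply pow_lt; lra). assert (K4 : 0 < kp ^ 4) by (apply pow_lt; lra).
  assert (HQ2 : 0 <= Q2) by (apply Rmult_le_pos; [lra|apply Rdiv_le_0_compat; lra]).
  assert (HQ4 : 0 <= Q4) by (apply Rmult_le_pos; [lra|apply Rdiv_le_0_compat; lra]).
  assert (Hpw : forall z, z <= 0 -> z ^ 2 * psi z <= Q2 /\ z ^ 4 * psi z <= Q4).
  { intros z Hz. exact (psi_power f vs M h al s0 Hal psi psi1 psi2 kp HP z Hz). }
  exists ((al - h) + Q2 + 16 * Q4). split; [lra|]. split.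
  - intros z Hz. assert (R := prof_range HP z Hz).
    destruct (Hpw z Hz) as [P2 P4]. split; [lra|].
    assert (T : - z <= 1 + z ^ 2) by nra.
    apply Rle_trans with ((1 + z ^ 2) * psi z); [apply Rmult_le_compat_r; lra|lra].
  - intros e z He Hz.
    assert (Hq : 2 <= 1 / (4 * e)) by (apply le_div; lra).
    assert (R := prof_range HP z ltac:(lra)).
    destruct (Hpw z ltac:(lra)) as [P2 P4].
    assert (He2 : 0 < e ^ 2) by (apply pow_lt; lra).
    assert (Hze : 1 <= 16 * e ^ 2 * z ^ 2).
    { assert (E : 1 / (4 * e) * (4 * e) = 1) by (field; lra).
      assert (1 <= - z * (4 * e)).
      { rewrite <- E. apply Rmult_le_compat_r; lra. }
      nra. }
    assert (T : z ^ 2 * psi z <= 16 * Q4 * e ^ 2).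
    { apply Rle_trans with (16 * e ^ 2 * z ^ 2 * (z ^ 2 * psi z)).
      - assert (0 <= z ^ 2 * psi z) by (apply Rmult_le_pos; [apply pow2_ge_0|lra]).
        rewrite <- (Rmult_1_l (z ^ 2 * psi z)) at 1. apply Rmult_le_compat_r; assumption.
      - replace (16 * e ^ 2 * z ^ 2 * (z ^ 2 * psi z)) with (16 * e ^ 2 * (z ^ 4 * psi z)) by ring.
        replace (16 * Q4 * e ^ 2) with (16 * e ^ 2 * Q4) by ring.
        apply Rmult_le_compat_l; lra. }
    assert (T2 : 0 <= (al - h + Q2) * e ^ 2) by (apply Rmult_le_pos; lra).
    split.
    + assert (psi z <= z ^ 2 * psi z) by (assert (1 <= z ^ 2) by nra; nra). lra.
    + assert (- z * psi z <= z ^ 2 * psi z) by (apply Rmult_le_compat_r; nra). lra.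
Qed.

(** With [S = s0 + e * x1] the orbit at the time [S * z] is compared with the profile at the
    dilated point [S * z / s0].  Taylor's formula at [z] produces the term
    [e * x1 / s0 * z * psi1 z], which is the part of [e * chi] that [x1] generates, and the other
    part is [O(e ^ 2)] because [b] is. *)
Theorem approximation_error (K c cL X : R) :
  0 <= K -> 0 < c -> 0 < cL -> 0 <= X ->
  exists C, 0 <= C /\ small (fun e => forall k b a L U U1 chi chi1 chi2,
    Rabs k <= K * e ^ 2 -> Rabs b <= K * e ^ 2 -> Rabs (a - h) <= e ->
    cL / e <= L <= 1 / e -> Rabs ((e * L - s0) / e) <= X ->
    half_orbit f vs al k b c a L U U1 ->
    first_order f fu fv vs h hv s0 psi (b / e) ((e * L - s0) / e) chi chi1 chi2 ->
    let S := e * L in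
    (forall z, - (1 / e) <= z <= 0 ->
       Rabs (U (S * z) - h - (psi z + e * chi z)) <= C * e ^ 2 /\
       Rabs (S * U1 (S * z) - (psi1 z + e * chi1 z)) <= C * e ^ 2 /\
       Rabs (- (S ^ 2 * reduced f vs al k b (U (S * z))) - (psi2 z + e * chi2 z)) <= C * e ^ 2) /\
    (forall z, z <= - (1 / (4 * e)) ->
       Rabs (psi z + e * chi z) <= C * e ^ 2 /\
       Rabs (psi1 z + e * chi1 z) <= C * e ^ 2 /\
       Rabs (psi2 z + e * chi2 z) <= C * e ^ 2)).
Proof.
  intros HK Hc HcL HX.
  assert (HQ := profile_normalize f vs M h al s0 kp psi psi1 psi2 Hs0 HP).
  destruct (half_orbit_close f fu fv lo hi vs M h al HB Hlo Hal Hhi Hf Hu _ _ _ _ HQ K c cL HK Hc HcL)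
    as [C0 [HC0 Hclose]].
  destruct psi_bounds as [Q [HQ0 [Qb Qt]]].
  destruct (bounded_left A) as [CA [HCA Ab]].
  { intros z. destruct (first_C2 HA) as [B0 _].
    apply (is_derive_continuous _ _ _ (B0 z)). }
  { apply (first_lim HA). }
  assert (Hs2 : 0 < s0 ^ 2) by (apply pow_lt; lra).
  (* Here [Cx] bounds the first-order profile and [Cx2] its second derivative; [CT] comes from the
     remainder of Taylor's formula, and [Ct] is for the region far from the layer. *)
  set (Cx := CA * K + X * M * Q).
  set (Cx2 := s0 ^ 2 * M * Cx + 2 * s0 * X * M * Q + s0 ^ 2 * M * (Rabs hv + 1) * K).
  assert (HCx : 0 <= Cx) by (unfold Cx; assert (0 <= X * M * Q) by nonneg; nra).
  assert (Hv0 := Rabs_pos hv).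
  assert (HCx2 : 0 <= Cx2).
  { unfold Cx2. assert (0 <= s0 ^ 2 * M * Cx) by nonneg.
    assert (0 <= 2 * s0 * X * M * Q) by nonneg.
    assert (0 <= s0 ^ 2 * M * (Rabs hv + 1) * K) by nonneg. lra. }
  set (W := K * (1 + (al - h + 1))). assert (HW : 0 <= W) by (unfold W; signs).
  set (CT := s0 ^ 2 * M * (al - h) * (4 / (kp / 2) ^ 2) * (X / s0) ^ 2).
  assert (HCT : 0 <= CT).
  { unfold CT. assert (0 < (kp / 2) ^ 2) by (apply pow_lt; lra).
    nonneg. }
  set (CE := C0 + CT + K * CA).
  assert (HCE : 0 <= CE) by (unfold CE; signs).
  set (CE2 := M * W + M * (CE + Cx) ^ 2 + M * Q * X ^ 2 + M * (CE + Cx * (2 * s0 * X + X ^ 2))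
              + s0 ^ 2 * K * (M * Rabs hv + M)).
  assert (HCE2 : 0 <= CE2).
  { unfold CE2. assert (0 <= M * W) by signs.
    assert (0 <= M * (CE + Cx) ^ 2) by (apply Rmult_le_pos; [lra|apply pow2_ge_0]).
    assert (0 <= M * Q * X ^ 2) by (apply Rmult_le_pos; [signs|apply pow2_ge_0]).
    assert (0 <= Cx * (2 * s0 * X + X ^ 2)).
    { apply Rmult_le_pos; [lra|]. assert (0 <= X ^ 2) by apply pow2_ge_0. signs. }
    assert (0 <= s0 ^ 2 * K * (M * Rabs hv + M)) by nonneg. signs. }
  set (Ct := (1 + s0 * M + s0 ^ 2 * M) * Q + (Cx + (2 * Cx + Cx2) + Cx2)).
  assert (HCt0 : 0 <= s0 * M + s0 ^ 2 * M) by signs.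
  assert (HCt1 : 0 <= (s0 * M + s0 ^ 2 * M) * Q) by signs.
  exists (CE + (2 * CE + CE2) + CE2 + Ct).
  split; [unfold Ct; lra|].
  apply (small_imp (fun e => (forall k b a L U U1,
    Rabs k <= K * e ^ 2 -> Rabs b <= K * e ^ 2 -> Rabs (a - h) <= e -> cL / e <= L ->
    half_orbit f vs al k b c a L U U1 ->
    forall t, - L <= t <= 0 -> Rabs (U t - h - psi (t / s0)) <= C0 * e ^ 2) /\
    ((1 * e < 1 / 8 /\ W * e < 1) /\ X / s0 * e < 1 / 2))).
  2:{ apply small_and; [exact Hclose|]. repeat apply small_and; apply small_linear; lra. }
  clear Hclose.
  intros e He [Hclose [[E1 E2] E3]] k b a L U U1 chi chi1 chi2 Hk Hb Ha HL Hx1 HO HF S.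
  assert (He2 : 0 < e ^ 2) by (apply pow_lt; lra). assert (He21 : e ^ 2 <= e) by (apply sq_le_self; lra).
  assert (HWe : W * e ^ 2 <= W * e) by (apply Rmult_le_compat_l; lra).
  set (x1 := (e * L - s0) / e) in *. set (b1 := b / e) in *.
  assert (ES : S = s0 + e * x1) by (unfold S, x1; field; lra).
  assert (Hb1 : Rabs b1 <= K * e).
  { unfold b1, Rdiv. rewrite Rabs_mult, (Rabs_pos_eq (/ e)) by (left; now apply Rinv_0_lt_compat).
    apply div_le; [lra|]. lra. }
  assert (HLpos : 0 < L) by (apply (half_L HO)).
  assert (HS : 0 < S <= 1).
  { unfold S. split; [signs|]. destruct HL as [_ HL]. 
    apply Rle_trans with (e * (1 / e)); [apply Rmult_le_compat_l; lra|right; field; lra]. }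
  assert (Hdec := first_order_decomposition f fu fv lo hi vs M h al hv s0 HB Hlo Hal Hhi Hs0
     psi psi1 psi2 kp HP b1 x1 chi chi1 chi2 A A1 A2 HF HA).
  destruct (first_C2 HF) as [X0 [X1 X2]].
  destruct (prof_C2 HP) as [P0 [P1 P2]].
  assert (Hslice := slice_u_bound f fu fv lo hi vs M h al s0 HB Hlo Hhi Hs0 psi psi1 psi2 kp HP).
  assert (Hsp : forall z, z <= 0 -> 0 < psi1 z <= s0 * M * psi z).
  { intros z Hz. split; [now apply (prof_pos HP)|].
    apply (prof_speed HP z Hz). }
  assert (Hxs : Rabs (x1 / s0) <= X / s0).
  { unfold Rdiv. rewrite Rabs_mult, (Rabs_pos_eq (/ s0)) by (left; now apply Rinv_0_lt_compat).
    apply Rmult_le_compat_r; [left; now apply Rinv_0_lt_compat|exact Hx1]. }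
  assert (Hchi : forall z, z <= 0 -> Rabs (chi z) <= CA * (K * e) + X * M * (- z * psi z)).
  { intros z Hz. rewrite (Hdec z Hz). eapply Rle_trans; [apply Rabs_triang|].
    rewrite !Rabs_mult. apply Rplus_le_compat.
    - rewrite Rmult_comm. apply Rmult_le_compat; try apply Rabs_pos; [now apply Ab|exact Hb1].
    - destruct (Hsp z Hz) as [S1 S2]. rewrite (Rabs_left1 z), (Rabs_pos_eq (psi1 z)) by lra.
      apply Rle_trans with (X / s0 * (- z * (s0 * M * psi z))).
      + apply Rmult_le_compat; [apply Rabs_pos|apply Rmult_le_pos; lra|exact Hxs|].
        apply Rmult_le_compat_l; lra.
      + right. field. lra. }
  assert (Hchi2 : forall z, z <= 0 -> Rabs (chi2 z) <=
     s0 ^ 2 * M * Rabs (chi z) + 2 * s0 * X * (M * psi z) + s0 ^ 2 * M * (Rabs hv + 1) * (K * e)).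
  { intros z Hz. rewrite (first_ode HF z Hz). unfold first_order_rhs.
    destruct (Hslice z Hz) as [F1 [F2 F3]].
    set (Fu := fu (h + psi z) vs) in *. set (Fv := fv (h + psi z) vs) in *.
    set (F0 := f (h + psi z) vs) in *.
    assert (T1 : Rabs (s0 ^ 2 * Fu * chi z) <= s0 ^ 2 * M * Rabs (chi z)).
    { rewrite !Rabs_mult, (Rabs_pos_eq (s0 ^ 2)) by lra.
      apply Rmult_le_compat_r; [apply Rabs_pos|]. apply Rmult_le_compat_l; lra. }
    assert (T2 : Rabs (2 * s0 * x1 * F0) <= 2 * s0 * X * (M * psi z)).
    { rewrite !Rabs_mult, (Rabs_pos_eq 2), (Rabs_pos_eq s0) by lra.
      apply Rmult_le_compat; try apply Rabs_pos; [apply Rmult_le_pos; [lra|apply Rabs_pos]| |exact F3].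
      apply Rmult_le_compat_l; [lra|exact Hx1]. }
    assert (T3 : Rabs (s0 ^ 2 * Fu * hv * b1) <= s0 ^ 2 * M * Rabs hv * (K * e)).
    { rewrite !Rabs_mult, (Rabs_pos_eq (s0 ^ 2)) by lra.
      apply Rmult_le_compat; try apply Rabs_pos; [nonneg| |exact Hb1].
      apply Rmult_le_compat_r; [apply Rabs_pos|]. apply Rmult_le_compat_l; lra. }
    assert (T4 : Rabs (s0 ^ 2 * Fv * b1) <= s0 ^ 2 * M * (K * e)).
    { rewrite !Rabs_mult, (Rabs_pos_eq (s0 ^ 2)) by lra.
      apply Rmult_le_compat; try apply Rabs_pos; [apply Rmult_le_pos; [lra|apply Rabs_pos]| |exact Hb1].
      apply Rmult_le_compat_l; lra. }
    apply Rabs_le_between in T1, T2, T3, T4. apply Rabs_le. lra. }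
  assert (HKe : K * e <= K * 1) by (apply Rmult_le_compat_l; lra).
  assert (Hchi' : forall z, z <= 0 -> Rabs (chi z) <= Cx).
  { intros z Hz. eapply Rle_trans; [now apply Hchi|]. unfold Cx.
    destruct (Qb z Hz) as [_ B2].
    assert (CA * (K * e) <= CA * (K * 1)) by (apply Rmult_le_compat_l; lra).
    assert (X * M * (- z * psi z) <= X * M * Q) by (apply Rmult_le_compat_l; [signs|exact B2]). lra. }
  assert (Htail : forall z, z <= - (1 / (4 * e)) -> Rabs (chi z) <= Cx * e /\ Rabs (chi2 z) <= Cx2 * e).
  { intros z Hz. assert (Hz0 : z <= 0).
    { assert (0 < 1 / (4 * e)) by (apply Rdiv_lt_0_compat; lra). lra. }
    destruct (Qt e z ltac:(lra) Hz) as [B1 B2].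
    assert (HXM : 0 <= X * M) by signs.
    assert (T1 : X * M * (- z * psi z) <= X * M * (Q * e)).
    { apply Rmult_le_compat_l; [exact HXM|]. eapply Rle_trans; [exact B2|].
      apply Rmult_le_compat_l; lra. }
    assert (T2 : Rabs (chi z) <= Cx * e).
    { eapply Rle_trans; [now apply Hchi|]. unfold Cx. lra. }
    split; [exact T2|]. eapply Rle_trans; [now apply Hchi2|]. unfold Cx2.
    assert (T3 : s0 ^ 2 * M * Rabs (chi z) <= s0 ^ 2 * M * (Cx * e))
      by (apply Rmult_le_compat_l; [signs|exact T2]).
    assert (T4 : 2 * s0 * X * (M * psi z) <= 2 * s0 * X * (M * (Q * e))).
    { apply Rmult_le_compat_l; [signs|]. apply Rmult_le_compat_l; [lra|].
      eapply Rle_trans; [exact B1|]. apply Rmult_le_compat_l; lra. }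
    lra. }
  assert (HUr := half_range HO).
  assert (HSz : forall z, - (1 / e) <= z <= 0 -> - L <= S * z <= 0).
  { intros z Hz. split; [|assert (0 <= S * - z) by signs; lra]. 
    apply Rle_trans with (S * - (1 / e)).
    - right. unfold S. field. lra.
    - apply Rmult_le_compat_l; lra. }
  assert (HE0 : forall z, - (1 / e) <= z <= 0 ->
            Rabs (U (S * z) - h - (psi z + e * chi z)) <= CE * e ^ 2).
  { intros z Hz. assert (B1 := Hclose k b a L U U1 Hk Hb Ha (proj1 HL) HO (S * z) (HSz z Hz)).
    set (y := S * z / s0) in *.
    assert (Ey : y - z = e * (x1 / s0) * z) by (unfold y; rewrite ES; field; lra).
    assert (Hsm : Rabs (e * (x1 / s0)) <= 1 / 2).
    { rewrite Rabs_mult, (Rabs_pos_eq e) by lra.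
      apply Rle_trans with (e * (X / s0)); [apply Rmult_le_compat_l; lra|lra]. }
    assert (Hsm' := proj1 (Rabs_le_between _ _) Hsm).
    assert (Hy : y <= z / 2) by (clear - Ey Hsm' Hz; nra).
    assert (T : Rabs (psi y - psi z - psi1 z * (y - z)) <= CT * e ^ 2).
    { destruct (mvt psi psi1 z y) as [c1 [Hc1 Ec1]]; [intros; apply P0|].
      destruct (mvt psi1 psi2 z c1) as [c2 [Hc2 Ec2]]; [intros; apply P1|].
      rewrite Ec1. replace (psi1 c1 * (y - z) - psi1 z * (y - z))
        with ((psi1 c1 - psi1 z) * (y - z)) by ring.
      rewrite Ec2. rewrite !Rabs_mult.
      assert (Hc1' : c1 <= z / 2 /\ Rabs (c1 - z) <= Rabs (y - z)).
      { revert Hc1. unfold Rmin, Rmax. destruct (Rle_dec z y); intros; split; try lra;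
        unfold Rabs; destruct (Rcase_abs (c1 - z)), (Rcase_abs (y - z)); lra. }
      assert (Hc2' : c2 <= z / 2).
      { revert Hc2. unfold Rmin, Rmax. destruct (Rle_dec z c1); intros; lra. }
      assert (F := prof_force HP c2 ltac:(lra)).
      assert (G := prof_decay HP c2 ltac:(lra)).
      assert (G2 : psi c2 <= (al - h) * exp (kp / 2 * z)).
      { eapply Rle_trans; [exact G|]. apply Rmult_le_compat_l; [lra|].
        apply exp_le.
        assert (kp * c2 <= kp * (z / 2)) by (apply Rmult_le_compat_l; lra). lra. }
      assert (G3 : Rabs (psi2 c2) <= s0 ^ 2 * M * (al - h) * exp (kp / 2 * z)).
      { eapply Rle_trans; [exact F|]. rewrite (Rmult_assoc _ (al - h)).
        apply Rmult_le_compat_l; [signs|exact G2]. }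
      assert (G4 : Rabs (y - z) * Rabs (y - z) <= (X / s0) ^ 2 * e ^ 2 * z ^ 2).
      { rewrite Ey, !Rabs_mult, (Rabs_pos_eq e) by lra.
        replace (e * Rabs (x1 / s0) * Rabs z * (e * Rabs (x1 / s0) * Rabs z))
          with (Rabs (x1 / s0) ^ 2 * e ^ 2 * Rabs z ^ 2) by ring.
        rewrite (pow2_abs z). apply Rmult_le_compat_r; [apply pow2_ge_0|].
        apply Rmult_le_compat_r; [lra|]. apply pow_incr. split; [apply Rabs_pos|exact Hxs]. }
      apply Rle_trans with (s0 ^ 2 * M * (al - h) * exp (kp / 2 * z) * ((X / s0) ^ 2 * e ^ 2 * z ^ 2)).
      - rewrite Rmult_assoc. apply Rmult_le_compat; try apply Rabs_pos; [|exact G3|].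
        + apply Rmult_le_pos; apply Rabs_pos.
        + eapply Rle_trans; [|exact G4]. apply Rmult_le_compat_r; [apply Rabs_pos|apply Hc1'].
      - assert (G5 := exp_pow2_le (kp / 2) z ltac:(lra) ltac:(lra)).
        assert (G6 : 0 <= s0 ^ 2 * M * (al - h) * (X / s0) ^ 2 * e ^ 2).
        { nonneg. }
        unfold CT.
        replace (s0 ^ 2 * M * (al - h) * exp (kp / 2 * z) * ((X / s0) ^ 2 * e ^ 2 * z ^ 2))
          with (s0 ^ 2 * M * (al - h) * (X / s0) ^ 2 * e ^ 2 * (z ^ 2 * exp (kp / 2 * z))) by ring.
        replace (s0 ^ 2 * M * (al - h) * (4 / (kp / 2) ^ 2) * (X / s0) ^ 2 * e ^ 2)
          with (s0 ^ 2 * M * (al - h) * (X / s0) ^ 2 * e ^ 2 * (4 / (kp / 2) ^ 2)) by ring.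
        now apply Rmult_le_compat_l. }
    rewrite (Hdec z ltac:(lra)).
    replace (U (S * z) - h - (psi z + e * (b1 * A z + x1 / s0 * (z * psi1 z))))
      with ((U (S * z) - h - psi y) + (psi y - psi z - psi1 z * (y - z)) - e * b1 * A z)
      by (rewrite Ey; ring).
    assert (T3 : Rabs (e * b1 * A z) <= K * CA * e ^ 2).
    { rewrite !Rabs_mult, (Rabs_pos_eq e) by lra.
      replace (K * CA * e ^ 2) with (e * (K * e) * CA) by ring.
      apply Rmult_le_compat; try apply Rabs_pos; [apply Rmult_le_pos; [lra|apply Rabs_pos]| |apply Ab; lra].
      apply Rmult_le_compat_l; lra. }
    apply Rabs_le_between in B1, T, T3. apply Rabs_le. unfold CE. lra. }
  assert (HE2 : forall z, - (1 / e) <= z <= 0 ->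
     Rabs (- (S ^ 2 * reduced f vs al k b (U (S * z))) - (psi2 z + e * chi2 z)) <= CE2 * e ^ 2).
  { intros z Hz. assert (BE := HE0 z Hz).
    assert (Hur := HUr (S * z) (HSz z Hz)).
    assert (Ha' := proj1 (Rabs_le_between _ _) Ha).
    assert (Hpr := prof_range HP z ltac:(lra)).
    rewrite (first_ode HF z) by lra.
    rewrite (prof_ode HP z) by lra. unfold first_order_rhs.
    destruct (Hslice z ltac:(lra)) as [F1 [F2 F3]].
    set (u := U (S * z)) in *.
    assert (BR : Rabs (reduced f vs al k b u - f u vs) <= M * (W * e ^ 2)).
    { assert (Q1 := slow_bound h al Hal K e k b u HK ltac:(lra) Hk Hb ltac:(lra)).
      cbv zeta in Q1. fold W in Q1. assert (Q2 := proj1 (Rabs_le_between _ _) Q1). unfold reduced.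
      eapply Rle_trans; [apply (box_lip f fu fv _ _ _ _ HB); split; lra|].
      rewrite Rminus_diag, Rabs_R0, Rplus_0_l. apply Rmult_le_compat_l; [lra|].
      replace (vs + b + k * (al - u) - vs) with (b + k * (al - u)) by ring. exact Q1. }
    assert (BT := box_taylor_u f fu fv lo hi vs M HB (h + psi z) u vs ltac:(split; lra) ltac:(split; lra)).
    set (Fu := fu (h + psi z) vs) in *. set (Fv := fv (h + psi z) vs) in *.
    set (F0 := f (h + psi z) vs) in *. set (R := reduced f vs al k b u) in *.
    set (Er := u - h - (psi z + e * chi z)) in *.
    replace (u - (h + psi z)) with (Er + e * chi z) in BT by (unfold Er; ring).
    assert (HX' := Hchi' z ltac:(lra)).
    assert (Bd : (Er + e * chi z) ^ 2 <= (CE + Cx) ^ 2 * e ^ 2).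
    { rewrite <- pow2_abs. replace ((CE + Cx) ^ 2 * e ^ 2) with (((CE + Cx) * e) ^ 2) by ring.
      apply pow_incr. split; [apply Rabs_pos|]. eapply Rle_trans; [apply Rabs_triang|].
      rewrite Rabs_mult, (Rabs_pos_eq e) by lra.
      assert (CE * e ^ 2 <= CE * e) by (apply Rmult_le_compat_l; lra).
      assert (e * Rabs (chi z) <= e * Cx) by (apply Rmult_le_compat_l; lra). lra. }
    assert (HS2 : 0 <= S ^ 2 <= 1) by (assert (S ^ 2 <= S) by (apply sq_le_self; lra); split; signs).
    assert (T1 : Rabs (S ^ 2 * (R - f u vs)) <= M * W * e ^ 2).
    { rewrite Rabs_mult, (Rabs_pos_eq (S ^ 2)) by lra. apply contract_le; [lra|apply Rabs_pos|lra]. }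
    assert (T2 : Rabs (S ^ 2 * (f u vs - F0 - Fu * (Er + e * chi z))) <= M * (CE + Cx) ^ 2 * e ^ 2).
    { rewrite Rabs_mult, (Rabs_pos_eq (S ^ 2)) by lra.
      assert (M * (Er + e * chi z) ^ 2 <= M * ((CE + Cx) ^ 2 * e ^ 2)) by (apply Rmult_le_compat_l; lra).
      apply contract_le; [lra|apply Rabs_pos|lra]. }
    assert (T3 : Rabs (F0 * (e ^ 2 * x1 ^ 2)) <= M * Q * X ^ 2 * e ^ 2).
    { rewrite Rabs_mult, (Rabs_pos_eq (e ^ 2 * x1 ^ 2)) by (apply Rmult_le_pos; [lra|apply pow2_ge_0]).
      replace (M * Q * X ^ 2 * e ^ 2) with (M * Q * (e ^ 2 * X ^ 2)) by ring.
      apply Rmult_le_compat; [apply Rabs_pos|apply Rmult_le_pos; [lra|apply pow2_ge_0]| |].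
      - eapply Rle_trans; [exact F3|]. apply Rmult_le_compat_l; [lra|]. apply (Qb z); lra.
      - apply Rmult_le_compat_l; [lra|]. rewrite <- (pow2_abs x1). apply pow_incr.
        split; [apply Rabs_pos|exact Hx1]. }
    assert (T4 : Rabs (Fu * (S ^ 2 * Er + e * chi z * (2 * e * s0 * x1 + e ^ 2 * x1 ^ 2)))
                 <= M * (CE + Cx * (2 * s0 * X + X ^ 2)) * e ^ 2).
    { rewrite Rabs_mult.
      replace (M * (CE + Cx * (2 * s0 * X + X ^ 2)) * e ^ 2)
        with (M * ((CE + Cx * (2 * s0 * X + X ^ 2)) * e ^ 2)) by ring.
      apply Rmult_le_compat; try apply Rabs_pos; [exact F1|].
      eapply Rle_trans; [apply Rabs_triang|]. rewrite !Rabs_mult.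
      rewrite (Rabs_pos_eq (S ^ 2)), (Rabs_pos_eq e) by lra.
      assert (Y1 : S ^ 2 * Rabs Er <= CE * e ^ 2) by (apply contract_le; [lra|apply Rabs_pos|lra]).
      assert (Y2 : Rabs (2 * e * s0 * x1 + e ^ 2 * x1 ^ 2) <= e * (2 * s0 * X + X ^ 2)).
      { eapply Rle_trans; [apply Rabs_triang|]. rewrite !Rabs_mult.
        rewrite (Rabs_pos_eq 2), (Rabs_pos_eq e), (Rabs_pos_eq s0), (Rabs_pos_eq (e ^ 2)) by lra.
        rewrite (Rabs_pos_eq (x1 ^ 2)) by apply pow2_ge_0. rewrite <- (pow2_abs x1).
        assert (Rabs x1 ^ 2 <= X ^ 2) by (apply pow_incr; split; [apply Rabs_pos|exact Hx1]).
        assert (2 * e * s0 * Rabs x1 <= 2 * e * s0 * X) by (apply Rmult_le_compat_l; signs).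
        assert (e ^ 2 * Rabs x1 ^ 2 <= e * X ^ 2).
        { apply Rmult_le_compat; try lra. apply pow2_ge_0. }
        lra. }
      assert (Y3 : e * Rabs (chi z) * Rabs (2 * e * s0 * x1 + e ^ 2 * x1 ^ 2)
                   <= e * Cx * (e * (2 * s0 * X + X ^ 2))).
      { apply Rmult_le_compat; try apply Rabs_pos; [apply Rmult_le_pos; [lra|apply Rabs_pos]| |exact Y2].
        apply Rmult_le_compat_l; lra. }
      lra. }
    assert (T5 : Rabs (e * (s0 ^ 2 * b1 * (Fu * hv + Fv))) <= s0 ^ 2 * K * (M * Rabs hv + M) * e ^ 2).
    { rewrite !Rabs_mult, (Rabs_pos_eq e), (Rabs_pos_eq (s0 ^ 2)) by lra.
      replace (s0 ^ 2 * K * (M * Rabs hv + M) * e ^ 2)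
        with (e * (s0 ^ 2 * (K * e) * (M * Rabs hv + M))) by ring.
      apply Rmult_le_compat_l; [lra|].
      apply Rmult_le_compat; try apply Rabs_pos; [apply Rmult_le_pos; [lra|apply Rabs_pos]| |].
      - apply Rmult_le_compat_l; lra.
      - eapply Rle_trans; [apply Rabs_triang|]. rewrite Rabs_mult.
        assert (Rabs Fu * Rabs hv <= M * Rabs hv) by (apply Rmult_le_compat_r; [apply Rabs_pos|lra]).
        lra. }
    replace (- (S ^ 2 * R) - (- (s0 ^ 2 * F0) + e * (- (s0 ^ 2 * Fu * chi z) - 2 * s0 * x1 * F0
              - s0 ^ 2 * Fu * hv * b1 - s0 ^ 2 * Fv * b1)))
      with (- (S ^ 2 * (R - f u vs)) - S ^ 2 * (f u vs - F0 - Fu * (Er + e * chi z))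
            - F0 * (e ^ 2 * x1 ^ 2)
            - Fu * (S ^ 2 * Er + e * chi z * (2 * e * s0 * x1 + e ^ 2 * x1 ^ 2))
            + e * (s0 ^ 2 * b1 * (Fu * hv + Fv))) by (rewrite ES; ring).
    apply Rabs_le_between in T1, T2, T3, T4, T5. apply Rabs_le. unfold CE2. lra. }
  assert (HCt : 0 <= Ct) by (unfold Ct; lra).
  split.
  - intros z Hz.
    assert (HE1 : Rabs (S * U1 (S * z) - (psi1 z + e * chi1 z)) <= 2 * (CE * e ^ 2) + CE2 * e ^ 2).
    { set (y := if Rle_dec z (-1) then z + 1 else z - 1).
      assert (H8 : 8 <= 1 / e) by (apply le_div; lra).
      assert (Hyz : Rabs (y - z) = 1).
      { unfold y. destruct (Rle_dec z (-1)).
        - replace (z + 1 - z) with 1 by ring. apply Rabs_R1.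
        - replace (z - 1 - z) with (-1) by ring. rewrite Rabs_left; lra. }
      assert (Hyr : forall x, Rmin z y <= x <= Rmax z y -> - (1 / e) <= x <= 0).
      { intros x Hx. apply (between_minmax _ _ z y); [lra| |exact Hx].
        unfold y. destruct (Rle_dec z (-1)); lra. }
      assert (DS : forall x, is_derive (fun x => S * x) x S).
      { intros x. apply (is_derive_eq _ _ (S * 1)); [|ring]. apply is_derive_R_scal, is_derive_R_id. }
      apply (interpolation (fun z => U (S * z) - h - (psi z + e * chi z))
               (fun z => S * U1 (S * z) - (psi1 z + e * chi1 z))
               (fun z => - (S ^ 2 * reduced f vs al k b (U (S * z))) - (psi2 z + e * chi2 z)) z y _ _ Hyz).
      - intros x _. apply (is_derive_eq _ _ ((U1 (S * x) * S - 0) - (psi1 x + e * chi1 x))); [|ring].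
        apply is_derive_R_minus; [apply is_derive_R_minus; [|apply is_derive_R_const]|].
        + apply (is_derive_R_comp U (fun x => S * x)); [apply (half_U HO)|apply DS].
        + apply is_derive_R_plus; [apply P0|apply is_derive_R_scal, X0].
      - intros x _.
        apply (is_derive_eq _ _ (S * (- reduced f vs al k b (U (S * x)) * S) - (psi2 x + e * chi2 x))); [|ring].
        apply is_derive_R_minus; [apply is_derive_R_scal|].
        + apply (is_derive_R_comp U1 (fun x => S * x)); [apply (half_U1 HO)|apply DS].
        + apply is_derive_R_plus; [apply P1|apply is_derive_R_scal, X1].
      - intros x Hx. apply HE0. now apply Hyr.
      - intros x Hx. apply HE2. now apply Hyr. }
    assert (Big : forall r, 0 <= r -> 0 <= r * e ^ 2) by (intros; apply Rmult_le_pos; lra).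
    assert (B1 := Big CE HCE). assert (B2 := Big CE2 HCE2). assert (B3 := Big Ct HCt).
    split; [|split].
    + eapply Rle_trans; [now apply HE0|]. lra.
    + eapply Rle_trans; [exact HE1|]. lra.
    + eapply Rle_trans; [now apply HE2|]. lra.
  - intros z Hz.
    assert (H4 : 0 < 1 / (4 * e)) by (apply Rdiv_lt_0_compat; lra).
    assert (Hz0 : z <= 0) by lra.
    destruct (Htail z Hz) as [T1 T2]. destruct (Qt e z ltac:(lra) Hz) as [B1 _].
    destruct (Hsp z Hz0) as [S1 S2]. assert (F := prof_force HP z Hz0).
    assert (R := prof_range HP z Hz0).
    assert (T3 : Rabs (chi1 z) <= 2 * (Cx * e) + Cx2 * e).
    { apply (interpolation chi chi1 chi2 z (z - 1)).
      - replace (z - 1 - z) with (-1) by ring. rewrite Rabs_left; lra.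
      - intros; apply X0.
      - intros; apply X1.
      - intros s Hs. rewrite Rmin_right, Rmax_left in Hs by lra. apply Htail. lra.
      - intros s Hs. rewrite Rmin_right, Rmax_left in Hs by lra. apply Htail. lra. }
    assert (Comb : forall p q Cp Cq, Rabs p <= Cp * e ^ 2 -> Rabs q <= Cq * e ->
              Rabs (p + e * q) <= (Cp + Cq) * e ^ 2).
    { intros p q Cp Cq Hp Hq. eapply Rle_trans; [apply Rabs_triang|].
      rewrite Rabs_mult, (Rabs_pos_eq e) by lra.
      assert (e * Rabs q <= e * (Cq * e)) by (apply Rmult_le_compat_l; lra). lra. }
    assert (V1 : s0 * M * psi z <= s0 * M * (Q * e ^ 2)) by (apply Rmult_le_compat_l; signs).
    assert (V2 : s0 ^ 2 * M * psi z <= s0 ^ 2 * M * (Q * e ^ 2)) by (apply Rmult_le_compat_l; signs).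
    assert (G1 : 0 <= s0 * M * Q) by nonneg.
    assert (G2 : 0 <= s0 ^ 2 * M * Q) by nonneg.
    split; [|split].
    + eapply Rle_trans; [apply (Comb _ _ Q Cx); [rewrite Rabs_pos_eq; lra|exact T1]|].
      apply Rmult_le_compat_r; [lra|]. unfold Ct. lra.
    + eapply Rle_trans; [apply (Comb _ _ (s0 * M * Q) (2 * Cx + Cx2)); [rewrite Rabs_pos_eq; lra|lra]|].
      apply Rmult_le_compat_r; [lra|]. unfold Ct. lra.
    + eapply Rle_trans; [apply (Comb _ _ (s0 ^ 2 * M * Q) Cx2); [lra|exact T2]|].
      apply Rmult_le_compat_r; [lra|]. unfold Ct. lra.
Qed.
End Approximation.

(** * The error functions of one half of the layer *)

Lemma locally_interval (P : R -> Prop) (p q y : R) :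
  p < y < q -> (forall s, p < s < q -> P s) -> locally y P.
Proof.
  intros Hy H. assert (Hr : 0 < Rmin (y - p) (q - y)) by (apply Rmin_pos; lra).
  exists (mkposreal _ Hr). intros s Hs. change (Rabs (s - y) < Rmin (y - p) (q - y)) in Hs.
  assert (H1 := Rlt_le_trans _ _ _ Hs (Rmin_l _ _)).
  assert (H2 := Rlt_le_trans _ _ _ Hs (Rmin_r _ _)).
  apply Rabs_lt_between in H1, H2. apply H. lra.
Qed.

Lemma constant_on_interval (w : R -> R) (p q c : R) :
  (forall s, p < s < q -> w s = c) ->
  (forall s, p < s < q -> is_derive w s 0) /\ (forall s, p < s < q -> Derive w s = 0).
Proof.
  intros H. assert (D : forall s, p < s < q -> is_derive w s 0).
  { intros s Hs. apply (is_derive_ext_loc (fun _ => c)); [|apply is_derive_R_const].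
    apply (locally_interval _ p q); [exact Hs|]. intros x Hx. symmetry. now apply H. }
  split; [exact D|]. intros s Hs. apply is_derive_unique. now apply D.
Qed.

(** The cut-off is constant near each end of the unit interval, so that freezing it beyond the
    ends preserves its smoothness and its derivatives are bounded. *)
Lemma cutoff_extension (theta : R -> R) :
  is_cutoff theta ->
  exists th th1 th2 CT, C2_line th th1 th2 /\ 0 <= CT /\
    (forall y, 0 <= y <= 1 -> th y = theta y /\ 0 <= th y <= 1 /\ Rabs (th1 y) <= CT /\ Rabs (th2 y) <= CT) /\
    (forall y, y < 1 / 2 -> th y = 0 /\ th1 y = 0) /\
    (forall y, 3 / 4 < y -> th y = 1 /\ th1 y = 0 /\ th2 y = 0).
Proof.
  intros [Hs [H0 [H1 Hr]]].
  set (th := fun y => theta (Rmax 0 (Rmin 1 y))).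
  assert (Hin : forall y, 0 <= y <= 1 -> th y = theta y).
  { intros y Hy. unfold th. rewrite Rmin_right, Rmax_right by lra. reflexivity. }
  assert (Hl : forall y, y < 1 / 2 -> th y = 0).
  { intros y Hy. unfold th. apply H0. rewrite Rmin_right by lra.
    split; [apply Rmax_l|apply Rmax_lub; lra]. }
  assert (Hh : forall y, 3 / 4 < y -> th y = 1).
  { intros y Hy. unfold th. apply H1. split.
    - eapply Rle_trans; [|apply Rmax_r]. apply Rmin_glb; lra.
    - apply Rmax_lub; [lra|apply Rmin_l]. }
  set (th1 := Derive th). set (th2 := Derive th1).
  assert (L1 : (forall s, s < 1 / 2 -> is_derive th s 0) /\ (forall s, s < 1 / 2 -> th1 s = 0)).
  { split; intros s Hs'; apply (constant_on_interval th (s - 1) (1 / 2) 0); try lra;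
      intros; apply Hl; lra. }
  assert (L2 : (forall s, s < 1 / 2 -> is_derive th1 s 0) /\ (forall s, s < 1 / 2 -> th2 s = 0)).
  { split; intros s Hs'; apply (constant_on_interval th1 (s - 1) (1 / 2) 0); try lra;
      intros; apply L1; lra. }
  assert (R1 : (forall s, 3 / 4 < s -> is_derive th s 0) /\ (forall s, 3 / 4 < s -> th1 s = 0)).
  { split; intros s Hs'; apply (constant_on_interval th (3 / 4) (s + 1) 1); try lra;
      intros; apply Hh; lra. }
  assert (R2 : (forall s, 3 / 4 < s -> is_derive th1 s 0) /\ (forall s, 3 / 4 < s -> th2 s = 0)).
  { split; intros s Hs'; apply (constant_on_interval th1 (3 / 4) (s + 1) 0); try lra;
      intros; apply R1; lra. }
  assert (I0 : forall s, 0 < s < 1 -> locally s (fun x => theta x = th x)).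
  { intros s Hs'. apply (locally_interval _ 0 1); [exact Hs'|]. intros x Hx. symmetry. apply Hin. lra. }
  assert (I1 : forall s, 0 < s < 1 -> Derive theta s = th1 s).
  { intros s Hs'. unfold th1. apply Derive_ext_loc. now apply I0. }
  assert (I2 : forall s, 0 < s < 1 -> Derive (Derive theta) s = th2 s).
  { intros s Hs'. unfold th2. apply Derive_ext_loc.
    apply (locally_interval _ 0 1); [exact Hs'|]. intros; now apply I1. }
  assert (Cases : forall y, y < 1 / 2 \/ 0 < y < 1 \/ 3 / 4 < y).
  { intros y. destruct (Rlt_le_dec y (1 / 2)); [now left|]. right.
    destruct (Rlt_le_dec y 1); [left|right]; lra. }
  assert (HC2 : C2_line th th1 th2).
  { split; [|split].
    - intros y. destruct (Cases y) as [h|[h|h]].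
      + rewrite (proj2 L1 y h). now apply L1.
      + apply Derive_correct. apply (ex_derive_ext_loc theta); [now apply I0|]. exact (Hs 1%nat y h).
      + rewrite (proj2 R1 y h). now apply R1.
    - intros y. destruct (Cases y) as [h|[h|h]].
      + rewrite (proj2 L2 y h). now apply L2.
      + apply Derive_correct. apply (ex_derive_ext_loc (Derive theta)); [|exact (Hs 2%nat y h)].
        apply (locally_interval _ 0 1); [exact h|]. intros; now apply I1.
      + rewrite (proj2 R2 y h). now apply R2.
    - intros y. destruct (Cases y) as [h|[h|h]].
      + apply (is_derive_continuous _ _ 0). apply (constant_on_interval th2 (y - 1) (1 / 2) 0); [|lra].
        intros; apply L2; lra.
      + apply (ex_derive_continuous th2 y). apply (ex_derive_ext_loc (Derive (Derive theta))).
        * apply (locally_interval _ 0 1); [exact h|]. intros; now apply I2.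
        * exact (Hs 3%nat y h).
      + apply (is_derive_continuous _ _ 0). apply (constant_on_interval th2 (3 / 4) (y + 1) 0); [|lra].
        intros; apply R2; lra. }
  destruct HC2 as [D0 [D1 C2]].
  assert (Bd : forall w : R -> R, (forall y, continuous w y) -> exists C, forall y, 0 <= y <= 1 -> Rabs (w y) <= C).
  { intros w Hw. destruct (continuity_ab_maj (fun y => Rabs (w y)) 0 1 ltac:(lra)) as [ym [Hm _]].
    - intros y _. apply continuity_pt_filterlim. apply (continuous_comp w Rabs); [apply Hw|apply continuous_Rabs].
    - exists (Rabs (w ym)). exact Hm. }
  destruct (Bd th1) as [Ca Ba]; [intros y; apply (is_derive_continuous _ _ _ (D1 y))|].
  destruct (Bd th2 C2) as [Cb Bb].
  exists th, th1, th2, (Rabs Ca + Rabs Cb). split; [split; [exact D0|split; [exact D1|exact C2]]|].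
  assert (Pa := Rabs_pos Ca). assert (Pb := Rabs_pos Cb).
  assert (Qa := Rle_abs Ca). assert (Qb := Rle_abs Cb).
  split; [lra|]. split; [|split].
  - intros y Hy. split; [now apply Hin|]. split; [rewrite Hin by exact Hy; now apply Hr|].
    split; [specialize (Ba y Hy)|specialize (Bb y Hy)]; lra.
  - intros y Hy. split; [now apply Hl|now apply L1].
  - intros y Hy. split; [now apply Hh|]. split; [now apply R1|now apply R2].
Qed.

Section HalfLayer.
Variables (f fu fv : R -> R -> R) (lo hi vs M h al s0 Dif : R) (hf theta phi0 : R -> R)
  (phi1 : R -> R -> R -> R).
Hypothesis HB : C2box f fu fv lo hi vs M.
Hypothesis Hlo : lo + 1 <= h.
Hypothesis Hal : h < al.
Hypothesis Hhi : al + 1 <= hi.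
Hypothesis Hf : f h vs = 0.
Hypothesis Hu : fu h vs < 0.
Hypothesis Hpot : forall u, h < u <= al -> RInt (fun s => f s vs) h u < 0.
Hypothesis Hs0 : 0 < s0.
Hypothesis HDif : Dif <> 0.
Hypothesis Hhf : hf vs = h.
Hypothesis Hth : is_cutoff theta.
Hypothesis Hphi0 : profile0_minus f hf vs s0 al phi0.
Hypothesis Hphi1 : forall b1 x1, profile1_minus f hf vs s0 phi0 b1 x1 (phi1 b1 x1).

Let M1 : 1 <= M := box_M HB.

(** The limits at infinity and the equation are inherited from the given profile, and only the
    extension beyond the end point has to be constructed. *)
Lemma first_order_exists (psi : R -> R) (b1 x1 : R) :
  (forall z, z <= 0 -> psi z = phi0 z) ->
  exists chi chi1 chi2, first_order f fu fv vs h (Derive hf vs) s0 psi b1 x1 chi chi1 chi2 /\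
    forall z, z <= 0 -> chi z = phi1 b1 x1 z.
Proof.
  intros Hpsi. assert (Hsol := Hphi1 b1 x1). unfold profile1_minus in Hsol. cbv zeta in Hsol.
  rewrite Hhf in Hsol.
  assert (Eu : forall u, partial_u f u vs = fu u vs).
  { intros u. apply is_derive_unique. apply (box_du HB). }
  assert (Ev : forall u, partial_v f u vs = fv u vs).
  { intros u. apply is_derive_unique. apply (box_dv HB). }
  destruct (extend_left _ _ _ Hsol) as [chi [chi1 [chi2 [HC2 Hext]]]].
  - intros z. set (p := fun s => phi0 (Rmin s 0)). set (y := fun s => phi1 b1 x1 (Rmin s 0)).
    assert (Hp : continuous p z) by (apply (solves_left_continuous _ _ _ (proj1 Hphi0))).
    assert (Hy : continuous y z) by (apply (solves_left_continuous _ _ _ Hsol)).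
    assert (Hq : continuous (fun s => h + p s) z).
    { apply (continuous_plus (V := R_NormedModule) (fun _ => h)); [apply continuous_const|exact Hp]. }
    assert (Along : forall g : R -> R -> R,
      (forall u v, continuous (fun q : R * R => g (fst q) (snd q)) (u, v)) ->
      continuous (fun s => g (h + p s) vs) z).
    { intros g Hg. apply (continuous_comp_2 (fun s => h + p s) (fun _ => vs) g);
        [exact Hq|apply continuous_const|apply Hg]. }
    assert (Cf := Along f (box_cont HB)).
    assert (Cu := Along fu (box_contu HB)).
    assert (Cv := Along fv (box_contv HB)).
    apply (continuous_ext (fun s => (((- s0 ^ 2) * (fu (h + p s) vs * y s) + (- (2 * s0 * x1)) * f (h + p s) vs)
        + (- (s0 ^ 2 * Derive hf vs * b1)) * fu (h + p s) vs) + (- (s0 ^ 2 * b1)) * fv (h + p s) vs)).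
    + intros s. rewrite Eu, Ev. unfold p, y. ring_R.
    + apply (continuous_plus (V := R_NormedModule)); [apply (continuous_plus (V := R_NormedModule)); [apply (continuous_plus (V := R_NormedModule))|]|];
        apply (continuous_scal_r (V := R_NormedModule)); try assumption.
      now apply (continuous_mult (fun s => fu (h + p s) vs) y).
  - exists chi, chi1, chi2. split; [|intros z Hz; apply (Hext z Hz)].
    destruct Hsol as [_ [_ [Hs3 Hs4]]]. split.
    + exact HC2.
    + intros z Hz. destruct (Hext z Hz) as [E1 E2]. rewrite E2, E1. unfold first_order_rhs.
      rewrite Hpsi, Eu, Ev by exact Hz. reflexivity.
    + rewrite (proj1 (Hext 0 (Rle_refl 0))). exact Hs3.
    + intros e He. destruct (lim_m_infty_eps _ Hs4 e He) as [Z HZ].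
      exists (Rmin Z (-1)). assert (m1 := Rmin_l Z (-1)). assert (m2 := Rmin_r Z (-1)).
      split; [lra|]. intros z Hz. rewrite (proj1 (Hext z ltac:(lra))). apply HZ. lra.
Qed.

Lemma continuous_sum3 (p q r : R -> R) (x : R) :
  continuous p x -> continuous q x -> continuous r x -> continuous (fun s => p s + q s + r s) x.
Proof.
  intros Hp Hq Hr. apply (continuous_plus (V := R_NormedModule) (fun s => p s + q s)); [|exact Hr].
  now apply (continuous_plus (V := R_NormedModule) p q).
Qed.

(** The slow component follows from the fast one by conservation, which explains the factor
    [e ^ 2 / Dif]; the constants subtracted from the profile in [V_minus] make the two agree
    at the layer position. *)
Theorem half_layer (K c cL X : R) :
  Rabs (/ Dif) <= K -> 0 < c -> 0 < cL -> 0 <= X ->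
  exists C, 0 <= C /\ small (fun e => forall b a L U U1,
    Rabs b <= K * e ^ 2 -> Rabs (a - h) <= e -> cL / e <= L <= 1 / e ->
    Rabs ((e * L - s0) / e) <= X ->
    half_orbit f vs al (e ^ 2 / Dif) b c a L U U1 ->
    let xs := e * L in let x1 := (xs - s0) / e in
    exists w w1 w2 r r1 r2, C2_line w w1 w2 /\ C2_line r r1 r2 /\
      w1 0 = 0 /\ r1 0 = 0 /\ w xs = 0 /\ r xs = 0 /\
      forall x, 0 <= x <= xs ->
        w x = U ((x - xs) / e) - U_minus hf vs theta phi0 phi1 e (b / e) x1 (x / xs) /\
        r x = vs + b + e ^ 2 / Dif * (al - U ((x - xs) / e))
              - V_minus Dif vs theta phi0 phi1 e (b / e) x1 (x / xs) /\
        Rabs (w x) <= C * e ^ 2 /\ Rabs (e * w1 x) <= C * e ^ 2 /\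
        Rabs (e ^ 2 * w2 x) <= C * e ^ 2 /\
        Rabs (r x) <= C * e ^ 2 /\ Rabs (r1 x) <= C * e ^ 2 /\ Rabs (r2 x) <= C * e ^ 2).
Proof.
  intros HKD Hc HcL HX.
  assert (HK : 0 <= K) by (eapply Rle_trans; [apply Rabs_pos|exact HKD]).
  set (hv := Derive hf vs).
  assert (Hphi0' : profile0_minus f (fun _ => h) vs s0 al phi0).
  { unfold profile0_minus in *. rewrite Hhf in Hphi0. exact Hphi0. }
  destruct (profile_analysis f fu fv lo hi vs M h al HB Hlo Hal Hhi Hf Hu Hpot s0 phi0 Hs0 Hphi0')
    as [psi [psi1 [psi2 [kp [HP Hpsi]]]]].
  destruct (first_order_exists psi 1 0 Hpsi) as [A [A1 [A2 [HA _]]]]. fold hv in HA.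
  destruct (approximation_error f fu fv lo hi vs M h al hv s0 HB Hlo Hal Hhi Hf Hu Hs0
              psi psi1 psi2 kp HP A A1 A2 HA K c cL X HK Hc HcL HX) as [C0 [HC0 Happ]].
  destruct (cutoff_extension theta Hth) as [th [th1 [th2 [CT [[T0 [T1 T2]] [HCT [Tin [Tlo Thi]]]]]]]].
  set (I := / cL). assert (HI : 0 < I) by now apply Rinv_0_lt_compat.
  set (Pm := (al - h) + Rabs hv * K). assert (HPm : 0 <= Pm).
  { unfold Pm. assert (0 <= Rabs hv * K) by (apply Rmult_le_pos; [apply Rabs_pos|lra]). lra. }
  set (Cw := (2 * C0 + Rabs hv * K) + (2 * C0 + CT * C0) * I + (2 * C0 + 3 * CT * C0) * I ^ 2).
  assert (HI2 : 0 < I ^ 2) by (apply pow_lt; lra).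
  assert (Hhv := Rabs_pos hv).
  assert (HhK : 0 <= Rabs hv * K) by (apply Rmult_le_pos; lra).
  assert (HTC : 0 <= CT * C0) by (apply Rmult_le_pos; lra).
  assert (HW1 : 0 <= (2 * C0 + CT * C0) * I) by (apply Rmult_le_pos; lra).
  assert (HW2 : 0 <= (2 * C0 + 3 * CT * C0) * I ^ 2) by (apply Rmult_le_pos; lra).
  assert (HCw : 0 <= Cw) by (unfold Cw; lra).
  set (Cr := K * (Cw + Pm + CT * I * Pm + CT * I ^ 2 * Pm)).
  assert (HTI : 0 <= CT * I * Pm) by nonneg. assert (HTI2 : 0 <= CT * I ^ 2 * Pm) by nonneg.
  assert (HCr : 0 <= Cr) by (unfold Cr; apply Rmult_le_pos; lra).
  exists (Cw + Cr). split; [lra|].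
  destruct Happ as [e0 [He0 Happ]].
  exists (Rmin e0 (1 / 8)). split; [apply Rmin_pos; lra|].
  intros e He. assert (Hee0 := Rmin_l e0 (1 / 8)). assert (Hee1 := Rmin_r e0 (1 / 8)).
  intros b a L U U1 Hb Ha HL Hx1 HO xs x1.
  assert (He2 : 0 < e ^ 2) by (apply pow_lt; lra). assert (He21 : e ^ 2 <= 1) by (assert (e ^ 2 <= e) by (apply sq_le_self; lra); lra).
  set (kap := e ^ 2 / Dif) in *.
  assert (Hkap : Rabs kap <= K * e ^ 2).
  { unfold kap, Rdiv. rewrite Rabs_mult, (Rabs_pos_eq (e ^ 2)), Rmult_comm by lra.
    apply Rmult_le_compat_r; lra. }
  set (b1 := b / e).
  destruct (first_order_exists psi b1 x1 Hpsi) as [chi [chi1 [chi2 [HF Hchi]]]]. fold hv in HF.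
  assert (Happ' := Happ e ltac:(lra) kap b a L U U1 chi chi1 chi2 Hkap Hb Ha HL Hx1 HO HF).
  cbv zeta in Happ'. fold xs in Happ'. destruct Happ' as [Hin Htail]. clear Happ.
  assert (HLpos : 0 < L) by (apply (half_L HO)).
  assert (Hxs : cL <= xs).
  { unfold xs. apply Rle_trans with (e * (cL / e)); [right; field; lra|].
    apply Rmult_le_compat_l; lra. }
  assert (HiS : 0 < / xs <= I).
  { split; [apply Rinv_0_lt_compat; lra|]. apply Rinv_le_contravar; lra. }
  destruct (first_C2 HF) as [X0 [X1 X2]].
  destruct (prof_C2 HP) as [P0 [P1 P2]].
  set (P := fun z => psi z + e * chi z). set (Pd := fun z => psi1 z + e * chi1 z).
  set (Pdd := fun z => psi2 z + e * chi2 z).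
  assert (DP : forall z, is_derive P z (Pd z)).
  { intros z. apply is_derive_R_plus; [apply P0|apply is_derive_R_scal, X0]. }
  assert (DPd : forall z, is_derive Pd z (Pdd z)).
  { intros z. apply is_derive_R_plus; [apply P1|apply is_derive_R_scal, X1]. }
  assert (CPdd : forall z, continuous Pdd z).
  { intros z. apply (continuous_plus (V := R_NormedModule) psi2); [apply P2|].
    apply (continuous_scal_r (V := R_NormedModule) e chi2). apply X2. }
  set (zz := fun x => (x / xs - 1) / e). set (tt := fun x => (x - xs) / e).
  assert (Ett : forall x, tt x = xs * zz x) by (intros; unfold tt, zz; field; lra).
  set (j := / (xs * e)).
  assert (Dzz : forall x, is_derive zz x j).
  { intros x. unfold zz, j. auto_derive; [exact Logic.I|]. field. lra. }
  assert (Dtt : forall x, is_derive tt x (/ e)).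
  { intros x. unfold tt. auto_derive; [exact Logic.I|]. field. lra. }
  assert (Dyy : forall x, is_derive (fun x => x / xs) x (/ xs)).
  { intros x. auto_derive; [exact Logic.I|]. field. lra. }
  assert (DU := half_U HO). assert (DU1 := half_U1 HO).
  assert (DthP : forall x, is_derive (fun x => th (x / xs) * P (zz x)) x
     (th1 (x / xs) * / xs * P (zz x) + th (x / xs) * (Pd (zz x) * j))).
  { intros x. apply (is_derive_R_mult (fun x => th (x / xs)) (fun x => P (zz x))).
    - apply (is_derive_R_comp th (fun x => x / xs)); [apply T0|apply Dyy].
    - apply (is_derive_R_comp P zz); [apply DP|apply Dzz]. }
  set (w := fun x => U (tt x) - ((h + e * hv * b1) + th (x / xs) * P (zz x))).
  set (w1 := fun x => U1 (tt x) * / e - (0 + (th1 (x / xs) * / xs * P (zz x) + th (x / xs) * (Pd (zz x) * j)))).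
  set (w2 := fun x => / e * (- reduced f vs al kap b (U (tt x)) * / e) -
     (/ xs * (th2 (x / xs) * / xs * P (zz x) + th1 (x / xs) * (Pd (zz x) * j))
      + j * (th1 (x / xs) * / xs * Pd (zz x) + th (x / xs) * (Pdd (zz x) * j)))).
  assert (Dw : forall x, is_derive w x (w1 x)).
  { intros x. apply is_derive_R_minus.
    - apply (is_derive_R_comp U tt); [apply DU|apply Dtt].
    - apply is_derive_R_plus; [apply is_derive_R_const|apply DthP]. }
  assert (Dw1 : forall x, is_derive w1 x (w2 x)).
  { intros x. apply is_derive_R_minus.
    - apply (is_derive_ext (fun x => / e * U1 (tt x))); [intros; ring_R|].
      apply is_derive_R_scal. apply (is_derive_R_comp U1 tt); [apply DU1|apply Dtt].
    - apply (is_derive_ext (fun x => / xs * (th1 (x / xs) * P (zz x)) + j * (th (x / xs) * Pd (zz x))));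
        [intros; ring_R|].
      apply is_derive_R_plus; apply is_derive_R_scal.
      + apply (is_derive_R_mult (fun x => th1 (x / xs)) (fun x => P (zz x))).
        * apply (is_derive_R_comp th1 (fun x => x / xs)); [apply T1|apply Dyy].
        * apply (is_derive_R_comp P zz); [apply DP|apply Dzz].
      + apply (is_derive_R_mult (fun x => th (x / xs)) (fun x => Pd (zz x))).
        * apply (is_derive_R_comp th (fun x => x / xs)); [apply T0|apply Dyy].
        * apply (is_derive_R_comp Pd zz); [apply DPd|apply Dzz]. }
  assert (Cyy : forall (g : R -> R) (x : R), (forall y, continuous g y) -> continuous (fun x => g (x / xs)) x).
  { intros g x Hg. apply (continuous_comp (fun x => x / xs) g); [|apply Hg].
    apply (is_derive_continuous _ _ _ (Dyy x)). }
  assert (Czz : forall (g : R -> R) (x : R), (forall y, continuous g y) -> continuous (fun x => g (zz x)) x).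
  { intros g x Hg. apply (continuous_comp zz g); [|apply Hg].
    apply (is_derive_continuous _ _ _ (Dzz x)). }
  assert (cP : forall z, continuous P z) by (intros z; apply (is_derive_continuous _ _ _ (DP z))).
  assert (cPd : forall z, continuous Pd z) by (intros z; apply (is_derive_continuous _ _ _ (DPd z))).
  assert (cth : forall z, continuous th z) by (intros z; apply (is_derive_continuous _ _ _ (T0 z))).
  assert (cth1 : forall z, continuous th1 z) by (intros z; apply (is_derive_continuous _ _ _ (T1 z))).
  assert (CU : forall x, continuous (fun x => reduced f vs al kap b (U (tt x))) x).
  { intros x. apply (continuous_comp (fun x => U (tt x)) (reduced f vs al kap b)).
    - apply (continuous_comp tt U); [apply (is_derive_continuous _ _ _ (Dtt x))|].
      apply (is_derive_continuous _ _ _ (DU (tt x))).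
    - apply (continuous_along f fu fv _ _ _ _ HB (fun s => s) (fun s => vs + b + kap * (al - s))).
      + apply continuous_id.
      + apply (is_derive_continuous _ _ (- kap)). auto_derive; [exact Logic.I|ring]. }
  assert (Cw2 : forall x, continuous w2 x).
  { intros x. apply (continuous_ext (fun x =>
      (- / e ^ 2) * reduced f vs al kap b (U (tt x))
      + (- / xs ^ 2) * (th2 (x / xs) * P (zz x))
      + ((- (2 * j * / xs)) * (th1 (x / xs) * Pd (zz x)) + (- j ^ 2) * (th (x / xs) * Pdd (zz x))))).
    - intros y. unfold w2. change (@eq R
        ((- / e ^ 2) * reduced f vs al kap b (U (tt y))
      + (- / xs ^ 2) * (th2 (y / xs) * P (zz y))
      + ((- (2 * j * / xs)) * (th1 (y / xs) * Pd (zz y)) + (- j ^ 2) * (th (y / xs) * Pdd (zz y)))) (w2 y)).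
      unfold w2. field. lra.
    - apply continuous_sum3.
      + apply (continuous_scal_r (V := R_NormedModule) (- / e ^ 2)). apply CU.
      + apply (continuous_scal_r (V := R_NormedModule) (- / xs ^ 2)).
        apply (continuous_mult (fun x => th2 (x / xs)) (fun x => P (zz x))); auto.
      + apply (continuous_plus (V := R_NormedModule)).
        * apply (continuous_scal_r (V := R_NormedModule) (- (2 * j * / xs))).
          apply (continuous_mult (fun x => th1 (x / xs)) (fun x => Pd (zz x))); auto.
        * apply (continuous_scal_r (V := R_NormedModule) (- j ^ 2)).
          apply (continuous_mult (fun x => th (x / xs)) (fun x => Pdd (zz x))); auto. }
  (* [P0'] is the value of the approximate profile at the layer position, where the slow
     components are matched; there the error of the slow component is [- kap * w]. *)
  set (P0' := al - h - e * hv * b1).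
  set (r := fun x => kap * (- w x + (1 - th (x / xs)) * P0')).
  set (r1 := fun x => kap * (- w1 x + (0 - th1 (x / xs) * / xs) * P0')).
  set (r2 := fun x => kap * (- w2 x + (0 - / xs * (th2 (x / xs) * / xs)) * P0')).
  assert (Dr : forall x, is_derive r x (r1 x)).
  { intros x. apply is_derive_R_scal. apply is_derive_R_plus; [apply is_derive_R_opp, Dw|].
    apply (is_derive_eq _ _ ((0 - th1 (x / xs) * / xs) * P0' + (1 - th (x / xs)) * 0)); [|ring].
    apply (is_derive_R_mult (fun x => 1 - th (x / xs)) (fun _ => P0')); [|apply is_derive_R_const].
    apply is_derive_R_minus; [apply is_derive_R_const|].
    apply (is_derive_R_comp th (fun x => x / xs)); [apply T0|apply Dyy]. }
  assert (Dr1 : forall x, is_derive r1 x (r2 x)).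
  { intros x. apply is_derive_R_scal. apply is_derive_R_plus; [apply is_derive_R_opp, Dw1|].
    apply (is_derive_eq _ _ ((0 - / xs * (th2 (x / xs) * / xs)) * P0' + (0 - th1 (x / xs) * / xs) * 0)); [|ring].
    apply (is_derive_R_mult (fun x => 0 - th1 (x / xs) * / xs) (fun _ => P0')); [|apply is_derive_R_const].
    apply is_derive_R_minus; [apply is_derive_R_const|].
    apply (is_derive_ext (fun x => / xs * th1 (x / xs))); [intros; ring_R|].
    apply is_derive_R_scal.
    apply (is_derive_R_comp th1 (fun x => x / xs)); [apply T1|apply Dyy]. }
  assert (Cr2 : forall x, continuous r2 x).
  { intros x. apply (continuous_ext (fun x => (- kap) * w2 x + (- (kap * P0' * / xs * / xs)) * th2 (x / xs))).
    - intros y. unfold r2. ring_R.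
    - apply (continuous_plus (V := R_NormedModule)).
      + apply (continuous_scal_r (V := R_NormedModule) (- kap)). apply Cw2.
      + apply (continuous_scal_r (V := R_NormedModule) (- (kap * P0' * / xs * / xs))).
        now apply Cyy. }
  assert (Hz0 : zz 0 = - (1 / e)) by (unfold zz; field; lra).
  assert (Ht0 : tt 0 = - L) by (unfold tt, xs; field; lra).
  assert (HzS : zz xs = 0) by (unfold zz; field; lra).
  assert (HtS : tt xs = 0) by (unfold tt; field; lra).
  assert (HyS : xs / xs = 1) by (field; lra).
  assert (Hy0 : 0 / xs = 0) by (field; lra).
  assert (HPat0 : P 0 = P0').
  { unfold P, P0'. rewrite (prof_0 HP), (first_0 HF). ring. }
  assert (Eb : e * b1 = b) by (unfold b1; field; lra).
  assert (Hw10 : w1 0 = 0).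
  { unfold w1. rewrite Ht0, Hy0, (proj2 (half_left HO)).
    destruct (Tlo 0 ltac:(lra)) as [-> ->]. ring. }
  assert (HwS : w xs = 0).
  { unfold w. rewrite HtS, HyS, HzS, HPat0, (half_0 HO).
    destruct (Thi 1 ltac:(lra)) as [-> _]. unfold P0'. ring. }
  exists w, w1, w2, r, r1, r2.
  split; [split; [exact Dw|split; [exact Dw1|exact Cw2]]|].
  split; [split; [exact Dr|split; [exact Dr1|exact Cr2]]|].
  split; [exact Hw10|].
  split; [unfold r1; rewrite Hw10, Hy0; destruct (Tlo 0 ltac:(lra)) as [_ ->]; ring|].
  split; [exact HwS|].
  split; [unfold r; rewrite HwS, HyS; destruct (Thi 1 ltac:(lra)) as [-> _]; ring|].
  intros x Hx.
  assert (Hy : 0 <= x / xs <= 1).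
  { split; [apply Rdiv_le_0_compat; lra|apply div_le; lra]. }
  assert (Hz : - (1 / e) <= zz x <= 0).
  { replace (zz x) with (- (1 / e) + x / xs * / e) by (unfold zz; field; lra).
    assert (0 < / e) by (apply Rinv_0_lt_compat; lra).
    assert (0 <= x / xs * / e <= 1 / e).
    { unfold Rdiv at 2. split; [apply Rmult_le_pos; lra|apply Rmult_le_compat_r; lra]. } lra. }
  destruct (Tin (x / xs) Hy) as [Eth [Hth01 [HT1 HT2]]].
  assert (Eq0 : w x = U ((x - xs) / e) - U_minus hf vs theta phi0 phi1 e b1 x1 (x / xs)).
  { unfold w, U_minus. rewrite Eth, Hhf. fold (tt x) (zz x) hv. unfold P.
    rewrite (Hpsi (zz x)), (Hchi (zz x)) by lra. ring. }
  assert (Ephi0 : phi0 0 = al - h).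
  { rewrite <- (Hpsi 0) by lra. apply (prof_0 HP). }
  assert (Ephi1 : phi1 b1 x1 0 = - hv * b1).
  { rewrite <- (Hchi 0) by lra. apply (first_0 HF). }
  assert (Eq1 : r x = vs + b + kap * (al - U ((x - xs) / e))
              - V_minus Dif vs theta phi0 phi1 e b1 x1 (x / xs)).
  { unfold r, w, V_minus, P. rewrite Eth. fold (tt x) (zz x).
    rewrite (Hpsi (zz x)), (Hchi (zz x)), Ephi0, Ephi1 by lra. rewrite Eb.
    unfold P0', kap. field. exact HDif. }
  split; [exact Eq0|]. split; [exact Eq1|].
  destruct (Hin (zz x) Hz) as [B0 [B1 B2]]. rewrite <- Ett in B0, B1, B2.
  fold (P (zz x)) in B0. fold (Pd (zz x)) in B1. fold (Pdd (zz x)) in B2.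
  set (B := C0 * e ^ 2) in *. assert (HBp : 0 <= B) by (unfold B; signs).
  (* Where the cut-off is not one the argument [zz x] is beyond [- 1 / (4 * e)], so all terms that
     the cut-off creates contain a profile that is already [O(e ^ 2)]. *)
  assert (Outer : Rabs ((1 - th (x / xs)) * P (zz x)) <= B /\ Rabs ((1 - th (x / xs)) * Pd (zz x)) <= B /\
     Rabs ((1 - th (x / xs)) * Pdd (zz x)) <= B /\ Rabs (th1 (x / xs) * P (zz x)) <= CT * B /\
     Rabs (th1 (x / xs) * Pd (zz x)) <= CT * B /\ Rabs (th2 (x / xs) * P (zz x)) <= CT * B).
  { assert (HCB : 0 <= CT * B) by signs.
    destruct (Rlt_le_dec (3 / 4) (x / xs)) as [hy|hy].
    - destruct (Thi _ hy) as [-> [-> ->]]. rewrite Rminus_diag, !Rmult_0_l, Rabs_R0. lra.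
    - assert (Hzt : zz x <= - (1 / (4 * e))).
      { unfold zz. apply div_le; [lra|]. replace (- (1 / (4 * e)) * e) with (- (1 / 4)) by (field; lra). lra. }
      destruct (Htail (zz x) Hzt) as [G0 [G1 G2]].
      fold (P (zz x)) in G0. fold (Pd (zz x)) in G1. fold (Pdd (zz x)) in G2. fold B in G0, G1, G2.
      assert (One : forall g, Rabs g <= B -> Rabs ((1 - th (x / xs)) * g) <= B).
      { intros g Hg. rewrite Rabs_mult, (Rabs_pos_eq (1 - th (x / xs))) by lra.
        apply contract_le; [lra|apply Rabs_pos|lra]. }
      assert (Two : forall t g, Rabs t <= CT -> Rabs g <= B -> Rabs (t * g) <= CT * B).
      { intros t g Ht Hg. rewrite Rabs_mult. apply Rmult_le_compat; try apply Rabs_pos; assumption. }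
      repeat split; auto. }
  destruct Outer as [O0 [O1 [O2 [O3 [O4 O5]]]]].
  assert (Ehb : Rabs (e * hv * b1) <= Rabs hv * K * e ^ 2).
  { replace (e * hv * b1) with (hv * b) by (rewrite <- Eb; ring). rewrite Rabs_mult, Rmult_assoc.
    apply Rmult_le_compat_l; [apply Rabs_pos|exact Hb]. }
  assert (Bw : Rabs (w x) <= (2 * C0 + Rabs hv * K) * e ^ 2).
  { replace (w x) with ((U (tt x) - h - P (zz x)) + (1 - th (x / xs)) * P (zz x) - e * hv * b1)
      by (unfold w; ring).
    apply Rabs_le_between in B0, O0, Ehb. apply Rabs_le. unfold B in *. lra. }
  assert (He1 : 0 < e <= 1) by lra.
  assert (Scale : forall g G, 0 <= G -> Rabs g <= G -> Rabs (/ xs * g) <= I * G).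
  { intros g G HG Hg. rewrite Rabs_mult, (Rabs_pos_eq (/ xs)) by lra.
    apply Rmult_le_compat; try apply Rabs_pos; lra. }
  assert (Bw1 : Rabs (e * w1 x) <= (2 * C0 + CT * C0) * I * e ^ 2).
  { replace (e * w1 x) with (/ xs * ((xs * U1 (tt x) - Pd (zz x)) + (1 - th (x / xs)) * Pd (zz x)
         - e * (th1 (x / xs) * P (zz x)))) by (unfold w1, j; field; lra).
    apply Rle_trans with (I * (2 * B + CT * B)).
    - apply Scale; [signs|]. assert (Q : Rabs (e * (th1 (x / xs) * P (zz x))) <= CT * B).
      { rewrite Rabs_mult, (Rabs_pos_eq e) by lra. apply contract_le; [lra|apply Rabs_pos|lra]. }
      apply Rabs_le_between in B1, O1, Q. apply Rabs_le. lra.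
    - unfold B. right. ring. }
  assert (Bw2 : Rabs (e ^ 2 * w2 x) <= (2 * C0 + 3 * CT * C0) * I ^ 2 * e ^ 2).
  { replace (e ^ 2 * w2 x) with (/ xs * (/ xs * ((- (xs ^ 2 * reduced f vs al kap b (U (tt x))) - Pdd (zz x))
         + (1 - th (x / xs)) * Pdd (zz x) - e ^ 2 * (th2 (x / xs) * P (zz x))
         - 2 * (e * (th1 (x / xs) * Pd (zz x)))))) by (unfold w2, j; field; lra).
    apply Rle_trans with (I * (I * (2 * B + 3 * (CT * B)))).
    - assert (G0 : 0 <= 2 * B + 3 * (CT * B)) by signs.
      apply Scale; [signs|]. apply Scale; [exact G0|].
      assert (Q : Rabs (e * (th1 (x / xs) * Pd (zz x))) <= CT * B).
      { rewrite Rabs_mult, (Rabs_pos_eq e) by lra. apply contract_le; [lra|apply Rabs_pos|lra]. }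
      assert (Q2 : Rabs (e ^ 2 * (th2 (x / xs) * P (zz x))) <= CT * B).
      { rewrite Rabs_mult, (Rabs_pos_eq (e ^ 2)) by lra. apply contract_le; [lra|apply Rabs_pos|lra]. }
      apply Rabs_le_between in B2, O2, Q, Q2. apply Rabs_le. lra.
    - unfold B. right. ring. }
  assert (Up : forall q, 0 <= q -> q <= Cw -> q * e ^ 2 <= (Cw + Cr) * e ^ 2).
  { intros q Hq0 Hq. apply Rmult_le_compat_r; lra. }
  assert (HP0' : Rabs P0' <= Pm).
  { assert (Rabs hv * K * e ^ 2 <= Rabs hv * K * 1) by (apply Rmult_le_compat_l; lra).
    apply Rabs_le_between in Ehb. apply Rabs_le. unfold P0', Pm. lra. }
  assert (Tail : forall g G, 0 <= G -> Rabs g <= G -> G <= Cw + Pm + CT * I * Pm + CT * I ^ 2 * Pm ->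
            Rabs (kap * g) <= (Cw + Cr) * e ^ 2).
  { intros g G HG Hg HG2. rewrite Rabs_mult.
    apply Rle_trans with (K * e ^ 2 * (Cw + Pm + CT * I * Pm + CT * I ^ 2 * Pm)).
    - apply Rmult_le_compat; try apply Rabs_pos; lra.
    - assert (0 <= Cw * e ^ 2) by signs. unfold Cr. lra. }
  assert (Bw' : Rabs (w x) <= Cw).
  { eapply Rle_trans; [exact Bw|]. 
    apply Rle_trans with ((2 * C0 + Rabs hv * K) * 1); [apply Rmult_le_compat_l; lra|unfold Cw; lra]. }
  assert (Bw1' : Rabs (w1 x) <= Cw).
  { rewrite Rabs_mult, (Rabs_pos_eq e) in Bw1 by lra.
    apply (Rmult_le_reg_l e); [lra|]. eapply Rle_trans; [exact Bw1|].
    apply Rle_trans with ((2 * C0 + CT * C0) * I * e); [apply Rmult_le_compat_l; [signs|apply sq_le_self; lra]|].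
    rewrite Rmult_comm. apply Rmult_le_compat_l; [lra|unfold Cw; lra]. }
  assert (Bw2' : Rabs (w2 x) <= Cw).
  { rewrite Rabs_mult, (Rabs_pos_eq (e ^ 2)) in Bw2 by lra.
    apply (Rmult_le_reg_l (e ^ 2)); [lra|]. eapply Rle_trans; [exact Bw2|].
    rewrite Rmult_comm. apply Rmult_le_compat_l; [lra|unfold Cw; lra]. }
  assert (TP : forall t G, 0 <= G -> Rabs t <= G -> Rabs (t * P0') <= G * Pm).
  { intros t G HG Ht. rewrite Rabs_mult. apply Rmult_le_compat; try apply Rabs_pos; assumption. }
  split; [eapply Rle_trans; [exact Bw|apply Up; [lra|unfold Cw; lra]]|].
  split; [eapply Rle_trans; [exact Bw1|apply Up; [lra|unfold Cw; lra]]|].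
  split; [eapply Rle_trans; [exact Bw2|apply Up; [lra|unfold Cw; lra]]|].
  split; [|split].
  - apply (Tail _ (Cw + 1 * Pm)); [lra| |lra]. eapply Rle_trans; [apply Rabs_triang|].
    rewrite Rabs_Ropp. apply Rplus_le_compat; [exact Bw'|]. apply TP; [lra|].
    rewrite Rabs_pos_eq; lra.
  - apply (Tail _ (Cw + CT * I * Pm)); [lra| |lra]. eapply Rle_trans; [apply Rabs_triang|].
    rewrite Rabs_Ropp. apply Rplus_le_compat; [exact Bw1'|]. apply TP; [signs|].
    rewrite Rminus_0_l, Rabs_Ropp, Rmult_comm, (Rmult_comm CT). apply Scale; assumption.
  - apply (Tail _ (Cw + CT * I ^ 2 * Pm)); [lra| |lra]. eapply Rle_trans; [apply Rabs_triang|].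
    rewrite Rabs_Ropp. apply Rplus_le_compat; [exact Bw2'|]. apply TP; [signs|].
    rewrite Rminus_0_l, Rabs_Ropp. replace (CT * I ^ 2) with (I * (I * CT)) by ring.
    apply Scale; [signs|]. rewrite Rmult_comm. now apply Scale.
Qed.
End HalfLayer.

(** * The position of the layer *)

(** The profile lies below an exponential, so that its integrals over bounded intervals converge
    at an exponential rate. *)
Lemma profile_integral (f : R -> R -> R) (vs M h al s0 k : R) (psi psi1 psi2 phi : R -> R) :
  h < al -> profile_facts f vs M h al s0 psi psi1 psi2 k ->
  (forall z, z <= 0 -> psi z = phi z) ->
  exists I0, is_RInt_gen phi (Rbar_locally m_infty) (at_point 0) I0 /\
    forall T, 0 <= T -> Rabs (RInt psi (- T) 0 - I0) <= (al - h) / k * exp (- (k * T)).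
Proof.
  intros Hal HP Hphi. assert (Hk := prof_k HP).
  destruct (prof_C2 HP) as [P0 [P1 _]].
  assert (Cp : forall z, continuous psi z) by (intros z; apply (is_derive_continuous _ _ _ (P0 z))).
  assert (Cp1 : forall z, continuous psi1 z) by (intros z; apply (is_derive_continuous _ _ _ (P1 z))).
  assert (Hpos : forall z, z <= 0 -> 0 < psi z) by apply (prof_range HP).
  assert (Piece : forall x y, x <= y <= 0 -> 0 <= RInt psi x y <= psi y / k).
  { intros x y Hxy. split.
    - apply RInt_ge_0; [lra|now apply ex_RInt_cont|]. intros z Hz. left. apply Hpos. lra.
    - assert (E : RInt psi1 x y = psi y - psi x).
      { apply is_RInt_unique. apply (is_RInt_derive (V := R_CompleteNormedModule) psi); intros; auto. }
      apply le_div; [exact Hk|]. rewrite Rmult_comm.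
      apply Rle_trans with (RInt psi1 x y).
      + replace (k * RInt psi x y) with (RInt (fun z => k * psi z) x y).
        * apply RInt_le; [lra| |now apply ex_RInt_cont|].
          -- apply ex_RInt_cont. intros z. now apply (continuous_scal_r (V := R_NormedModule) k psi).
          -- intros z Hz. apply (prof_speed HP). lra.
        * apply (RInt_scal (V := R_CompleteNormedModule)). now apply ex_RInt_cont.
      + rewrite E. generalize (Hpos x ltac:(lra)). lra. }
  set (J := fun T => RInt psi (- T) 0).
  set (tl := fun T => (al - h) / k * exp (- (k * T))).
  assert (Hstep : forall T T', 0 <= T <= T' -> J T <= J T' <= J T + tl T).
  { intros T T' HT. assert (C := RInt_Chasles_R psi (- T') (- T) 0 Cp).
    destruct (Piece (- T') (- T) ltac:(lra)) as [B1 B2].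
    assert (D := prof_decay HP (- T) ltac:(lra)).
    assert (B3 : psi (- T) / k <= tl T).
    { apply div_le; [exact Hk|]. unfold tl. replace ((al - h) / k * exp (- (k * T)) * k)
        with ((al - h) * exp (- (k * T))) by (field; lra).
      replace (- (k * T)) with (k * - T) by ring. exact D. }
    unfold J. lra. }
  destruct (completeness (fun y => exists T, 0 <= T /\ y = J T)) as [I0 [HI1 HI2]].
  { exists (J 0 + tl 0). intros y [T [HT ->]]. apply Hstep. lra. }
  { exists (J 0), 0. split; [lra|reflexivity]. }
  assert (Hlim : forall T, 0 <= T -> J T <= I0 <= J T + tl T).
  { intros T HT. split.
    - apply HI1. now exists T.
    - apply HI2. intros y [T' [HT' ->]]. destruct (Rle_dec T T') as [hT|hT].
      + apply Hstep. lra.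
      + destruct (Hstep T' T ltac:(lra)) as [B _].
        assert (0 < tl T).
        { unfold tl. apply Rmult_lt_0_compat; [apply Rdiv_lt_0_compat; lra|apply exp_pos]. } lra. }
  assert (Hfin : forall T, 0 <= T -> Rabs (J T - I0) <= tl T).
  { intros T HT. specialize (Hlim T HT). apply Rabs_le.
    assert (0 < tl T).
    { unfold tl. apply Rmult_lt_0_compat; [apply Rdiv_lt_0_compat; lra|apply exp_pos]. } lra. }
  exists I0. split; [|exact Hfin].
  intros Pr [eps Heps].
  set (c := (al - h) / k). assert (Hc : 0 < c) by (apply Rdiv_lt_0_compat; lra).
  assert (He := cond_pos eps). assert (Hce : 0 < c / eps) by (apply Rdiv_lt_0_compat; lra).
  set (T0 := ln (1 + c / eps) / k).
  assert (HT0 : 0 <= T0).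
  { apply Rdiv_le_0_compat; [|exact Hk]. rewrite <- ln_1. left. apply ln_increasing; lra. }
  assert (Htl : forall T, T0 <= T -> tl T < eps).
  { intros T HT. apply Rle_lt_trans with (c * exp (- ln (1 + c / eps))).
    - unfold tl. fold c. apply Rmult_le_compat_l; [lra|].
      assert (k * T0 <= k * T) by (apply Rmult_le_compat_l; lra).
      assert (k * T0 = ln (1 + c / eps)) by (unfold T0; field; lra).
      apply exp_le. lra.
    - rewrite exp_Ropp, exp_ln by lra. change (c / (1 + c / eps) < eps).
      apply Rlt_div_l; [lra|]. replace (eps * (1 + c / eps)) with (eps + c) by (field; lra). lra. }
  apply (Filter_prod _ _ _ (fun x => x < - T0) (fun y => y = 0)).
  - exists (- T0). auto.
  - reflexivity.
  - intros x y Hx ->. simpl. exists (RInt psi x 0). split.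
    + apply (is_RInt_ext psi).
      * intros z Hz. rewrite Rmin_left, Rmax_right in Hz by lra. apply Hphi. lra.
      * apply (RInt_correct (V := R_CompleteNormedModule)). now apply ex_RInt_cont.
    + apply Heps. change (Rabs (RInt psi x 0 - I0) < eps).
      assert (B := Hfin (- x) ltac:(lra)). unfold J in B. rewrite Ropp_involutive in B.
      eapply Rle_lt_trans; [exact B|]. apply Htl. lra.
Qed.

Lemma is_RInt_gen_reflect (phi : R -> R) (I0 : R) :
  is_RInt_gen (fun z => - phi (- z)) (Rbar_locally m_infty) (at_point 0) I0 ->
  is_RInt_gen phi (at_point 0) (Rbar_locally p_infty) (- I0).
Proof.
  intros H Pr HPr.
  assert (HP' : locally I0 (fun y => Pr (- y))).
  { destruct HPr as [eps Heps]. exists eps. intros y Hy. apply Heps.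
    change (Rabs (- y - - I0) < eps). change (Rabs (y - I0) < eps) in Hy.
    replace (- y - - I0) with (- (y - I0)) by ring. now rewrite Rabs_Ropp. }
  destruct (H _ HP') as [Q R0 [Z HZ] HR HQR].
  apply (Filter_prod _ _ _ (fun x => x = 0) (fun y => - Z < y)).
  - reflexivity.
  - exists (- Z). auto.
  - intros x y -> Hy. destruct (HQR (- y) 0 (HZ (- y) ltac:(lra)) HR) as [l [Hl Hp]]. simpl in *.
    exists (- l). split; [|exact Hp].
    apply (is_RInt_swap (V := R_NormedModule)) in Hl.
    replace 0 with (- 0) in Hl by ring.
    apply (is_RInt_comp_opp (V := R_NormedModule)) in Hl.
    apply (is_RInt_ext (fun z => opp (- phi (- - z)))); [|exact Hl].
    intros z _. unfold opp; simpl. rewrite !Ropp_involutive. reflexivity.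
Qed.

Lemma half_decay (f : R -> R -> R) (vs al k b c a L h e : R) (U U1 : R -> R) :
  half_orbit f vs al k b c a L U U1 -> 0 < c -> Rabs (a - h) <= e -> e <= 1 ->
  forall t, - L <= t <= 0 -> Rabs (U t - h) <= e + (al - h + 1) * exp (c * t).
Proof.
  intros HO Hc Ha He t Ht.
  assert (Ha' := proj1 (Rabs_le_between _ _) Ha).
  assert (B := exp_comparison (fun x => U x - a) U1 c t (proj2 Ht)).
  assert (B' : U t - a <= (U 0 - a) * exp (c * t)).
  { apply B.
    - intros x. apply (is_derive_eq _ _ (U1 x - 0)); [|ring].
      apply is_derive_R_minus; [apply (half_U HO)|apply is_derive_R_const].
    - intros x Hx. apply (half_speed HO). lra. }
  rewrite (half_0 HO) in B'.
  assert (R := half_range HO t Ht).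
  assert (E := exp_pos (c * t)).
  assert ((al - a) * exp (c * t) <= (al - h + 1) * exp (c * t)) by (apply Rmult_le_compat_r; lra).
  apply Rabs_le. lra.
Qed.

(** The end value contributes at most [e * L <= 1], the layer itself the integral of an
    exponential whose rate does not depend on [e]. *)
Lemma half_mass_coarse (f : R -> R -> R) (vs al k b c a L h e : R) (U U1 : R -> R) :
  half_orbit f vs al k b c a L U U1 -> 0 < c -> Rabs (a - h) <= e -> 0 < e <= 1 -> L <= 1 / e ->
  Rabs (RInt (fun t => U t - h) (- L) 0) <= (al - h + 1) / c + 1.
Proof.
  intros HO Hc Ha He HLe.
  assert (Ha' := proj1 (Rabs_le_between _ _) Ha).
  assert (HL := half_L HO).
  assert (DU := half_U HO). assert (DU1 := half_U1 HO).
  assert (CU : forall t, continuous U t) by (intros t; apply (is_derive_continuous _ _ _ (DU t))).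
  assert (CU1 : forall t, continuous U1 t) by (intros t; apply (is_derive_continuous _ _ _ (DU1 t))).
  assert (R := half_range HO).
  assert (CUa : forall r t, continuous (fun t => U t - r) t).
  { intros r t. apply (continuous_minus (V := R_NormedModule) U (fun _ => r)); [apply CU|apply continuous_const]. }
  assert (B1 : 0 <= RInt (fun t => U t - a) (- L) 0).
  { apply RInt_ge_0; [lra|now apply ex_RInt_cont|]. intros t Ht. specialize (R t ltac:(lra)). lra. }
  assert (E : RInt U1 (- L) 0 = al - a).
  { apply is_RInt_unique. rewrite <- (half_0 HO).
    rewrite <- (proj1 (half_left HO)).
    apply (is_RInt_derive (V := R_CompleteNormedModule) U); intros; auto. }
  assert (B2 : RInt (fun t => U t - a) (- L) 0 <= (al - a) / c).
  { apply le_div; [exact Hc|]. rewrite <- E, Rmult_comm.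
    replace (c * RInt (fun t => U t - a) (- L) 0) with (RInt (fun t => c * (U t - a)) (- L) 0).
    - apply RInt_le; [lra| |now apply ex_RInt_cont|].
      + apply ex_RInt_cont. intros t. now apply (continuous_scal_r (V := R_NormedModule) c (fun t => U t - a)).
      + intros t Ht. apply (half_speed HO). lra.
    - apply (RInt_scal (V := R_CompleteNormedModule)). now apply ex_RInt_cont. }
  assert (E2 : RInt (fun t => U t - h) (- L) 0 = RInt (fun t => U t - a) (- L) 0 + L * (a - h)).
  { rewrite (RInt_ext (fun t => U t - h) (fun t => plus (U t - a) (a - h))).
    - rewrite (RInt_plus (V := R_CompleteNormedModule));
        [|now apply ex_RInt_cont|apply ex_RInt_cont; intros; apply continuous_const].
      rewrite RInt_const_R. unfold plus; simpl. f_equal. ring.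
    - intros t _. unfold plus; simpl. ring_R. }
  assert (B3 : Rabs (L * (a - h)) <= 1).
  { rewrite Rabs_mult, (Rabs_pos_eq L) by lra.
    apply Rle_trans with (1 / e * e); [apply Rmult_le_compat; try apply Rabs_pos; lra|right; field; lra]. }
  assert (B4 : (al - a) / c <= (al - h + 1) / c).
  { unfold Rdiv. apply Rmult_le_compat_r; [left; now apply Rinv_0_lt_compat|lra]. }
  rewrite E2. apply Rabs_le_between in B3. apply Rabs_le. lra.
Qed.

Section HalfMass.
Variables (f fu fv : R -> R -> R) (lo hi vs M h al s0 : R) (phi0 : R -> R).
Hypothesis HB : C2box f fu fv lo hi vs M.
Hypothesis Hlo : lo + 1 <= h.
Hypothesis Hal : h < al.
Hypothesis Hhi : al + 1 <= hi.
Hypothesis Hf : f h vs = 0.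
Hypothesis Hu : fu h vs < 0.
Hypothesis Hpot : forall u, h < u <= al -> RInt (fun s => f s vs) h u < 0.
Hypothesis Hs0 : 0 < s0.
Hypothesis Hphi0 : profile0_minus f (fun _ => h) vs s0 al phi0.

(** The pointwise distance [O (e ^ 2)] over a time of order [1 / e] leaves an error [O (e)]
    in the excess mass. *)
Lemma half_mass (K c cL : R) :
  0 <= K -> 0 < c -> 0 < cL ->
  exists I0 C, 0 <= C /\ is_RInt_gen phi0 (Rbar_locally m_infty) (at_point 0) I0 /\
    small (fun e => forall k b a L U U1,
      Rabs k <= K * e ^ 2 -> Rabs b <= K * e ^ 2 -> Rabs (a - h) <= e -> cL / e <= L <= 1 / e ->
      half_orbit f vs al k b c a L U U1 ->
      Rabs (RInt (fun t => U t - h) (- L) 0 - s0 * I0) <= C * e).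
Proof.
  intros HK Hc HcL.
  destruct (profile_analysis f fu fv lo hi vs M h al HB Hlo Hal Hhi Hf Hu Hpot s0 phi0 Hs0 Hphi0)
    as [psi [psi1 [psi2 [kp [HP Hpsi]]]]].
  assert (HQ := profile_normalize f vs M h al s0 kp psi psi1 psi2 Hs0 HP).
  destruct (half_orbit_close f fu fv lo hi vs M h al HB Hlo Hal Hhi Hf Hu _ _ _ _ HQ K c cL HK Hc HcL)
    as [C0 [HC0 Hclose]].
  destruct (profile_integral f vs M h al s0 kp psi psi1 psi2 phi0 Hal HP Hpsi) as [I0 [HI0 Htail]].
  assert (Hk := prof_k HP).
  set (C1 := s0 * ((al - h) / kp) * (4 / (kp * cL / s0) ^ 2)).
  assert (Hkc : 0 < kp * cL / s0) by (apply Rdiv_lt_0_compat; nra).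
  assert (Hkc2 : 0 < (kp * cL / s0) ^ 2) by (apply pow_lt; lra).
  assert (HC1 : 0 <= C1).
  { unfold C1. apply Rmult_le_pos; [apply Rmult_le_pos; [lra|]|]; apply Rdiv_le_0_compat; lra. }
  exists I0, (C0 + C1). split; [lra|]. split; [exact HI0|].
  destruct Hclose as [e0 [He0 Hclose]]. exists (Rmin e0 1). split; [apply Rmin_pos; lra|].
  intros e He. assert (m1 := Rmin_l e0 1). assert (m2 := Rmin_r e0 1).
  intros k b a L U U1 Hkb Hb Ha HL HO.
  assert (HLpos := half_L HO).
  assert (DU := half_U HO).
  assert (CU : forall t, continuous (fun t => U t - h) t).
  { intros t. apply (continuous_minus (V := R_NormedModule) U (fun _ => h)); [|apply continuous_const].
    apply (is_derive_continuous _ _ _ (DU t)). }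
  destruct (prof_C2 HP) as [P0 _].
  assert (Cp : forall z, continuous psi z) by (intros z; apply (is_derive_continuous _ _ _ (P0 z))).
  assert (Cq : forall t, continuous (fun t => psi (t / s0)) t).
  { intros t. apply (continuous_comp (fun t => t / s0) psi); [|apply Cp].
    apply (is_derive_continuous _ _ (/ s0)). auto_derive; [exact I|ring]. }
  assert (B1 : Rabs (RInt (fun t => U t - h) (- L) 0 - RInt (fun t => psi (t / s0)) (- L) 0)
               <= (0 - - L) * (C0 * e ^ 2)).
  { apply RInt_abs_diff_le; [lra|exact CU|exact Cq|]. intros t Ht.
    apply (Hclose e ltac:(lra) k b a L U U1); try assumption; lra. }
  assert (B2 : (0 - - L) * (C0 * e ^ 2) <= C0 * e).
  { apply Rle_trans with (1 / e * (C0 * e ^ 2)).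
    - apply Rmult_le_compat_r; [apply Rmult_le_pos; [lra|apply pow2_ge_0]|lra].
    - right. field. lra. }
  assert (E : RInt (fun t => psi (t / s0)) (- L) 0 = s0 * RInt psi (- (L / s0)) 0).
  { assert (E1 := RInt_comp_lin psi (/ s0) 0 (- L) 0).
    replace (/ s0 * - L + 0) with (- (L / s0)) in E1 by (field; lra).
    replace (/ s0 * 0 + 0) with 0 in E1 by ring.
    rewrite <- E1 by now apply ex_RInt_cont.
    rewrite (RInt_ext (fun y => scal (/ s0) (psi (/ s0 * y + 0))) (fun y => scal (/ s0) (psi (y / s0)))).
    - rewrite (RInt_scal (V := R_CompleteNormedModule)) by now apply ex_RInt_cont.
      unfold scal; simpl; unfold mult; simpl.
      match goal with |- ?x = _ => generalize (x : R) end. intros y.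
      change (@eq R y (s0 * (/ s0 * y))). field. lra.
    - intros t _. do 2 f_equal. unfold Rdiv. ring. }
  assert (HLs : 0 <= L / s0) by (apply Rdiv_le_0_compat; lra).
  assert (B3 := Htail (L / s0) HLs).
  assert (B4 : exp (- (kp * (L / s0))) <= 4 / (kp * cL / s0) ^ 2 * e ^ 2).
  { assert (S : kp * cL / s0 / e <= kp * (L / s0)).
    { replace (kp * cL / s0 / e) with (kp / s0 * (cL / e)) by (field; lra).
      replace (kp * (L / s0)) with (kp / s0 * L) by (field; lra).
      apply Rmult_le_compat_l; [apply Rdiv_le_0_compat; lra|lra]. }
    assert (S5 : 0 < kp * cL / s0 / e) by (apply Rdiv_lt_0_compat; lra).
    apply Rle_trans with (exp (- (kp * cL / s0 / e))).
    - apply exp_le. lra.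
    - eapply Rle_trans; [apply exp_neg_le; exact S5|]. right. field. repeat split; lra. }
  assert (B5 : Rabs (s0 * RInt psi (- (L / s0)) 0 - s0 * I0) <= C1 * e).
  { replace (s0 * RInt psi (- (L / s0)) 0 - s0 * I0) with (s0 * (RInt psi (- (L / s0)) 0 - I0)) by ring.
    rewrite Rabs_mult, (Rabs_pos_eq s0) by lra.
    apply Rle_trans with (s0 * ((al - h) / kp * (4 / (kp * cL / s0) ^ 2 * e ^ 2))).
    - apply Rmult_le_compat_l; [lra|]. eapply Rle_trans; [exact B3|].
      apply Rmult_le_compat_l; [apply Rdiv_le_0_compat; lra|exact B4].
    - replace (s0 * ((al - h) / kp * (4 / (kp * cL / s0) ^ 2 * e ^ 2))) with (C1 * e ^ 2) by (unfold C1; ring).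
      apply Rmult_le_compat_l; nra. }
  rewrite E in B1. apply Rabs_le_between in B1, B5. apply Rabs_le. lra.
Qed.
End HalfMass.

Section Position.
Variables (f : R -> R -> R) (hm hp vs al xi k c e a d b L R1 : R) (U U1 : R -> R).
Hypothesis HO : layer_orbit f hm hp vs al xi k c e a d b L R1 U U1.
Hypothesis Hal : hm < al < hp.
Hypothesis Hc : 0 < c.

Let DU := orbit_U HO.
Let DU1 := orbit_U1 HO.

Lemma layer_monotone (x y : R) : - L <= x -> x <= y -> y <= R1 -> U x <= U y.
Proof.
  intros Hx Hxy Hy. apply (nondecreasing_of_derive U U1); [exact Hxy|intros; apply DU|].
  intros t Ht. eapply Rle_trans; [|apply (orbit_speed HO); lra].
  assert (R := orbit_range HO t).
  apply Rmult_le_pos; [lra|]. apply Rmult_le_pos; lra.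
Qed.

Lemma left_half : e <= (hp - al) / 2 ->
  half_orbit f vs al k b (c * ((hp - al) / 2)) a L U U1.
Proof.
  intros He. assert (Hd := proj1 (Rabs_le_between _ _) (orbit_d HO)).
  assert (HL := orbit_L HO).
  assert (HR := orbit_R HO).
  assert (U0 := orbit_0 HO).
  assert (Hup : forall t, - L <= t <= 0 -> a <= U t <= al).
  { intros t Ht. split; [apply (orbit_range HO)|].
    rewrite <- U0. apply layer_monotone; lra. }
  split; try assumption.
  - exact (orbit_left HO).
  - intros t Ht. eapply Rle_trans; [|apply (orbit_speed HO); lra].
    specialize (Hup t Ht). rewrite Rmult_assoc. apply Rmult_le_compat_l; [lra|].
    rewrite Rmult_comm. apply Rmult_le_compat_l; lra.
  - rewrite (orbit_energy HO 0), U0. reflexivity.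
Qed.

Lemma reduced_reflect (s : R) :
  reduced (reflect f) vs (- al) (- k) b s = - reduced f vs al k b (- s).
Proof. unfold reduced, reflect. do 2 f_equal. ring. Qed.

(** Time reversal and the reflection of [u] exchange the halves; the slow variable increases with
    the reflected fast one, which changes the sign of [k]. *)
Lemma right_half : (forall x, continuous (reduced f vs al k b) x) -> e <= (al - hm) / 2 ->
  half_orbit (reflect f) vs (- al) (- k) b (c * ((al - hm) / 2)) (- d) R1
    (fun t => - U (- t)) (fun t => U1 (- t)).
Proof.
  intros Hcont He. assert (Ha := proj1 (Rabs_le_between _ _) (orbit_a HO)).
  assert (HL := orbit_L HO).
  assert (HR := orbit_R HO).
  assert (U0 := orbit_0 HO).
  destruct (orbit_right HO) as [Ud U1d].
  assert (Hup : forall t, - R1 <= t <= 0 -> - d <= - U (- t) <= - al).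
  { intros t Ht. assert (R := orbit_range HO (- t)).
    split; [lra|]. apply Ropp_le_contravar. rewrite <- U0. apply layer_monotone; lra. }
  split; try assumption.
  - intros t. apply (is_derive_eq _ _ (- - U1 (- t))); [|ring].
    apply is_derive_R_opp. apply (is_derive_reflect U). apply DU.
  - intros t. rewrite reduced_reflect, Ropp_involutive, Ropp_involutive.
    apply (is_derive_eq _ _ (- - reduced f vs al k b (U (- t)))); [|ring].
    apply (is_derive_reflect U1). apply DU1.
  - rewrite Ropp_involutive, Ud, U1d. split; reflexivity.
  - rewrite Ropp_0, U0. reflexivity.
  - intros t Ht. eapply Rle_trans; [|apply (orbit_speed HO); lra].
    specialize (Hup t Ht). rewrite Rmult_assoc. apply Rmult_le_compat_l; [lra|].
    replace (- U (- t) - - d) with (d - U (- t)) by ring.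
    apply Rmult_le_compat_r; lra.
  - rewrite Ropp_0, (orbit_energy HO 0), U0. f_equal.
    rewrite (RInt_ext (reduced (reflect f) vs (- al) (- k) b) (fun s => - reduced f vs al k b (- s)))
      by (intros; apply reduced_reflect).
    rewrite RInt_reflect, !Ropp_involutive by exact Hcont.
    assert (C := RInt_Chasles_R (reduced f vs al k b) a al d Hcont).
    rewrite (orbit_area HO) in C. lra.
Qed.

(** The mass condition, solved for the length of the left half: with the outer states alone it
    would be [(hp + vs - xi) / ((hp - hm) * e)], which is [x0 / e], and the excess masses of the
    two halves and the deviation of the slow variable correct it. *)
Lemma mass_identity : 0 < e -> k < 1 ->
  (hp - hm) * L = (hp + vs - xi) / e
    + (RInt (fun t => U t - hm) (- L) 0 + RInt (fun t => U t - hp) 0 R1)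
    + (b + k * al + k * (vs - xi)) / ((1 - k) * e).
Proof.
  intros He Hk.
  assert (CU : forall t, continuous U t) by (intros t; apply (is_derive_continuous _ _ _ (DU t))).
  assert (Haff : forall x y m n, RInt (fun t => m * U t + n) x y = m * RInt U x y + (y - x) * n).
  { intros x y m n.
    assert (C1 : ex_RInt (fun t => scal m (U t)) x y).
    { apply (ex_RInt_scal (V := R_NormedModule)). now apply ex_RInt_cont. }
    rewrite (RInt_ext (fun t => m * U t + n) (fun t => plus (scal m (U t)) n)) by (intros; reflexivity).
    rewrite (RInt_plus (V := R_CompleteNormedModule));
      [|exact C1|apply ex_RInt_cont; intros; apply continuous_const].
    rewrite (RInt_scal (V := R_CompleteNormedModule)) by now apply ex_RInt_cont.
    rewrite RInt_const_R. reflexivity. }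
  assert (Hsub : forall x y r, RInt (fun t => U t - r) x y = RInt U x y - (y - x) * r).
  { intros x y r. rewrite (RInt_ext (fun t => U t - r) (fun t => 1 * U t + - r)) by (intros; ring_R).
    rewrite Haff. ring_R. }
  assert (Hm := orbit_mass HO). rewrite Haff in Hm.
  assert (C := RInt_Chasles_R U (- L) 0 R1 CU). rewrite <- C in Hm.
  rewrite !Hsub.
  assert (Hlen := orbit_length HO).
  set (I1 := RInt U (- L) 0 : R) in *. set (I2 := RInt U 0 R1 : R) in *.
  assert (HR1 : R1 = 1 / e - L) by lra. rewrite HR1 in *.
  apply (Rmult_eq_reg_l (1 - k)); [|lra].
  replace ((1 - k) * ((hp + vs - xi) / e + (I1 - (0 - - L) * hm + (I2 - (1 / e - L - 0) * hp))
            + (b + k * al + k * (vs - xi)) / ((1 - k) * e)))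
    with ((1 - k) * (I1 + I2) + (1 / e - L - - L) * (vs + b + k * al - xi) + (1 - k) * ((hp - hm) * L))
    by (field; lra).
  lra.
Qed.
End Position.

(** * Norms on intervals and limits at zero *)

Lemma is_derive_on_of_line (c d x l : R) (g w : R -> R) :
  c <= x <= d -> (forall y, c <= y <= d -> g y = w y) -> is_derive w x l -> is_derive_on c d g x l.
Proof.
  intros Hx Hg Hw P [eps HP]. apply is_derive_Reals in Hw.
  destruct (Hw eps (cond_pos eps)) as [r Hr].
  exists r. intros y Hy Hne Hyc. change (Rabs (y - x) < r) in Hy.
  apply HP. change (Rabs ((g y - g x) / (y - x) - l) < eps).
  rewrite !Hg by assumption. specialize (Hr (y - x)).
  rewrite Rplus_minus in Hr. apply Hr; [|exact Hy].
  intros E. apply Hne. change (@eq R y x). change (@eq R (y - x) 0) in E. lra.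
Qed.

Lemma C2_on_of_line (c d : R) (g w w1 w2 : R -> R) :
  (forall y, c <= y <= d -> g y = w y) -> C2_line w w1 w2 -> C2_on c d g w1 w2.
Proof.
  intros Hg [D0 [D1 C2]] x Hx. split; [|split].
  - apply (is_derive_on_of_line c d x _ g w); auto.
  - apply (is_derive_on_of_line c d x _ w1 w1); auto.
  - intros P HP. assert (H := C2 x P HP). unfold filtermap in *. unfold within.
    revert H. apply filter_imp. auto.
Qed.

Lemma max_abs_exists (c d B : R) (w : R -> R) :
  c <= d -> (forall x, continuous w x) -> (forall x, c <= x <= d -> Rabs (w x) <= B) ->
  exists m, is_max_abs c d w m /\ 0 <= m <= B.
Proof.
  intros Hcd Hw HB.
  destruct (continuity_ab_maj (fun x => Rabs (w x)) c d Hcd) as [xm [Hm Hxm]].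
  { intros x _. apply continuity_pt_filterlim. apply (continuous_comp w Rabs); [apply Hw|apply continuous_Rabs]. }
  exists (Rabs (w xm)). split; [|split; [apply Rabs_pos|now apply HB]].
  split; [now exists xm|exact Hm].
Qed.

(** The maxima in the norm are attained because [w] is smooth on the whole line. *)
Lemma C2_norm_exists (nu c d B : R) (g w w1 w2 : R -> R) :
  c <= d -> (forall y, c <= y <= d -> g y = w y) -> C2_line w w1 w2 ->
  (forall x, c <= x <= d ->
     Rabs (w x) <= B /\ Rabs (nu * w1 x) <= B /\ Rabs (nu ^ 2 * w2 x) <= B) ->
  exists n, is_C2_norm nu c d g n /\ 0 <= n <= 3 * B.
Proof.
  intros Hcd Hg HC HB. assert (HC' := HC). destruct HC' as [D0 [D1 C2]].
  destruct (max_abs_exists c d B w Hcd) as [m0 [M0 B0]].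
  { intros x. apply (is_derive_continuous _ _ _ (D0 x)). } { intros x Hx. now apply HB. }
  destruct (max_abs_exists c d B (fun x => nu * w1 x) Hcd) as [m1 [M1 B1]].
  { intros x. apply (continuous_scal_r (V := R_NormedModule) nu w1).
    apply (is_derive_continuous _ _ _ (D1 x)). } { intros x Hx. now apply HB. }
  destruct (max_abs_exists c d B (fun x => nu ^ 2 * w2 x) Hcd) as [m2 [M2 B2]].
  { intros x. apply (continuous_scal_r (V := R_NormedModule) (nu ^ 2) w2), C2. }
  { intros x Hx. now apply HB. }
  exists (m0 + m1 + m2). split; [|lra].
  exists w1, w2, m0, m1, m2. split; [now apply (C2_on_of_line c d g w)|].
  split; [|split; [exact M1|split; [exact M2|reflexivity]]].
  destruct M0 as [[x [Hx E]] M0]. split.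
  - exists x. split; [exact Hx|]. now rewrite Hg.
  - intros y Hy. rewrite Hg by exact Hy. now apply M0.
Qed.

Lemma at_right_of_small (P : R -> Prop) : small P -> at_right 0 P.
Proof.
  intros [e0 [He0 H]]. exists (mkposreal e0 He0). intros y Hy Hpos.
  change (Rabs (y - 0) < e0) in Hy. apply Rabs_lt_between in Hy. apply H. lra.
Qed.

Lemma lim_at_right_of_bound (g : R -> R) (l C : R) :
  small (fun e => Rabs (g e - l) <= C * e) -> filterlim g (at_right 0) (locally l).
Proof.
  intros H P [eps HP]. unfold filtermap. apply at_right_of_small.
  apply (small_imp (fun e => Rabs (g e - l) <= C * e /\ C * e < eps)).
  - intros e _ [H1 H2]. apply HP. change (Rabs (g e - l) < eps). lra.
  - apply small_and; [exact H|]. apply small_linear. apply cond_pos.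
Qed.

(** * Reflection of the right half *)

Lemma at_right_eps (phi : R -> R) (l : R) :
  filterlim phi (at_right 0) (locally l) -> filterlim (fun z => - phi (- z)) (at_left 0) (locally (- l)).
Proof.
  intros H P HP.
  assert (HP' : locally l (fun y => P (- y))).
  { destruct HP as [eps Heps]. exists eps. intros y Hy. apply Heps.
    change (Rabs (- y - - l) < eps). change (Rabs (y - l) < eps) in Hy.
    replace (- y - - l) with (- (y - l)) by ring. now rewrite Rabs_Ropp. }
  destruct (H _ HP') as [r Hr]. exists r. intros y Hy Hneg. apply (Hr (- y)); [|lra].
  change (Rabs (- y - 0) < r). change (Rabs (y - 0) < r) in Hy.
  replace (- y - 0) with (- (y - 0)) by ring. now rewrite Rabs_Ropp.
Qed.

Lemma solves_right_reflect (rhs phi : R -> R) (a : R) :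
  solves_right rhs a phi -> solves_left (fun z => - rhs (- z)) (- a) (fun z => - phi (- z)).
Proof.
  intros [H1 [H2 [H3 H4]]].
  assert (D1 : forall z, z < 0 -> is_derive (fun z => - phi (- z)) z (Derive phi (- z))).
  { intros z Hz. apply (is_derive_eq _ _ (- - Derive phi (- z))); [|ring].
    apply is_derive_R_opp. apply (is_derive_reflect phi). apply Derive_correct. apply H1. lra. }
  split; [|split; [|split]].
  - intros z Hz. split; [now exists (Derive phi (- z)); apply D1|].
    change (is_derive (Derive (fun z => - phi (- z))) z (- rhs (- z))).
    apply (is_derive_ext_loc (fun z => Derive phi (- z))).
    + apply (locally_interval _ (z - 1) 0); [lra|]. intros s Hs. symmetry.
      apply is_derive_unique. apply D1. lra.
    + apply (is_derive_reflect (Derive phi)). apply (proj2 (H1 (- z) ltac:(lra))).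
  - cbv beta. rewrite Ropp_0. now apply at_right_eps.
  - rewrite Ropp_0, H3. reflexivity.
  - apply is_lim_spec. apply is_lim_spec in H4. intros eps. destruct (H4 eps) as [Z HZ].
    exists (- Z). intros z Hz. specialize (HZ (- z) ltac:(lra)).
    simpl in HZ |- *. rewrite Rminus_0_r in *. now rewrite Rabs_Ropp.
Qed.

Lemma solves_left_ext (rhs rhs' phi : R -> R) (a : R) :
  (forall z, rhs z = rhs' z) -> solves_left rhs a phi -> solves_left rhs' a phi.
Proof.
  intros E [H1 H2]. split; [|exact H2]. intros z Hz. rewrite <- E. now apply H1.
Qed.

Lemma partial_u_reflect (f fu fv : R -> R -> R) (lo hi vs M u v : R) :
  C2box f fu fv lo hi vs M -> partial_u (reflect f) u v = partial_u f (- u) v.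
Proof.
  intros HB. assert (HR := C2box_reflect _ _ _ _ _ _ _ HB).
  assert (E1 : partial_u (reflect f) u v = fu (- u) v)
    by apply (is_derive_unique _ _ _ (box_du HR u v)).
  assert (E2 : partial_u f (- u) v = fu (- u) v)
    by apply (is_derive_unique _ _ _ (box_du HB (- u) v)).
  congruence.
Qed.

Lemma partial_v_reflect (f fu fv : R -> R -> R) (lo hi vs M u v : R) :
  C2box f fu fv lo hi vs M -> partial_v (reflect f) u v = - partial_v f (- u) v.
Proof.
  intros HB. assert (HR := C2box_reflect _ _ _ _ _ _ _ HB).
  assert (E1 : partial_v (reflect f) u v = reflect fv u v)
    by apply (is_derive_unique _ _ _ (box_dv HR u v)).
  assert (E2 : partial_v f (- u) v = fv (- u) v)
    by apply (is_derive_unique _ _ _ (box_dv HB (- u) v)).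
  rewrite E1, E2. reflexivity.
Qed.

Lemma profile0_reflect (f : R -> R -> R) (hp : R -> R) (vs x0 al : R) (phi : R -> R) :
  profile0_plus f hp vs x0 al phi ->
  profile0_minus (reflect f) (fun v => - hp v) vs (1 - x0) (- al) (fun z => - phi (- z)).
Proof.
  intros [H1 H2]. split.
  - replace (- al - - hp vs) with (- (al - hp vs)) by ring.
    apply solves_right_reflect in H1. revert H1. apply solves_left_ext.
    intros z. unfold reflect.
    replace (- (- hp vs + - phi (- z))) with (hp vs + phi (- z)) by ring. ring.
  - intros z1 z2 Hz. apply Ropp_le_contravar. apply H2. lra.
Qed.

(** A shift of the layer to the right lengthens the left half and shortens the right one, hence
    the change of sign of [x1]. *)
Lemma profile1_reflect (f fu fv : R -> R -> R) (lo hi M : R) (hp : R -> R) (vs x0 : R)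
    (phi0 : R -> R) (b1 x1 : R) (phi1 : R -> R) :
  C2box f fu fv lo hi vs M ->
  profile1_plus f hp vs x0 phi0 b1 x1 phi1 ->
  profile1_minus (reflect f) (fun v => - hp v) vs (1 - x0) (fun z => - phi0 (- z)) b1 (- x1)
    (fun z => - phi1 (- z)).
Proof.
  intros HB H. unfold profile1_minus, profile1_plus in *. cbv zeta in *.
  rewrite (Derive_opp hp).
  replace (- - Derive hp vs * b1) with (- (- Derive hp vs * b1)) by ring.
  apply solves_right_reflect in H. revert H. apply solves_left_ext. intros z.
  rewrite (partial_u_reflect _ _ _ _ _ _ _ _ _ HB), (partial_v_reflect _ _ _ _ _ _ _ _ _ HB).
  unfold reflect.
  replace (- (- hp vs + - phi0 (- z))) with (hp vs + phi0 (- z)) by ring. ring.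
Qed.

Lemma U_minus_reflect (hp : R -> R) (vs : R) (theta phi0 : R -> R) (phi1 : R -> R -> R -> R)
    (e b1 x1 y : R) :
  U_minus (fun v => - hp v) vs theta (fun z => - phi0 (- z)) (fun b x z => - phi1 b (- x) (- z))
    e b1 x1 y = - U_plus hp vs theta phi0 phi1 e b1 (- x1) (1 - y).
Proof.
  unfold U_minus, U_plus. rewrite (Derive_opp hp).
  replace (1 - (1 - y)) with y by ring.
  replace (- ((y - 1) / e)) with ((1 - y) / e) by (unfold Rdiv; ring). ring.
Qed.

(** The slow variable is not reflected, so that its profile [- phi0 / D] changes sign with
    [phi0] unless [D] does. *)
Lemma V_minus_reflect (D vs : R) (theta phi0 : R -> R) (phi1 : R -> R -> R -> R) (e b1 x1 y : R) :
  D <> 0 ->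
  V_minus (- D) vs theta (fun z => - phi0 (- z)) (fun b x z => - phi1 b (- x) (- z)) e b1 x1 y
  = V_plus D vs theta phi0 phi1 e b1 (- x1) (1 - y).
Proof.
  intros HD. unfold V_minus, V_plus. cbv zeta. rewrite Ropp_0.
  replace (1 - (1 - y)) with y by ring.
  replace (- ((y - 1) / e)) with ((1 - y) / e) by (unfold Rdiv; ring). field. exact HD.
Qed.

Lemma C2_line_flip (w w1 w2 : R -> R) (sg : R) :
  C2_line w w1 w2 ->
  C2_line (fun x => sg * w (1 - x)) (fun x => - sg * w1 (1 - x)) (fun x => sg * w2 (1 - x)).
Proof.
  intros [D0 [D1 C2]].
  assert (Dx : forall x, is_derive (fun x => 1 - x) x (-1)).
  { intros x. auto_derive; [exact I|ring]. }
  split; [|split].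
  - intros x. apply (is_derive_eq _ _ (sg * (w1 (1 - x) * -1))); [|ring].
    apply is_derive_R_scal. apply (is_derive_R_comp w (fun x => 1 - x)); [apply D0|apply Dx].
  - intros x. apply (is_derive_eq _ _ (- sg * (w2 (1 - x) * -1))); [|ring].
    apply is_derive_R_scal. apply (is_derive_R_comp w1 (fun x => 1 - x)); [apply D1|apply Dx].
  - intros x. apply (continuous_scal_r (V := R_NormedModule) sg (fun x => w2 (1 - x))).
    apply (continuous_comp (fun x => 1 - x) w2); [apply (is_derive_continuous _ _ _ (Dx x))|apply C2].
Qed.

(** * The bistable potential *)

Lemma sign_right_of_zero (g : R -> R) (p q l : R) :
  (forall x, continuous g x) -> is_derive g p l -> l < 0 -> g p = 0 ->
  (forall x, p < x < q -> g x <> 0) -> forall x, p < x < q -> g x < 0.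
Proof.
  intros Hc Hd Hl Hp Hnz x Hx. apply is_derive_Reals in Hd.
  destruct (Hd (- l) ltac:(lra)) as [r Hr]. assert (r0 := cond_pos r).
  set (h := Rmin r (x - p) / 2).
  assert (Hh : 0 < Rmin r (x - p)) by (apply Rmin_pos; lra).
  assert (m1 := Rmin_l r (x - p)). assert (m2 := Rmin_r r (x - p)).
  specialize (Hr h ltac:(unfold h; lra) ltac:(apply Rabs_lt_between; unfold h; lra)).
  apply Rabs_lt_between in Hr. rewrite Hp, Rminus_0_r in Hr.
  assert (Hh0 : 0 < h) by (unfold h; lra).
  assert (Hgy : g (p + h) < 0).
  { assert (Q : g (p + h) / h < 0) by lra.
    replace (g (p + h)) with (g (p + h) / h * h) by (field; lra). nra. }
  apply Rnot_le_lt. intros Hge.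
  destruct (IVT_gen g (p + h) x 0) as [y [Hy Ey]].
  - intros y. apply continuity_pt_filterlim. apply Hc.
  - rewrite Rmin_left, Rmax_right by lra. lra.
  - rewrite Rmin_left, Rmax_right in Hy by (unfold h; lra).
    apply (Hnz y); [lra|exact Ey].
Qed.

(** The potential decreases up to the middle zero and then increases to its value zero at the
    last one. *)
Lemma bistable_potential (g : R -> R) (p q r lp lr : R) :
  (forall x, continuous g x) -> p < q < r -> (forall x, g x = 0 <-> x = p \/ x = q \/ x = r) ->
  is_derive g p lp -> lp < 0 -> is_derive g r lr -> lr < 0 -> RInt g p r = 0 ->
  forall u, p < u < r -> RInt g p u < 0.
Proof.
  intros Hc Hpqr Hz Dp Hlp Dr Hlr Hint.
  assert (Neg : forall x, p < x < q -> g x < 0).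
  { apply (sign_right_of_zero g p q lp); try assumption.
    - apply Hz. now left.
    - intros x Hx E. apply Hz in E. lra. }
  assert (Pos : forall x, q < x < r -> 0 < g x).
  { intros x Hx.
    assert (A := sign_right_of_zero (fun x => - g (- x)) (- r) (- q) lr).
    assert (B : - g (- - x) < 0).
    { apply A; try lra.
      - intros y. now apply continuous_neg_arg.
      - apply (is_derive_eq _ _ (- - lr)); [|ring]. apply is_derive_R_opp.
        apply (is_derive_reflect g). now rewrite Ropp_involutive.
      - rewrite Ropp_involutive. assert (g r = 0) by (apply Hz; auto). lra.
      - intros y Hy E. assert (E' : g (- y) = 0) by lra. apply Hz in E'. lra. }
    rewrite Ropp_involutive in B. lra. }
  intros u Hu. destruct (Rle_lt_dec u q) as [h|h].
  - assert (P : 0 < RInt (fun x => - g x) p u).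
    { apply RInt_gt_0; [lra| |].
      - intros x Hx. assert (g x < 0) by (apply Neg; lra). lra.
      - intros x _. apply (continuous_opp (V := R_NormedModule) g), Hc. }
    assert (E : RInt (fun x => - g x) p u = - RInt g p u).
    { apply (RInt_opp (V := R_CompleteNormedModule)). now apply ex_RInt_cont. }
    lra.
  - assert (P : 0 < RInt g u r).
    { apply RInt_gt_0; [lra| |].
      - intros x Hx. apply Pos. lra.
      - intros x _. apply Hc. }
    assert (C := RInt_Chasles_R g p u r Hc). lra.
Qed.


(** * From the orbit to the solution on the unit interval *)

Section Unfold.
Variables (f : R -> R -> R) (vs al b D e xs xi : R) (U U1 : R -> R).
Let k := e ^ 2 / D.
Let u x := U ((x - xs) / e).
Let v x := vs + b + k * (al - u x).
Hypothesis He : 0 < e.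
Hypothesis HD : 0 < D.
Hypothesis DU : forall t, is_derive U t (U1 t).
Hypothesis DU1 : forall t, is_derive U1 t (- reduced f vs al k b (U t)).
Hypothesis Hcont : forall s, continuous (reduced f vs al k b) s.

Lemma unfold_derive (w : R -> R) (l x : R) :
  is_derive w ((x - xs) / e) l -> is_derive (fun x => w ((x - xs) / e)) x (l / e).
Proof.
  intros Hw. apply (is_derive_eq _ _ (l * / e)); [|reflexivity].
  apply (is_derive_R_comp w (fun x => (x - xs) / e)); [exact Hw|].
  auto_derive; [exact I|field; lra].
Qed.

(** The acceleration of [v] is [- k] times that of [u], which is the conservation law again. *)
Lemma orbit_neumann :
  U1 ((0 - xs) / e) = 0 -> U1 ((1 - xs) / e) = 0 -> is_neumann_solution D f e u v.
Proof.
  intros H0 H1.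
  set (u1 := fun x => U1 ((x - xs) / e) / e).
  set (u2 := fun x => - reduced f vs al k b (U ((x - xs) / e)) / e ^ 2).
  assert (CU : C2_line u u1 u2).
  { split; [|split].
    - intros x. unfold u, u1. apply unfold_derive, DU.
    - intros x. unfold u1, u2.
      apply (is_derive_eq _ _ (/ e * (- reduced f vs al k b (U ((x - xs) / e)) / e))); [|field; lra].
      apply (is_derive_ext (fun x => / e * U1 ((x - xs) / e))); [intros; unfold Rdiv; ring_R|].
      apply is_derive_R_scal. apply (unfold_derive U1). apply DU1.
    - intros x. unfold u2.
      apply (continuous_ext (fun x => scal (- / e ^ 2) (reduced f vs al k b (u x)))).
      { intros y. unfold u, Rdiv. change (- / e ^ 2 * reduced f vs al k b (U ((y - xs) * / e))
          = - reduced f vs al k b (U ((y - xs) * / e)) * / e ^ 2). ring. }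
      apply (continuous_scal_r (V := R_NormedModule)).
      apply (continuous_comp u (reduced f vs al k b)); [|apply Hcont].
      apply (is_derive_continuous u x (u1 x)). unfold u, u1. apply unfold_derive, DU. }
  assert (CV : C2_line v (fun x => - k * u1 x) (fun x => - k * u2 x)).
  { destruct CU as [D0 [D1 C2]]. split; [|split].
    - intros x. unfold v. apply (is_derive_eq _ _ (0 + k * (0 - u1 x))); [|ring].
      apply is_derive_R_plus; [apply is_derive_R_const|]. apply is_derive_R_scal.
      apply is_derive_R_minus; [apply is_derive_R_const|apply D0].
    - intros x. apply is_derive_R_scal. apply D1.
    - intros x. apply (continuous_scal_r (V := R_NormedModule) (- k) u2), C2. }
  exists u1, u2, (fun x => - k * u1 x), (fun x => - k * u2 x).
  split; [now apply (C2_on_of_line 0 1 u u)|]. split; [now apply (C2_on_of_line 0 1 v v)|].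
  split.
  - intros x _. unfold u2, v. change (U ((x - xs) / e)) with (u x). unfold reduced.
    split; [field; lra|]. unfold k at 1. field. lra.
  - unfold u1. rewrite H0, H1. unfold Rdiv. repeat split; ring.
Qed.

Lemma orbit_total_mass :
  RInt (fun t => (1 - k) * U t + (vs + b + k * al - xi)) ((0 - xs) / e) ((1 - xs) / e) = 0 ->
  is_RInt (fun x => u x + v x) 0 1 xi.
Proof.
  intros Hm.
  set (F := fun t => (1 - k) * U t + (vs + b + k * al - xi)) in *.
  assert (CF : forall t, continuous F t).
  { intros t. apply (is_derive_continuous F t ((1 - k) * U1 t + 0)).
    apply is_derive_R_plus; [apply is_derive_R_scal, DU|apply is_derive_R_const]. }
  assert (H1 : is_RInt F (/ e * 0 + - xs / e) (/ e * 1 + - xs / e) 0).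
  { replace (/ e * 0 + - xs / e) with ((0 - xs) / e) by (field; lra).
    replace (/ e * 1 + - xs / e) with ((1 - xs) / e) by (field; lra).
    apply (eq_ind _ (is_RInt F ((0 - xs) / e) ((1 - xs) / e))) with (2 := Hm).
    apply (RInt_correct (V := R_CompleteNormedModule)). now apply ex_RInt_cont. }
  apply (is_RInt_comp_lin (V := R_NormedModule)) in H1.
  apply (is_RInt_scal (V := R_NormedModule) _ _ _ e) in H1.
  assert (H2 := is_RInt_const (V := R_NormedModule) 0 1 xi).
  assert (H3 := is_RInt_plus (V := R_NormedModule) _ _ _ _ _ _ H1 H2).
  replace xi with (plus (scal e 0) (scal (1 - 0) xi)).
  2:{ change (e * 0 + (1 - 0) * xi = xi). ring. }
  revert H3. apply is_RInt_ext. intros x _. unfold F, v, u.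
  change (e * (/ e * ((1 - k) * U (/ e * x + - xs / e) + (vs + b + k * al - xi))) + xi
    = U ((x - xs) / e) + (vs + b + k * (al - U ((x - xs) / e)))).
  replace (/ e * x + - xs / e) with ((x - xs) / e) by (field; lra). field. lra.
Qed.

End Unfold.

(** * The family of layer solutions *)

Section Family.
Variables (D : R) (f fu fv : R -> R -> R) (M : R) (hm hp : R -> R) (vs xi al : R)
  (theta phi0m phi0p : R -> R) (phi1m phi1p : R -> R -> R -> R).
Let a0 := hm vs.
Let d0 := hp vs.
Let x0 := layer_x0 hm hp vs xi.
Hypothesis HD : 0 < D.
Hypothesis HB : C2box f fu fv (a0 - 1) (d0 + 1) vs M.
Hypothesis Hfm : f a0 vs = 0.
Hypothesis Hfp : f d0 vs = 0.
Hypothesis Hum : fu a0 vs < 0.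
Hypothesis Hup : fu d0 vs < 0.
Hypothesis Harea : RInt (fun s => f s vs) a0 d0 = 0.
Hypothesis Hpot : forall u, a0 < u < d0 -> RInt (fun s => f s vs) a0 u < 0.
Hypothesis Hslope : RInt (fun s => fv s vs) a0 d0 <> 0.
Hypothesis Hal : a0 < al < d0.
Hypothesis Hxi : a0 + vs < xi < d0 + vs.
Hypothesis Hth : is_cutoff theta.
Hypothesis Hp0m : profile0_minus f hm vs x0 al phi0m.
Hypothesis Hp0p : profile0_plus f hp vs x0 al phi0p.
Hypothesis Hp1m : forall b1 x1, profile1_minus f hm vs x0 phi0m b1 x1 (phi1m b1 x1).
Hypothesis Hp1p : forall b1 x1, profile1_plus f hp vs x0 phi0p b1 x1 (phi1p b1 x1).

(** Everything that the theorem asks of the solution for one value of [e], with rates; [b / e] and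
    [(e * L - x0) / e] are the two parameters of the approximations. *)
Record layer_family (X1 C c e : R) (b L : R) (u v : R -> R) (err : R) : Prop := {
  fam_b : Rabs (b / e) <= C * e;
  fam_x1 : Rabs ((e * L - x0) / e - X1) <= C * e;
  fam_sol : is_neumann_solution D f e u v;
  fam_mass : is_RInt (fun x => u x + v x) 0 1 xi;
  fam_xs : 0 < e * L < 1;
  fam_u : u (e * L) = al;
  fam_v : v (e * L) = vs + e * (b / e);
  fam_left : forall x, 0 <= x <= e * L -> Rabs (u x - a0) <= e + C * exp (c * ((x - e * L) / e));
  fam_right : forall x, e * L <= x <= 1 -> Rabs (u x - d0) <= e + C * exp (- (c * ((x - e * L) / e)));
  fam_slow : forall x, 0 <= x <= 1 -> Rabs (v x - vs) <= C * e;
  fam_errors :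
    let x1 := (e * L - x0) / e in
    let dum x := u x - U_minus hm vs theta phi0m phi1m e (b / e) x1 (x / (e * L)) in
    let dvm x := v x - V_minus D vs theta phi0m phi1m e (b / e) x1 (x / (e * L)) in
    let dup x := u x - U_plus hp vs theta phi0p phi1p e (b / e) x1 ((x - e * L) / (1 - e * L)) in
    let dvp x := v x - V_plus D vs theta phi0p phi1p e (b / e) x1 ((x - e * L) / (1 - e * L)) in
    (exists num nvm nup nvp : R,
       is_C2_norm e 0 (e * L) dum num /\ is_C2_norm 1 0 (e * L) dvm nvm /\
       is_C2_norm e (e * L) 1 dup nup /\ is_C2_norm 1 (e * L) 1 dvp nvp /\
       err = num + nvm + nup + nvp) /\
    is_derive_on 0 (e * L) dum 0 0 /\ is_derive_on 0 (e * L) dvm 0 0 /\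
    dum (e * L) = 0 /\ dvm (e * L) = 0 /\ dup (e * L) = 0 /\ dvp (e * L) = 0 /\
    is_derive_on (e * L) 1 dup 1 0 /\ is_derive_on (e * L) 1 dvp 1 0;
  fam_err : Rabs err <= C * e ^ 2 }.

Lemma x0_range : 0 < x0 < 1.
Proof.
  unfold x0, layer_x0. fold a0 d0. split.
  - apply Rdiv_lt_0_compat; lra.
  - apply Rlt_div_l; lra.
Qed.

Lemma right_potential (u : R) :
  - d0 < u <= - al -> RInt (fun s => reflect f s vs) (- d0) u < 0.
Proof.
  intros Hu. unfold reflect.
  assert (Cf : forall x, continuous (fun s => f s vs) x) by apply (continuous_slice f fu fv a0 d0 vs M HB).
  rewrite (RInt_reflect (fun s => f s vs)) by exact Cf. rewrite Ropp_involutive.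
  assert (C := RInt_Chasles_R (fun s => f s vs) a0 (- u) d0 Cf).
  assert (P := Hpot (- u) ltac:(lra)). lra.
Qed.

(** The accurate comparison with the profiles needs to know that both sides of the layer have a
    length of order one.  This follows from the mass and the bounded excess of each half; the
    comparison then refines the position. *)
Theorem layer_family_exists :
  let X1 := (x0 * RInt_gen phi0m (Rbar_locally m_infty) (at_point 0)
            + (1 - x0) * RInt_gen phi0p (at_point 0) (Rbar_locally p_infty)) / (d0 - a0) in
  exists C c, 0 < c /\ 0 <= C /\
    small (fun e => exists b L u v err, layer_family X1 C c e b L u v err).
Proof.
  intros X1. assert (Hx0 := x0_range).
  assert (M1 : 1 <= M) by apply (box_M HB).
  destruct (layer_exists f fu fv a0 d0 vs al M D xi HB Hal Hfm Hfp Hum Hup Harea Hpot Hslope HD Hxi)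
    as [B [c [HB0 [Hc Hex]]]].
  assert (HiD : 0 < / D) by now apply Rinv_0_lt_compat.
  set (K := B + / D). assert (HK : 0 <= K) by (unfold K; lra).
  set (cm := c * ((d0 - al) / 2)). set (cp := c * ((al - a0) / 2)).
  assert (Hcm : 0 < cm) by (unfold cm; nra). assert (Hcp : 0 < cp) by (unfold cp; nra).
  set (Hd := d0 - a0). assert (HHd : 0 < Hd) by (unfold Hd; lra).
  set (CE := 2 * K * (1 + Rabs al + Rabs (vs - xi))).
  assert (HCE : 0 <= CE).
  { unfold CE. generalize (Rabs_pos al) (Rabs_pos (vs - xi)). intros. nonneg. }
  set (Cc := ((al - a0 + 1) / cm + 1) + ((- al - - d0 + 1) / cp + 1) + CE).
  assert (HCc : 0 <= Cc).
  { unfold Cc. assert (0 <= (al - a0 + 1) / cm) by (apply Rdiv_le_0_compat; lra).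
    assert (0 <= (- al - - d0 + 1) / cp) by (apply Rdiv_le_0_compat; lra). lra. }
  set (X := Cc / Hd). assert (HX : 0 <= X) by (apply Rdiv_le_0_compat; lra).
  set (cL := Rmin x0 (1 - x0) / 2).
  assert (HcL : 0 < cL) by (unfold cL; assert (0 < Rmin x0 (1 - x0)) by (apply Rmin_pos; lra); lra).
  assert (HcL1 : 2 * cL <= x0) by (unfold cL; generalize (Rmin_l x0 (1 - x0)); lra).
  assert (HcL2 : 2 * cL <= 1 - x0) by (unfold cL; generalize (Rmin_r x0 (1 - x0)); lra).
  assert (HBr := C2box_reflect _ _ _ _ _ _ _ HB).
  assert (HKm : Rabs (/ D) <= K) by (rewrite Rabs_pos_eq; unfold K; lra).
  assert (HKp : Rabs (/ - D) <= K) by (rewrite Rinv_opp, Rabs_Ropp; exact HKm).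
  assert (Hfr : reflect f (- d0) vs = 0) by (unfold reflect; rewrite Ropp_involutive, Hfp; ring).
  assert (Hur : fu (- - d0) vs < 0) by (rewrite Ropp_involutive; exact Hup).
  assert (Hpm : forall u, a0 < u <= al -> RInt (fun s => f s vs) a0 u < 0) by (intros; apply Hpot; lra).
  assert (Hp0r := profile0_reflect _ _ _ _ _ _ Hp0p).
  assert (Hp1r : forall b1 x1, profile1_minus (reflect f) (fun v => - hp v) vs (1 - x0)
     (fun z => - phi0p (- z)) b1 x1 ((fun b x z => - phi1p b (- x) (- z)) b1 x1)).
  { intros b1 x1. assert (P := profile1_reflect _ _ _ _ _ _ _ _ _ _ _ _ _ HB (Hp1p b1 (- x1))).
    rewrite Ropp_involutive in P. exact P. }
  destruct (half_layer f fu fv (a0 - 1) (d0 + 1) vs M a0 al x0 D hm theta phi0m phi1m HB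
     ltac:(lra) ltac:(lra) ltac:(lra) Hfm Hum Hpm ltac:(lra) ltac:(lra) eq_refl Hth Hp0m Hp1m
     K cm cL X HKm Hcm HcL HX) as [Cl [HCl [el [Hel Hleft]]]].
  destruct (half_layer (reflect f) (fun u v => fu (- u) v) (reflect fv) (- (d0 + 1)) (- (a0 - 1)) vs M
     (- d0) (- al) (1 - x0) (- D) (fun v => - hp v) theta (fun z => - phi0p (- z))
     (fun b x z => - phi1p b (- x) (- z)) HBr
     ltac:(lra) ltac:(lra) ltac:(lra) Hfr Hur right_potential ltac:(lra) ltac:(lra) eq_refl Hth Hp0r Hp1r
     K cp cL X HKp Hcp HcL HX) as [Cr [HCr [er [Her Hright]]]].
  destruct (half_mass f fu fv (a0 - 1) (d0 + 1) vs M a0 al x0 phi0m HB ltac:(lra) ltac:(lra)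
     ltac:(lra) Hfm Hum Hpm ltac:(lra) Hp0m K cm cL HK Hcm HcL)
    as [Im [CIm [HCIm [HIm [em [Hem Hmassm]]]]]].
  destruct (half_mass (reflect f) (fun u v => fu (- u) v) (reflect fv) (- (d0 + 1)) (- (a0 - 1)) vs M
     (- d0) (- al) (1 - x0) (fun z => - phi0p (- z)) HBr ltac:(lra) ltac:(lra) ltac:(lra) Hfr Hur
     right_potential ltac:(lra) Hp0r K cp cL HK Hcp HcL)
    as [Ip [CIp [HCIp [HIp [ep [Hep Hmassp]]]]]].
  assert (EX1 : X1 = (x0 * Im - (1 - x0) * Ip) / Hd).
  { unfold X1. fold Hd. rewrite (is_RInt_gen_unique _ _ HIm).
    rewrite (is_RInt_gen_unique _ _ (is_RInt_gen_reflect _ _ HIp)). f_equal. ring. }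
  set (C := K * (1 + Hd + 1) + (CIm + CIp + CE) / Hd + (Hd + 1) + 6 * (Cl + Cr)).
  set (c1 := Rmin cm cp). assert (Hc1 : 0 < c1) by (now apply Rmin_pos).
  assert (HC1 : 0 <= K * (1 + Hd + 1)) by (apply Rmult_le_pos; lra).
  assert (HC2 : 0 <= (CIm + CIp + CE) / Hd) by (apply Rdiv_le_0_compat; lra).
  assert (HCd : Hd + 1 <= C) by (unfold C; lra).
  exists C, c1. split; [exact Hc1|]. split; [unfold C; lra|].
  destruct Hex as [ex [Hex0 Hex]].
  apply (small_imp (fun e => (1 * e < ex /\ (1 * e < el /\ 1 * e < er)) /\ ((1 * e < em /\ 1 * e < ep)
    /\ ((1 * e < 1 /\ / D * e < 1 / 2) /\ (X * e < cL /\ (1 * e < (d0 - al) / 2 /\ 1 * e < (al - a0) / 2)))))).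
  2:{ repeat apply small_and; apply small_linear; lra. }
  intros e He [[E1 [E2 E3]] [[E4 E5] [[E6 E7] [E8 [E9 E10]]]]].
  destruct (Hex e ltac:(lra)) as [a [d [b [L [R1 [U [U1 [Hb HO]]]]]]]]. clear Hex.
  set (k := e ^ 2 / D) in *.
  assert (He2 : 0 < e ^ 2) by (apply pow_lt; lra). assert (He21 : e ^ 2 <= e) by (apply sq_le_self; lra).
  assert (Ek : k = / D * e ^ 2) by (unfold k; field; lra).
  assert (Hk0 : 0 < k) by (unfold k; apply Rdiv_lt_0_compat; lra).
  assert (Hk2 : k < 1 / 2) by (rewrite Ek; assert (/ D * e ^ 2 <= / D * e) by (apply Rmult_le_compat_l; lra); lra).
  assert (HkK : Rabs k <= K * e ^ 2).
  { rewrite Rabs_pos_eq, Ek by lra. apply Rmult_le_compat_r; [lra|unfold K; lra]. }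
  assert (HbK : Rabs b <= K * e ^ 2).
  { eapply Rle_trans; [exact Hb|]. apply Rmult_le_compat_r; [lra|unfold K; lra]. }
  assert (Hcont : forall x, continuous (reduced f vs al k b) x)
    by (apply (continuous_reduced f fu fv a0 d0 vs al M HB)).
  assert (HOl := left_half f a0 d0 vs al xi k c e a d b L R1 U U1 HO Hc ltac:(lra)).
  assert (HOr := right_half f a0 d0 vs al xi k c e a d b L R1 U U1 HO Hc Hcont ltac:(lra)).
  fold cm in HOl. fold cp in HOr.
  assert (Ha := orbit_a HO).
  assert (Hdd := orbit_d HO).
  assert (Hda : Rabs (- d - - d0) <= e).
  { replace (- d - - d0) with (- (d - d0)) by ring. now rewrite Rabs_Ropp. }
  assert (HL := orbit_L HO).
  assert (HR := orbit_R HO).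
  assert (Hlen := orbit_length HO).
  assert (Hmass := mass_identity f a0 d0 vs al xi k c e a d b L R1 U U1 HO He ltac:(lra)).
  fold Hd in Hmass.
  set (Ml := RInt (fun t => U t - a0) (- L) 0) in *. set (Mr := RInt (fun t => U t - d0) 0 R1) in *.
  set (Er := (b + k * al + k * (vs - xi)) / ((1 - k) * e)) in *.
  assert (DU := orbit_U HO).
  assert (DU1 := orbit_U1 HO).
  assert (CU : forall t, continuous U t) by (intros t; apply (is_derive_continuous _ _ _ (DU t))).
  assert (CU1 : forall t, continuous U1 t) by (intros t; apply (is_derive_continuous _ _ _ (DU1 t))).
  assert (EMr : RInt (fun t => - U (- t) - - d0) (- R1) 0 = - Mr).
  { rewrite (RInt_ext _ (fun t => - ((fun s => U s - d0) (- t)))) by (intros; cbv beta; ring_R).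
    rewrite (RInt_reflect (fun s => U s - d0)), Ropp_0, Ropp_involutive; [reflexivity|].
    intros s. apply (continuous_minus (V := R_NormedModule) U (fun _ => d0)); [apply CU|apply continuous_const]. }
  assert (HEr : Rabs Er <= CE * e).
  { unfold Er, Rdiv. rewrite Rabs_mult.
    assert (Hke : 1 / 2 * e <= (1 - k) * e) by (apply Rmult_le_compat_r; lra).
    rewrite (Rabs_pos_eq (/ ((1 - k) * e))) by (left; apply Rinv_0_lt_compat; lra).
    apply div_le; [lra|].
    assert (T1 : Rabs (b + k * al + k * (vs - xi)) <= K * e ^ 2 * (1 + Rabs al + Rabs (vs - xi))).
    { eapply Rle_trans; [apply Rabs_triang|]. rewrite Rabs_mult.
      assert (T2 := Rabs_triang b (k * al)). rewrite Rabs_mult in T2.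
      assert (Rabs k * Rabs al <= K * e ^ 2 * Rabs al) by (apply Rmult_le_compat_r; [apply Rabs_pos|exact HkK]).
      assert (Rabs k * Rabs (vs - xi) <= K * e ^ 2 * Rabs (vs - xi)) by (apply Rmult_le_compat_r; [apply Rabs_pos|exact HkK]).
      lra. }
    eapply Rle_trans; [exact T1|].
    apply Rle_trans with (CE * e * (1 / 2 * e)); [right; unfold CE; field|].
    apply Rmult_le_compat_l; [apply Rmult_le_pos; lra|exact Hke]. }
  assert (HCEe : CE * e <= CE * 1) by (apply Rmult_le_compat_l; lra).
  assert (HLe : L <= 1 / e) by lra. assert (HRe : R1 <= 1 / e) by lra.
  assert (HMl := half_mass_coarse f vs al k b cm a L a0 e U U1 HOl Hcm Ha ltac:(lra) HLe). fold Ml in HMl.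
  assert (HMr := half_mass_coarse (reflect f) vs (- al) (- k) b cp (- d) R1 (- d0) e _ _ HOr Hcp Hda ltac:(lra) HRe).
  cbv beta in HMr. rewrite EMr, Rabs_Ropp in HMr.
  set (x1 := (e * L - x0) / e).
  assert (Ex1 : Hd * x1 = Ml + Mr + Er).
  { unfold x1. replace (Hd * ((e * L - x0) / e)) with (Hd * L - Hd * x0 / e) by (field; lra).
    rewrite Hmass. unfold x0, layer_x0. fold a0 d0. fold Hd.
    replace (Hd * ((vs + d0 - xi) / Hd) / e) with ((d0 + vs - xi) / e) by (field; lra). ring. }
  (* The coarse bounds on the excess masses already bound the displacement of the layer. *)
  assert (Hx1 : Rabs x1 <= X).
  { unfold X. apply le_div; [exact HHd|]. rewrite <- (Rabs_pos_eq Hd) at 1 by lra.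
    rewrite <- Rabs_mult, Rmult_comm, Ex1.
    apply Rabs_le_between in HMl, HMr, HEr. apply Rabs_le. unfold Cc. lra. }
  set (xs := e * L).
  assert (Exs : xs = x0 + e * x1) by (unfold xs, x1; field; lra).
  assert (HeX : Rabs (e * x1) <= cL).
  { rewrite Rabs_mult, (Rabs_pos_eq e) by lra.
    assert (e * Rabs x1 <= e * X) by (apply Rmult_le_compat_l; lra). lra. }
  assert (HeX' := proj1 (Rabs_le_between _ _) HeX).
  assert (ER1 : e * R1 = 1 - xs).
  { unfold xs. replace R1 with (1 / e - L) by lra. field. lra. }
  assert (HLc : cL / e <= L).
  { apply div_le; [lra|]. replace (L * e) with xs by (unfold xs; ring). lra. }
  assert (HRc : cL / e <= R1).
  { apply div_le; [lra|]. replace (R1 * e) with (1 - xs) by lra. lra. }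
  assert (Ex1r : (e * R1 - (1 - x0)) / e = - x1) by (rewrite ER1, Exs; field; lra).
  (* Now that both halves have a length of order [1 / e], the excess masses are known up to
     [O(e)], and so is the displacement. *)
  assert (HMl2 := Hmassm e ltac:(lra) k b a L U U1 HkK HbK Ha (conj HLc HLe) HOl). fold Ml in HMl2.
  assert (HnkK : Rabs (- k) <= K * e ^ 2) by (rewrite Rabs_Ropp; exact HkK).
  assert (HMr2 := Hmassp e ltac:(lra) (- k) b (- d) R1 _ _ HnkK HbK Hda (conj HRc HRe) HOr).
  cbv beta in HMr2. rewrite EMr in HMr2.
  assert (HX1 : Rabs (x1 - X1) <= (CIm + CIp + CE) / Hd * e).
  { replace ((CIm + CIp + CE) / Hd * e) with ((CIm + CIp + CE) * e / Hd) by (field; lra).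
    apply le_div; [exact HHd|]. rewrite <- (Rabs_pos_eq Hd) at 1 by lra.
    rewrite <- Rabs_mult, Rmult_comm.
    replace (Hd * (x1 - X1)) with (Ml + Mr + Er - (x0 * Im - (1 - x0) * Ip))
      by (rewrite <- Ex1, EX1; field; lra).
    apply Rabs_le_between in HMl2, HMr2, HEr. apply Rabs_le. lra. }
  destruct (Hleft e ltac:(lra) b a L U U1 HbK Ha (conj HLc HLe) Hx1 HOl)
    as [w [w1 [w2 [r [r1 [r2 [Cw [Cr' [w10 [r10 [wS [rS Hw]]]]]]]]]]]].
  fold xs in w10, r10, wS, rS, Hw. fold x1 k in Hw.
  assert (Hx1r : Rabs ((e * R1 - (1 - x0)) / e) <= X) by (rewrite Ex1r, Rabs_Ropp; exact Hx1).
  assert (Ekr : e ^ 2 / - D = - k) by (unfold k; field; lra).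
  rewrite <- Ekr in HOr.
  destruct (Hright e ltac:(lra) b (- d) R1 _ _ HbK Hda (conj HRc HRe) Hx1r HOr)
    as [y [y1 [y2 [q [q1 [q2 [Cy [Cq [y10 [q10 [yS [qS Hy]]]]]]]]]]]].
  rewrite Ex1r in Hy. rewrite ER1 in yS, qS, Hy.
  set (u := fun x => U ((x - xs) / e)). set (v := fun x => vs + b + k * (al - u x)).
  assert (Hxs : 0 < xs < 1) by (split; lra).
  assert (Ebe : e * (b / e) = b) by (field; lra).
  assert (Hu_l : forall x, 0 <= x <= xs ->
    u x - U_minus hm vs theta phi0m phi1m e (b / e) x1 (x / xs) = w x).
  { intros x Hx. symmetry. apply (Hw x Hx). }
  assert (Hv_l : forall x, 0 <= x <= xs ->
    v x - V_minus D vs theta phi0m phi1m e (b / e) x1 (x / xs) = r x).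
  { intros x Hx. symmetry. apply (Hw x Hx). }
  assert (Earg : forall x, 1 - (1 - x) / (1 - xs) = (x - xs) / (1 - xs)) by (intros; field; lra).
  assert (Etime : forall x, - ((1 - x - (1 - xs)) / e) = (x - xs) / e) by (intros; field; lra).
  assert (Hu_r : forall x, xs <= x <= 1 ->
    u x - U_plus hp vs theta phi0p phi1p e (b / e) x1 ((x - xs) / (1 - xs)) = -1 * y (1 - x)).
  { intros x Hx. destruct (Hy (1 - x) ltac:(lra)) as [Y _]. rewrite Y.
    rewrite U_minus_reflect, Ropp_involutive, Earg, Etime. unfold u. ring. }
  assert (Hv_r : forall x, xs <= x <= 1 ->
    v x - V_plus D vs theta phi0p phi1p e (b / e) x1 ((x - xs) / (1 - xs)) = 1 * q (1 - x)).
  { intros x Hx. destruct (Hy (1 - x) ltac:(lra)) as [_ [Y _]]. rewrite Y.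
    rewrite V_minus_reflect, Ropp_involutive, Earg, Etime by lra. unfold v, u. rewrite Ekr. ring. }
  assert (Fy := C2_line_flip y y1 y2 (-1) Cy). assert (Fq := C2_line_flip q q1 q2 1 Cq).
  destruct (C2_norm_exists e 0 xs (Cl * e ^ 2)
    (fun x => u x - U_minus hm vs theta phi0m phi1m e (b / e) x1 (x / xs)) w w1 w2)
    as [num [Num Bum]]; [lra|exact Hu_l|exact Cw| |].
  { intros x Hx. destruct (Hw x Hx) as [_ [_ [W0 [W1 [W2 _]]]]]. repeat split; assumption. }
  destruct (C2_norm_exists 1 0 xs (Cl * e ^ 2)
    (fun x => v x - V_minus D vs theta phi0m phi1m e (b / e) x1 (x / xs)) r r1 r2)
    as [nvm [Nvm Bvm]]; [lra|exact Hv_l|exact Cr'| |].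
  { intros x Hx. destruct (Hw x Hx) as [_ [_ [_ [_ [_ [W0 [W1 W2]]]]]]].
    rewrite pow1, !Rmult_1_l. repeat split; assumption. }
  destruct (C2_norm_exists e xs 1 (Cr * e ^ 2)
    (fun x => u x - U_plus hp vs theta phi0p phi1p e (b / e) x1 ((x - xs) / (1 - xs)))
    (fun x => -1 * y (1 - x)) (fun x => - -1 * y1 (1 - x)) (fun x => -1 * y2 (1 - x)))
    as [nup [Nup Bup]]; [lra|exact Hu_r|exact Fy| |].
  { intros x Hx. destruct (Hy (1 - x) ltac:(lra)) as [_ [_ [W0 [W1 [W2 _]]]]].
    rewrite <- Rabs_Ropp in W0. rewrite <- Rabs_Ropp in W2. repeat split.
    - replace (-1 * y (1 - x)) with (- y (1 - x)) by ring. exact W0.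
    - replace (e * (- -1 * y1 (1 - x))) with (e * y1 (1 - x)) by ring. exact W1.
    - replace (e ^ 2 * (-1 * y2 (1 - x))) with (- (e ^ 2 * y2 (1 - x))) by ring. exact W2. }
  destruct (C2_norm_exists 1 xs 1 (Cr * e ^ 2)
    (fun x => v x - V_plus D vs theta phi0p phi1p e (b / e) x1 ((x - xs) / (1 - xs)))
    (fun x => 1 * q (1 - x)) (fun x => - 1 * q1 (1 - x)) (fun x => 1 * q2 (1 - x)))
    as [nvp [Nvp Bvp]]; [lra|exact Hv_r|exact Fq| |].
  { intros x Hx. destruct (Hy (1 - x) ltac:(lra)) as [_ [_ [_ [_ [_ [W0 [W1 W2]]]]]]].
    rewrite <- Rabs_Ropp in W1. repeat split.
    - rewrite Rmult_1_l. exact W0.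
    - replace (1 * (-1 * q1 (1 - x))) with (- q1 (1 - x)) by ring. exact W1.
    - replace (1 ^ 2 * (1 * q2 (1 - x))) with (q2 (1 - x)) by ring. exact W2. }
  assert (Uxs : u xs = al).
  { unfold u. replace ((xs - xs) / e) with 0 by (field; lra). apply (half_0 HOl). }
  assert (T0 : (0 - xs) / e = - L) by (unfold xs; field; lra).
  assert (T1 : (1 - xs) / e = R1) by (rewrite <- ER1; field; lra).
  exists b, L, u, v, (num + nvm + nup + nvp). split; fold xs.
  - unfold Rdiv. rewrite Rabs_mult, (Rabs_pos_eq (/ e)) by (left; apply Rinv_0_lt_compat; lra).
    apply div_le; [lra|]. eapply Rle_trans; [exact HbK|].
    replace (C * e * e) with (C * e ^ 2) by ring. apply Rmult_le_compat_r; [lra|].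
    apply Rle_trans with (K * (1 + Hd + 1)); [|unfold C; lra].
    rewrite <- (Rmult_1_r K) at 1. apply Rmult_le_compat_l; lra.
  - fold x1. eapply Rle_trans; [exact HX1|]. apply Rmult_le_compat_r; [lra|unfold C; lra].
  - apply (orbit_neumann f vs al b D e xs U U1 He HD DU DU1 Hcont).
    + rewrite T0. apply (orbit_left HO).
    + rewrite T1. apply (orbit_right HO).
  - apply (orbit_total_mass vs al b D e xs xi U U1 He DU). rewrite T0, T1.
    exact (orbit_mass HO).
  - exact Hxs.
  - exact Uxs.
  - unfold v. rewrite Uxs, Ebe. ring.
  - intros x Hx.
    assert (Ht : - L <= (x - xs) / e <= 0).
    { rewrite <- T0. split.
      - apply Rmult_le_compat_r; [left; apply Rinv_0_lt_compat|]; lra.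
      - apply div_le; lra. }
    assert (B1 := half_decay f vs al k b cm a L a0 e U U1 HOl Hcm Ha ltac:(lra) _ Ht).
    fold (u x) in B1. eapply Rle_trans; [exact B1|]. apply Rplus_le_compat_l.
    assert (P := exp_pos (cm * ((x - xs) / e))). apply Rmult_le_compat; [lra|lra|unfold Hd in HCd; lra|].
    apply exp_le. rewrite !(Rmult_comm _ ((x - xs) / e)).
    apply Rmult_le_compat_neg_l; [lra|apply Rmin_l].
  - intros x Hx.
    assert (Ht : - R1 <= - ((x - xs) / e) <= 0).
    { rewrite <- T1. split.
      - apply Ropp_le_contravar. apply Rmult_le_compat_r; [left; apply Rinv_0_lt_compat|]; lra.
      - assert (0 <= (x - xs) / e) by (apply Rdiv_le_0_compat; lra). lra. }
    assert (B1 := half_decay _ _ _ _ _ _ _ _ (- d0) e _ _ HOr Hcp Hda ltac:(lra) _ Ht).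
    cbv beta in B1. rewrite Ropp_involutive in B1. fold (u x) in B1.
    replace (- u x - - d0) with (- (u x - d0)) in B1 by ring. rewrite Rabs_Ropp in B1.
    eapply Rle_trans; [exact B1|]. apply Rplus_le_compat_l.
    assert (P := exp_pos (cp * - ((x - xs) / e))). apply Rmult_le_compat; [lra|lra|unfold Hd in HCd; lra|].
    apply exp_le. rewrite <- Ropp_mult_distr_r. apply Ropp_le_contravar.
    apply Rmult_le_compat_r; [lra|apply Rmin_r].
  - intros x Hx. unfold v.
    assert (Hux := orbit_range HO ((x - xs) / e)). fold (u x) in Hux.
    assert (Ha' := proj1 (Rabs_le_between _ _) Ha). assert (Hdd' := proj1 (Rabs_le_between _ _) Hdd).
    replace (vs + b + k * (al - u x) - vs) with (b + k * (al - u x)) by ring.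
    assert (S1 : Rabs (k * (al - u x)) <= K * e ^ 2 * (Hd + 1)).
    { rewrite Rabs_mult. apply Rmult_le_compat; [apply Rabs_pos|apply Rabs_pos|exact HkK|].
      apply Rabs_le. unfold Hd. lra. }
    eapply Rle_trans; [apply Rabs_triang|].
    apply Rle_trans with (K * (1 + Hd + 1) * e ^ 2); [lra|].
    apply Rmult_le_compat; [exact HC1|lra|unfold C; lra|exact He21].
  - cbv zeta. fold x1. split; [exists num, nvm, nup, nvp; repeat split; assumption|].
    assert (Dw : is_derive w 0 0) by (rewrite <- w10 at 2; apply Cw).
    assert (Dr : is_derive r 0 0) by (rewrite <- r10 at 2; apply Cr').
    assert (E11 : 1 - 1 = 0) by ring.
    split; [|split; [|split; [|split; [|split; [|split; [|split]]]]]].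
    + apply (is_derive_on_of_line 0 xs 0 0 _ w); [lra|exact Hu_l|exact Dw].
    + apply (is_derive_on_of_line 0 xs 0 0 _ r); [lra|exact Hv_l|exact Dr].
    + rewrite Hu_l by lra. exact wS.
    + rewrite Hv_l by lra. exact rS.
    + rewrite Hu_r by lra. rewrite yS. ring.
    + rewrite Hv_r by lra. rewrite qS. ring.
    + apply (is_derive_on_of_line xs 1 1 0 _ (fun x => -1 * y (1 - x))); [lra|exact Hu_r|].
      apply (is_derive_eq _ _ _ _ (proj1 Fy 1)). rewrite E11, y10. ring.
    + apply (is_derive_on_of_line xs 1 1 0 _ (fun x => 1 * q (1 - x))); [lra|exact Hv_r|].
      apply (is_derive_eq _ _ _ _ (proj1 Fq 1)). rewrite E11, q10. ring.
  - rewrite Rabs_pos_eq by lra. apply Rle_trans with (6 * (Cl + Cr) * e ^ 2); [lra|].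
    apply Rmult_le_compat_r; [lra|unfold C; lra].
Qed.
End Family.

Arguments fam_b {D f hm hp vs xi al theta phi0m phi0p phi1m phi1p X1 C c e b L u v err}.
Arguments fam_x1 {D f hm hp vs xi al theta phi0m phi0p phi1m phi1p X1 C c e b L u v err}.
Arguments fam_sol {D f hm hp vs xi al theta phi0m phi0p phi1m phi1p X1 C c e b L u v err}.
Arguments fam_mass {D f hm hp vs xi al theta phi0m phi0p phi1m phi1p X1 C c e b L u v err}.
Arguments fam_xs {D f hm hp vs xi al theta phi0m phi0p phi1m phi1p X1 C c e b L u v err}.
Arguments fam_u {D f hm hp vs xi al theta phi0m phi0p phi1m phi1p X1 C c e b L u v err}.
Arguments fam_v {D f hm hp vs xi al theta phi0m phi0p phi1m phi1p X1 C c e b L u v err}.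
Arguments fam_left {D f hm hp vs xi al theta phi0m phi0p phi1m phi1p X1 C c e b L u v err}.
Arguments fam_right {D f hm hp vs xi al theta phi0m phi0p phi1m phi1p X1 C c e b L u v err}.
Arguments fam_slow {D f hm hp vs xi al theta phi0m phi0p phi1m phi1p X1 C c e b L u v err}.
Arguments fam_errors {D f hm hp vs xi al theta phi0m phi0p phi1m phi1p X1 C c e b L u v err}.
Arguments fam_err {D f hm hp vs xi al theta phi0m phi0p phi1m phi1p X1 C c e b L u v err}.

(** * Transition layers *)

Lemma compact_avoids (K : R -> Prop) (x0 : R) :
  Rtopology.compact K -> ~ K x0 -> exists dl, 0 < dl /\ forall x, K x -> dl <= Rabs (x - x0).
Proof.
  intros HK Hx. destruct (Rtopology.compact_P2 K HK x0 Hx) as [dl Hdl].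
  exists dl. split; [apply cond_pos|]. intros x Kx. apply Rnot_lt_le. intros H.
  exact (Hdl x H Kx).
Qed.

Lemma exp_layer_tail (c dl e s : R) :
  0 < c -> 0 < dl -> 0 < e -> dl <= s -> exp (- (c * (s / e))) <= 4 / (c * dl) ^ 2 * e ^ 2.
Proof.
  intros Hc Hd He Hs.
  assert (Hcd : 0 < c * dl) by now apply Rmult_lt_0_compat.
  assert (Hy : 0 < c * dl / e) by now apply Rdiv_lt_0_compat.
  apply Rle_trans with (exp (- (c * dl / e))).
  - apply exp_le. apply Ropp_le_contravar.
    replace (c * (s / e)) with (c * s / e) by (unfold Rdiv; ring).
    apply Rmult_le_compat_r; [left; now apply Rinv_0_lt_compat|].
    apply Rmult_le_compat_l; lra.
  - eapply Rle_trans; [now apply exp_neg_le|]. right. field. split; lra.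
Qed.

(** A compact set that avoids the limit position keeps a positive distance from the layer, which
    is eventually much larger than its width [e]. *)
Lemma jump_up_of_bounds (x0 um up vs C c : R) (u v : R -> R -> R) (xs : R -> R) :
  0 < c -> 0 <= C ->
  small (fun e => Rabs (xs e - x0) <= C * e) ->
  small (fun e => (forall x, 0 <= x <= xs e -> Rabs (u e x - um) <= e + C * exp (c * ((x - xs e) / e))) /\
    (forall x, xs e <= x <= 1 -> Rabs (u e x - up) <= e + C * exp (- (c * ((x - xs e) / e)))) /\
    (forall x, 0 <= x <= 1 -> Rabs (v e x - vs) <= C * e)) ->
  jump_up_layer x0 um up vs u v.
Proof.
  intros Hc HC Hxs Hb. split.
  - intros K HK HKx eta Heta. apply at_right_of_small.
    destruct (compact_avoids K x0 HK) as [dl [Hdl Hav]].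
    { intros Kx0. destruct (HKx x0 Kx0); lra. }
    set (A := 4 / (c * (dl / 2)) ^ 2).
    assert (HA : 0 <= A).
    { apply Rdiv_le_0_compat; [lra|]. apply pow_lt. apply Rmult_lt_0_compat; lra. }
    assert (HCA : 0 <= C * A) by (apply Rmult_le_pos; lra).
    generalize (small_and _ _ (small_and _ _ Hxs Hb) (small_and _ _
       (small_and _ _ (small_linear C (dl / 2) ltac:(lra)) (small_linear 1 1 ltac:(lra)))
       (small_linear (1 + C * A) eta Heta))).
    apply small_imp. intros e He [[H1 [Hl [Hr _]]] [[H2 H3] H4]] x Kx.
    assert (He2 : e ^ 2 <= e) by nra.
    assert (Tail : forall t, t <= 4 / (c * (dl / 2)) ^ 2 * e ^ 2 -> e + C * t < eta).
    { intros t Ht. fold A in Ht. assert (A * e ^ 2 <= A * e) by (apply Rmult_le_compat_l; lra).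
      assert (C * t <= C * (A * e)) by (apply Rmult_le_compat_l; lra). lra. }
    assert (Hd := Hav x Kx). assert (H1' := proj1 (Rabs_le_between _ _) H1).
    destruct (HKx x Kx) as [Hx|Hx].
    + split; [intros _|lra]. rewrite Rabs_left in Hd by lra.
      eapply Rle_lt_trans; [apply Hl; lra|]. apply Tail.
      replace (c * ((x - xs e) / e)) with (- (c * ((xs e - x) / e))) by (field; lra).
      apply exp_layer_tail; lra.
    + split; [lra|intros _]. rewrite Rabs_pos_eq in Hd by lra.
      eapply Rle_lt_trans; [apply Hr; lra|]. apply Tail. apply exp_layer_tail; lra.
  - intros eta Heta. apply at_right_of_small.
    generalize (small_and _ _ Hb (small_linear C eta Heta)).
    apply small_imp. intros e _ [[_ [_ H]] H2] x Hx. specialize (H x Hx). lra.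
Qed.

Theorem theorem2p1 :
  exists N : nat,
  forall (D : R) (f : R -> R -> R) (vlo vhi : Rbar) (hm h0 hp : R -> R)
    (vs xi alpha : R) (theta phi0m phi0p : R -> R) (phi1m phi1p : R -> R -> R -> R),
  let x0 := layer_x0 hm hp vs xi in
  0 < D ->
  (forall u v, ex_diff_n f N u v) ->
  assumption_A1 f vlo vhi hm h0 hp ->
  assumption_A2 f vlo vhi hm hp vs ->
  assumption_A4 hm hp vs xi ->
  hm vs < alpha < hp vs ->
  is_cutoff theta ->
  profile0_minus f hm vs x0 alpha phi0m ->
  profile0_plus f hp vs x0 alpha phi0p ->
  (forall b1 x1, profile1_minus f hm vs x0 phi0m b1 x1 (phi1m b1 x1)) ->
  (forall b1 x1, profile1_plus f hp vs x0 phi0p b1 x1 (phi1p b1 x1)) ->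
  exists (eps3 : R) (beta1 x1 : R -> R) (u v : R -> R -> R) (err : R -> R),
    let xs eps := x0 + eps * x1 eps in
    0 < eps3 /\
    beta1 0 = 0 /\
    filterlim beta1 (at_right 0) (locally (beta1 0)) /\
    x1 0 = (x0 * RInt_gen phi0m (Rbar_locally m_infty) (at_point 0)
            + (1 - x0) * RInt_gen phi0p (at_point 0) (Rbar_locally p_infty))
           / (hp vs - hm vs) /\
    filterlim x1 (at_right 0) (locally (x1 0)) /\
    jump_up_layer x0 (hm vs) (hp vs) vs u v /\
    (forall eps, 0 < eps < eps3 ->
      let dum x := u eps x - U_minus hm vs theta phi0m phi1m eps (beta1 eps) (x1 eps)
                               (x / xs eps) in
      let dvm x := v eps x - V_minus D vs theta phi0m phi1m eps (beta1 eps) (x1 eps)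
                               (x / xs eps) in
      let dup x := u eps x - U_plus hp vs theta phi0p phi1p eps (beta1 eps) (x1 eps)
                               ((x - xs eps) / (1 - xs eps)) in
      let dvp x := v eps x - V_plus D vs theta phi0p phi1p eps (beta1 eps) (x1 eps)
                               ((x - xs eps) / (1 - xs eps)) in
      is_neumann_solution D f eps (u eps) (v eps) /\
      is_RInt (fun x => u eps x + v eps x) 0 1 xi /\
      0 < xs eps < 1 /\
      u eps (xs eps) = alpha /\
      v eps (xs eps) = vs + eps * beta1 eps /\
      (exists num nvm nup nvp : R,
        is_C2_norm eps 0 (xs eps) dum num /\
        is_C2_norm 1 0 (xs eps) dvm nvm /\
        is_C2_norm eps (xs eps) 1 dup nup /\
        is_C2_norm 1 (xs eps) 1 dvp nvp /\
        err eps = num + nvm + nup + nvp) /\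
      is_derive_on 0 (xs eps) dum 0 0 /\
      is_derive_on 0 (xs eps) dvm 0 0 /\
      dum (xs eps) = 0 /\
      dvm (xs eps) = 0 /\
      dup (xs eps) = 0 /\
      dvp (xs eps) = 0 /\
      is_derive_on (xs eps) 1 dup 1 0 /\
      is_derive_on (xs eps) 1 dvp 1 0) /\
    filterlim (fun eps => err eps / eps) (at_right 0) (locally 0).
Proof.
  exists 2%nat. intros D f vlo vhi hm h0 hp vs xi al theta phi0m phi0p phi1m phi1p x0
    HD Hf HA1 [HvsI [HJ [_ [_ Hslope]]]] HA4 Hal Hth Hp0m Hp0p Hp1m Hp1p.
  destruct (HA1 vs HvsI) as [Hord [Hroots [Hum [Hup _]]]].
  destruct (C2box_of_ex_diff f (hm vs - 1) (hp vs + 1) vs Hf) as [M HB].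
  assert (Hfm : f (hm vs) vs = 0) by (apply Hroots; auto).
  assert (Hfp : f (hp vs) vs = 0) by (apply Hroots; auto).
  assert (Hpot : forall u, hm vs < u < hp vs -> RInt (fun s => f s vs) (hm vs) u < 0).
  { apply (bistable_potential (fun s => f s vs) (hm vs) (h0 vs) (hp vs)
      (partial_u f (hm vs) vs) (partial_u f (hp vs) vs)); try assumption.
    - apply (continuous_slice f _ _ (hm vs) (hp vs) vs M HB).
    - apply (box_du HB).
    - apply (box_du HB). }
  destruct (layer_family_exists D f (partial_u f) (partial_v f) M hm hp vs xi al theta phi0m phi0p
    phi1m phi1p HD HB Hfm Hfp Hum Hup HJ Hpot Hslope Hal HA4 Hth Hp0m Hp0p Hp1m Hp1p)
    as [C [c [Hc [HC [e0 [He0 Hfam]]]]]].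
  fold x0 in Hfam.
  set (X1 := (x0 * RInt_gen phi0m (Rbar_locally m_infty) (at_point 0)
            + (1 - x0) * RInt_gen phi0p (at_point 0) (Rbar_locally p_infty)) / (hp vs - hm vs)) in *.
  set (family := fun e b L u v err => layer_family D f hm hp vs xi al theta phi0m phi0p phi1m phi1p X1 C c e b L u v err) in *.
  assert (Hchoice : exists (b L : R -> R) (u v : R -> R -> R) (err : R -> R),
    forall e, 0 < e < e0 -> family e (b e) (L e) (u e) (v e) (err e)).
  { assert (Hsel : forall e, exists s : R * R * (R -> R) * (R -> R) * R, 0 < e < e0 ->
      family e (fst (fst (fst (fst s)))) (snd (fst (fst (fst s)))) (snd (fst (fst s))) (snd (fst s)) (snd s)).
    { intros e. destruct (classic (0 < e < e0)) as [He|He].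
      - destruct (Hfam e He) as [b [L [u [v [err H]]]]]. now exists (b, L, u, v, err).
      - exists (0, 0, fun _ => 0, fun _ => 0, 0). intros; contradiction. }
    set (s := fun e => proj1_sig (constructive_indefinite_description _ (Hsel e))).
    exists (fun e => fst (fst (fst (fst (s e))))), (fun e => snd (fst (fst (fst (s e))))),
      (fun e => snd (fst (fst (s e)))), (fun e => snd (fst (s e))), (fun e => snd (s e)).
    intros e. unfold s. now destruct (constructive_indefinite_description _ (Hsel e)). }
  clear Hfam. destruct Hchoice as [b [L [u [v [err Hfam]]]]].
  assert (Hpatch : forall (w : R -> R) (w0 : R), exists w', w' 0 = w0 /\ forall e, 0 < e -> w' e = w e).
  { intros w w0. exists (fun e => if Rlt_dec 0 e then w e else w0).
    split; [|intros e He]; destruct Rlt_dec; lra. }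
  destruct (Hpatch (fun e => b e / e) 0) as [beta1 [Hb0 Hb]].
  destruct (Hpatch (fun e => (e * L e - x0) / e) X1) as [x1 [Hx10 Hx1]]. clear Hpatch.
  assert (Exs : forall e, 0 < e -> x0 + e * x1 e = e * L e).
  { intros e He. rewrite Hx1 by exact He. field. lra. }
  assert (Hsm : forall P : R -> Prop, (forall e, 0 < e < e0 -> P e) -> small P).
  { intros P H. now exists e0. }
  assert (Hx1X : small (fun e => Rabs (x1 e - X1) <= C * e)).
  { apply Hsm. intros e He. rewrite Hx1 by lra. apply (fam_x1 (Hfam e He)). }
  exists e0, beta1, x1, u, v, err. cbv zeta. rewrite Hb0, Hx10.
  split; [exact He0|]. split; [reflexivity|]. split; [|split; [reflexivity|split; [|split; [|split]]]].
  - apply (lim_at_right_of_bound beta1 0 C). apply Hsm. intros e He.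
    rewrite Rminus_0_r, Hb by lra. apply (fam_b (Hfam e He)).
  - now apply (lim_at_right_of_bound x1 X1 C).
  - apply (jump_up_of_bounds x0 (hm vs) (hp vs) vs (Rabs X1 + C) c u v (fun e => e * L e) Hc).
    + generalize (Rabs_pos X1). lra.
    + generalize (small_and _ _ Hx1X (small_linear 1 1 ltac:(lra))). apply small_imp.
      intros e He [H1 H2]. rewrite <- Exs by exact He.
      replace (x0 + e * x1 e - x0) with (e * (X1 + (x1 e - X1))) by ring.
      rewrite Rabs_mult, (Rabs_pos_eq e), Rmult_comm by lra. apply Rmult_le_compat_r; [lra|].
      eapply Rle_trans; [apply Rabs_triang|]. apply Rplus_le_compat_l.
      assert (C * e <= C * 1) by (apply Rmult_le_compat_l; lra). lra.
    + apply Hsm. intros e He. assert (F := Hfam e He). assert (HX := Rabs_pos X1).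
      assert (Hexp : forall t, e + C * exp t <= e + (Rabs X1 + C) * exp t).
      { intros t. apply Rplus_le_compat_l. apply Rmult_le_compat_r; [left; apply exp_pos|lra]. }
      split; [|split]; intros x Hx; eapply Rle_trans.
      * apply (fam_left F x Hx).
      * apply Hexp.
      * apply (fam_right F x Hx).
      * apply Hexp.
      * apply (fam_slow F x Hx).
      * apply Rmult_le_compat_r; lra.
  - intros e He. assert (F := Hfam e He).
    rewrite !Exs, !Hb, !Hx1 by lra.
    split; [exact (fam_sol F)|].
    split; [exact (fam_mass F)|].
    split; [exact (fam_xs F)|].
    split; [exact (fam_u F)|].
    split; [exact (fam_v F)|].
    exact (fam_errors F).
  - apply (lim_at_right_of_bound (fun e => err e / e) 0 C). apply Hsm. intros e He.
    assert (F := fam_err (Hfam e He)).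
    rewrite Rminus_0_r. unfold Rdiv. rewrite Rabs_mult, (Rabs_pos_eq (/ e)) by (left; apply Rinv_0_lt_compat; lra).
    apply div_le; [lra|]. lra.
Qed.
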